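(* Let $\Gamma$ be a discrete subgroup of finite covolume in $PSL(2,\mathbb R)$ and let $1<t_0<t$. For $k,l\in\widehat{\mathcal A}_{t_0}$ define $$\mathcal C_t(k,l)=\frac{d}{ds}(k*_sl)\Big|_{s=t,\ s>t}.$$ Then for all $N$, all $k_1,\dots,k_N\in\widehat{\mathcal A}_{t_0}$ and all $l_1,\dots,l_N\in\mathcal A_t$, $$\sum_{i,j=1}^N\tau_{\mathcal A_t}\big(l_i^**_t\,\mathcal C_t(k_i^*,k_j)*_t\,l_j\big)\le0 .$$ Equivalently, the matrix $(\mathcal C_t(k_i^*,k_j))_{i,j}$ is negative (i.e. $\le 0$) in $M_N(\mathcal A_t)$.
   Context: Let $\mathbb H$ be the upper half-plane, $d\nu_t(z)=(\operatorname{Im}z)^{t-2}\,dx\,dy$, and for $t>1$ let $H_t$ be the Hilbert space of analytic functions in $L^2(\mathbb H,\nu_t)$. Put $q(\bar z,\xi)=(\bar z-\xi)/(-2i)$ (positive real part; principal powers), $c_t=(t-1)/(4\pi)$. Reproducing vectors: $e^t_z(\xi)=c_t\,q(\bar z,\xi)^{-t}$, $\langle f,e_z^t\rangle=f(z)$. The symbol of $A\in B(H_t)$ is $\hat A(\bar z,\xi)=\langle Ae_z^t,e_\xi^t\rangle/\langle e_z^t,e_\xi^t\rangle$; operators are identified with their symbols, and the adjoint has symbol $k^*(\bar z,\xi)=\overline{k(\bar\xi,z)}$. $\mathcal A_t\subseteq B(H_t)$ is the von Neumann algebra of operators commuting with all $f\mapsto (cz+d)^{-t}f\big(\frac{az+b}{cz+d}\big)$,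 $\left(\begin{smallmatrix}a&b\\c&d\end{smallmatrix}\right)\in\Gamma$ (any analytic branch of the power); its trace is $\tau_{\mathcal A_t}(k)=\frac1{\nu_0(F)}\int_Fk(\bar z,z)\,d\nu_0(z)$, $F$ a fundamental domain of $\Gamma$. The product of symbols in $\mathcal A_s$ is $$(k*_sl)(\bar z,\xi)=c_s\int_{\mathbb H}k(\bar z,\eta)\,l(\bar\eta,\xi)\Big[\frac{(\bar z-\xi)(\bar\eta-\eta)}{(\bar z-\eta)(\bar\eta-\xi)}\Big]^sd\nu_0(\eta).$$ With $d(z,\eta)=(\operatorname{Im}z)^{1/2}(\operatorname{Im}\eta)^{1/2}/|q(\bar z,\eta)|$, $\widehat{\mathcal A}_{t_0}$ is the involutive algebra of all $k\in\mathcal A_{t_0}$ with $\sup_z\int|k(\bar z,\eta)|d(z,\eta)^{t_0}\,d\nu_0(\eta)<\infty$ and $\sup_\eta\int|k(\bar z,\eta)|d(z,\eta)^{t_0}\,d\nu_0(z)<\infty$; its elements are, for each $s\ge t_0$, also symbols of operators in $\mathcal A_s$, and it is closed under $*_s$. The derivative defining $\mathcal C_t(k,l)$ is the pointwise derivative of symbols; it is the symbol of an operator in $\mathcal A_t$. *)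

(* Defs.v *)
From HB Require Import structures.
From mathcomp Require Import all_boot all_order all_algebra.
From mathcomp Require Import complex.
From mathcomp Require Import all_classical all_reals all_analysis.

Set Implicit Arguments.
Unset Strict Implicit.
Unset Printing Implicit Defensive.
Import Order.TTheory GRing.Theory Num.Theory.
Import numFieldNormedType.Exports.
Local Open Scope classical_set_scope.
Local Open Scope ring_scope.
Local Open Scope complex_scope.

Section Berezin.
Context {R : realType}.
Local Notation C := R[i].
Local Notation lebesgue2 := (@lebesgue_measure R \x @lebesgue_measure R)%E.

Definition cabs (w : C) : R := complex.Re `|w|.

(* Principal argument, in ]-pi, pi] for w <> 0. *)
Definition carg (w : C) : R :=
  let a := acos (complex.Re w / cabs w) in
  if complex.Im w < 0 then - a else a.

(* Principal branch of w ^ s for a real exponent s. *)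
Definition cpow (w : C) (s : R) : C :=
  (cabs w `^ s)%:C * (cos (s * carg w) +i* sin (s * carg w)).

Definition uhp : set C := [set z | 0 < complex.Im z].

Definition toC (p : measurableTypeR R * measurableTypeR R) : C := p.1 +i* p.2.

(* Integrals over D `&` uhp against d nu_t(z) = (Im z)^(t-2) dx dy. *)
Definition eint_nu (t : R) (D : set C) (f : C -> R) : \bar R :=
  (\int[lebesgue2]_(p in toC @^-1` (D `&` uhp))
     (f (toC p) * p.2 `^ (t - 2))%:E)%E.

Definition cint_nu (t : R) (D : set C) (f : C -> C) : C :=
  (\int[lebesgue2]_(p in toC @^-1` (D `&` uhp))
     (complex.Re (f (toC p)) * p.2 `^ (t - 2)))
  +i*
  (\int[lebesgue2]_(p in toC @^-1` (D `&` uhp))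
     (complex.Im (f (toC p)) * p.2 `^ (t - 2))).

(* H_t. Vectors are functions on uhp, extended by 0 to C so that equality of
   vectors is equality of functions. *)
Definition Hspace (t : R) : set (C -> C) :=
  [set f | [/\ forall z, ~ uhp z -> f z = 0,
    forall z, uhp z -> derivable (f : C^o -> C^o) z 1 &
    lebesgue2.-integrable (toC @^-1` uhp)
      (fun p => (cabs (f (toC p)) ^+ 2 * p.2 `^ (t - 2))%:E)]].

Definition inner (t : R) (f g : C -> C) : C :=
  cint_nu t uhp (fun z => f z * (g z)^*).

Definition normH (t : R) (f : C -> C) : R :=
  Num.sqrt (complex.Re (inner t f f)).

Definition qker (w xi : C) : C := (w - xi) / (0 -i* 2).

Definition c_nu (t : R) : R := (t - 1) / (4 * pi).

Definition evec (t : R) (z : C) : C -> C := fun xi =>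
  if 0 < complex.Im xi then (c_nu t)%:C * cpow (qker z^* xi) (- t) else 0.

Definition operator := (C -> C) -> (C -> C).

(* B(H_t); the values of A outside H_t are irrelevant. *)
Definition bounded_operator (t : R) (A : operator) : Prop :=
  [/\ forall f, Hspace t f -> Hspace t (A f),
    forall (a : C) f g, Hspace t f -> Hspace t g ->
      A (fun z => a * f z + g z) = (fun z => a * A f z + A g z) &
    exists M : R, forall f, Hspace t f -> normH t (A f) <= M * normH t f].

(* A symbol k is a function of (zbar, xi): it is applied to a first argument in
   the lower half-plane and a second one in the upper half-plane, and its other
   values are irrelevant. *)
Definition symbol := C -> C -> C.

Definition is_symbol (t : R) (A : operator) (k : symbol) : Prop :=
  forall z xi, uhp z -> uhp xi ->
    k z^* xi = inner t (A (evec t z)) (evec t xi)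
               / inner t (evec t z) (evec t xi).

Definition adj (k : symbol) : symbol := fun w xi => (k xi^* w^*)^*.

(* k *_s l, with w = zbar. The bracket has positive real part; its
   principal power is the product of the principal powers of qker w xi,
   qker eta^* eta, (qker w eta)^-1 and (qker eta^* xi)^-1. *)
Definition star (s : R) (k l : symbol) : symbol := fun w xi =>
  (c_nu s)%:C * cint_nu 0 uhp (fun eta =>
    k w eta * l eta^* xi *
    cpow (((w - xi) * (eta^* - eta)) / ((w - eta) * (eta^* - xi))) s).

Definition Cderiv (t : R) (k l : symbol) : symbol := fun w xi =>
  lim ((((s - t)^-1)%:C * (star s k l w xi - star t k l w xi) : C^o)
         @[s --> t^'+]).

Definition mobius (g : 'M[R]_2) (z : C) : C :=
  ((g 0 0)%:C * z + (g 0 1)%:C) / ((g 1 0)%:C * z + (g 1 1)%:C).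

(* A subgroup of PSL(2, R) is given by its inverse image in SL(2, R), that is,
   by a subgroup of SL(2, R) that contains -1; one is discrete iff the other
   is. *)
Definition discrete_subgroup_PSL2 (G : set 'M[R]_2) : Prop :=
  [/\ forall g, G g -> \det g = 1,
    G 1%:M /\ G (- 1%:M),
    forall g h, G g -> G h -> G (g *m h),
    forall g, G g -> G (invmx g) &
    forall g, G g -> isolated G g].

Definition nu0_null (A : set C) : Prop :=
  lebesgue2.-negligible (toC @^-1` A).

(* On uhp, Lebesgue null sets and nu_0-null sets are the same. *)
Definition fundamental_domain (G : set 'M[R]_2) (F : set C) : Prop :=
  [/\ F `<=` uhp, measurable (toC @^-1` F),
    nu0_null (uhp `\` \bigcup_(g in G) (mobius g @` F)) &
    forall g, G g -> g <> 1%:M -> g <> - 1%:M ->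
      nu0_null (F `&` (mobius g @` F))].

Definition covolume (F : set C) : \bar R := eint_nu 0 F (fun=> 1).

Definition tau (F : set C) (k : symbol) : C :=
  ((fine (covolume F))^-1)%:C * cint_nu 0 F (fun z => k z^* z).

(* The principal branch of (c z + d)^(-t) is analytic on uhp; another branch
   differs from it by a constant factor of modulus 1, so that the commutant is
   the same. *)
Definition slash (t : R) (g : 'M[R]_2) (f : C -> C) : C -> C := fun z =>
  cpow ((g 1 0)%:C * z + (g 1 1)%:C) (- t) * f (mobius g z).

Definition vN_alg (G : set 'M[R]_2) (t : R) : set operator :=
  [set A | bounded_operator t A /\
    forall g f, G g -> Hspace t f -> A (slash t g f) = slash t g (A f)].

(* The algebra A_t, its elements being identified with their symbols. *)
Definition sym_alg (G : set 'M[R]_2) (t : R) : set symbol :=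
  [set k | exists2 A, vN_alg G t A & is_symbol t A k].

Definition dker (z eta : C) : R :=
  Num.sqrt (complex.Im z) * Num.sqrt (complex.Im eta) / cabs (qker z^* eta).

Definition hat_alg (G : set 'M[R]_2) (t0 : R) : set symbol :=
  [set k | [/\ sym_alg G t0 k,
    (ereal_sup [set eint_nu 0 uhp
       (fun eta => (cabs (k z^* eta) * dker z eta `^ t0)%R)
       | z in uhp] < +oo)%E &
    (ereal_sup [set eint_nu 0 uhp
       (fun z => (cabs (k z^* eta) * dker z eta `^ t0)%R)
       | eta in uhp] < +oo)%E]].

(* (m i j) <= 0 in M_N(A_t), as a bounded operator on the direct sum of N
   copies of H_t. If a and b are the symbols of A and B, then a *_t b is the
   symbol of B o A (the integral formula applies A first). So the symbol
   algebra is the opposite of the operator algebra, and a matrix of symbols of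
   operators T i j is represented on H_t^N by the transposed matrix, which
   gives <T i j (f i), f j> below instead of <T i j (f j), f i>. For instance
   m i j = adj (k i) *_t k j, which is positive in M_N(A_t), is the symbol of
   K j o (K i)^*, with \sum_(i, j) <K j (K i)^* (f i), f j>
   = || \sum_i (K i)^* (f i) ||^2. *)
Definition nonpos_matrix (G : set 'M[R]_2) (t : R) (N : nat)
    (m : 'I_N -> 'I_N -> symbol) : Prop :=
  exists T : 'I_N -> 'I_N -> operator,
    (forall i j, vN_alg G t (T i j) /\ is_symbol t (T i j) (m i j)) /\
    forall f : 'I_N -> C -> C, (forall i, Hspace t (f i)) ->
      \sum_(i < N) \sum_(j < N) inner t (T i j (f i)) (f j) <= 0.

End Berezin.

(* Main.v *)
(* In the coordinates (s, r) |-> e^r (s + i), in which nu_0 is ds dr, a function f of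
   H_t becomes f(p) e^(t r / 2), square integrable for ds dr, and the reproducing
   kernel becomes, up to a constant, D_t(p, q) = (q(p^bar, q) / sqrt(Im p Im q))^(-t), so
   that D_t D_d = D_(t+d) and |D_t| <= 1.  Since D_d is positive definite (Gamma
   integral), a kernel V with int V(p,e) D_t(e,x) de = mass(t) V(p,x), where
   mass(t) = int |D_t(p,e)|^2 de, satisfies
     mass(t) int |int V(p,e) D_d(p,e) dp|^2 de
       <= mass(t+d) int int int V(p,e) V(q,e)^* D_d(p,q) dp dq de.
   With b(p,e,q) the bracket of the product of symbols,
   D_d(p,e) D_d(q,e)^* = D_d(p,q) b^d, and (t - 1) mass(t) does not depend on t; so
     int int int V(p,e) V(q,e)^* D_d(p,q) ((t - 1 + d) b^d - (t - 1)) <= 0.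
   Dividing by d -> 0 gives
     int int int V(p,e) V(q,e)^* (1 + (t - 1) Log b) <= 0.
   For V(p,e) = sum_i h_i(p) k_i(e,p)^* D_(t-t0)(p,e) this is, up to a positive
   constant, the quadratic form of the operator matrix (C_t(k_i^*, k_j)) at (h_i); the
   integrand of the trace is its value at h_i = l_i(., p)^*, suitably normalized. *)

From HB Require Import structures.
From mathcomp Require Import all_boot all_order all_algebra.
From mathcomp Require Import complex.
From mathcomp Require Import all_classical all_reals all_analysis measurable_realfun.
From mathcomp Require Import ring lra.
Require Import Defs.

Set Implicit Arguments.
Unset Strict Implicit.
Unset Printing Implicit Defensive.
Import Order.TTheory GRing.Theory Num.Theory.
Import numFieldNormedType.Exports.
Local Open Scope classical_set_scope.
Local Open Scope ring_scope.
Local Open Scope complex_scope.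
Local Notation "x ^*" := (conjc x) : ring_scope.

(** * Complex numbers, limits, exponential and logarithm *)

(** The integral inequality expresses that restriction to the diagonal is bounded from the product
    of H_t and H_d to H_(t+d), with the constant dictated by the kernels: the kernel of the target
    is the product of the two others. As d tends to 0, H_d is no longer a space of square integrable
    functions; only its kernel is left, whence the proof of its positivity by a Gamma integral. Both
    sides agree at d = 0, so the derivative there has a sign. The analytic obstacle is the unbounded
    Log b. The elements k_i satisfy Schur bounds already for the exponent t0, and the gap t - t0 is
    spent on absorbing the logarithm and its square. The elements of A_t are given only as bounded
    operators. The regularity of their kernels in the first variable is drawn from the positivity of
    M^2 D_t(x, y) - Phi(x) Phi(y)^*, which says that Phi is a bounded functional evaluated on
    reproducing vectors; this takes the place of adjoints. The value of mass(t) is never computed: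
    total derivatives relate t to t + 1, and monotonicity does the rest. *)

Section ComplexBasics.
Context {R : realType}.
Local Notation C := R[i].
Implicit Types (z w : C) (x y : R).

Lemma cabsE z : cabs z = Num.sqrt (complex.Re z ^+ 2 + complex.Im z ^+ 2).
Proof. by case: z. Qed.

Lemma normC_cabs z : `|z| = (cabs z)%:C.
Proof. by rewrite normc_def cabsE. Qed.

Lemma cabs_ge0 z : 0 <= cabs z.
Proof. by rewrite cabsE sqrtr_ge0. Qed.

Lemma cabsM z w : cabs (z * w) = cabs z * cabs w.
Proof. by apply: complexI; rewrite rmorphM/= -!normC_cabs normrM. Qed.

Lemma cabsD z w : cabs (z + w) <= cabs z + cabs w.
Proof. by rewrite -lecR rmorphD/= -!normC_cabs ler_normD. Qed.

Lemma cabsN z : cabs (- z) = cabs z.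
Proof. by apply: complexI; rewrite -!normC_cabs normrN. Qed.

Lemma cabsB z w : cabs (z - w) <= cabs z + cabs w.
Proof. by rewrite (le_trans (cabsD _ _))// cabsN. Qed.

Lemma cabsC z w : cabs (z - w) = cabs (w - z).
Proof. by rewrite -cabsN opprB. Qed.

Lemma cabsV z : cabs z^-1 = (cabs z)^-1.
Proof. by apply: complexI; rewrite fmorphV/= -!normC_cabs normfV. Qed.

Lemma cabsX z n : cabs (z ^+ n) = cabs z ^+ n.
Proof. by apply: complexI; rewrite rmorphXn/= -!normC_cabs normrX. Qed.

Lemma cabs0 : cabs (0 : C) = 0.
Proof. by apply: complexI; rewrite -normC_cabs normr0. Qed.

Lemma cabs1 : cabs (1 : C) = 1.
Proof. by apply: complexI; rewrite -normC_cabs normr1. Qed.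

Lemma cabs_eq0 z : (cabs z == 0) = (z == 0).
Proof. by rewrite -(normr_eq0 z) normC_cabs fmorph_eq0. Qed.

Lemma cabs_gt0 z : (0 < cabs z) = (z != 0).
Proof. by rewrite lt0r cabs_ge0 andbT cabs_eq0. Qed.

Lemma cabs_real x : cabs (x%:C) = `|x|.
Proof. by rewrite cabsE/= expr0n/= addr0 sqrtr_sqr. Qed.

Lemma cabsJ z : cabs (z^*) = cabs z.
Proof. by apply: complexI; rewrite -!normC_cabs normcJ. Qed.

Lemma ger_Re_cabs z : `|complex.Re z| <= cabs z.
Proof. by rewrite cabsE -sqrtr_sqr ler_wsqrtr// lerDl sqr_ge0. Qed.

Lemma ger_Im_cabs z : `|complex.Im z| <= cabs z.
Proof. by rewrite cabsE -sqrtr_sqr ler_wsqrtr// lerDr sqr_ge0. Qed.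

Lemma cabs_le_ReIm z : cabs z <= `|complex.Re z| + `|complex.Im z|.
Proof.
rewrite cabsE -[leRHS]ger0_norm ?addr_ge0// -sqrtr_sqr ler_wsqrtr//.
rewrite sqrrD !real_normK ?num_real// -addrA lerD2l lerDr.
by rewrite mulrn_wge0// mulr_ge0.
Qed.

Lemma sqr_cabs z : cabs z ^+ 2 = complex.Re z ^+ 2 + complex.Im z ^+ 2.
Proof. by rewrite cabsE sqr_sqrtr// addr_ge0// sqr_ge0. Qed.

Lemma mulcJ z : z * z^* = (cabs z ^+ 2)%:C.
Proof. by rewrite rmorphXn/= -normC_cabs sqr_normc. Qed.

Lemma cabs_sub_dist z w : `|cabs z - cabs w| <= cabs (z - w).
Proof.
rewrite ler_norml; apply/andP; split.
  by rewrite lerNl opprB lerBlDr cabsC (le_trans _ (cabsD _ _))// subrK.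
by rewrite lerBlDr (le_trans _ (cabsD _ _))// subrK.
Qed.

Lemma cabs_sum (I : Type) (r : seq I) (P : pred I) (F : I -> C) :
  cabs (\sum_(i <- r | P i) F i) <= \sum_(i <- r | P i) cabs (F i).
Proof.
elim/big_rec2: _ => [|i y1 y2 _ IH]; first by rewrite cabs0.
by rewrite (le_trans (cabsD _ _))// lerD2l.
Qed.

Lemma cReM z w : complex.Re (z * w) =
  complex.Re z * complex.Re w - complex.Im z * complex.Im w.
Proof. by case: z; case: w. Qed.

Lemma cImM z w : complex.Im (z * w) =
  complex.Re z * complex.Im w + complex.Im z * complex.Re w.
Proof. by case: z; case: w. Qed.

Lemma cReD z w : complex.Re (z + w) = complex.Re z + complex.Re w.
Proof. by case: z; case: w. Qed.
Lemma cImD z w : complex.Im (z + w) = complex.Im z + complex.Im w.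
Proof. by case: z; case: w. Qed.
Lemma cReN z : complex.Re (- z) = - complex.Re z. Proof. by case: z. Qed.
Lemma cImN z : complex.Im (- z) = - complex.Im z. Proof. by case: z. Qed.
Lemma cReJ z : complex.Re (z^*) = complex.Re z. Proof. by case: z. Qed.
Lemma cImJ z : complex.Im (z^*) = - complex.Im z. Proof. by case: z. Qed.

Lemma num_conjE z : Num.conj z = z^*. Proof. by []. Qed.

Lemma cJM z w : (z * w)^* = z^* * w^*. Proof. exact: (rmorphM (@conjc R)). Qed.
Lemma cJD z w : (z + w)^* = z^* + w^*. Proof. exact: (rmorphD (@conjc R)). Qed.
Lemma cJB z w : (z - w)^* = z^* - w^*. Proof. exact: (rmorphB (@conjc R)). Qed.
Lemma cJN z : (- z)^* = - z^*. Proof. exact: (rmorphN (@conjc R)). Qed.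
Lemma cJR x : x%:C^* = x%:C. Proof. by rewrite /= oppr0. Qed.
Lemma cJ_sum (I : Type) (r : seq I) (P : pred I) (F : I -> C) :
  (\sum_(i <- r | P i) F i)^* = \sum_(i <- r | P i) (F i)^*.
Proof. exact: (rmorph_sum (@conjc R)). Qed.

Lemma cReMr z x : complex.Re (z * x%:C) = complex.Re z * x.
Proof. by rewrite cReM/= mulr0 subr0. Qed.
Lemma cImMr z x : complex.Im (z * x%:C) = complex.Im z * x.
Proof. by rewrite cImM/= mulr0 add0r. Qed.
Lemma cReMl z x : complex.Re (x%:C * z) = x * complex.Re z.
Proof. by rewrite mulrC cReMr mulrC. Qed.
Lemma cImMl z x : complex.Im (x%:C * z) = x * complex.Im z.
Proof. by rewrite mulrC cImMr mulrC. Qed.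

Lemma ceqP z w : complex.Re z = complex.Re w -> complex.Im z = complex.Im w -> z = w.
Proof. by case: z; case: w => a b c d /= -> ->. Qed.

End ComplexBasics.

Section ComplexTopology.
Context {R : realType}.
Local Notation C := R[i].
Implicit Types (z w : C) (x y : R).

(** The balls of [R[i]] have radii in [R[i]]; this filter has real radii, so that estimates with
    [cabs] apply directly. *)
Definition cnbhs z : set_system C :=
  [set P | exists2 e : R, 0 < e & forall w, cabs (w - z) < e -> P w].

Global Instance cnbhs_filter z : Filter (cnbhs z).
Proof.
split.
- by exists 1.
- move=> P Q [e e0 Pe] [d d0 Qd]; exists (Num.min e d).
    by rewrite lt_min e0.
  by move=> w; rewrite lt_min => /andP[we wd]; split; [exact: Pe|exact: Qd].
- by move=> P Q PQ [e e0 Pe]; exists e => // w /Pe/PQ.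
Qed.

Lemma cnbhsP z (P : set C) :
  cnbhs z P <-> exists2 e : R, 0 < e & forall w, cabs (w - z) < e -> P w.
Proof. by []. Qed.

Lemma cnbhs_singleton z P : cnbhs z P -> P z.
Proof. by case=> e e0; apply; rewrite subrr cabs0. Qed.

End ComplexTopology.
Global Opaque cnbhs.

Section ComplexLimits.
Context {R : realType}.
Local Notation C := R[i].
Implicit Types (z w : C) (x y : R).

Definition ccvg {T : Type} (F : set_system T) (f : T -> C) (l : C) :=
  forall e : R, 0 < e -> F (fun t => cabs (l - f t) < e).

Section ccvg_lemmas.
Context {T : Type} {F : set_system T} {FF : Filter F}.
Implicit Types (f g : T -> C) (l : C).

Lemma ccvg_ReIm f l : ccvg F f l <->
  (complex.Re (f t) @[t --> F] --> complex.Re l) /\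
     (complex.Im (f t) @[t --> F] --> complex.Im l).
Proof.
split.
  move=> h; split; apply/cvgrPdist_lt => e e0;
    have := h _ e0; apply: filterS => t; apply: le_lt_trans.
    by rewrite -cReN -cReD ger_Re_cabs.
  by rewrite -cImN -cImD ger_Im_cabs.
move=> [/cvgrPdist_lt h1 /cvgrPdist_lt h2] e e0.
have e20 : 0 < e / 2 by rewrite divr_gt0.
have := h1 _ e20; have := h2 _ e20.
apply: filterS2 => t A B; rewrite (le_lt_trans (cabs_le_ReIm _))//.
by rewrite cReD cImD cReN cImN (splitr e) ltrD.
Qed.

Lemma ccvg_Re f l : ccvg F f l -> complex.Re (f t) @[t --> F] --> complex.Re l.
Proof. by move=> /ccvg_ReIm[]. Qed.

Lemma ccvg_Im f l : ccvg F f l -> complex.Im (f t) @[t --> F] --> complex.Im l.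
Proof. by move=> /ccvg_ReIm[]. Qed.

Lemma ccvg_cabs f l : ccvg F f l -> cabs (f t) @[t --> F] --> cabs l.
Proof.
move=> h; apply/cvgrPdist_lt => e e0; have := h _ e0.
by apply: filterS => t; apply: le_lt_trans; exact: cabs_sub_dist.
Qed.

Lemma ccvg_cst l : ccvg F (fun=> l) l.
Proof. by move=> e e0; apply: filterE => t; rewrite subrr cabs0. Qed.

Lemma ccvgD f g l m : ccvg F f l -> ccvg F g m -> ccvg F (fun t => f t + g t) (l + m).
Proof.
move=> /ccvg_ReIm[a b] /ccvg_ReIm[c d]; apply/ccvg_ReIm; split.
  by under eq_fun do rewrite cReD; rewrite cReD; exact: cvgD.
by under eq_fun do rewrite cImD; rewrite cImD; exact: cvgD.
Qed.

Lemma ccvgN f l : ccvg F f l -> ccvg F (fun t => - f t) (- l).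
Proof.
by move=> h e e0; have := h _ e0; apply: filterS => t; rewrite -opprD cabsN.
Qed.

Lemma ccvgB f g l m : ccvg F f l -> ccvg F g m -> ccvg F (fun t => f t - g t) (l - m).
Proof. by move=> a b; apply: ccvgD => //; exact: ccvgN. Qed.

Lemma ccvgM f g l m : ccvg F f l -> ccvg F g m -> ccvg F (fun t => f t * g t) (l * m).
Proof.
move=> /ccvg_ReIm[a b] /ccvg_ReIm[c d]; apply/ccvg_ReIm; split.
  by under eq_fun do rewrite cReM; rewrite cReM; apply: cvgB; exact: cvgM.
by under eq_fun do rewrite cImM; rewrite cImM; apply: cvgD; exact: cvgM.
Qed.

Lemma ccvgJ f l : ccvg F f l -> ccvg F (fun t => (f t)^*) (l^*).
Proof.
by move=> h e e0; have := h _ e0; apply: filterS => t; rewrite -rmorphB/= cabsJ.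
Qed.

Lemma ccvg_real (f : T -> R) (l : R) : f @ F --> l -> ccvg F (fun t => (f t)%:C) (l%:C).
Proof. by move=> h; apply/ccvg_ReIm; split => //=; exact: cvg_cst. Qed.

Lemma ccvgV f l : ccvg F f l -> l != 0 -> ccvg F (fun t => (f t)^-1) (l^-1).
Proof.
move=> h l0; rewrite (_ : (fun _ => _) = (fun t => (f t)^* * ((cabs (f t) ^+ 2)^-1)%:C)).
  rewrite (_ : l^-1 = l^* * ((cabs l ^+ 2)^-1)%:C).
    apply: ccvgM; first exact: ccvgJ.
    apply: ccvg_real; apply: cvgV; first by rewrite expf_neq0// cabs_eq0.
    by apply: cvgM; exact: ccvg_cabs.
  by rewrite invc_norm normC_cabs -rmorphXn -fmorphV mulrC.
by apply/funext => t; rewrite invc_norm normC_cabs -rmorphXn -fmorphV mulrC.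
Qed.

Lemma ccvg_comp (f : T -> C) (g : C -> C) l m :
  ccvg F f l -> ccvg (cnbhs l) g m -> ccvg F (fun t => g (f t)) m.
Proof.
move=> h k e e0; have /cnbhsP[d d0 H] := k _ e0.
by have := h _ d0; apply: filterS => t ft; apply: H; rewrite cabsC.
Qed.

Lemma ccvg_near f g l : F (fun t => f t = g t) -> ccvg F f l -> ccvg F g l.
Proof.
by move=> fg h e e0; have := h _ e0; apply: filterS2 fg => t ->.
Qed.

End ccvg_lemmas.

Lemma ccvg_id z : ccvg (cnbhs z) id z.
Proof. by move=> e e0; apply/cnbhsP; exists e => // w; rewrite cabsC. Qed.

(** The two notions agree because a positive element of [R[i]] is real: the order on [R[i]] compares
    only numbers with equal imaginary parts. *)
Lemma ccvg_co {T : Type} {F : set_system T} {FF : Filter F} (f : T -> C) (l : C) :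
  ccvg F f l <-> (f : T -> C^o) @ F --> (l : C^o).
Proof.
split; last first.
  move=> /cvgrPdist_lt h e e0.
  have := h e%:C; rewrite ltcR => /(_ e0); apply: filterS => t.
  by rewrite [`|_|]normC_cabs ltcR.
move=> h; apply/cvgrPdist_lt => e e0.
have eE : e = (complex.Re e)%:C.
  by move: e0; rewrite ltcE => /andP[/eqP/= i0 _]; case: e i0 => a b /= ->.
have e0' : 0 < complex.Re e by rewrite -ltcR -eE.
have := h _ e0'; apply: filterS => t.
by rewrite [`|_|]normC_cabs {2}eE ltcR.
Qed.

Definition ccont (f : C -> C) z := ccvg (cnbhs z) f (f z).

(* Caratheodory's form of complex differentiability, which makes the product and
   the chain rules immediate. *)
Definition cderivable (f : C -> C) (z : C) (d : C) := exists phi : C -> C,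
  [/\ ccont phi z, phi z = d & forall w, f w = f z + phi w * (w - z)].

Definition chol (f : C -> C) z := exists d, cderivable f z d.

Lemma cderivable_ccont f z d : cderivable f z d -> ccont f z.
Proof.
move=> [phi [cphi _ fE]]; rewrite /ccont.
have : ccvg (cnbhs z) (fun w => f z + phi w * (w - z)) (f z + phi z * (z - z)).
  apply: ccvgD; first exact: ccvg_cst.
  by apply: ccvgM => //; apply: ccvgB; [exact: ccvg_id|exact: ccvg_cst].
rewrite subrr mulr0 addr0; apply: ccvg_near.
by apply: filterE => w; rewrite -fE.
Qed.

Lemma chol_ccont f z : chol f z -> ccont f z.
Proof. by case=> d; exact: cderivable_ccont. Qed.

Lemma cderivable_eps f z d : (forall e : R, 0 < e -> exists2 r : R, 0 < r &
  forall h, cabs h < r -> cabs (f (z + h) - f z - d * h) <= e * cabs h) ->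
  cderivable f z d.
Proof.
move=> H; pose phi w := if w == z then d else (f w - f z) / (w - z).
exists phi; split; last 2 first.
- by rewrite /phi eqxx.
- move=> w; rewrite /phi; case: eqVneq => [->|wz].
    by rewrite subrr mulr0 addr0.
  by rewrite mulfVK ?subr_eq0//; ring.
move=> e e0; have [r r0 Hr] := H (e / 2) (divr_gt0 e0 (ltr0Sn _ _)).
apply/cnbhsP; exists r => // w wz; rewrite /phi eqxx; case: eqVneq => [//|nwz].
  by rewrite subrr cabs0.
have hn : 0 < cabs (w - z) by rewrite cabs_gt0 subr_eq0.
have := Hr (w - z) wz; rewrite (addrC z) subrK => K.
rewrite cabsC -(ltr_pM2r hn) -cabsM mulrBl mulfVK ?subr_eq0//.
by rewrite (le_lt_trans K)// ltr_pM2r// ltr_pdivrMr// ltr_pMr// ltr1n.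
Qed.

Lemma cderivable_epsP f z d : cderivable f z d -> forall e : R, 0 < e -> exists2 r : R, 0 < r &
  forall h, cabs h < r -> cabs (f (z + h) - f z - d * h) <= e * cabs h.
Proof.
move=> [phi [cphi <- fE]] e e0.
have /cnbhsP[r r0 H] := cphi _ e0.
exists r => // h hr; rewrite (fE (z + h)).
rewrite (_ : _ - _ = (phi (z + h) - phi z) * h); last by ring.
rewrite cabsM ler_wpM2r ?cabs_ge0// ltW// cabsC H//.
by rewrite addrAC subrr add0r.
Qed.

Lemma cderivable_id z : cderivable id z 1.
Proof.
exists (fun=> 1); split=> //; first exact: ccvg_cst.
by move=> w; rewrite mul1r addrC subrK.
Qed.

Lemma cderivable_cst c z : cderivable (fun=> c) z 0.
Proof.
exists (fun=> 0); split=> //; first exact: ccvg_cst.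
by move=> w; rewrite mul0r addr0.
Qed.

Lemma cderivableD f g z d d' : cderivable f z d -> cderivable g z d' ->
  cderivable (fun w => f w + g w) z (d + d').
Proof.
move=> [p [cp <- fE]] [q [cq <- gE]]; exists (fun w => p w + q w); split=> //.
  exact: ccvgD.
by move=> w; rewrite fE gE; ring.
Qed.

Lemma cderivableM f g z d d' : cderivable f z d -> cderivable g z d' ->
  cderivable (fun w => f w * g w) z (d * g z + f z * d').
Proof.
move=> F G; have cg := cderivable_ccont G.
case: F G => [p [cp <- fE]] [q [cq <- gE]].
exists (fun w => p w * g w + f z * q w); split=> //.
  by apply: ccvgD; apply: ccvgM => //; exact: ccvg_cst.
by move=> w; rewrite (fE w) (gE w); ring.
Qed.

Lemma cderivable_comp f g z d d' : cderivable f z d -> cderivable g (f z) d' ->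
  cderivable (fun w => g (f w)) z (d' * d).
Proof.
move=> F G; have cf := cderivable_ccont F.
case: F G => [p [cp <- fE]] [q [cq <- gE]].
exists (fun w => q (f w) * p w); split=> //.
  by apply: ccvgM => //; exact: (ccvg_comp cf).
by move=> w; rewrite (gE (f w)) [X in q _ * (X - _)]fE; ring.
Qed.

Lemma cderivableV f z d : cderivable f z d -> f z != 0 ->
  cderivable (fun w => (f w)^-1) z (- d / f z ^+ 2).
Proof.
move=> F fz0; have cf := cderivable_ccont F.
case: F => [p [cp pd fE]].
(* The slope identity is required at every w, also where f vanishes and the inverse takes the
   default value 0; there the slope is the raw difference quotient. *)
pose phi w := if f w == 0 then ((f w)^-1 - (f z)^-1) / (w - z) else - p w / (f w * f z).
exists phi; split; last 2 first.
- by rewrite /phi (negbTE fz0) pd expr2.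
- move=> w; rewrite /phi; case: eqP => [fw0|/eqP fw0].
    rewrite mulfVK; first by rewrite addrC subrK.
    by rewrite subr_eq0; apply/eqP => wz; rewrite -wz fw0 eqxx in fz0.
  have pE : p w * (w - z) = f w - f z by rewrite (fE w); ring.
  by rewrite mulrAC mulNr pE; field; exact/andP.
have nz : cnbhs z (fun w => f w != 0).
  have fz0' : 0 < cabs (f z) by rewrite cabs_gt0.
  have := cf _ fz0'; apply: filterS => w; apply: contraTN => /eqP ->.
  by rewrite subr0 ltxx.
have : ccvg (cnbhs z) (fun w => - p w / (f w * f z)) (phi z).
  rewrite /phi (negbTE fz0); apply: ccvgM; first exact: ccvgN.
  apply: ccvgV; last by rewrite mulf_neq0.
  by apply: ccvgM => //; exact: ccvg_cst.
apply: ccvg_near; move: nz; apply: filterS => w fw0.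
by rewrite /phi (negbTE fw0).
Qed.

Lemma cderivable_near f g z d : cnbhs z (fun w => f w = g w) ->
  cderivable f z d -> cderivable g z d.
Proof.
move=> fg F; have fgz := cnbhs_singleton fg.
apply: cderivable_eps => e e0.
have [r r0 H] := cderivable_epsP F e0.
have /cnbhsP[r' r'0 H'] := fg.
exists (Num.min r r'); first by rewrite lt_min r0.
move=> h; rewrite lt_min => /andP[h1 h2].
by rewrite -fgz -H' ?H// addrAC subrr add0r.
Qed.

(** Ties the derivability used in the definition of [Hspace] to Caratheodory's form, in which all
    holomorphy below is proved. *)
Lemma derivable_chol (f : C -> C) z :
  derivable (f : C^o -> C^o) z 1 <-> chol f z.
Proof.
split.
  move=> /cvg_ex[/= l /ccvg_co dfl].
  exists l; apply: cderivable_eps => e e0.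
  have := dfl _ e0; rewrite /dnbhs /within/= => /nbhs_ballP[r0' /= r0].
  have rE : r0' = (complex.Re r0')%:C.
    by move: r0; rewrite ltcE => /andP[/eqP/= i0 _]; case: (r0') i0 => a b /= ->.
  rewrite /ball/= => H.
  exists (complex.Re r0'); first by rewrite -ltcR -rE.
  move=> h hr; case: (eqVneq h 0) => [->|h0].
    by rewrite addr0 subrr mulr0 subr0 cabs0 mulr0.
  have := H h; rewrite /ball_/= sub0r normrN [`|_|]normC_cabs rE ltcR => /(_ hr h0) K.
  rewrite (_ : f (z + h) - f z - l * h =
    - (l - h^-1 *: (f (h *: (1 : C^o) + z) - f z)) * h).
    by rewrite cabsM cabsN ler_wpM2r ?cabs_ge0// ltW.
  rewrite -[h *: (1 : C^o)]/(h * 1) mulr1 [h + z]addrC -[h^-1 *: _]/(h^-1 * _).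
  by field.
move=> [d /cderivable_epsP F].
apply/cvg_ex; exists d; apply/ccvg_co => e e0.
have [r r0 H] := F (e / 2) (divr_gt0 e0 (ltr0Sn _ _)).
rewrite /dnbhs /within/=; apply/nbhs_ballP; exists r%:C => /=; first by rewrite ltcR.
move=> h; rewrite /ball/= sub0r normrN [`|_|]normC_cabs ltcR => hr h0.
have hn : 0 < cabs h by rewrite cabs_gt0.
have K := H h hr.
rewrite -(ltr_pM2r hn) -cabsM.
rewrite (_ : (d - h^-1 *: (f (h *: (1 : C^o) + z) - f z)) * h =
   - (f (z + h) - f z - d * h)).
  by rewrite cabsN (le_lt_trans K)// ltr_pM2r// ltr_pdivrMr// ltr_pMr// ltr1n.
rewrite -[h *: (1 : C^o)]/(h * 1) mulr1 [h + z]addrC -[h^-1 *: _]/(h^-1 * _).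
by field.
Qed.

Lemma chol_cst c z : chol (fun=> c) z.
Proof. by exists 0; exact: cderivable_cst. Qed.
Lemma chol_id z : chol (fun w => w) z.
Proof. by exists 1; exact: cderivable_id. Qed.
Lemma cholD f g z : chol f z -> chol g z -> chol (fun w => f w + g w) z.
Proof. by move=> [d F] [e G]; eexists; exact: cderivableD F G. Qed.
Lemma cholM f g z : chol f z -> chol g z -> chol (fun w => f w * g w) z.
Proof. by move=> [d F] [e G]; eexists; exact: cderivableM F G. Qed.
Lemma cholZ c f z : chol f z -> chol (fun w => c * f w) z.
Proof. by move=> F; apply: cholM => //; exact: chol_cst. Qed.
Lemma cholN f z : chol f z -> chol (fun w => - f w) z.
Proof.
move=> F; rewrite (_ : (fun _ => _) = (fun w => (-1) * f w)); first exact: cholZ.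
by apply/funext => w; rewrite mulN1r.
Qed.
Lemma cholB f g z : chol f z -> chol g z -> chol (fun w => f w - g w) z.
Proof. by move=> F G; apply: cholD => //; exact: cholN. Qed.
Lemma chol_comp f g z : chol f z -> chol g (f z) -> chol (fun w => g (f w)) z.
Proof. by move=> [d F] [e G]; eexists; exact: cderivable_comp F G. Qed.
Lemma cholV f z : chol f z -> f z != 0 -> chol (fun w => (f w)^-1) z.
Proof. by move=> [d F] ?; eexists; exact: cderivableV F _. Qed.
Lemma chol_near f g z : cnbhs z (fun w => f w = g w) -> chol f z -> chol g z.
Proof. by move=> fg [d F]; exists d; exact: cderivable_near fg F. Qed.

End ComplexLimits.

(** * Complex exponential and principal logarithm *)

HB.lock Definition cexp (R : realType) (z : R[i]) : R[i] :=
  (expR (complex.Re z))%:C * (cos (complex.Im z) +i* sin (complex.Im z)).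

Arguments cexp {R} z.

Section ComplexExp.
Context {R : realType}.
Local Notation C := R[i].
Implicit Types (z w : C) (x y : R).

Lemma cReCexp z : complex.Re (cexp z) = expR (complex.Re z) * cos (complex.Im z).
Proof. by rewrite cexp.unlock cReMl. Qed.
Lemma cImCexp z : complex.Im (cexp z) = expR (complex.Re z) * sin (complex.Im z).
Proof. by rewrite cexp.unlock cImMl. Qed.

Lemma cexpD z w : cexp (z + w) = cexp z * cexp w.
Proof.
apply: ceqP.
  by rewrite cReM !cReCexp !cImCexp cReD cImD expRD cosD; ring.
by rewrite cImM !cReCexp !cImCexp cReD cImD expRD sinD; ring.
Qed.

Lemma cexp0 : cexp (0 : C) = 1.
Proof. by apply: ceqP; rewrite ?cReCexp ?cImCexp/= expR0 ?cos0 ?sin0 mul1r. Qed.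

Lemma cabs_cexp z : cabs (cexp z) = expR (complex.Re z).
Proof.
rewrite cabsE cReCexp cImCexp !exprMn -mulrDr cos2Dsin2 mulr1 sqrtr_sqr.
by rewrite ger0_norm ?expR_ge0.
Qed.

Lemma cexp_neq0 z : cexp z != 0.
Proof. by rewrite -cabs_eq0 cabs_cexp gt_eqF// expR_gt0. Qed.

Lemma cexpN z : cexp (- z) = (cexp z)^-1.
Proof.
by apply: (mulIf (cexp_neq0 z)); rewrite -cexpD addNr cexp0 mulVf// cexp_neq0.
Qed.

Lemma cexpJ z : cexp (z^*) = (cexp z)^*.
Proof.
by apply: ceqP; rewrite ?cReJ ?cImJ ?cReCexp ?cImCexp cReJ cImJ ?cosN// sinN mulrN.
Qed.

(** From e^(-x) >= 1 - x one gets e^x (1 - x) <= 1, so that 0 <= e^x - 1 - x <= x^2 / (1 - x), and 1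
    - x >= 1/2. *)
Lemma expR_taylor1 x : x <= 1/2 -> `|expR x - 1 - x| <= 2 * x ^+ 2.
Proof.
move=> x2; have h1 := expR_ge1Dx x; have h2 := expR_ge1Dx (- x).
have e0 := expR_gt0 x; rewrite expRN in h2.
have {}h2 : expR x * (1 - x) <= 1.
  by rewrite mulrC -ler_pdivlMr// mul1r.
rewrite ger0_norm; last by lra.
nra.
Qed.

Lemma normr_sin_le x : `|sin x| <= `|x|.
Proof.
wlog x0 : x / 0 < x => [H|].
  have [x0|x0|->] := ltgtP x 0; last by rewrite sin0.
    by have := H (- x); rewrite oppr_gt0 sinN !normrN; exact.
  exact: H.
have [c _ H] := @MVT_segment R sin cos 0 x (ltW x0) (fun x _ => is_derive_sin x)
   (continuous_subspaceT (@continuous_sin R)).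
rewrite sin0 !subr0 in H; rewrite H normrM ler_piMl//.
by rewrite ler_norml cos_le1 cos_geN1.
Qed.

Lemma cos_dist1 x : `|cos x - 1| <= x ^+ 2 / 2 /\ `|cos x - 1| <= `|x|.
Proof.
have xE : x = x / 2 + x / 2 by rewrite -splitr.
have -> : cos x - 1 = - (2 * sin (x / 2) ^+ 2).
  by rewrite {1}xE cosD -!expr2 cos2sin2; ring.
have h := normr_sin_le (x / 2).
have h1 : `|sin (x / 2)| <= 1 by rewrite ler_norml sin_le1 sin_geN1.
rewrite normrN normrM normrX ger0_norm// -(real_normK (num_real x)).
rewrite normrM (@ger0_norm _ (2^-1)) ?invr_ge0// in h.
have := normr_ge0 (sin (x / 2)); have := normr_ge0 x.
by split; nra.
Qed.

Lemma sin_taylor1 x : `|sin x - x| <= x ^+ 2.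
Proof.
wlog x0 : x / 0 < x => [H|].
  have [x0|x0|->] := ltgtP x 0; last by rewrite sin0 subrr normr0 expr2 mulr0.
    have := H (- x); rewrite oppr_gt0 sinN sqrrN => /(_ x0); congr (_ <= _).
    by rewrite -normrN; congr `|_|; ring.
  exact: H.
have dg (y : R) : is_derive y 1 (fun y => sin y - y) (cos y - 1).
  by apply: is_deriveB.
have cg : {within `[0, x], continuous (fun y : R => sin y - y)}.
  apply: continuous_subspaceT => y; apply: cvgB; [exact: continuous_sin|exact: cvg_id].
have [c cx H] := @MVT_segment R _ _ 0 x (ltW x0) (fun y _ => dg y) cg.
rewrite sin0 !subr0 in H; rewrite H normrM (ger0_norm (ltW x0)) expr2 ler_pM2r//.
have [_ /le_trans] := cos_dist1 c; apply.
by move: cx; rewrite in_itv/= => /andP[c0 cx]; rewrite ger0_norm.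
Qed.

(** The real part is bounded only from above. This is the form needed for small multiples of Log b,
    whose real part is at most 1 but can be arbitrarily negative. *)
Lemma cexp_taylor1 z : complex.Re z <= 1/2 -> cabs (cexp z - 1 - z) <= 3 * cabs z ^+ 2.
Proof.
move=> z2; rewrite (le_trans (cabs_le_ReIm _))// sqr_cabs.
rewrite !cReD !cImD !cReN !cImN cReCexp cImCexp/= subr0.
case: z z2 => a b /= a2.
have A := expR_taylor1 a2; have [B1 B2] := cos_dist1 b; have D := sin_taylor1 b.
have E := normr_sin_le b.
have e2 : expR a <= 2.
  have h := expR_ge1Dx (- a); rewrite expRN in h.
  have h2 : expR a * (1 - a) <= 1.
    by rewrite mulrC -ler_pdivlMr ?expR_gt0// mul1r.
  by have := expR_gt0 a; nra.
have F : `|expR a - 1| <= 2 * `|a|.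
  have [a0|a0] := leP 0 a.
    rewrite (ger0_norm a0) ler_norml.
    by move: A; rewrite ler_norml => /andP[A1 A2]; apply/andP; split; nra.
  rewrite (ltr0_norm a0) ler_norml; have h1 := expR_ge1Dx a.
  have h3 : expR a <= 1 by rewrite -expR0 ler_expR ltW.
  by apply/andP; split; lra.
have G1 : `|expR a * cos b - 1 - a| <= 2 * a ^+ 2 + b ^+ 2.
  rewrite (_ : expR a * cos b - 1 - a = (expR a - 1 - a) + expR a * (cos b - 1)); last by ring.
  rewrite (le_trans (ler_normD _ _))// normrM (ger0_norm (expR_ge0 _)) lerD//.
  have := normr_ge0 (cos b - 1); have := expR_gt0 a; nra.
have G2 : `|expR a * sin b - b| <= a ^+ 2 + 2 * b ^+ 2.
  rewrite (_ : expR a * sin b - b = (expR a - 1) * sin b + (sin b - b)); last by ring.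
  rewrite (le_trans (ler_normD _ _))// normrM.
  rewrite -(real_normK (num_real a)) -(real_normK (num_real b)).
  rewrite -(real_normK (num_real b)) in D.
  have K : `|expR a - 1| * `|sin b| <= 2 * `|a| * `|b| by apply: ler_pM.
  have := sqr_ge0 (`|a| - `|b|); nra.
nra.
Qed.

Lemma cexp_deriv z : cderivable cexp z (cexp z).
Proof.
apply: cderivable_eps => e e0.
pose M := 3 * cabs (cexp z).
have M0 : 0 < M by rewrite mulr_gt0// cabs_gt0 cexp_neq0.
exists (Num.min (1/2) (e / M)); first by rewrite lt_min divr_gt0//= divr_gt0.
move=> h; rewrite lt_min => /andP[h1 h2].
rewrite cexpD (_ : _ - _ - _ = cexp z * (cexp h - 1 - h)); last by ring.
rewrite cabsM; have K := @cexp_taylor1 h _.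
rewrite (le_trans (ler_wpM2l (cabs_ge0 _) (K _)))//.
  by rewrite (le_trans _ (ltW h1))// (le_trans _ (ger_Re_cabs _))// ler_norm.
rewrite expr2 !mulrA ler_wpM2r ?cabs_ge0// mulrC mulrCA mulrC.
by move: h2; rewrite ltr_pdivlMr// /M => /ltW; rewrite mulrA.
Qed.

Lemma cexp_chol z : chol cexp z.
Proof. by exists (cexp z); exact: cexp_deriv. Qed.

(** For the difference d of the imaginary parts, cos d = 1 gives sin (d / 2) = 0, and |d / 2| < pi
    leaves only d = 0. *)
Lemma cexp_inj z w : cexp z = cexp w -> `|complex.Im z - complex.Im w| < 2 * pi -> z = w.
Proof.
move=> zw h; have rE : complex.Re z = complex.Re w.
  by apply: expR_inj; rewrite -!cabs_cexp zw.
apply: ceqP => //.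
set d := complex.Im z - complex.Im w in h.
have dE : cexp (z - w) = 1 by rewrite cexpD cexpN zw mulfV// cexp_neq0.
have c1 : cos d = 1.
  by have := congr1 (@complex.Re R) dE; rewrite cReCexp cReD cImD cReN cImN rE subrr expR0 mul1r.
have s0 : sin (d / 2) = 0.
  apply/eqP; rewrite -sqrf_eq0.
  have : cos d = 1 - 2 * sin (d / 2) ^+ 2.
    by rewrite {1}(splitr d) cosD -!expr2 cos2sin2; ring.
  by rewrite c1 => /eqP; rewrite eq_sym subr_eq addrC -subr_eq subrr eq_sym mulf_eq0 (pnatr_eq0 R 2).
have d2 : `|d / 2| < pi.
  by rewrite normrM (@ger0_norm _ (2^-1)) ?invr_ge0// ltr_pdivrMr// mulrC.
apply/eqP; rewrite -subr_eq0 -/d; apply: contraT => dn0.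
have dn : 0 < `|d / 2| by rewrite normr_gt0 mulf_neq0// invr_eq0 (pnatr_eq0 R 2).
have sp := @sin_gt0_pi R `|d / 2|; rewrite dn d2 in sp.
have := sp isT.
have [d0|d0] := leP 0 (d / 2).
  by rewrite ger0_norm// s0 ltxx.
by rewrite ltr0_norm// sinN s0 oppr0 ltxx.
Qed.

End ComplexExp.

Section ComplexLog.
Context {R : realType}.
Local Notation C := R[i].
Implicit Types (z w : C) (x y : R).

Definition clog w : C := ln (cabs w) +i* carg w.

Let ReIm_bound w : -1 <= complex.Re w / cabs w <= 1.
Proof.
have [->|w0] := eqVneq w 0; first by rewrite cabs0 invr0 mulr0; apply/andP; split; lra.
have c0 : 0 < cabs w by rewrite cabs_gt0.
by rewrite -ler_norml normrM normfV (ger0_norm (ltW c0)) ler_pdivrMr// mul1r ger_Re_cabs.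
Qed.

Lemma carg_bound w : - pi <= carg w <= pi.
Proof.
rewrite /carg; have := acos_ge0 (ReIm_bound w); have := acos_lepi (ReIm_bound w).
by have := pi_gt0 R; case: ifP => _ ? ? ?; apply/andP; split; lra.
Qed.

Lemma carg_ge0 w : 0 <= complex.Im w -> 0 <= carg w.
Proof. by move=> w0; rewrite /carg ltNge w0/=; exact: acos_ge0 (ReIm_bound w). Qed.

Lemma carg_le0 w : complex.Im w < 0 -> carg w <= 0.
Proof. by move=> w0; rewrite /carg w0 oppr_le0; exact: acos_ge0 (ReIm_bound w). Qed.

Lemma cexp_clog w : w != 0 -> cexp (clog w) = w.
Proof.
move=> w0; have c0 : 0 < cabs w by rewrite cabs_gt0.
have cn := lt0r_neq0 c0.
have rE : cos (carg w) = complex.Re w / cabs w.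
  rewrite /carg; case: ifP => _; rewrite ?cosN acosK// in_itv/=; exact: ReIm_bound.
have sE : sin (acos (complex.Re w / cabs w)) = `|complex.Im w| / cabs w.
  rewrite sin_acos ?ReIm_bound//.
  rewrite (_ : 1 - _ = (complex.Im w / cabs w) ^+ 2).
    by rewrite sqrtr_sqr normrM normfV (ger0_norm (ltW c0)).
  rewrite !exprMn -[1](@divff _ (cabs w ^+ 2)) ?expf_neq0// exprVn -mulrBl.
  by rewrite sqr_cabs addrAC subrr add0r.
have iE : sin (carg w) = complex.Im w / cabs w.
  rewrite /carg; case: ltP => i0; rewrite ?sinN sE.
    by rewrite ltr0_norm// mulNr opprK.
  by rewrite ger0_norm.
apply: ceqP; rewrite ?cReCexp ?cImCexp/= lnK ?posrE//.
  by rewrite rE mulrCA mulfV// mulr1.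
by rewrite iE mulrCA mulfV// mulr1.
Qed.

Lemma cpowE w x : w != 0 -> cpow w x = cexp (x%:C * clog w).
Proof.
move=> w0; rewrite /cpow cexp.unlock cReMl cImMl/= -/(clog w).
by rewrite /powR cabs_eq0 (negbTE w0).
Qed.

Lemma cabs_cpow w x : w != 0 -> cabs (cpow w x) = cabs w `^ x.
Proof.
by move=> w0; rewrite cpowE// cabs_cexp cReMl/= /powR cabs_eq0 (negbTE w0).
Qed.

Lemma cpowD w x y : w != 0 -> cpow w (x + y) = cpow w x * cpow w y.
Proof. by move=> w0; rewrite !cpowE// -cexpD -mulrDl -rmorphD. Qed.

Lemma cpowr0 w : w != 0 -> cpow w 0 = 1.
Proof. by move=> w0; rewrite cpowE// rmorph0 mul0r cexp0. Qed.

Lemma cpowr1 w : w != 0 -> cpow w 1 = w.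
Proof. by move=> w0; rewrite cpowE// rmorph1 mul1r cexp_clog. Qed.

Lemma Re_gt0_neq0 w : 0 < complex.Re w -> w != 0.
Proof. by apply: contraTneq => ->; rewrite ltxx. Qed.

(** On the right half-plane the case distinction in [carg] disappears, and the continuity of the
    argument becomes that of the arctangent. *)
Lemma carg_atan w : 0 < complex.Re w -> carg w = atan (complex.Im w / complex.Re w).
Proof.
move=> r0; have w0 := Re_gt0_neq0 r0.
have c0 : 0 < cabs w by rewrite cabs_gt0.
set a := atan _.
have ca : cos a = complex.Re w / cabs w.
  rewrite cos_atan (_ : 1 + _ = (cabs w / complex.Re w) ^+ 2).
    by rewrite sqrtr_sqr ger0_norm ?divr_ge0 ?ltW// invf_div.
  by rewrite !expr_div_n sqr_cabs [RHS]mulrDl mulfV// expf_neq0// lt0r_neq0.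
have := atan_gtNpi2 (complex.Im w / complex.Re w).
have := atan_ltpi2 (complex.Im w / complex.Re w); rewrite -/a => a1 a2.
have p0 := pi_gt0 R.
rewrite /carg -ca; case: ltP => i0.
  have aneg : a <= 0.
    by rewrite -(@atan0 R) le_atan// pmulr_lle0 ?invr_gt0// ltW.
  by rewrite cosKN ?opprK//; apply/andP; split; lra.
have apos : 0 <= a by rewrite -(@atan0 R) le_atan// divr_ge0// ltW.
by rewrite cosK// in_itv/=; apply/andP; split; lra.
Qed.

Lemma carg_pi2 w : 0 < complex.Re w -> `|carg w| < pi / 2.
Proof.
by move=> r0; rewrite carg_atan// ltr_norml atan_gtNpi2 atan_ltpi2.
Qed.

Lemma clogJ w : 0 < complex.Re w -> clog (w^*) = (clog w)^*.
Proof.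
move=> r0; rewrite /clog cabsJ; apply: ceqP => //=.
by rewrite !carg_atan ?cReJ// cImJ mulNr atanN.
Qed.

Lemma clog_ccont w : 0 < complex.Re w -> ccont clog w.
Proof.
move=> r0; have w0 := Re_gt0_neq0 r0.
apply/ccvg_ReIm; split => /=.
  apply: (@continuous_cvg _ _ _ _ _ (@cabs R) (@ln R)).
    by apply: continuous_ln; rewrite cabs_gt0.
  by apply: ccvg_cabs; exact: ccvg_id.
rewrite carg_atan//.
have : (atan (complex.Im z / complex.Re z)) @[z --> cnbhs w] -->
    atan (complex.Im w / complex.Re w).
  apply: (@continuous_cvg _ _ _ _ _ (fun z : C => complex.Im z / complex.Re z) (@atan R)).
    exact: continuous_atan.
  apply: cvgM; first by apply: ccvg_Im; exact: ccvg_id.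
  apply: cvgV; first exact: lt0r_neq0.
  by apply: ccvg_Re; exact: ccvg_id.
apply: cvg_trans; apply: near_eq_cvg.
apply/cnbhsP; exists (complex.Re w) => // z zw; rewrite carg_atan//.
have := le_lt_trans (ger_Re_cabs _) zw; rewrite cReD cReN ltr_norml => /andP[]; lra.
Qed.

(** Derivative of an inverse function: the slope of [clog] is the inverse of the slope [phi] of
    [cexp] between the two logarithms. That slope vanishes for no nonzero z, since otherwise z = w,
    where it equals w. *)
Lemma clog_chol w : 0 < complex.Re w -> chol clog w.
Proof.
move=> r0; have w0 := Re_gt0_neq0 r0.
have [phi [cphi phi1 H]] := cexp_deriv (clog w).
have phin z : z != 0 -> phi (clog z) != 0.
  move=> z0; apply/eqP => p0; have := H (clog z).
  rewrite p0 mul0r addr0 !cexp_clog// => zw.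
  by move: p0; rewrite zw phi1 => /eqP; rewrite (negbTE (cexp_neq0 _)).
pose psi z := if z == 0 then (clog z - clog w) / (z - w) else (phi (clog z))^-1.
exists (psi w), psi; split => //.
  have : ccvg (cnbhs w) (fun z => (phi (clog z))^-1) (psi w).
    rewrite /psi (negbTE w0); apply: ccvgV; last exact: phin.
    by apply: ccvg_comp cphi; exact: clog_ccont.
  apply: ccvg_near; apply/cnbhsP; exists (cabs w); first by rewrite cabs_gt0.
  move=> z zw; rewrite /psi; case: eqP => // z0.
  by move: zw; rewrite z0 sub0r cabsN ltxx.
move=> z; rewrite /psi; case: eqVneq => [->|z0].
  rewrite mulfVK; first by rewrite addrC subrK.
  by rewrite sub0r oppr_eq0.
have := H (clog z); rewrite !cexp_clog// => zE.
rewrite (_ : z - w = phi (clog z) * (clog z - clog w)); last by rewrite {1}zE; ring.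
by rewrite mulKf ?phin//; ring.
Qed.

Lemma cpow_chol x w : 0 < complex.Re w -> chol (fun z => cpow z x) w.
Proof.
move=> r0; have w0 := Re_gt0_neq0 r0.
have : chol (fun z => cexp (x%:C * clog z)) w.
  apply: (@chol_comp _ (fun z => x%:C * clog z) cexp); last exact: cexp_chol.
  by apply: cholZ; exact: clog_chol.
apply: chol_near; apply/cnbhsP; exists (cabs w); first by rewrite cabs_gt0.
move=> z zw; rewrite cpowE//; apply/eqP => z0.
by move: zw; rewrite z0 sub0r cabsN ltxx.
Qed.

(* An argument determined up to less than a full turn. *)
Lemma clog_unique z w : 0 < complex.Re w -> cexp z = w ->
  `|complex.Im z| <= 3 * (pi / 2) -> z = clog w.
Proof.
move=> r0 zw h; apply: cexp_inj; first by rewrite cexp_clog// Re_gt0_neq0.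
rewrite (le_lt_trans (ler_normB _ _))//= .
by have := carg_pi2 r0; lra.
Qed.

End ComplexLog.

(* The coordinates (s, r) |-> e^r (s + i) of the upper half-plane, in which
   nu_0 is the Lebesgue measure ds dr. *)
Definition hpt {R : realType} (p : R * R) : R[i] :=
  (expR p.2 * p.1) +i* expR p.2.

Definition hcoord {R : realType} (z : R[i]) : R * R :=
  (complex.Re z * expR (- ln (complex.Im z)), ln (complex.Im z)).

HB.lock Definition qz (R : realType) (p p' : R * R) : R[i] :=
  qker (hpt p)^* (hpt p').
Arguments qz {R} p p'.

(* The weight-r kernel in these coordinates; its modulus is the distance function d of the paper to the power r. *)
HB.lock Definition Dk (R : realType) (r : R) (p p' : R * R) : R[i] :=
  cpow (qz p p') (- r) * (expR (r * ((p.2 + p'.2) / 2)))%:C.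
Arguments Dk {R} r p p'.

(** * The kernels in half-plane coordinates *)

Section Kernel.
Context {R : realType}.
Local Notation C := R[i].
Local Notation X := (R * R)%type.
Implicit Types (z w : C) (x y r s : R) (p : X).

Lemma hpt_uhp p : uhp (hpt p). Proof. exact: expR_gt0. Qed.

Lemma hcoordK z : uhp z -> hpt (hcoord z) = z.
Proof.
case: z => a b; rewrite /uhp/= => b0.
apply: ceqP; rewrite /hpt/= lnK ?posrE// expRN lnK ?posrE//; field; exact: lt0r_neq0.
Qed.

Lemma hptK p : hcoord (hpt p) = p.
Proof.
case: p => a b; rewrite /hcoord/= expRK expRN; congr pair.
by field; exact: lt0r_neq0 (expR_gt0 _).
Qed.

Lemma qkerE z w : qker (z^*) w =
  ((complex.Im z + complex.Im w) / 2) +i* ((complex.Re z - complex.Re w) / 2).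
Proof.
rewrite /qker; apply: (mulIf (_ : 0 -i* 2 != 0 :> C)).
  by rewrite -cabs_eq0 cabsE/= expr0n/= add0r sqrrN sqrtr_sqr normr_eq0 (pnatr_eq0 R 2).
rewrite mulfVK.
  by case: z w => a b [c d]; apply: ceqP; rewrite ?cReM ?cImM/=; field.
by rewrite -cabs_eq0 cabsE/= expr0n/= add0r sqrrN sqrtr_sqr normr_eq0 (pnatr_eq0 R 2).
Qed.

Lemma Re_qker z w : uhp z -> uhp w -> 0 < complex.Re (qker (z^*) w).
Proof. by rewrite qkerE /uhp /= => z0 w0; rewrite divr_gt0// addr_gt0. Qed.

Lemma qkerJ z w : (qker (z^*) w)^* = qker (w^*) z.
Proof. rewrite !qkerE; apply: ceqP => /=; first by rewrite addrC.
by rewrite -mulNr opprB. Qed.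

Lemma qzE p p' : qz p p' =
  ((expR p.2 + expR p'.2) / 2) +i* ((expR p.2 * p.1 - expR p'.2 * p'.1) / 2).
Proof. by rewrite qz.unlock qkerE. Qed.

Lemma Re_qz p p' : 0 < complex.Re (qz p p').
Proof. by rewrite qz.unlock; apply: Re_qker; exact: hpt_uhp. Qed.

Lemma qz_neq0 p p' : qz p p' != 0.
Proof. by apply: Re_gt0_neq0; exact: Re_qz. Qed.

Lemma qzJ p p' : (qz p p')^* = qz p' p.
Proof. by rewrite qz.unlock qkerJ. Qed.

(** A single exponential, linear in r: additivity in r and hermitian symmetry follow without any
    question of branches. *)
Lemma DkE r p p' : Dk r p p' =
  cexp (r%:C * (((p.2 + p'.2) / 2)%:C - clog (qz p p'))).
Proof.
rewrite Dk.unlock cpowE ?qz_neq0// mulrBr cexpD mulrC.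
congr (_ * _); last by rewrite rmorphN/= mulNr.
rewrite -rmorphM; apply: ceqP; first by rewrite cReCexp/= cos0 mulr1.
by rewrite cImCexp/= sin0 mulr0.
Qed.

Lemma DkJ r p p' : (Dk r p p')^* = Dk r p' p.
Proof.
rewrite !DkE -cexpJ; congr cexp.
rewrite -(qzJ p p') clogJ ?Re_qz// (addrC p'.2).
by rewrite cJM cJB !cJR.
Qed.

Lemma DkD r s p p' : Dk (r + s) p p' = Dk r p p' * Dk s p p'.
Proof. by rewrite !DkE -cexpD -mulrDl rmorphD. Qed.

Lemma Dk_neq0 r p p' : Dk r p p' != 0.
Proof. by rewrite DkE cexp_neq0. Qed.

Definition dX p p' : R := expR ((p.2 + p'.2) / 2) / cabs (qz p p').

Lemma cabs_qz_gt0 p p' : 0 < cabs (qz p p').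
Proof. by rewrite cabs_gt0 qz_neq0. Qed.

Lemma dX_gt0 p p' : 0 < dX p p'.
Proof. by rewrite divr_gt0 ?expR_gt0// cabs_qz_gt0. Qed.

Lemma ln_dX p p' : ln (dX p p') = (p.2 + p'.2) / 2 - ln (cabs (qz p p')).
Proof. by rewrite ln_div ?posrE ?expR_gt0 ?cabs_qz_gt0// expRK. Qed.

Lemma cabs_Dk r p p' : cabs (Dk r p p') = dX p p' `^ r.
Proof.
by rewrite DkE cabs_cexp cReMl cReD cReN/= -ln_dX /powR gt_eqF// dX_gt0.
Qed.

(** The modulus of q is at least its real part, the arithmetic mean of the two heights, which is at
    least their geometric mean. *)
Lemma dX_le1 p p' : dX p p' <= 1.
Proof.
rewrite ler_pdivrMr ?cabs_qz_gt0// mul1r (le_trans _ (ger_Re_cabs _))//.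
rewrite ger0_norm; last by rewrite ltW// Re_qz.
rewrite qzE/= mulrDl expRD.
have e2 x : expR x = expR (x / 2) ^+ 2 by rewrite expr2 -expRD -splitr.
rewrite (e2 p.2) (e2 p'.2).
have := sqr_ge0 (expR (p.2 / 2) - expR (p'.2 / 2)); rewrite sqrrB; lra.
Qed.

Lemma dkerE p p' : dker (hpt p) (hpt p') = dX p p'.
Proof.
rewrite /dker /dX qz.unlock/=; congr (_ / _).
rewrite -[p.2 in LHS](@mulfK _ 2)// -[p'.2 in LHS](@mulfK _ 2)//.
rewrite -!(mulrAC _ _ 2) ![_ * 2]mulrC !mulr2n !mulrDl !mul1r !expRD -!expr2.
by rewrite !sqrtr_sqr !ger0_norm ?expR_ge0.
Qed.

Lemma Dkxx r p : Dk r p p = 1.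
Proof.
have -> : Dk r p p = cexp (r%:C * (0 : C)).
  rewrite DkE; congr (cexp (_ * _)); rewrite /clog.
  have -> : qz p p = (expR p.2)%:C.
    by rewrite qzE subrr mul0r; congr (_ +i* _); field.
  rewrite cabs_real ger0_norm ?expR_ge0// expRK carg_atan/= ?expR_gt0//.
  rewrite mul0r atan0 (_ : (p.2 + p.2) / 2 = p.2) ?subrr//; by field.
by rewrite mulr0 cexp0.
Qed.

Lemma dX_powR_le1 r p p' : 0 <= r -> dX p p' `^ r <= 1.
Proof. by move=> r0; rewrite (le_trans (ge0_ler_powR r0 _ _ (dX_le1 p p')))// ?nnegrE ?powR1// ltW// dX_gt0. Qed.

Section continuity.
Context {T : Type} {F : set_system T} {FF : Filter F}.
Variables (f g : T -> X) (p p' : X).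
Hypotheses (fp : f @ F --> p) (gp : g @ F --> p').

Lemma ccvg_hpt : ccvg F (fun t => hpt (f t)) (hpt p).
Proof.
have c1 : fst (f t) @[t --> F] --> fst p by apply: (@cvg_comp _ _ _ f fst _ _ _ fp); exact: cvg_fst.
have c2 : snd (f t) @[t --> F] --> snd p by apply: (@cvg_comp _ _ _ f snd _ _ _ fp); exact: cvg_snd.
apply/ccvg_ReIm; split => /=.
  apply: cvgM => //; apply: (@continuous_cvg _ _ _ _ _ _ (@expR R)) => //.
  exact: continuous_expR.
apply: (@continuous_cvg _ _ _ _ _ _ (@expR R)) => //.
exact: continuous_expR.
Qed.

End continuity.

Lemma ccvg_qker {T : Type} {F : set_system T} {FF : Filter F} (f g : T -> C) z w :
  ccvg F f z -> ccvg F g w -> ccvg F (fun t => qker (f t) (g t)) (qker z w).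
Proof. by move=> h k; apply: ccvgM; [exact: ccvgB|exact: ccvg_cst]. Qed.

Lemma ccvg_Dk {T : Type} {F : set_system T} {FF : Filter F} (f g : T -> X) p p' r :
  f @ F --> p -> g @ F --> p' -> ccvg F (fun t => Dk r (f t) (g t)) (Dk r p p').
Proof.
move=> fp gp.
have c2 : snd (f t) @[t --> F] --> snd p by apply: (@cvg_comp _ _ _ f snd _ _ _ fp); exact: cvg_snd.
have c4 : snd (g t) @[t --> F] --> snd p' by apply: (@cvg_comp _ _ _ g snd _ _ _ gp); exact: cvg_snd.
under eq_fun do rewrite DkE; rewrite DkE.
apply: (@ccvg_comp _ _ _ _ (fun t => _) cexp); last exact: chol_ccont (cexp_chol _).
apply: ccvgM; first exact: ccvg_cst.
apply: ccvgB.
  by apply: ccvg_real; apply: cvgM; [exact: cvgD|exact: cvg_cst].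
apply: (@ccvg_comp _ _ _ _ (fun t => _) clog); last exact: clog_ccont (Re_qz _ _).
rewrite qz.unlock; apply: ccvg_qker; last exact: ccvg_hpt.
by apply: ccvgJ; exact: ccvg_hpt.
Qed.

Lemma qker_chol z w : chol (qker z) w.
Proof.
apply: cholM; last exact: chol_cst.
by apply: cholB; [exact: chol_cst|exact: chol_id].
Qed.

Lemma cpow_qker_chol z w r : uhp z -> uhp w -> chol (fun u => cpow (qker (z^*) u) r) w.
Proof.
move=> z0 w0; apply: (@chol_comp _ (qker z^*) (fun u => cpow u r)).
  exact: qker_chol.
by apply: cpow_chol; exact: Re_qker.
Qed.

Lemma clog_qker_chol z w : uhp z -> uhp w -> chol (fun u => clog (qker (z^*) u)) w.
Proof.
move=> z0 w0; apply: (@chol_comp _ (qker z^*) clog); first exact: qker_chol.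
by apply: clog_chol; exact: Re_qker.
Qed.

End Kernel.

(** * The bracket in the product of symbols and its logarithm *)

Section Bracket.
Context {R : realType}.
Local Notation C := R[i].
Local Notation X := (R * R)%type.
Implicit Types (z w : C) (x y r s t : R) (p e : X).

Definition brk w z (xi : C) : C := ((w - xi) * (z^* - z)) / ((w - z) * (z^* - xi)).
Definition bX p e p' : C := brk (hpt p)^* (hpt e) (hpt p').

(* Additive, hence free of branch cuts; it is a logarithm of bX by cexp_lbX. *)
Definition lbX p e p' : C := clog (qz p p') + (e.2)%:C - clog (qz p e) - clog (qz e p').

Lemma bXE p e p' : bX p e p' = qz p p' * (expR e.2)%:C / (qz p e * qz e p').
Proof.
have i0 : (0 -i* 2 : C) != 0.
  by rewrite -cabs_eq0 cabsE/= expr0n/= add0r sqrrN sqrtr_sqr normr_eq0 (pnatr_eq0 R 2).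
have := qz_neq0 p e; have := qz_neq0 e p'; rewrite !qz.unlock /qker /bX /brk.
rewrite !mulf_eq0 !invr_eq0 (negbTE i0) !orbF => h1 h2.
have -> : (hpt e)^* - hpt e = (expR e.2)%:C * (0 -i* 2).
  by apply: ceqP; rewrite ?cReM ?cImM/=; ring.
by field; rewrite h1 h2 i0.
Qed.

Lemma cexp_lbX p e p' : cexp (lbX p e p') = bX p e p'.
Proof.
rewrite /lbX !cexpD !cexpN !cexp_clog ?qz_neq0// bXE.
have -> : cexp (e.2)%:C = (expR e.2)%:C :> C.
  by apply: ceqP; rewrite ?cReCexp ?cImCexp/= ?cos0 ?sin0 ?mulr1 ?mulr0.
by field; rewrite !qz_neq0.
Qed.

Lemma cabs_lt_uhp z w : uhp z -> uhp w -> cabs (z - w) < cabs (z - w^*).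
Proof.
case: z w => a b [c d]; rewrite /uhp/= => b0 d0.
rewrite -(ltr_pXn2r (n := 2))// ?nnegrE ?cabs_ge0// !sqr_cabs/=; nra.
Qed.

Lemma bX_dist1 p e p' : cabs (1 - bX p e p') < 1.
Proof.
have u1 := hpt_uhp p; have u2 := hpt_uhp e; have u3 := hpt_uhp p'.
have h1 := cabs_lt_uhp u1 u2; have h2 := cabs_lt_uhp u3 u2.
set z := hpt p in u1 h1 *; set w := hpt e in u2 h1 h2 *; set x := hpt p' in u3 h2 *.
have n1 : z^* - w != 0.
  by rewrite -cabs_gt0 -cabsJ cJB conjcK (le_lt_trans _ h1)// cabs_ge0.
have n2 : x - w^* != 0 by rewrite -cabs_gt0 (le_lt_trans _ h2)// cabs_ge0.
have n3 : w^* - x != 0 by rewrite -oppr_eq0 opprB.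
rewrite (_ : 1 - _ = (z - w)^* * (x - w) / ((z^* - w) * (x - w^*))).
  rewrite !(cabsM, cabsV) cabsJ -[cabs (z^* - w)]cabsJ cJB conjcK.
  rewrite ltr_pdivrMr ?mul1r; last first.
    by rewrite mulr_gt0// (le_lt_trans _ h1, le_lt_trans _ h2)// cabs_ge0.
  by rewrite ltr_pM// cabs_ge0.
by rewrite /bX /brk -/z -/w -/x cJB; field; rewrite n1 n2 n3.
Qed.

Lemma Re_bX p e p' : 0 < complex.Re (bX p e p').
Proof.
have := le_lt_trans (ger_Re_cabs _) (bX_dist1 p e p').
by rewrite cReD cReN/= ltr_norml => /andP[]; lra.
Qed.

Lemma cabs_bX p e p' : cabs (bX p e p') <= 2.
Proof.
rewrite (_ : bX p e p' = 1 - (1 - bX p e p')); last by ring.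
by rewrite (le_trans (cabsB _ _))// cabs1; have := bX_dist1 p e p'; lra.
Qed.

(** The three arguments in [lbX] are each less than pi / 2 in modulus, so that their sum stays in
    the range of [clog_unique]. *)
Lemma clog_bX p e p' : clog (bX p e p') = lbX p e p'.
Proof.
apply/esym/clog_unique; [exact: Re_bX|exact: cexp_lbX|].
rewrite /lbX !cImD !cImN/= addr0.
have := carg_pi2 (Re_qz p p'); have := carg_pi2 (Re_qz p e).
have := carg_pi2 (Re_qz e p'); rewrite !ltr_norml => /andP[? ?] /andP[? ?] /andP[? ?].
by rewrite ler_norml; apply/andP; split; lra.
Qed.

Lemma bX_neq0 p e p' : bX p e p' != 0.
Proof. by apply: Re_gt0_neq0; exact: Re_bX. Qed.

Lemma cpow_bX_Dk s p e p' : cpow (bX p e p') s * Dk s p p' = Dk s p e * Dk s e p'.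
Proof.
rewrite cpowE ?bX_neq0// clog_bX !DkE -!cexpD -!mulrDr; congr (cexp (_ * _)).
rewrite /lbX (_ : ((p.2 + e.2) / 2)%:C = ((p.2 + p'.2) / 2)%:C + (e.2)%:C - ((e.2 + p'.2) / 2)%:C :> C).
  ring.
by rewrite -!(rmorphD, rmorphN)/=; congr (_%:C); field.
Qed.

Lemma ln_cabs_bX p e p' : ln (cabs (bX p e p')) <= 1.
Proof.
have c0 : 0 < cabs (bX p e p') by rewrite cabs_gt0 bX_neq0.
rewrite -(expRK 1) ler_ln ?posrE ?expR_gt0// (le_trans (cabs_bX _ _ _))//.
by have := expR_ge1Dx (1 : R); lra.
Qed.

(* Any power of the logarithm up to the second is absorbed by lowering the
   exponent from t to t0. *)
Lemma log_bound (t0 t : R) : t0 < t -> exists2 M : R, 0 < M & forall p e p',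
  cabs (cpow (bX p e p') t) * (1 + cabs (lbX p e p') + cabs (lbX p e p') ^+ 2)
   <= M * cabs (cpow (bX p e p') t0).
Proof.
move=> tt; pose a := t - t0; have a0 : 0 < a by rewrite subr_gt0.
(* With x = log |b| one has 1 + L + L^2 <= 7 + 5 |x| + x^2. If x >= 0, then x <= 1 bounds this by
   13. If x < 0, put u = - a x / 2: then (1 + u)^2 <= e^(2 u) = e^(- a x), and - x = 2 u / a
   produces the terms 10 / a and 4 / a^2. *)
pose M := 13 * expR a + 7 + 10 / a + 4 / a ^+ 2.
have ia : 0 < a^-1 by rewrite invr_gt0.
have ia2 : 0 < (a ^+ 2)^-1 by rewrite invr_gt0 exprn_gt0.
have ea := expR_gt0 a.
exists M; first by rewrite /M; nra.
move=> p e p'; have c0 : 0 < cabs (bX p e p') by rewrite cabs_gt0 bX_neq0.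
rewrite !cabs_cpow ?bX_neq0// (_ : t = t0 + a); last by rewrite /a; ring.
rewrite powRD; last by rewrite (gt_eqF c0) implybT.
rewrite -mulrA mulrC ler_pM2r ?powR_gt0//.
set L := cabs (lbX p e p').
set x := ln (cabs (bX p e p')).
have x1 : x <= 1 by exact: ln_cabs_bX.
have L1 : L <= `|x| + 2.
  rewrite /L -clog_bX (le_trans (cabs_le_ReIm _))//= lerD2l.
  by rewrite (le_trans (ltW (carg_pi2 (Re_bX p e p'))))//; have := @pihalf_lt2 R; lra.
have L0 : 0 <= L by exact: cabs_ge0.
rewrite /powR (gt_eqF c0) -/x.
have E0 := expR_gt0 (a * x).
have P : 1 + L + L ^+ 2 <= 7 + 5 * `|x| + `|x| ^+ 2.
  by have := normr_ge0 x; nra.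
apply: le_trans (ler_wpM2l (ltW E0) P) _.
have [x0|x0] := leP 0 x.
  rewrite ger0_norm//.
  have ex : expR (a * x) <= expR a by rewrite ler_expR; nra.
  have : expR (a * x) * (7 + 5 * x + x ^+ 2) <= expR a * 13.
    by apply: ler_pM; nra.
  by rewrite /M; nra.
rewrite ltr0_norm//; pose u := a * (- x) / 2.
have u0 : 0 <= u by rewrite /u; nra.
have H : (1 + u) ^+ 2 * expR (a * x) <= 1.
  have h := expR_ge1Dx u.
  have eE : expR u ^+ 2 * expR (a * x) = 1.
    by rewrite expr2 -!expRD (_ : _ + _ = 0) ?expR0// /u; field.
  rewrite -eE ler_pM2r// ler_pXn2r// ?nnegrE; lra.
have xE : - x = 2 * u / a by rewrite /u; field; exact: lt0r_neq0.
rewrite xE.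
have h1 : expR (a * x) <= 1 by nra.
have h2 : expR (a * x) * u <= 1 by nra.
have h3 : expR (a * x) * u ^+ 2 <= 1 by nra.
rewrite /M; move: (expR (a * x)) E0 h1 h2 h3 => E E0 h1 h2 h3.
rewrite (_ : E * _ = 7 * E + 10 * (E * u) / a + 4 * (E * u ^+ 2) / a ^+ 2); last by field; exact: lt0r_neq0.
have k1 : 10 * (E * u) / a <= 10 / a by rewrite ler_pM2r//; lra.
have k2 : 4 * (E * u ^+ 2) / a ^+ 2 <= 4 / a ^+ 2 by rewrite ler_pM2r//; lra.
nra.
Qed.

(** b^s = b^t e^((s - t) Log b), and the real part of (s - t) Log b is at most 1/2 because log |b|
    <= 1. *)
Lemma cpow_bX_taylor t s p e p' : t <= s -> s - t <= 1 / 2 ->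
  cabs (cpow (bX p e p') s - cpow (bX p e p') t -
        (s - t)%:C * (cpow (bX p e p') t * lbX p e p'))
   <= 3 * (s - t) ^+ 2 * (cabs (cpow (bX p e p') t) * cabs (lbX p e p') ^+ 2).
Proof.
move=> ts st; have d0 : 0 <= s - t by rewrite subr_ge0.
set b := bX p e p'; set L := lbX p e p'.
have -> : cpow b s = cpow b t * cexp ((s - t)%:C * L).
  rewrite /L -clog_bX -/b -cpowE ?bX_neq0// -cpowD ?bX_neq0//; congr cpow; ring.
rewrite (_ : _ - _ - _ = cpow b t * (cexp ((s - t)%:C * L) - 1 - (s - t)%:C * L)); last by ring.
rewrite cabsM mulrCA ler_wpM2l ?cabs_ge0//.
apply: le_trans (cexp_taylor1 _) _.
  rewrite cReMl (_ : complex.Re L = ln (cabs b)); last by rewrite /L -clog_bX.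
  by have := ln_cabs_bX p e p'; rewrite -/b; nra.
by rewrite cabsM cabs_real (ger0_norm d0) exprMn mulrA.
Qed.

End Bracket.

(** * Integration of complex functions *)

Section ComplexIntegral.
Context d (T : measurableType d) (R : realType).
Local Notation C := R[i].
Implicit Types (D : set T) (f g : T -> C) (c : C).

Definition cmeas D f := measurable_fun D (fun x => complex.Re (f x)) /\
  measurable_fun D (fun x => complex.Im (f x)).

Lemma cmeas_cst D c : cmeas D (fun=> c).
Proof. by split; exact: measurable_cst. Qed.

Lemma cmeasD D f g : cmeas D f -> cmeas D g -> cmeas D (fun x => f x + g x).
Proof.
move=> [a b] [a' b']; split.
  by under eq_fun do rewrite cReD; exact: measurable_funD.
by under eq_fun do rewrite cImD; exact: measurable_funD.
Qed.

Lemma cmeasN D f : cmeas D f -> cmeas D (fun x => - f x).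
Proof.
move=> [a b]; split.
  by under eq_fun do rewrite cReN; exact: measurable_funN.
by under eq_fun do rewrite cImN; exact: measurable_funN.
Qed.

Lemma cmeasB D f g : cmeas D f -> cmeas D g -> cmeas D (fun x => f x - g x).
Proof. by move=> a b; apply: cmeasD => //; exact: cmeasN. Qed.

Lemma cmeasM D f g : cmeas D f -> cmeas D g -> cmeas D (fun x => f x * g x).
Proof.
move=> [a b] [a' b']; split.
  by under eq_fun do rewrite cReM; apply: measurable_funB; exact: measurable_funM.
by under eq_fun do rewrite cImM; apply: measurable_funD; exact: measurable_funM.
Qed.

Lemma cmeasJ D f : cmeas D f -> cmeas D (fun x => (f x)^*).
Proof.
move=> [a b]; split.
  by under eq_fun do rewrite cReJ.
by under eq_fun do rewrite cImJ; exact: measurable_funN.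
Qed.

Lemma cmeas_real D (f : T -> R) : measurable_fun D f -> cmeas D (fun x => (f x)%:C).
Proof. by split => //=; exact: measurable_cst. Qed.

Lemma cmeas_sum D (I : Type) (s : seq I) (f : I -> T -> C) :
  (forall i, cmeas D (f i)) -> cmeas D (fun x => \sum_(i <- s) f i x).
Proof.
move=> h; elim: s => [|i s IH].
  by under eq_fun do rewrite big_nil; exact: cmeas_cst.
by under eq_fun do rewrite big_cons; exact: cmeasD.
Qed.

Lemma measurable_cabs D f : cmeas D f -> measurable_fun D (fun x => cabs (f x)).
Proof.
move=> [a b]; under eq_fun do rewrite cabsE.
apply: (measurableT_comp (continuous_measurable_fun (@sqrt_continuous R))).
by apply: measurable_funD; apply: measurable_funX.
Qed.

Lemma measurable_ecabs D f : cmeas D f -> measurable_fun D (fun x => (cabs (f x))%:E).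
Proof. by move=> h; apply/measurable_EFinP; exact: measurable_cabs. Qed.

Lemma cmeas_lim D (f_ : nat -> T -> C) f : measurable D -> (forall n, cmeas D (f_ n)) ->
  (forall x, D x -> ccvg \oo (fun n => f_ n x) (f x)) -> cmeas D f.
Proof.
move=> mD mf h; split.
  apply: (@measurable_fun_cvg _ _ _ _ (fun n x => complex.Re (f_ n x))) => //.
  - by move=> n; have [] := mf n.
  - by move=> x Dx; apply: ccvg_Re; exact: h.
apply: (@measurable_fun_cvg _ _ _ _ (fun n x => complex.Im (f_ n x))) => //.
- by move=> n; have [] := mf n.
- by move=> x Dx; apply: ccvg_Im; exact: h.
Qed.

Variable mu : {measure set T -> \bar R}.

Definition cint D f : C := (\int[mu]_(x in D) complex.Re (f x)) +i*
  (\int[mu]_(x in D) complex.Im (f x)).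

Definition cintg D f := cmeas D f /\ (\int[mu]_(x in D) (cabs (f x))%:E < +oo)%E.

Variable D : set T.
Hypothesis mD : measurable D.

Lemma cintg_le f (g : T -> R) : cmeas D f -> measurable_fun D g ->
  (forall x, D x -> cabs (f x) <= g x) -> (\int[mu]_(x in D) (g x)%:E < +oo)%E ->
  cintg D f.
Proof.
move=> mf mg fg h; split => //; apply: le_lt_trans h.
apply: ge0_le_integral => //.
- by move=> x _; rewrite lee_fin cabs_ge0.
- exact: measurable_ecabs.
- exact/measurable_EFinP.
Qed.

Lemma cintg_Re f : cintg D f -> mu.-integrable D (fun x => (complex.Re (f x))%:E).
Proof.
move=> [mf h]; apply/integrableP; split; first by apply/measurable_EFinP; case: mf.
apply: le_lt_trans h; apply: ge0_le_integral => //.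
- by apply/measurable_EFinP/measurableT_comp => //; case: mf.
- exact: measurable_ecabs.
- by move=> x _; rewrite lee_fin ger_Re_cabs.
Qed.

Lemma cintg_Im f : cintg D f -> mu.-integrable D (fun x => (complex.Im (f x))%:E).
Proof.
move=> [mf h]; apply/integrableP; split; first by apply/measurable_EFinP; case: mf.
apply: le_lt_trans h; apply: ge0_le_integral => //.
- by apply/measurable_EFinP/measurableT_comp => //; case: mf.
- exact: measurable_ecabs.
- by move=> x _; rewrite lee_fin ger_Im_cabs.
Qed.

Lemma cintg_cabs f : cintg D f -> mu.-integrable D (fun x => (cabs (f x))%:E).
Proof.
move=> [mf h]; apply/integrableP; split; first exact: measurable_ecabs.
by under eq_integral => x _ do rewrite /= ger0_norm ?cabs_ge0//.
Qed.

Lemma cintgD f g : cintg D f -> cintg D g -> cintg D (fun x => f x + g x).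
Proof.
move=> F G; apply: (@cintg_le _ (fun x => cabs (f x) + cabs (g x))).
- by apply: cmeasD; [case: F|case: G].
- by apply: measurable_funD; apply: measurable_cabs; [case: F|case: G].
- by move=> x _; exact: cabsD.
under eq_integral => x _ do rewrite EFinD.
rewrite ge0_integralD//.
- by apply: lte_add_pinfty; [case: F|case: G].
- by move=> x _; rewrite lee_fin cabs_ge0.
- by apply: measurable_ecabs; case: F.
- by move=> x _; rewrite lee_fin cabs_ge0.
- by apply: measurable_ecabs; case: G.
Qed.

Lemma cintgZ c f : cintg D f -> cintg D (fun x => c * f x).
Proof.
move=> F; split; first by apply: cmeasM; [exact: cmeas_cst|case: F].
under eq_integral => x _ do rewrite cabsM EFinM.
rewrite ge0_integralZl//.
- by rewrite lte_mul_pinfty ?lee_fin ?cabs_ge0//; case: F.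
- by apply: measurable_ecabs; case: F.
- by move=> x _; rewrite lee_fin cabs_ge0.
- by rewrite lee_fin cabs_ge0.
Qed.

Lemma cintgN f : cintg D f -> cintg D (fun x => - f x).
Proof.
move=> [mf F]; split; first exact: cmeasN.
by under eq_integral => x _ do rewrite cabsN.
Qed.

Lemma cintgB f g : cintg D f -> cintg D g -> cintg D (fun x => f x - g x).
Proof. by move=> F G; apply: cintgD => //; exact: cintgN. Qed.

Lemma cintgJ f : cintg D f -> cintg D (fun x => (f x)^*).
Proof.
move=> [mf F]; split; first exact: cmeasJ.
by under eq_integral => x _ do rewrite cabsJ.
Qed.

Lemma cintg0 : cintg D (fun=> 0).
Proof.
split; first exact: cmeas_cst.
by under eq_integral => x _ do rewrite cabs0; rewrite integral0.
Qed.

Lemma cintg_sum (I : Type) (s : seq I) (f : I -> T -> C) :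
  (forall i, cintg D (f i)) -> cintg D (fun x => \sum_(i <- s) f i x).
Proof.
move=> h; elim: s => [|i s IH].
  by under eq_fun do rewrite big_nil; exact: cintg0.
by under eq_fun do rewrite big_cons; exact: cintgD.
Qed.

Lemma eq_cint f g : (forall x, D x -> f x = g x) -> cint D f = cint D g.
Proof.
move=> fg; apply: ceqP => /=; apply: eq_Rintegral => x; rewrite inE => Dx;
by rewrite fg.
Qed.

Lemma cintD f g : cintg D f -> cintg D g ->
  cint D (fun x => f x + g x) = cint D f + cint D g.
Proof.
move=> F G; apply: ceqP => /=.
  under eq_Rintegral => x _ do rewrite cReD.
  by rewrite RintegralD//; exact: cintg_Re.
under eq_Rintegral => x _ do rewrite cImD.
by rewrite RintegralD//; exact: cintg_Im.
Qed.

Lemma cint0 : cint D (fun=> 0) = 0.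
Proof. by rewrite /cint /= !Rintegral_cst// !mul0r. Qed.

Lemma cintZ c f : cintg D f -> cint D (fun x => c * f x) = c * cint D f.
Proof.
move=> F; have re := cintg_Re F; have im := cintg_Im F.
apply: ceqP.
  rewrite cReM /=; under eq_Rintegral => x _ do rewrite cReM.
  rewrite RintegralB//; last first.
  - exact: (integrableZl mD _ im).
  - exact: (integrableZl mD _ re).
  by rewrite !RintegralZl.
rewrite cImM /=; under eq_Rintegral => x _ do rewrite cImM.
rewrite RintegralD//; last first.
- exact: (integrableZl mD _ re).
- exact: (integrableZl mD _ im).
by rewrite !RintegralZl.
Qed.

Lemma cintN f : cintg D f -> cint D (fun x => - f x) = - cint D f.
Proof.
by move=> F; rewrite -mulN1r -cintZ//; apply: eq_cint => x _; rewrite mulN1r.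
Qed.

Lemma cintB f g : cintg D f -> cintg D g ->
  cint D (fun x => f x - g x) = cint D f - cint D g.
Proof. by move=> F G; rewrite cintD ?cintN//; exact: cintgN. Qed.

Lemma cintZr c f : cintg D f -> cint D (fun x => f x * c) = cint D f * c.
Proof. by move=> F; rewrite mulrC -cintZ//; apply: eq_cint => x _; rewrite mulrC. Qed.

Lemma cintgZr c f : cintg D f -> cintg D (fun x => f x * c).
Proof. by move=> /(cintgZ c); under eq_fun do rewrite mulrC. Qed.

Lemma cintJ f : cintg D f -> cint D (fun x => (f x)^*) = (cint D f)^*.
Proof.
move=> F; have im := cintg_Im F; apply: ceqP => /=.
  by apply: eq_Rintegral => x _; rewrite cReJ.
under eq_Rintegral => x _ do rewrite cImJ -mulN1r.
by rewrite RintegralZl// mulN1r.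
Qed.

Lemma cint_sum (I : Type) (s : seq I) (f : I -> T -> C) :
  (forall i, cintg D (f i)) ->
  cint D (fun x => \sum_(i <- s) f i x) = \sum_(i <- s) cint D (f i).
Proof.
move=> h; elim: s => [|i s IH].
  by under eq_fun do rewrite big_nil; rewrite big_nil cint0.
under eq_fun do rewrite big_cons; rewrite big_cons cintD ?IH//.
exact: cintg_sum.
Qed.

Lemma cint_ge0 f : (forall x, D x -> 0 <= f x) -> 0 <= cint D f.
Proof.
move=> f0; rewrite lecE /=; apply/andP; split; last first.
  by apply: Rintegral_ge0 => x /f0; rewrite lecE => /andP[].
rewrite (@eq_Rintegral _ _ _ _ _ (fun=> 0)); first by rewrite Rintegral_cst// mul0r.
by move=> x; rewrite inE => /f0; rewrite lecE => /andP[/eqP].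
Qed.

Lemma cint_real (f : T -> R) : cint D (fun x => (f x)%:C) = (\int[mu]_(x in D) f x)%:C.
Proof. by rewrite /cint/= Rintegral_cst// mul0r. Qed.

(** Multiplying by the conjugate of the integral I makes it real: |I|^2 is the integral of Re (I^*
    f), at most |I| times that of |f|. *)
Lemma cabs_cint f : cintg D f -> cabs (cint D f) <= \int[mu]_(x in D) cabs (f x).
Proof.
move=> F; set I := cint D f; have [I0|I0] := eqVneq I 0.
  by rewrite I0 cabs0; apply: Rintegral_ge0 => x _; exact: cabs_ge0.
have c0 : 0 < cabs I by rewrite cabs_gt0.
rewrite -(ler_pM2l c0) -expr2.
have -> : cabs I ^+ 2 = complex.Re (I^* * I) by rewrite mulrC mulcJ.
rewrite -[in leLHS]cintZ// /= -RintegralZl//; last exact: cintg_cabs.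
apply: le_Rintegral => //.
- by apply: cintg_Re; exact: cintgZ.
- by apply: (@integrableZl _ _ _ mu D mD (cabs I) (fun x => (cabs (f x))%:E)); exact: cintg_cabs.
- move=> x _; rewrite (le_trans (ler_norm _))// (le_trans (ger_Re_cabs _))//.
  by rewrite cabsM -[_ -i* _]/(I^*) cabsJ.
Qed.

(** In extended reals the bound also covers a non-integrable f, so that it can be used before
    integrability is known, in particular to establish it. *)
Lemma ecabs_cint f : cmeas D f ->
  ((cabs (cint D f))%:E <= \int[mu]_(x in D) (cabs (f x))%:E)%E.
Proof.
move=> mf; have [F|] := boolP (\int[mu]_(x in D) (cabs (f x))%:E < +oo)%E; last first.
  by rewrite -leNgt leye_eq => /eqP ->; rewrite leey.
have {}F : cintg D f by [].
rewrite -[leRHS]fineK; first by rewrite lee_fin; exact: cabs_cint.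
by apply: integrable_fin_num => //; exact: cintg_cabs.
Qed.

Lemma cabs_cint_le f (g : T -> R) : cintg D f -> measurable_fun D g ->
  (forall x, D x -> cabs (f x) <= g x) -> (\int[mu]_(x in D) (g x)%:E < +oo)%E ->
  cabs (cint D f) <= \int[mu]_(x in D) g x.
Proof.
move=> F mg fg h; rewrite (le_trans (cabs_cint F))//.
apply: le_Rintegral => //; first exact: cintg_cabs.
apply/integrableP; split; first exact/measurable_EFinP.
under eq_integral => x xD.
  rewrite /= ger0_norm; last by rewrite (le_trans (cabs_ge0 (f x)))// fg//; rewrite inE in xD.
  over.
exact: h.
Qed.

Lemma cint_dominated (f_ : nat -> T -> C) f (g : T -> R) :
  (forall n, cmeas D (f_ n)) ->
  (forall x, D x -> ccvg \oo (fun n => f_ n x) (f x)) ->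
  measurable_fun D g -> (\int[mu]_(x in D) (g x)%:E < +oo)%E ->
  (forall n x, D x -> cabs (f_ n x) <= g x) ->
  cintg D f /\ ccvg \oo (fun n => cint D (f_ n)) (cint D f).
Proof.
move=> mf cf mg ig fg.
have mf' : cmeas D f by exact: cmeas_lim mf cf.
have fg' x : D x -> cabs (f x) <= g x.
  move=> Dx; rewrite -(cvg_lim _ (ccvg_cabs (cf x Dx)))//.
  apply: limr_le; last by apply: nearW => n; exact: fg.
  by apply/cvg_ex; exists (cabs (f x)); apply: ccvg_cabs; exact: cf.
have F : cintg D f by exact: cintg_le fg' ig.
split => //.
have ig' : mu.-integrable D (EFin \o g).
  apply/integrableP; split; first exact/measurable_EFinP.
  under eq_integral => x xD.
    rewrite /= ger0_norm; last by rewrite (le_trans (cabs_ge0 (f x)))// fg'//; rewrite inE in xD.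
    over.
  exact: ig.
have Fn n : cintg D (f_ n) by apply: cintg_le ig => //; exact: fg.
apply/ccvg_ReIm; split => /=.
  rewrite /Rintegral; apply: fine_cvg; rewrite fineK; last first.
    by apply: integrable_fin_num => //; exact: cintg_Re.
  have [] := @dominated_convergence _ _ _ mu D mD (fun n x => (complex.Re (f_ n x))%:E)
    (fun x => (complex.Re (f x))%:E) (EFin \o g).
  - by move=> n; apply/measurable_EFinP; case: (mf n).
  - by apply/measurable_EFinP; case: mf'.
  - apply: aeW => x Dx; apply: cvg_EFin; first exact: nearW.
    by apply: ccvg_Re; exact: cf.
  - exact: ig'.
  - apply: aeW => x n Dx; rewrite lee_fin (le_trans (ger_Re_cabs _))//; exact: fg.
  by [].
rewrite /Rintegral; apply: fine_cvg; rewrite fineK; last first.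
    by apply: integrable_fin_num => //; exact: cintg_Im.
have [] := @dominated_convergence _ _ _ mu D mD (fun n x => (complex.Im (f_ n x))%:E)
  (fun x => (complex.Im (f x))%:E) (EFin \o g).
- by move=> n; apply/measurable_EFinP; case: (mf n).
- by apply/measurable_EFinP; case: mf'.
- apply: aeW => x Dx; apply: cvg_EFin; first exact: nearW.
  by apply: ccvg_Im; exact: cf.
- exact: ig'.
- apply: aeW => x n Dx; rewrite lee_fin (le_trans (ger_Im_cabs _))//; exact: fg.
by [].
Qed.

End ComplexIntegral.

Lemma cmeas_comp d d' (T : measurableType d) (T' : measurableType d') (R : realType)
  (h : T' -> T) (f : T -> R[i]) :
  measurable_fun setT h -> cmeas setT f -> cmeas setT (fun x => f (h x)).
Proof.
move=> mh [a b]; split; first exact: (measurableT_comp a mh).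
exact: (measurableT_comp b mh).
Qed.

Section ComplexFubini.
Context d1 d2 (T1 : measurableType d1) (T2 : measurableType d2) (R : realType).
Variable m1 : {sigma_finite_measure set T1 -> \bar R}.
Variable m2 : {sigma_finite_measure set T2 -> \bar R}.
Local Notation C := R[i].

(** [Rintegral] is defined for every section, with a default value where the section is not
    integrable. Writing the inner integral as the finite part of a difference of two Tonelli
    integrals gives measurability at those points as well. *)
Let meas_fine (f : T1 * T2 -> R) : measurable_fun setT f ->
  measurable_fun setT (fun x => \int[m2]_y f (x, y)).
Proof.
move=> mf; apply: (measurableT_comp (@fine_measurable R setT measurableT)).
rewrite (_ : (fun x => _) = (fun x => \int[m2]_y (EFin \o f)^\+ (x, y) -
    \int[m2]_y (EFin \o f)^\- (x, y))%E); last first.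
  apply/funext => x; rewrite integralE; congr (_ - _)%E; apply: eq_integral => y _.
    by rewrite !funeposE.
  by rewrite !funenegE.
have mf' : measurable_fun setT (EFin \o f) by exact/measurable_EFinP.
apply: emeasurable_funB.
  by apply: measurable_fun_fubini_tonelli_F => //; exact: measurable_funepos.
by apply: measurable_fun_fubini_tonelli_F => //; exact: measurable_funeneg.
Qed.

Let meas_fine2 (f : T1 * T2 -> R) : measurable_fun setT f ->
  measurable_fun setT (fun y => \int[m1]_x f (x, y)).
Proof.
move=> mf; apply: (measurableT_comp (@fine_measurable R setT measurableT)).
rewrite (_ : (fun x => _) = (fun y => \int[m1]_x (EFin \o f)^\+ (x, y) -
    \int[m1]_x (EFin \o f)^\- (x, y))%E); last first.
  apply/funext => x; rewrite integralE; congr (_ - _)%E; apply: eq_integral => y _.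
    by rewrite !funeposE.
  by rewrite !funenegE.
have mf' : measurable_fun setT (EFin \o f) by exact/measurable_EFinP.
apply: emeasurable_funB.
  by apply: measurable_fun_fubini_tonelli_G => //; exact: measurable_funepos.
by apply: measurable_fun_fubini_tonelli_G => //; exact: measurable_funeneg.
Qed.

Lemma cmeas_cint1 (f : T1 -> T2 -> C) : cmeas setT (fun p : T1 * T2 => f p.1 p.2) ->
  cmeas setT (fun x => cint m2 setT (f x)).
Proof. by move=> [a b]; split => /=; [exact: (meas_fine a)|exact: (meas_fine b)]. Qed.

(** The extended inner integral and its finite part agree at almost every point, namely where the
    section is integrable. *)
Let fub (f : T1 * T2 -> R) : (m1 \x m2)%E.-integrable setT (EFin \o f) ->
  \int[m1]_x \int[m2]_y f (x, y) = \int[m2]_y \int[m1]_x f (x, y).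
Proof.
move=> F; have := Fubini F => H; rewrite /Rintegral; congr fine.
transitivity (\int[m1]_x \int[m2]_y (f (x, y))%:E)%E.
  apply: ae_eq_integral => //.
  - by apply/measurable_EFinP; apply: meas_fine; move/measurable_int : F => /measurable_EFinP.
  - exact: (measurable_fubini_F F).
  have := ae_integrable1 F; apply: filterS => x ix _.
  by rewrite fineK//; exact: (integrable_fin_num measurableT ix).
rewrite H; apply: ae_eq_integral => //.
- exact: (measurable_fubini_G F).
- by apply/measurable_EFinP; apply: meas_fine2; move/measurable_int : F => /measurable_EFinP.
have := ae_integrable2 F; apply: filterS => x ix _.
by rewrite fineK//; exact: (integrable_fin_num measurableT ix).
Qed.

Lemma cfubini (f : T1 -> T2 -> C) : cmeas setT (fun p : T1 * T2 => f p.1 p.2) ->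
  (\int[m1]_x \int[m2]_y (cabs (f x y))%:E < +oo)%E ->
  cint m1 setT (fun x => cint m2 setT (f x)) =
  cint m2 setT (fun y => cint m1 setT (f ^~ y)).
Proof.
move=> mf h.
have F : cintg (m1 \x m2)%E setT (fun p : T1 * T2 => f p.1 p.2).
  split => //; rewrite fubini_tonelli1//=; first exact: measurable_ecabs.
  by move=> p; rewrite lee_fin cabs_ge0.
have re := cintg_Re measurableT F; have im := cintg_Im measurableT F.
by apply: ceqP => /=; [exact: (fub re)|exact: (fub im)].
Qed.

Lemma tonelli_cabs (f : T1 -> T2 -> C) : cmeas setT (fun p : T1 * T2 => f p.1 p.2) ->
  (\int[m1]_x \int[m2]_y (cabs (f x y))%:E = \int[m2]_y \int[m1]_x (cabs (f x y))%:E)%E.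
Proof.
move=> mf; apply: (@fubini_tonelli _ _ _ _ _ m1 m2 (fun p => (cabs (f p.1 p.2))%:E)) => //.
  by apply: measurable_ecabs.
by move=> p; rewrite lee_fin cabs_ge0.
Qed.

Lemma cintg_cint1 (f : T1 -> T2 -> C) : cmeas setT (fun p : T1 * T2 => f p.1 p.2) ->
  (\int[m1]_x \int[m2]_y (cabs (f x y))%:E < +oo)%E ->
  cintg m1 setT (fun x => cint m2 setT (f x)).
Proof.
move=> mf h; split; first exact: cmeas_cint1.
apply: le_lt_trans h; apply: ge0_le_integral => //.
- by move=> x _; rewrite lee_fin cabs_ge0.
- by apply: measurable_ecabs; exact: cmeas_cint1.
- apply: (measurable_fun_fubini_tonelli_F (fun p => (cabs (f p.1 p.2))%:E)) => //.
    exact: measurable_ecabs.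
  by move=> p; rewrite lee_fin cabs_ge0.
- move=> x _; apply: ecabs_cint => //; split.
    by case: mf => a _; exact: (measurableT_comp a (pair1_measurable x)).
  by case: mf => _ a; exact: (measurableT_comp a (pair1_measurable x)).
Qed.

End ComplexFubini.

(** * Continuous functions are measurable for product sigma-algebras *)

Section CountableBasis.

(** The sigma-algebra of a product is generated by rectangles, not by open sets. A countable basis
    consisting of measurable sets makes every open set measurable, and this property passes to
    products. *)
Definition countable_basis (T : topologicalType) (ms : set (set T)) :=
  exists B : nat -> set T, (forall n, ms (B n)) /\
    forall x U, nbhs x U -> exists2 n, B n x & B n `<=` U.

Lemma countable_basis_open (T : topologicalType) (ms : set (set T)) (U : set T) :
  ms set0 -> (forall F : nat -> set T, (forall n, ms (F n)) -> ms (\bigcup_n F n)) ->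
  countable_basis ms -> open U -> ms U.
Proof.
move=> ms0 msU [B [mB HB]] oU.
rewrite (_ : U = \bigcup_n (if pselect (B n `<=` U) is left _ then B n else set0)).
  by apply: msU => n; case: pselect.
apply/seteqP; split => [x Ux|x [n _]]; last by case: pselect => // H; exact: H.
have [n Bx BU] := HB x U (open_nbhs_nbhs (conj oU Ux)).
by exists n => //; case: pselect.
Qed.

Lemma countable_basis_real (R : realType) :
  @countable_basis R (@measurable _ (measurableTypeR R)).
Proof.
pose B (n : nat) : set R := if unpickle n is Some (a, b) then
  [set x : R | (ratr a < x < ratr b)] else set0.
exists B; split.
  move=> n; rewrite /B; case: unpickle => [[a b]|]; last exact: measurable0.
  rewrite (_ : [set x | _] = `](ratr a), (ratr b)[%classic); first exact: measurable_itv.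
  by apply/seteqP; split => x /=; rewrite in_itv.
move=> x U /nbhs_ballP[e /= e0 eU].
have /rat_in_itvoo[a] : x - e < x by rewrite ltrBlDr ltrDl.
have /rat_in_itvoo[b] : x < x + e by rewrite ltrDl.
rewrite !in_itv/= => /andP[b1 b2] /andP[a1 a2].
exists (pickle (a, b)); first by rewrite /B pickleK/= a2 b1.
move=> y; rewrite /B pickleK/= => /andP[y1 y2]; apply: eU.
by rewrite /ball/= ltr_norml; apply/andP; split; lra.
Qed.

Lemma countable_basis_prod (T1 T2 : topologicalType) (ms1 : set (set T1))
    (ms2 : set (set T2)) (ms : set (set (T1 * T2))) :
  ms set0 -> (forall A B, ms1 A -> ms2 B -> ms (A `*` B)) ->
  countable_basis ms1 -> countable_basis ms2 -> countable_basis ms.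
Proof.
move=> ms0 msX [B1 [m1 H1]] [B2 [m2 H2]].
pose B (n : nat) : set (T1 * T2) :=
  if unpickle n is Some (a, b) then B1 a `*` B2 b else set0.
exists B; split.
  by move=> n; rewrite /B; case: unpickle => [[a b]|] //; exact: msX.
move=> [x y] U [[V W] [/= Vx Wy] VWU].
have [n nx nV] := H1 x V Vx; have [m my mW] := H2 y W Wy.
exists (pickle (n, m)); first by rewrite /B pickleK.
by rewrite /B pickleK => -[u v] [/= Bu Bv]; apply: VWU; split; [exact: nV|exact: mW].
Qed.

(** The map i stands for the identity from a space with its sigma-algebra to the same space with its
    topology. *)
Lemma continuous_measurable_basis (R : realType) (d : measure_display) (M : measurableType d)
    (T : topologicalType) (i : M -> T) (f : T -> R) :
  countable_basis [set A : set T | measurable (i @^-1` A)] -> continuous f ->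
  measurable_fun setT (f \o i).
Proof.
move=> cb /continuousP cf; apply: (measurability _ (RGenOpens.measurableE R)).
move=> _ [_ [a [b ->] <-]]; rewrite setTI comp_preimage.
apply: (@countable_basis_open T [set A : set T | measurable (i @^-1` A)]) => //.
- by rewrite /= preimage_set0.
- by move=> F mF /=; rewrite preimage_bigcup; exact: bigcupT_measurable.
- exact/cf/interval_open.
Qed.

End CountableBasis.

Notation MX R := (measurableTypeR R * measurableTypeR R)%type.

Section PlaneMeasurability.
Context {R : realType}.
Local Notation C := R[i].
Local Notation X := (R * R)%type.

Lemma countable_basis_plane :
  @countable_basis X [set A : set X | @measurable _ (MX R) A].
Proof.
apply: countable_basis_prod; [exact: measurable0| |exact: countable_basis_real..].
by move=> A B mA mB; exact: measurableX.
Qed.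

Lemma continuous_measurable_plane (f : X -> R) : continuous f ->
  measurable_fun (setT : set (MX R)) f.
Proof.
exact: (@continuous_measurable_basis R _ (MX R) X id f countable_basis_plane).
Qed.

Lemma continuous_measurable_plane2 (f : X * X -> R) : continuous f ->
  measurable_fun (setT : set (MX R * MX R)) f.
Proof.
apply: (@continuous_measurable_basis R _ (MX R * MX R)%type (X * X)%type id f).
apply: countable_basis_prod; [exact: measurable0| |exact: countable_basis_plane..].
by move=> A B mA mB; exact: measurableX.
Qed.

Lemma ccvg_cmeas (f : X -> C) : (forall p, ccvg (nbhs p) f (f p)) ->
  cmeas (setT : set (MX R)) f.
Proof.
by move=> h; split; apply: continuous_measurable_plane => p;
  [apply: ccvg_Re|apply: ccvg_Im]; exact: h.
Qed.

Lemma ccvg_cmeas2 (f : X -> X -> C) :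
  (forall p p', ccvg (nbhs (p, p')) (fun u => f u.1 u.2) (f p p')) ->
  cmeas (setT : set (MX R * MX R)) (fun u => f u.1 u.2).
Proof.
by move=> h; split; apply: continuous_measurable_plane2 => -[p p'];
  [apply: ccvg_Re|apply: ccvg_Im]; exact: h.
Qed.

Lemma cmeas_Dk r : cmeas (setT : set (MX R * MX R)) (fun u => Dk r u.1 u.2).
Proof.
apply: (@ccvg_cmeas2 (Dk r)) => p p'.
by apply: ccvg_Dk; [exact: cvg_fst|exact: cvg_snd].
Qed.

Lemma cmeas_Dk2 r p : cmeas (setT : set (MX R)) (Dk r p).
Proof. by apply: ccvg_cmeas => p'; apply: ccvg_Dk; [exact: cvg_cst|exact: cvg_id]. Qed.

Lemma cmeas_Dk1 r p : cmeas (setT : set (MX R)) (Dk r ^~ p).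
Proof. by apply: ccvg_cmeas => p'; apply: ccvg_Dk; [exact: cvg_id|exact: cvg_cst]. Qed.

(* The inclusion of the plane into C, used by the integrals of Defs. *)
Lemma ccvg_toC (p : X) : ccvg (nbhs p) (@toC R) (toC p).
Proof. by apply/ccvg_ReIm; split => /=; [exact: cvg_fst|exact: cvg_snd]. Qed.

Lemma cmeas_toC : cmeas (setT : set (MX R)) (@toC R).
Proof. by apply: ccvg_cmeas => p; exact: ccvg_toC. Qed.

Lemma measurable_uhp : measurable ((@toC R) @^-1` uhp : set (MX R)).
Proof.
have [_ h] := cmeas_toC.
rewrite (_ : _ @^-1` _ = setT `&` (fun p => complex.Im (toC p)) @^-1` `]0, +oo[).
  exact: (h measurableT).
by apply/seteqP; split => p /=; rewrite /uhp/= in_itv/= andbT //; case.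
Qed.

End PlaneMeasurability.

(** * Measure-preserving maps of the plane *)

Section MeasurePreserving.
Context {R : realType}.
Local Notation mu := (@lebesgue_measure R).
Local Notation mu2 := (@lebesgue_measure R \x @lebesgue_measure R)%E.
Local Open Scope ereal_scope.

Lemma lebesgue_shift (c : R) (F : measurableTypeR R -> \bar R) :
  measurable_fun setT F -> (forall x, 0 <= F x) ->
  \int[mu]_x F (x + c)%R = \int[mu]_x F x.
Proof.
move=> mF F0.
have ms : measurable_fun setT ((fun x => x + c)%R : measurableTypeR R -> measurableTypeR R).
  by apply: measurable_funD => //; exact: measurable_cst.
transitivity (\int[pushforward mu ((fun x => x + c)%R : measurableTypeR R -> measurableTypeR R)]_x F x).
  by rewrite ge0_integral_pushforward.
apply: eq_measure_integral => A mA _; apply/esym/lebesgue_measure_unique => //= _ [[a b]] _ <-.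
rewrite /pushforward (_ : _ @^-1` _ = `](a - c)%R, (b - c)%R]%classic); last first.
  by apply/seteqP; split => x /=; rewrite !in_itv/= ltrBlDr lerBrDr.
rewrite !lebesgue_measure_itv/= !lte_fin ltrD2r.
by case: ifP => // _; rewrite -!EFinD; congr EFin; ring.
Qed.

Lemma lebesgue_opp (F : measurableTypeR R -> \bar R) :
  measurable_fun setT F -> (forall x, 0 <= F x) ->
  \int[mu]_x F (- x)%R = \int[mu]_x F x.
Proof.
move=> mF F0.
transitivity (\int[pushforward mu (-%R : measurableTypeR R -> measurableTypeR R)]_x F x).
  by rewrite ge0_integral_pushforward.
by apply: eq_measure_integral => A mA _; exact: lebesgue_measureN.
Qed.

(** Stated for integrals of nonnegative functions, so that a shear is handled by Tonelli's theorem
    and translation invariance on each line. *)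
Definition mpreserving (phi : MX R -> MX R) := measurable_fun setT phi /\
  forall F : MX R -> \bar R, measurable_fun setT F -> (forall p, 0 <= F p) ->
    \int[mu2]_p F (phi p) = \int[mu2]_p F p.

Lemma mpreserving_comp phi psi : mpreserving phi -> mpreserving psi ->
  mpreserving (phi \o psi).
Proof.
move=> [m1 h1] [m2 h2]; split; first exact: measurableT_comp m1 m2.
move=> F mF F0; rewrite -(h1 F)// -(h2 (F \o phi))//; last by move=> p; exact: F0.
exact: measurableT_comp.
Qed.

Lemma mpreserving_vshear (f : R -> R) : measurable_fun setT f ->
  mpreserving (fun p => (p.1, p.2 + f p.1)%R).
Proof.
move=> mf; have mphi : measurable_fun setT (fun p : MX R => ((p.1, p.2 + f p.1)%R : MX R)).
  apply: measurable_fun_pair => //; apply: measurable_funD => //.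
  exact: measurableT_comp.
split => // F mF F0.
rewrite (fubini_tonelli1 (fun p : MX R => F (p.1, p.2 + f p.1)%R))//=; last exact: measurableT_comp.
rewrite (fubini_tonelli1 F mF F0); apply: eq_integral => x _ /=.
apply: (lebesgue_shift (f x) (F := fun y : measurableTypeR R => F (x, y))) => //.
exact: measurableT_comp.
Qed.

Lemma mpreserving_hshear (f : R -> R) : measurable_fun setT f ->
  mpreserving (fun p => (p.1 + f p.2, p.2)%R).
Proof.
move=> mf; have mphi : measurable_fun setT (fun p : MX R => ((p.1 + f p.2, p.2)%R : MX R)).
  apply: measurable_fun_pair => //; apply: measurable_funD => //.
  exact: measurableT_comp.
split => // F mF F0.
rewrite (fubini_tonelli2 (fun p : MX R => F (p.1 + f p.2, p.2)%R))//=; last exact: measurableT_comp.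
rewrite (fubini_tonelli2 F mF F0); apply: eq_integral => y _ /=.
apply: (lebesgue_shift (f y) (F := fun x : measurableTypeR R => F (x, y))) => //.
exact: measurableT_comp.
Qed.

Lemma mpreserving_opp : mpreserving (fun p => (- p.1, - p.2)%R).
Proof.
have mphi : measurable_fun setT (fun p : MX R => ((- p.1, - p.2)%R : MX R)).
  by apply: measurable_fun_pair; exact: measurable_funN.
split => // F mF F0.
rewrite (fubini_tonelli1 (fun p : MX R => F (- p.1, - p.2)%R))//=; last exact: measurableT_comp.
rewrite (fubini_tonelli1 F mF F0).
transitivity (\int[mu]_x \int[mu]_y F (- x, y)%R).
  apply: eq_integral => x _; apply: (lebesgue_opp (F := fun y : measurableTypeR R => F (- x, y)%R)) => //.
  exact: measurableT_comp.
apply: (lebesgue_opp (F := fun x : measurableTypeR R => \int[mu]_y F (x, y))).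
  exact: measurable_fun_fubini_tonelli_F.
by move=> x; exact: integral_ge0.
Qed.

End MeasurePreserving.

Section MeasurePreservingComplex.
Context {R : realType}.
Local Notation C := R[i].
Local Notation mu2 := (@lebesgue_measure R \x @lebesgue_measure R)%E.

Lemma mpreserving_cint phi (F : MX R -> C) : mpreserving phi ->
  cintg mu2 setT F -> cintg mu2 setT (F \o phi) /\
  cint mu2 setT (F \o phi) = cint mu2 setT F.
Proof.
move=> [mphi h] iF; have [mF fF] := iF.
have iF' : cintg mu2 setT (F \o phi).
  split; first exact: cmeas_comp.
  rewrite (h (fun p => (cabs (F p))%:E))//; first exact: measurable_ecabs.
  by move=> p; rewrite lee_fin cabs_ge0.
split => //.
have K (f : MX R -> R) : mu2.-integrable setT (EFin \o f) ->
    \int[mu2]_p f (phi p) = \int[mu2]_p f p.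
  move=> jf; have mf := measurable_int _ jf.
  rewrite /Rintegral; congr fine.
  rewrite [LHS]integralE [RHS]integralE; congr (_ - _)%E.
    rewrite -(h ((EFin \o f)^\+)%E)//; last exact: measurable_funepos.
    by apply: eq_integral => p _; rewrite !funeposE.
  rewrite -(h ((EFin \o f)^\-)%E)//; last exact: measurable_funeneg.
  by apply: eq_integral => p _; rewrite !funenegE.
apply: ceqP; first exact: (K (fun p => complex.Re (F p)) (cintg_Re measurableT iF)).
exact: (K (fun p => complex.Im (F p)) (cintg_Im measurableT iF)).
Qed.

End MeasurePreservingComplex.

(** * Invariant measure *)

Section ChangeOfVariables.
Context {R : realType}.
Local Notation mu := (@lebesgue_measure R).
Local Notation mu2 := (@lebesgue_measure R \x @lebesgue_measure R)%E.
Local Notation X := (R * R)%type.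

(** Substitution takes place on the intervals [-n, n] and their images [e^(-n), e^n]; both sides are
    then exhausted by monotone convergence. *)
Lemma integral_exp_subst (K : R -> R) : continuous K -> (forall x, 0 <= K x) ->
  (\int[mu]_(y in `]0%R, +oo[) (K (ln y))%:E = \int[mu]_x (K x * expR x)%:E)%E.
Proof.
move=> cK K0.
have d1 : derive1 (expR : R -> R) = expR by apply/funext => x; rewrite derive1E derive_val.
have cG (y : R) : 0 < y -> {for y, continuous (K \o @ln R)}.
  by move=> y0; apply: continuous_comp; [exact: continuous_ln|exact: cK].
pose F1 (n : nat) := `[expR (- n%:R), expR n%:R]%classic : set (measurableTypeR R).
pose F2 (n : nat) := `[(- n%:R), n%:R]%classic : set (measurableTypeR R).
have E (n : nat) : (\int[mu]_(y in F1 n) (K (ln y))%:E =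
    \int[mu]_(x in F2 n) (K x * expR x)%:E)%E.
  have nn : (- n%:R <= n%:R :> R) by have := ler0n R n; lra.
  have := @integration_by_substitution_increasing R expR (K \o @ln R) (- n%:R) n%:R nn.
  rewrite d1 => ->.
  - by apply: eq_integral => x _; rewrite /= !fctE/= expRK.
  - by move=> x y _ _; rewrite ltr_expR.
  - by move=> x _; exact: continuous_expR.
  - by apply/cvg_ex; exists (expR (- n%:R)); apply: cvg_at_right_filter; exact: continuous_expR.
  - by apply/cvg_ex; exists (expR n%:R); apply: cvg_at_left_filter; exact: continuous_expR.
  - split.
    + by move=> x _; exact: derivable_expR.
    + by apply: cvg_at_right_filter; exact: continuous_expR.
    + by apply: cvg_at_left_filter; exact: continuous_expR.
  - apply: continuous_in_subspaceT => y; rewrite inE/= in_itv/= => /andP[y0 _].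
    by apply: cG; rewrite (lt_le_trans _ y0)// expR_gt0.
have mK : measurable_fun setT (fun x : R => K x * expR x).
  by apply: measurable_funM; [exact: continuous_measurable_fun|exact: measurable_expR].
have mL : measurable_fun setT (fun x : R => K (ln x)).
  by apply: (measurableT_comp (continuous_measurable_fun cK)); exact: measurable_ln.
have U1 : \bigcup_n F1 n = `]0, +oo[%classic.
  apply/seteqP; split => [x [n _]|x].
    by rewrite /F1/= !in_itv/= andbT => /andP[h _]; rewrite (lt_le_trans _ h)// expR_gt0.
  rewrite /= in_itv/= andbT => x0.
  have [n nx] : exists n : nat, `|ln x| <= n%:R.
    by exists (Num.truncn `|ln x|).+1; rewrite ltW// truncnS_gt.
  have xE : expR (ln x) = x by rewrite lnK.
  move: nx; rewrite ler_norml => /andP[n1 n2].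
  exists n => //; rewrite /F1/= in_itv/=; apply/andP; split.
    by rewrite -[leRHS]xE ler_expR.
  by rewrite -[leLHS]xE ler_expR.
have U2 : \bigcup_n F2 n = setT.
  apply/seteqP; split => // x _.
  have [n nx] : exists n : nat, `|x| <= n%:R.
    by exists (Num.truncn `|x|).+1; rewrite ltW// truncnS_gt.
  by exists n => //; rewrite /F2/= in_itv/= -ler_norml.
rewrite -U1 -U2.
have L1 : (\int[mu]_(x in F1 n) (K (ln x))%:E @[n --> \oo] -->
    \int[mu]_(x in \bigcup_n F1 n) (K (ln x))%:E)%E.
  apply: ge0_nondecreasing_set_cvg_integral.
  - move=> n m nm; rewrite subsetEset => x; rewrite /F1/= !in_itv/= => /andP[h1 h2].
    have nm' : n%:R <= m%:R :> R by rewrite ler_nat.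
    rewrite (le_trans _ h1) ?ler_expR ?lerN2//= (le_trans h2)// ler_expR//.
  - by move=> n; exact: measurable_itv.
  - by move=> n; apply/measurable_EFinP; exact: measurable_funTS.
  - by move=> n x _; rewrite lee_fin.
have L2 : (\int[mu]_(x in F2 n) (K x * expR x)%:E @[n --> \oo] -->
    \int[mu]_(x in \bigcup_n F2 n) (K x * expR x)%:E)%E.
  apply: ge0_nondecreasing_set_cvg_integral.
  - move=> n m nm; rewrite subsetEset => x; rewrite /F2/= !in_itv/= => /andP[h1 h2].
    have nm' : n%:R <= m%:R :> R by rewrite ler_nat.
    by rewrite (le_trans _ h1) ?lerN2//= (le_trans h2).
  - by move=> n; exact: measurable_itv.
  - by move=> n; apply/measurable_EFinP; exact: measurable_funTS.
  - by move=> n x _; rewrite lee_fin mulr_ge0// expR_ge0.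
apply: (cvg_unique _ L1 _) => //.
rewrite (_ : (fun n => _) = (fun n => \int[mu]_(x in F2 n) (K x * expR x)%:E)%E)//.
by apply/funext => n; exact: E.
Qed.

Lemma integral_scale (c : R) (g : R -> R) : 0 < c -> continuous g -> (forall x, 0 <= g x) ->
  (\int[mu]_x (g x)%:E = \int[mu]_x (c * g (c * x))%:E)%E.
Proof.
move=> c0 cg g0.
have dF (x : R) : derivable (fun s : R => c * s) x 1 by apply: derivableM.
have d1 : derive1 (fun s : R => c * s) = cst c.
  by apply/funext => x; rewrite derive1E deriveZ// derive_id; exact: mulr1.
rewrite (@increasing_ge0_integration_by_substitutionT R (fun s : R => c * s) g).
- by rewrite d1; apply: eq_integral => x _; rewrite /= !fctE/= mulrC.
- by move=> x y xy; rewrite ltr_pM2l.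
- by rewrite d1 => x; exact: cvg_cst.
- by rewrite d1; apply/cvg_ex; exists c; exact: cvg_cst.
- by rewrite d1; apply/cvg_ex; exists c; exact: cvg_cst.
- exact: dF.
- by under eq_fun do rewrite mulrC; exact: (gt0_cvgMlNy c0 cvg_id).
- by under eq_fun do rewrite mulrC; exact: (gt0_cvgMly c0 cvg_id).
- exact: cg.
- exact: g0.
Qed.

Lemma continuous_pair2 (h : X -> R) (f g : R -> R) : continuous h -> continuous f ->
  continuous g -> continuous (fun x => h (f x, g x)).
Proof.
move=> ch cf cg x.
apply: (@cvg_comp R X R (fun x => (f x, g x)) h (nbhs x) (nbhs (f x, g x))); last exact: ch.
exact: (cvg_pair (cf x) (cg x)).
Qed.

Lemma measurable_hcoord : measurable_fun (setT : set (MX R))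
  (fun p => (hcoord (toC p) : MX R)).
Proof.
have m2 : measurable_fun (setT : set (MX R)) (fun p : MX R => ln p.2).
  by apply: measurableT_comp => //; exact: measurable_ln.
apply: measurable_fun_pair => //=; apply: measurable_funM => //.
by apply: (measurableT_comp (@measurable_expR R)); exact: measurable_funN.
Qed.

(** dx dy = e^(2 r) ds dr: the scaling x = e^r s of each horizontal line gives one factor e^r, and y
    = e^r gives the other. *)
Lemma integral_hcoord (h : X -> R) : continuous h -> (forall p, 0 <= h p) ->
  (\int[mu2]_(p in (@toC R) @^-1` uhp) (h (hcoord (toC p)))%:E =
   \int[mu2]_p (h p * expR (2 * p.2))%:E)%E.
Proof.
move=> ch h0.
have mh : measurable_fun (setT : set (MX R)) h by exact: continuous_measurable_plane.
pose u (p : MX R) : \bar R := if 0 < p.2 then (h (hcoord (toC p)))%:E else 0%E.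
have pos : measurable_fun (setT : set (MX R)) (fun p : MX R => 0 < p.2).
  by apply: measurable_fun_ltr => //; exact: measurable_cst.
have mu_ : measurable_fun (setT : set (MX R)) u.
  apply: measurable_fun_ifT => //.
  by apply/measurable_EFinP; apply: (measurableT_comp mh); exact: measurable_hcoord.
have u0 p : (0 <= u p)%E by rewrite /u; case: ifP => // _; rewrite lee_fin.
transitivity (\int[mu2]_p u p)%E.
  rewrite integral_mkcond; apply: eq_integral => p _; rewrite patchE /u.
  have -> : (p \in (@toC R) @^-1` uhp) = (0 < p.2); last by [].
  by apply/idP/idP; rewrite inE.
rewrite (fubini_tonelli2 u)//=.
pose V (p : MX R) : \bar R := if 0 < p.2 then (p.2 * h (p.1, ln p.2))%:E else 0%E.
have mV : measurable_fun (setT : set (MX R)) V.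
  apply: measurable_fun_ifT => //.
  apply/measurable_EFinP; apply: measurable_funM => //.
  apply: (measurableT_comp mh); apply: measurable_fun_pair => //.
  by apply: measurableT_comp => //; exact: measurable_ln.
have V0 p : (0 <= V p)%E.
  by rewrite /V; case: ifP => // p0; rewrite lee_fin mulr_ge0// ltW.
transitivity (\int[mu]_y \int[mu]_x V (x, y))%E.
  apply: eq_integral => y _; rewrite /fubini_G /u /V /=.
  case: ltP => y0; last by rewrite !integral0.
  rewrite (integral_scale (c := y)) //; last first.
    apply: (@continuous_pair2 h (fun x => x * expR (- ln y)) (fun=> ln y)) => // x.
      by apply: cvgM; [exact: cvg_id|exact: cvg_cst].
    exact: cvg_cst.
  apply: eq_integral => x _; rewrite /hcoord/= expRN lnK ?posrE//.
  by rewrite mulrAC mulfV ?lt0r_neq0// mul1r.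
have mW : measurable_fun setT (fun p : MX R => (h p * expR (2 * p.2))%:E).
  apply/measurable_EFinP; apply: measurable_funM => //.
  by apply: (measurableT_comp (@measurable_expR R)); apply: measurable_funM.
have W0 (p : MX R) : (0 <= (h p * expR (2 * p.2))%:E)%E.
  by rewrite lee_fin mulr_ge0// expR_ge0.
rewrite -(fubini_tonelli V mV V0) (fubini_tonelli1 _ mW W0).
apply: eq_integral => s _; rewrite /fubini_F /V /=.
have cK : continuous (fun r : R => expR r * h (s, r)).
  move=> r; apply: cvgM; first exact: continuous_expR.
  by apply: (@continuous_pair2 h (fun=> s) id) => // x; [exact: cvg_cst|exact: cvg_id].
transitivity (\int[mu]_(y in `]0%R, +oo[) (expR (ln y) * h (s, ln y))%:E)%E.
  rewrite [RHS]integral_mkcond; apply: eq_integral => y _; rewrite patchE.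
  have -> : (y \in `]0, +oo[%classic) = (0 < y).
    by apply/idP/idP; rewrite inE/= in_itv/= andbT.
  by case: ifP => // y0; rewrite lnK.
rewrite (integral_exp_subst cK); last by move=> x; rewrite mulr_ge0// expR_ge0.
apply: eq_integral => r _; congr EFin.
by rewrite mulrAC mulrC -expRD; congr (_ * expR _); ring.
Qed.

(** The positive and negative parts, written as (|g| + g) / 2 and (|g| - g) / 2 to stay continuous,
    are transformed separately; the equality thus includes the default values for a non-integrable
    g. *)
Lemma Rintegral_hcoord (g : X -> R) : continuous g ->
  \int[mu2]_(p in (@toC R) @^-1` uhp) g (hcoord (toC p)) =
  \int[mu2]_p (g p * expR (2 * p.2)).
Proof.
move=> cg; rewrite /Rintegral; congr fine.
have maxE (x : R) : maxe x%:E 0%E = ((x + `|x|) / 2)%:E.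
  rewrite -EFin_max; congr EFin; have [x0|x0] := leP x 0.
    by rewrite (ler0_norm x0) subrr mul0r.
  by rewrite (gtr0_norm x0); field.
have c1 (f : X -> R) : continuous f -> continuous (fun p => (f p + `|f p|) / 2).
  move=> cf p; apply: cvgM; last exact: cvg_cst.
  by apply: cvgD; [exact: cf|apply: cvg_norm; exact: cf].
have cgN : continuous (fun p => - g p) by move=> p; apply: cvgN; exact: cg.
have g0 (f : X -> R) p : 0 <= (f p + `|f p|) / 2.
  by rewrite divr_ge0// -lerBlDl sub0r -normrN ler_norm.
have pull (x e : R) : 0 <= e -> (x * e + `|x * e|) / 2 = (x + `|x|) / 2 * e.
  by move=> e0; rewrite normrM (ger0_norm e0); ring.
rewrite [LHS]integralE [RHS]integralE; congr (_ - _)%E.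
  under eq_integral => p _ do rewrite funeposE maxE.
  rewrite (integral_hcoord (c1 _ cg) (g0 g)).
  by apply: eq_integral => p _; rewrite funeposE maxE pull ?expR_ge0.
under eq_integral => p _ do rewrite funenegE -EFinN maxE.
rewrite (integral_hcoord (c1 _ cgN) (g0 (fun p => - g p))).
by apply: eq_integral => p _; rewrite funenegE -EFinN maxE -mulNr pull ?expR_ge0.
Qed.

Lemma powR_toC (t : R) (p : X) : 0 < p.2 -> p.2 `^ t = expR (t * (hcoord (toC p)).2).
Proof. by move=> p0; rewrite /powR gt_eqF. Qed.

Lemma hpt_toC (p : X) : 0 < p.2 -> hpt (hcoord (toC p)) = toC p.
Proof. by move=> p0; apply: hcoordK. Qed.

Let exp_split (t : R) (p : X) : expR ((t - 2) * p.2) * expR (2 * p.2) = expR (t * p.2).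
Proof. by rewrite -expRD; congr expR; ring. Qed.

Lemma continuous_expR2 (t : R) : continuous (fun p : X => expR (t * p.2)).
Proof.
move=> p; apply: (@continuous_cvg _ _ _ _ _ (fun p : X => t * p.2) (@expR R)).
  exact: continuous_expR.
by apply: cvgM; [exact: cvg_cst|exact: cvg_snd].
Qed.

Lemma eint_nuE (t : R) (f : R[i] -> R) : continuous (f \o @hpt R) ->
  (forall p, 0 <= f (hpt p)) ->
  eint_nu t uhp f = (\int[mu2]_p (f (hpt p) * expR (t * p.2))%:E)%E.
Proof.
move=> cf f0; rewrite /eint_nu setIid.
transitivity (\int[mu2]_(p in (@toC R) @^-1` uhp)
   ((fun q => f (hpt q) * expR ((t - 2) * q.2)) (hcoord (toC p)))%:E)%E.
  by apply: eq_integral => p; rewrite inE => p0; rewrite hpt_toC// powR_toC.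
rewrite (integral_hcoord (h := fun q => f (hpt q) * expR ((t - 2) * q.2))).
- by apply: eq_integral => p _; rewrite -mulrA exp_split.
- by move=> p; apply: cvgM; [exact: cf|exact: continuous_expR2].
- by move=> p; rewrite mulr_ge0// expR_ge0.
Qed.

Lemma cint_nuE (t : R) (f : R[i] -> R[i]) :
  (forall p, ccvg (nbhs p) (f \o @hpt R) (f (hpt p))) ->
  cint_nu t uhp f = cint mu2 setT (fun p : MX R => f (hpt p) * (expR (t * p.2))%:C).
Proof.
move=> cf; rewrite /cint_nu setIid.
have H (g : X -> R) (h : MX R -> R) : continuous g -> (forall p, h p = g (hcoord (toC p))) ->
  \int[mu2]_(p in (@toC R) @^-1` uhp) (h p * p.2 `^ (t - 2)) =
  \int[mu2]_p (g p * expR (t * p.2)).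
  move=> cg hg.
  transitivity (\int[mu2]_(p in (@toC R) @^-1` uhp)
     (fun q => g q * expR ((t - 2) * q.2)) (hcoord (toC p))).
    by apply: eq_Rintegral => p; rewrite inE => p0; rewrite hg powR_toC.
  rewrite (Rintegral_hcoord (g := fun q => g q * expR ((t - 2) * q.2))).
    by apply: eq_Rintegral => p _; rewrite -mulrA exp_split.
  by move=> p; apply: cvgM; [exact: cg|exact: continuous_expR2].
have H' (g : X -> R) (h : MX R -> R) : continuous g ->
    (forall p : X, 0 < p.2 -> h p = g (hcoord (toC p))) ->
  \int[mu2]_(p in (@toC R) @^-1` uhp) (h p * p.2 `^ (t - 2)) =
  \int[mu2]_p (g p * expR (t * p.2)).
  move=> cg hg; rewrite -(H g (fun p => g (hcoord (toC p))))//.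
  by apply: eq_Rintegral => p; rewrite inE => p0; rewrite hg.
apply: ceqP => /=.
  rewrite (H' (fun q => complex.Re (f (hpt q)))).
  - by apply: eq_Rintegral => p _; rewrite cReMr.
  - by move=> p; apply: ccvg_Re; exact: cf.
  - by move=> p p0; rewrite hpt_toC.
rewrite (H' (fun q => complex.Im (f (hpt q)))).
- by apply: eq_Rintegral => p _; rewrite cImMr.
- by move=> p; apply: ccvg_Im; exact: cf.
- by move=> p p0; rewrite hpt_toC.
Qed.

End ChangeOfVariables.

Section Moebius.
Context {R : realType}.
Local Notation C := R[i].
Local Notation X := (R * R)%type.
Implicit Types (g : 'M[R]_2) (p : X).

Definition mob g (p : X) : X := hcoord (mobius g (hpt p)).

(** This and the next two are the maps z + b, e^m z and - 1 / z in the coordinates (s, r): shears,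
    followed by a point reflection for the last. All preserve ds dr, and they generate the action of
    SL(2, R). *)
Definition mtrans (b : R) (p : X) : X := (p.1 + b * expR (- p.2), p.2).
Definition mscal (m : R) (p : X) : X := (p.1, p.2 + m).
Definition minv (p : X) : X := (- p.1, - p.2 - ln (1 + p.1 ^+ 2)).

Lemma hpt_mtrans b p : hpt (mtrans b p) = hpt p + b%:C.
Proof.
by apply: ceqP => /=; rewrite ?addr0// mulrDr mulrCA -expRD subrr expR0 mulr1.
Qed.

Lemma hpt_mscal m p : hpt (mscal m p) = (expR m)%:C * hpt p.
Proof. by apply: ceqP; rewrite ?cReMl ?cImMl/= expRD; ring. Qed.

Lemma hpt_neq0 p : hpt p != 0.
Proof.
apply/eqP => /(congr1 (@complex.Im R))/=; have := expR_gt0 p.2; lra.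
Qed.

Lemma hpt_minv p : hpt (minv p) = - (hpt p)^-1.
Proof.
have p1 : 0 < 1 + p.1 ^+ 2 by rewrite ltr_pwDl// sqr_ge0.
apply: (mulIf (hpt_neq0 p)); rewrite mulNr mulVf ?hpt_neq0//.
have e0 := lt0r_neq0 (expR_gt0 p.2); have p1' := lt0r_neq0 p1.
apply: ceqP; rewrite ?cReM ?cImM/= !expRD !expRN lnK ?posrE//; field; by rewrite ?e0 ?p1'.
Qed.

Lemma mpreserving_mtrans b : mpreserving (mtrans b : MX R -> MX R).
Proof.
apply: (mpreserving_hshear (f := fun r => b * expR (- r))).
apply: measurable_funM; first exact: measurable_cst.
by apply: (measurableT_comp (@measurable_expR R)); exact: measurable_funN.
Qed.

Lemma mpreserving_mscal m : mpreserving (mscal m : MX R -> MX R).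
Proof. by apply: (mpreserving_vshear (f := fun=> m)); exact: measurable_cst. Qed.

Lemma mpreserving_minv : mpreserving (minv : MX R -> MX R).
Proof.
have h := @mpreserving_vshear R (fun s => ln (1 + s ^+ 2)).
rewrite (_ : (minv : MX R -> MX R) = (fun p : MX R => (- p.1, - p.2)) \o
   (fun p : MX R => (p.1, p.2 + ln (1 + p.1 ^+ 2)))); last first.
  by apply/funext => p; rewrite /minv/= opprD.
apply: mpreserving_comp; first exact: mpreserving_opp.
apply: h; apply: (measurableT_comp (@measurable_ln R)).
apply: measurable_funD; first exact: measurable_cst.
exact: measurable_funX.
Qed.

Lemma det2E g : \det g = g 0 0 * g 1 1 - g 0 1 * g 1 0.
Proof.
rewrite (expand_det_row _ 0) !big_ord_recl big_ord0 /cofactor !det_mx11 !mxE /=.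
have l0 (i : 'I_1) : lift 0 i = 1 :> 'I_2 by rewrite (ord1 i); exact: val_inj.
have l1 : lift 1 0 = 0 :> 'I_2 by exact: val_inj.
by rewrite !l0 l1 /bump/= expr0 expr1 mul1r addr0; ring.
Qed.

Definition cfac g (z : C) : C := (g 1 0)%:C * z + (g 1 1)%:C.

Lemma cfac_neq0 g z : \det g = 1 -> uhp z -> cfac g z != 0.
Proof.
rewrite det2E => dg z0; apply/eqP => h.
have := congr1 (@complex.Im R) h; rewrite cImD cImMl/= addr0 => /eqP.
rewrite mulf_eq0 (gt_eqF z0) orbF => /eqP g10.
have := congr1 (@complex.Re R) h; rewrite cReD cReMl/= g10 mul0r add0r => g11.
by move: dg; rewrite g10 g11 !mulr0 subrr => /eqP; rewrite eq_sym oner_eq0.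
Qed.

(** Bruhat decomposition: (a z + b) / d = a^2 z + a b if c = 0, and otherwise (a z + b) / (c z + d)
    = a / c - c^(-2) / (z + d / c). *)
Lemma mobius_comp g : \det g = 1 -> exists phi : X -> X,
  mpreserving (phi : MX R -> MX R) /\ forall p, hpt (phi p) = mobius g (hpt p).
Proof.
move=> dg; have dg' := dg; rewrite det2E in dg'.
have [c0|c0] := eqVneq (g 1 0) 0.
  rewrite c0 mulr0 subr0 in dg'.
  have a0 : g 0 0 != 0 by apply: contra_eq_neq dg' => ->; rewrite mul0r eq_sym oner_neq0.
  have d0 : g 1 1 != 0 by apply: contra_eq_neq dg' => ->; rewrite mulr0 eq_sym oner_neq0.
  have a2 : 0 < g 0 0 ^+ 2 by rewrite exprn_even_gt0.
  exists (mtrans (g 0 1 * g 0 0) \o mscal (ln (g 0 0 ^+ 2))); split.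
    apply: mpreserving_comp; [exact: mpreserving_mtrans|exact: mpreserving_mscal].
  move=> p; rewrite /= hpt_mtrans hpt_mscal lnK ?posrE// /mobius c0 mul0r add0r.
  have dE : g 1 1 = (g 0 0)^-1 by apply: (mulfI a0); rewrite dg' mulfV.
  by rewrite dE fmorphV invrK mulrDl -rmorphM rmorphXn/= -mulrA [hpt p * _]mulrC mulrA -expr2.
have c2 : 0 < (g 1 0) ^- 2 by rewrite invr_gt0 exprn_even_gt0.
exists (mtrans (g 0 0 / g 1 0) \o (mscal (ln ((g 1 0) ^- 2)) \o (minv \o mtrans (g 1 1 / g 1 0)))).
split.
  apply: mpreserving_comp; first exact: mpreserving_mtrans.
  apply: mpreserving_comp; first exact: mpreserving_mscal.
  by apply: mpreserving_comp; [exact: mpreserving_minv|exact: mpreserving_mtrans].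
move=> p; have nz := cfac_neq0 dg (hpt_uhp p).
rewrite /= hpt_mtrans hpt_mscal hpt_minv hpt_mtrans lnK ?posrE// /mobius -/(cfac g _).
have c0' : (g 1 0)%:C != 0 :> C by rewrite fmorph_eq0.
have -> : hpt p + (g 1 1 / g 1 0)%:C = cfac g (hpt p) / (g 1 0)%:C.
  rewrite /cfac rmorphM fmorphV/=; field; exact: c0'.
have -> : (g 0 0)%:C * hpt p + (g 0 1)%:C =
    ((g 0 0)%:C * cfac g (hpt p) - 1) / (g 1 0)%:C.
  have -> : 1 = (g 0 0)%:C * (g 1 1)%:C - (g 0 1)%:C * (g 1 0)%:C :> C.
    by rewrite -!rmorphM -rmorphB/= dg'.
  rewrite /cfac; field; exact: c0'.
rewrite fmorphV rmorphXn rmorphM fmorphV/=; field; rewrite nz c0' //.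
Qed.

Lemma mobius_uhp g z : \det g = 1 -> uhp z -> uhp (mobius g z).
Proof.
move=> dg z0; have [phi [_ h]] := mobius_comp dg.
by rewrite -(hcoordK z0) -h; exact: hpt_uhp.
Qed.

Lemma hpt_mob g p : \det g = 1 -> hpt (mob g p) = mobius g (hpt p).
Proof. by move=> dg; rewrite /mob hcoordK//; apply: mobius_uhp => //; exact: hpt_uhp. Qed.

Lemma mpreserving_mob g : \det g = 1 -> mpreserving (mob g : MX R -> MX R).
Proof.
move=> dg; have [phi [m h]] := mobius_comp dg.
rewrite (_ : mob g = phi)//; apply/funext => p.
by rewrite /mob -h hptK.
Qed.

End Moebius.

(** * Goursat and the mean value property *)

Section Goursat.
Context {R : realType}.
Local Notation C := R[i].
Local Notation mu := (@lebesgue_measure R).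
Implicit Types (f g : C -> C) (a b c d x y : R).

Lemma ccvg_vert f x y : ccont f (x +i* y) -> ccvg (nbhs y) (fun t : R => f (x +i* t)) (f (x +i* y)).
Proof.
move=> cf; apply: (@ccvg_comp _ _ _ _ (fun t : R => x +i* t) f (x +i* y) _) => //.
by apply/ccvg_ReIm; split => /=; [exact: cvg_cst|exact: cvg_id].
Qed.

Lemma ccvg_horiz f x y : ccont f (x +i* y) -> ccvg (nbhs x) (fun t : R => f (t +i* y)) (f (x +i* y)).
Proof.
move=> cf; apply: (@ccvg_comp _ _ _ _ (fun t : R => t +i* y) f (x +i* y) _) => //.
by apply/ccvg_ReIm; split => /=; [exact: cvg_id|exact: cvg_cst].
Qed.

Lemma cintg_seg (g : measurableTypeR R -> C) a b :
  (forall x : R, a <= x <= b -> ccvg (nbhs x) g (g x)) -> cintg mu `[a, b] g.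
Proof.
move=> cg.
have cR : {within `[a, b], continuous (fun x : R => complex.Re (g x))}.
  apply: continuous_in_subspaceT => x; rewrite inE/= in_itv/= => xab.
  exact: ccvg_Re (cg x xab).
have cI : {within `[a, b], continuous (fun x : R => complex.Im (g x))}.
  apply: continuous_in_subspaceT => x; rewrite inE/= in_itv/= => xab.
  exact: ccvg_Im (cg x xab).
have cA : {within `[a, b], continuous (fun x : R => cabs (g x))}.
  apply: continuous_in_subspaceT => x; rewrite inE/= in_itv/= => xab.
  exact: ccvg_cabs (cg x xab).
split.
  by split; apply: subspace_continuous_measurable_fun => //; exact: measurable_itv.
have /integrableP[_] := continuous_compact_integrable (@segment_compact R a b) cA.
move=> h; rewrite (@eq_integral _ _ _ mu _ (fun x => `|((EFin \o (fun x => cabs (g x))) x)|%E))// => x _ /=.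
by rewrite ger0_norm ?cabs_ge0.
Qed.

Lemma Rintegral_split (h : R -> R) a b m : a <= m <= b ->
  mu.-integrable `[a, b] (EFin \o h) ->
  \int[mu]_(x in `[a, b]) h x = \int[mu]_(x in `[a, m]) h x + \int[mu]_(x in `[m, b]) h x.
Proof.
move=> /andP[am mb] ih; apply/eqP; rewrite addrC -subr_eq; apply/eqP.
rewrite (@Rintegral_itvB R h (BLeft a) (BRight b) m)//.
rewrite Rintegral_itv_obnd_cbnd//.
apply: integrableS ih => //; [exact: measurable_itv..|].
by apply: subset_itvr; rewrite bnd_simp.
Qed.

Lemma cint_split (g : measurableTypeR R -> C) a b m : a <= m <= b -> cintg mu `[a, b] g ->
  cint mu `[a, b] g = cint mu `[a, m] g + cint mu `[m, b] g.
Proof.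
move=> amb ig; have mD : measurable (`[a, b]%classic : set (measurableTypeR R)) by exact: measurable_itv.
apply: ceqP => /=; apply: Rintegral_split => //.
  exact: (cintg_Re mD ig).
exact: (cintg_Im mD ig).
Qed.

Lemma lebesgue_itvcc a b : a <= b -> mu `[a, b]%classic = (b - a)%:E.
Proof.
move=> ab; rewrite lebesgue_measure_itv/= lte_fin; case: ltP => [_|ba]; first by rewrite EFinB.
by rewrite (_ : b = a) ?subrr//; apply/eqP; rewrite eq_le ab ba.
Qed.

Lemma Rintegral_cst_itv a b r : a <= b -> \int[mu]_(x in `[a, b]) r = r * (b - a).
Proof.
move=> ab.
rewrite -[b - a]/(fine (b - a)%:E) -(lebesgue_itvcc ab).
exact: (Rintegral_cst mu (measurable_itv `[a, b]) r).
Qed.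

Lemma cint_cst_itv a b (k : C) : a <= b -> cint mu `[a, b] (fun=> k) = k * (b - a)%:C.
Proof.
by move=> ab; apply: ceqP; rewrite ?cReMr ?cImMr /= Rintegral_cst_itv.
Qed.

(** The counterclockwise integral of f along the boundary of the rectangle, opposite sides being
    paired. *)
Definition rbnd f a b c d : C :=
  (0 +i* 1) * cint mu `[c, d] (fun t => f (b +i* t) - f (a +i* t))
  - cint mu `[a, b] (fun t => f (t +i* d) - f (t +i* c)).

Definition crect a b c d : set C :=
  [set z | a <= complex.Re z <= b /\ c <= complex.Im z <= d].

Let miv a b : measurable (`[a, b]%classic : set (measurableTypeR R)).
Proof. exact: measurable_itv. Qed.

Lemma cintg_vert f a b c d x : (forall z, crect a b c d z -> ccont f z) ->
  a <= x <= b -> cintg mu `[c, d] (fun t => f (x +i* t)).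
Proof.
by move=> cf xab; apply: cintg_seg => t tcd; apply: ccvg_vert; apply: cf; split.
Qed.

Lemma cintg_horiz f a b c d x : (forall z, crect a b c d z -> ccont f z) ->
  c <= x <= d -> cintg mu `[a, b] (fun t => f (t +i* x)).
Proof.
by move=> cf xab; apply: cintg_seg => t tcd; apply: ccvg_horiz; apply: cf; split.
Qed.

Lemma rbnd_splitx f a b c d m : (forall z, crect a b c d z -> ccont f z) ->
  a <= m <= b -> c <= d -> rbnd f a b c d = rbnd f a m c d + rbnd f m b c d.
Proof.
move=> cf amb cd; have /andP[am mb] := amb.
have ab : a <= b by exact: le_trans mb.
rewrite /rbnd (cint_split amb); last first.
  by apply: cintgB => //; apply: cintg_horiz cf _; rewrite lexx ?cd.
have V x : a <= x <= b -> cintg mu `[c, d] (fun t => f (x +i* t)) by apply: cintg_vert.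
have Va : cintg mu `[c, d] (fun t => f (a +i* t)) by apply: V; rewrite lexx.
have Vb : cintg mu `[c, d] (fun t => f (b +i* t)) by apply: V; rewrite lexx ab.
have Vm := V m amb.
rewrite (cintB (@miv c d) Vb Va) (cintB (@miv c d) Vm Va) (cintB (@miv c d) Vb Vm); ring.
Qed.

Lemma rbnd_splity f a b c d m : (forall z, crect a b c d z -> ccont f z) ->
  a <= b -> c <= m <= d -> rbnd f a b c d = rbnd f a b c m + rbnd f a b m d.
Proof.
move=> cf ab cmd; have /andP[cm md] := cmd.
have cd : c <= d by exact: le_trans md.
rewrite /rbnd (cint_split cmd); last first.
  by apply: cintgB => //; apply: cintg_vert cf _; rewrite lexx ?ab.
have H x : c <= x <= d -> cintg mu `[a, b] (fun t => f (t +i* x)) by apply: cintg_horiz.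
have Hc : cintg mu `[a, b] (fun t => f (t +i* c)) by apply: H; rewrite lexx.
have Hd : cintg mu `[a, b] (fun t => f (t +i* d)) by apply: H; rewrite lexx cd.
have Hm := H m cmd.
rewrite (cintB (@miv a b) Hd Hc) (cintB (@miv a b) Hm Hc) (cintB (@miv a b) Hd Hm); ring.
Qed.

Definition rect := (R * R * R * R)%type.
Definition rb f (r : rect) := let: (a, b, c, d) := r in cabs (rbnd f a b c d).
Definition rset (r : rect) := let: (a, b, c, d) := r in crect a b c d.

Definition quarter f (r : rect) : rect := let: (a, b, c, d) := r in
  let m := (a + b) / 2 in let n := (c + d) / 2 in
  if rb f r <= 4 * rb f (a, m, c, n) then (a, m, c, n) else
  if rb f r <= 4 * rb f (m, b, c, n) then (m, b, c, n) else
  if rb f r <= 4 * rb f (a, m, n, d) then (a, m, n, d) else (m, b, n, d).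

Definition rok (r : rect) := let: (a, b, c, d) := r in a <= b /\ c <= d.

(** The contours of the four quarters add up to the whole one. If each of the first three carries
    less than a fourth, the last one carries more, which justifies its choice as the default in
    [quarter]. *)
Lemma quarterP f r : rok r -> (forall z, rset r z -> ccont f z) ->
  rb f r <= 4 * rb f (quarter f r).
Proof.
case: r => -[[a b] c] d [ab cd] cf; rewrite /quarter.
set m := (a + b) / 2; set n := (c + d) / 2.
have am : a <= m <= b by rewrite /m; apply/andP; split; lra.
have cn : c <= n <= d by rewrite /n; apply/andP; split; lra.
have /andP[am1 am2] := am; have /andP[cn1 cn2] := cn.
case: ifP => // /negbT; rewrite -ltNge => h1.
case: ifP => // /negbT; rewrite -ltNge => h2.
case: ifP => // /negbT; rewrite -ltNge => h3.
move: h1 h2 h3; rewrite /rb.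
rewrite (rbnd_splity cf ab cn).
have cf1 z : crect a b c n z -> ccont f z.
  by move=> [h1 /andP[h2 h3]]; apply: cf; split => //; rewrite h2 (le_trans h3).
have cf2 z : crect a b n d z -> ccont f z.
  by move=> [h1 /andP[h2 h3]]; apply: cf; split => //; rewrite h3 (le_trans _ h2).
rewrite (rbnd_splitx cf1 am cn1) (rbnd_splitx cf2 am cn2).
move: (rbnd f a m c n) (rbnd f m b c n) (rbnd f a m n d) (rbnd f m b n d) => B1 B2 B3 B4.
have := cabsD (B1 + B2) (B3 + B4); have := cabsD B1 B2; have := cabsD B3 B4; lra.
Qed.

Definition rlen (r : rect) := let: (a, b, c, d) := r in (b - a) + (d - c).

Lemma quarter_sub f r : rok r -> [/\ rok (quarter f r),
  rset (quarter f r) `<=` rset r & rlen (quarter f r) = rlen r / 2].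
Proof.
case: r => -[[a b] c] d [ab cd]; rewrite /quarter.
set m := (a + b) / 2; set n := (c + d) / 2.
have mE : m = (a + b) / 2 by []; have nE : n = (c + d) / 2 by [].
by do 3? case: ifP => _; (split;
  [by split; lra|
   move=> z /= [/andP[h1 h2] /andP[h3 h4]]; split; apply/andP; split; lra|
   rewrite /=; lra]).
Qed.

(** The affine part f(p) + dz (z - p) contributes nothing to the contour integral. The remainder is
    at most e L on the rectangle, L being half the perimeter, and opposite sides together contribute
    twice this times a side length. *)
Lemma rb_small f r p dz (e : R) : rok r -> rset r p -> (forall z, rset r z -> ccont f z) ->
  (forall z, rset r z -> cabs (f z - f p - dz * (z - p)) <= e * cabs (z - p)) ->
  0 <= e -> rb f r <= 2 * e * rlen r ^+ 2.
Proof.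
case: r => -[[a b] c] d [ab cd] [/andP[pa pb] /andP[pc pd]] cf H e0.
pose g z := f z - f p - dz * (z - p).
pose L := (b - a) + (d - c).
have L0 : 0 <= L by rewrite /L; lra.
have cL z : crect a b c d z -> cabs (g z) <= e * L.
  move=> zr; rewrite (le_trans (H z zr))// ler_wpM2l//.
  rewrite (le_trans (cabs_le_ReIm _))// cReD cImD cReN cImN.
  case: zr => /andP[h1 h2] /andP[h3 h4]; apply: lerD; rewrite ler_norml; apply/andP; split; lra.
have cg z : crect a b c d z -> ccont g z.
  move=> zr; apply: ccvgB; first by apply: ccvgB; [exact: cf|exact: ccvg_cst].
  apply: ccvgM; first exact: ccvg_cst.
  by apply: ccvgB; [exact: ccvg_id|exact: ccvg_cst].
have Va : a <= a <= b by rewrite lexx. have Vb : a <= b <= b by rewrite lexx ab.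
have Hc : c <= c <= d by rewrite lexx. have Hd : c <= d <= d by rewrite lexx cd.
have gE : rbnd f a b c d = rbnd g a b c d.
  rewrite /rbnd.
  rewrite (@eq_cint _ _ _ mu _ _ (fun t => (g (b +i* t) - g (a +i* t)) + dz * (b - a)%:C)); last first.
    move=> t _; rewrite /g (_ : (b - a)%:C = (b +i* t) - (a +i* t)); first by ring.
    by apply: ceqP => /=; ring.
  rewrite (@eq_cint _ _ _ mu `[a, b] _ (fun t => (g (t +i* d) - g (t +i* c)) + dz * ((0 +i* 1) * (d - c)%:C))); last first.
    move=> t _; rewrite /g (_ : (0 +i* 1) * (d - c)%:C = (t +i* d) - (t +i* c)); first by ring.
    by apply: ceqP; rewrite ?cReMr ?cImMr/=; ring.
  have ivv : cintg mu `[c, d] (fun t => g (b +i* t) - g (a +i* t)).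
    by apply: cintgB => //; apply: cintg_vert cg _.
  have ihh : cintg mu `[a, b] (fun t => g (t +i* d) - g (t +i* c)).
    by apply: cintgB => //; apply: cintg_horiz cg _.
  have ic x y (k : C) : cintg mu `[x, y] (fun=> k).
    by apply: cintg_seg => t _; exact: ccvg_cst.
  rewrite (cintD (@miv c d) ivv (ic _ _ _)) (cintD (@miv a b) ihh (ic _ _ _)).
  rewrite !cint_cst_itv//; ring.
have est (h : R -> C) x y : x <= y -> cintg mu `[x, y] h ->
    (forall t, x <= t <= y -> cabs (h t) <= 2 * (e * L)) ->
    cabs (cint mu `[x, y] h) <= 2 * (e * L) * (y - x).
  move=> xy ih hh.
  have -> : 2 * (e * L) * (y - x) = \int[mu]_(t in `[x, y]) (2 * (e * L)).
    by rewrite Rintegral_cst_itv.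
  apply: cabs_cint_le => //.
  by rewrite integral_cst//= lebesgue_itvcc// -EFinM ltry.
rewrite /rb gE /rbnd (le_trans (cabsB _ _))// cabsM.
have -> : cabs (0 +i* 1 : C) = 1 by rewrite cabsE/= expr0n expr1n add0r sqrtr1.
rewrite mul1r.
have e1 : cabs (cint mu `[c, d] (fun t => g (b +i* t) - g (a +i* t))) <= 2 * (e * L) * (d - c).
  apply: est => //.
    by apply: cintgB => //; apply: cintg_vert cg _.
  move=> t tcd; rewrite (le_trans (cabsB _ _))// mulr2n mulrDl mul1r lerD// cL//; split => //.
have e2 : cabs (cint mu `[a, b] (fun t => g (t +i* d) - g (t +i* c))) <= 2 * (e * L) * (b - a).
  apply: est => //.
    by apply: cintgB => //; apply: cintg_horiz cg _.
  move=> t tcd; rewrite (le_trans (cabsB _ _))// mulr2n mulrDl mul1r lerD// cL//; split => //.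
rewrite (le_trans (lerD e1 e2))// /rlen -/L expr2.
by rewrite (_ : _ + _ = 2 * e * (L * L))// /L; ring.
Qed.

(* Goursat's lemma by repeated bisection. *)
Theorem goursat f a b c d : a <= b -> c <= d ->
  (forall z, crect a b c d z -> chol f z) -> rbnd f a b c d = 0.
Proof.
move=> ab cd hf.
pose r0 : rect := (a, b, c, d).
pose r n := iter n (quarter f) r0.
have cf z : rset r0 z -> ccont f z by move=> /hf; exact: chol_ccont.
have inv n : [/\ rok (r n), rset (r n) `<=` rset r0, rlen (r n) = rlen r0 / 2 ^+ n
    & rb f r0 <= 4 ^+ n * rb f (r n)].
  elim: n => [|n [ok sub len bd]]; first by split; rewrite ?expr0 ?divr1 ?mul1r//=.
  have [ok' sub' len'] := quarter_sub f ok.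
  split => //; first by apply: subset_trans sub; exact: sub'.
    by rewrite [LHS]len' len exprS invfM mulrCA mulrC.
  apply: (le_trans bd); rewrite exprSr -mulrA ler_wpM2l ?exprn_ge0//.
  by apply: quarterP => // z /sub; exact: cf.
pose A n := (r n).1.1.1; pose B n := (r n).1.1.2; pose Cc n := (r n).1.2; pose D n := (r n).2.
have rE n : r n = (A n, B n, Cc n, D n) by rewrite /A /B /Cc /D; case: (r n) => -[[? ?] ?] ?.
have step n : [/\ A n <= A n.+1, B n.+1 <= B n, Cc n <= Cc n.+1 & D n.+1 <= D n].
  have [ok _ _ _] := inv n; have [ok' sub' _] := quarter_sub f ok.
  have rS : quarter f (r n) = r n.+1 by [].
  rewrite rS !rE in ok' sub'; case: ok' => o1 o2.
  have [] := sub' (A n.+1 +i* Cc n.+1) _; first by split => /=; rewrite lexx.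
  have [] := sub' (B n.+1 +i* D n.+1) _; first by split => /=; rewrite lexx ?o1 ?o2.
  by move=> /= /andP[_ h1] /andP[_ h2] /andP[h3 _] /andP[h4 _].
have okn n : A n <= B n /\ Cc n <= D n by have [] := inv n; rewrite rE.
have hA : {homo A : n m / (n <= m)%N >-> n <= m}.
  by apply: homo_leq => // [x y z|n]; [exact: le_trans|have [] := step n].
have hC : {homo Cc : n m / (n <= m)%N >-> n <= m}.
  by apply: homo_leq => // [x y z|n]; [exact: le_trans|have [] := step n].
have hB : {homo B : n m / (n <= m)%N >-> m <= n}.
  by apply: (@homo_leq _ B (fun x y => y <= x)) => // [x y z yx zy|n]; [exact: le_trans zy yx|have [] := step n].
have hD : {homo D : n m / (n <= m)%N >-> m <= n}.
  by apply: (@homo_leq _ D (fun x y => y <= x)) => // [x y z yx zy|n]; [exact: le_trans zy yx|have [] := step n].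
have AB n m : A n <= B m.
  by rewrite (le_trans (hA n (maxn n m) (leq_maxl _ _)))// (le_trans (okn _).1)// hB// leq_maxr.
have CD n m : Cc n <= D m.
  by rewrite (le_trans (hC n (maxn n m) (leq_maxl _ _)))// (le_trans (okn _).2)// hD// leq_maxr.
(* Nested intervals have a common point, the supremum of the left ends. *)
have bnd (U : nat -> R) (V : nat -> R) : (forall n m, U n <= V m) ->
    exists x, forall n, U n <= x <= V n.
  move=> UV; exists (sup (range U)) => n.
  have hs : has_sup (range U).
    by split; [exists (U 0%N), 0%N|exists (V 0%N) => _ [m _ <-]].
  apply/andP; split; first by apply: ub_le_sup; [case: hs|exists n].
  by apply: ge_sup; [case: hs|move=> _ [m _ <-]].
have [x xP] := bnd _ _ AB; have [y yP] := bnd _ _ CD.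
pose p : C := x +i* y.
have pr n : rset (r n) p by rewrite rE; split => /=; [exact: xP|exact: yP].
have [dz /cderivable_epsP F] := hf p (pr 0%N).
apply/eqP; rewrite -cabs_eq0 eq_le cabs_ge0 andbT.
have L0 : 0 <= rlen r0 by rewrite /rlen /r0; lra.
apply/ler_addgt0Pr => e e0; rewrite add0r.
(* After n bisections the factor 4^n cancels the square of L / 2^n, leaving (e / k) 2 L^2, which is
   at most e; the added 1 keeps k positive for a degenerate rectangle. *)
pose k := 2 * (rlen r0 + 1) ^+ 2.
have k0 : 0 < k by rewrite mulr_gt0// exprn_gt0//; lra.
have [del del0 Hd] := F (e / k) (divr_gt0 e0 k0).
have [n nP] : exists n, rlen r0 / 2 ^+ n < del.
  exists (Num.truncn (rlen r0 / del)).+1.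
  rewrite ltr_pdivrMr ?exprn_gt0// mulrC -ltr_pdivrMr//.
  rewrite (lt_trans (truncnS_gt _))// -natrX ltr_nat ltn_expl//.
have [ok sub len bd] := inv n.
have := @rb_small f (r n) p dz (e / k) ok (pr n) _ _ (ltW (divr_gt0 e0 k0)).
have cfn z : rset (r n) z -> ccont f z by move=> /sub; exact: cf.
have est z : rset (r n) z -> cabs (f z - f p - dz * (z - p)) <= e / k * cabs (z - p).
  move=> zr; have := Hd (z - p); rewrite (addrC p) subrK; apply.
  rewrite (le_lt_trans _ nP)// -len (le_trans (cabs_le_ReIm _))//.
  move: zr; have := pr n; rewrite rE => -[/andP[q1 q2] /andP[q3 q4]] [/andP[h1 h2] /andP[h3 h4]].
  rewrite cReD cImD cReN cImN; apply: lerD; rewrite ler_norml; apply/andP; split; lra.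
move=> /(_ cfn est) small.
rewrite (le_trans bd)// (le_trans (ler_wpM2l _ small)) ?exprn_ge0//.
have E4 : (2 ^+ n) ^+ 2 = 4 ^+ n :> R by rewrite -exprM mulnC exprM -natrX.
have n4 : 4 ^+ n != 0 :> R by rewrite expf_neq0.
have kn : k != 0 by rewrite lt0r_neq0.
have -> : 4 ^+ n * (2 * (e / k) * rlen (r n) ^+ 2) = (e / k) * (2 * rlen r0 ^+ 2).
  by rewrite len expr_div_n E4; field; rewrite kn n4.
rewrite mulrAC ler_pdivrMr// ler_wpM2l ?(ltW e0)//.
by rewrite /k ler_wpM2l// ler_pXn2r// ?nnegrE ?lerDl// addr_ge0.
Qed.

End Goursat.

Section CircleMean.
Context {R : realType}.
Local Notation C := R[i].
Local Notation mu := (@lebesgue_measure R).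
Local Notation I := ('i%C : C).
Implicit Types (z w : C) (x y : R).

(** These matrices fix i. Through the Cayley transform they act on the disk as rotations by the
    angle 2 x. *)
Definition crot (x : R) : 'M[R]_2 :=
  \matrix_(i < 2, j < 2) if i == 0 then (if j == 0 then cos x else sin x)
                         else (if j == 0 then - sin x else cos x).

Lemma det_crot x : \det (crot x) = 1.
Proof. by rewrite det2E !mxE/= -(cos2Dsin2 x); ring. Qed.

Lemma sqri : I * I = -1.
Proof. by rewrite -expr2 sqr_i. Qed.

Definition ckay w : C := I * ((1 + w) / (1 - w)).

Lemma sub1_neq0 w : cabs w < 1 -> 1 - w != 0.
Proof. by move=> w1; rewrite subr_eq0; apply/eqP => E; move: w1; rewrite -E cabs1 ltxx. Qed.

Lemma uhp_ckay w : cabs w < 1 -> uhp (ckay w).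
Proof.
move=> w1; have w0 := sub1_neq0 w1; have n0 : cabs (1 - w) ^+ 2 != 0 by rewrite expf_neq0 ?cabs_eq0.
have E : (1 + w) / (1 - w) = ((1 + w) * (1 - w)^*) * ((cabs (1 - w) ^+ 2)^-1)%:C.
  apply: (mulIf w0); rewrite divfK// -!mulrA (mulrC _ (1 - w)) (mulrA _^* ) (mulrC _^* ) mulcJ.
  by rewrite -rmorphM/= divff// mulr1.
rewrite /uhp/= /ckay E cImM /= mul0r add0r mul1r cReMr mulr_gt0//; last first.
  by rewrite invr_gt0 exprn_gt0// cabs_gt0.
rewrite cReM cReJ cImJ !cReD !cImD cReN cImN/=.
have : cabs w ^+ 2 < 1 by rewrite expr_lt1// cabs_ge0.
by rewrite sqr_cabs; nra.
Qed.

Lemma ckay_chol w : cabs w < 1 -> chol ckay w.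
Proof.
move=> w1; apply: cholZ; apply: cholM; first by apply: cholD; [exact: chol_cst|exact: chol_id].
apply: cholV; last exact: sub1_neq0.
by apply: cholB; [exact: chol_cst|exact: chol_id].
Qed.

Lemma ckay0 : ckay 0 = I.
Proof. by rewrite /ckay addr0 subr0 divr1 mulr1. Qed.

Lemma uhp_i : uhp I.
Proof. by rewrite /uhp/= ltr01. Qed.

Lemma cexp_i x : cexp (0 +i* x) = (cos x)%:C + I * (sin x)%:C.
Proof.
apply: ceqP; first by rewrite cReCexp cReD cReMr/= expR0; ring.
by rewrite cImCexp cImD cImMr/= expR0; ring.
Qed.

Definition cay z : C := (z - I) / (z + I).

Lemma cabs_cay z : uhp z -> cabs (cay z) < 1.
Proof.
move=> zu; have := cabs_lt_uhp zu uhp_i.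
have -> : z - I^* = z + I by apply: ceqP => /=; rewrite ?cReD ?cImD ?cReN ?cImN ?cReJ ?cImJ/=; ring.
move=> h; have h0 : 0 < cabs (z + I) by rewrite (le_lt_trans _ h)// cabs_ge0.
by rewrite /cay cabsM cabsV ltr_pdivrMr// mul1r.
Qed.

Lemma add_i_neq0 z : uhp z -> z + I != 0.
Proof.
by move=> zu; apply/eqP => /(congr1 (@complex.Im R)); rewrite cImD/= => h; move: zu; rewrite /uhp/= => zu; lra.
Qed.

(** For the numerator A and the denominator B, A - i B = e^(i x) (z - i) and A + i B = e^(- i x) (z
    + i); their quotient is the Cayley transform of A / B. *)
Lemma mobius_crot x z : uhp z ->
  mobius (crot x) z = ckay (cexp (0 +i* (2 * x)) * cay z).
Proof.
move=> zu; have B0 := cfac_neq0 (det_crot x) zu.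
have := mobius_uhp (det_crot x) zu => mu0.
rewrite /mobius in mu0 *; move: B0 mu0; rewrite /cfac !mxE/=.
set c := (cos x)%:C; set s := (sin x)%:C; rewrite rmorphN/= -/s.
set A := c * z + s; set B := - s * z + c => B0 mu0.
pose e := c + I * s; pose e' := c - I * s.
have ee : e * e' = 1.
  rewrite /e /e' (_ : _ * _ = c * c - (I * I) * s * s); last by ring.
  by rewrite sqri mulN1r mulNr opprK -!rmorphM -rmorphD/= -!expr2 cos2Dsin2.
have e0 : e != 0 by apply/eqP => E; move: ee; rewrite E mul0r => /esym/eqP; rewrite oner_eq0.
have eE : e = cexp (0 +i* x) by rewrite cexp_i.
have -> : cexp (0 +i* (2 * x)) = e * e.
  by rewrite eE -cexpD; congr cexp; apply: ceqP; rewrite ?cReD ?cImD/=; ring.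
have e'E : e' = e^-1 by apply: (mulfI e0); rewrite ee divff.
have AmB : A - I * B = e * (z - I).
  transitivity (c * z - I * c + I * s * z - (I * I) * s); last by rewrite /e; ring.
  by rewrite sqri /A /B; ring.
have ApB : A + I * B = e' * (z + I).
  transitivity (c * z + I * c - I * s * z - (I * I) * s); last by rewrite /e'; ring.
  by rewrite sqri /A /B; ring.
have zi := add_i_neq0 zu.
have D0 : A + I * B != 0 by rewrite ApB mulf_neq0// e'E invr_eq0.
have -> : e * e * cay z = (A - I * B) / (A + I * B).
  by rewrite AmB ApB e'E /cay; field; rewrite e0 zi.
have i0 : I != 0 by apply/eqP => /(congr1 (@complex.Im R)) /= /eqP; rewrite oner_eq0.
rewrite /ckay (_ : 1 + _ = 2 * A / (A + I * B)); last by field.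
rewrite (_ : 1 - _ = 2 * I * B / (A + I * B)); last by field.
by field; rewrite D0 B0 i0.
Qed.

Lemma cexp_2pi z : cexp (z + (0 +i* (2 * pi))) = cexp z.
Proof.
rewrite cexpD cexp_i.
have -> : cos (2 * pi) = 1 :> R by rewrite mulr_natl cos2pi.
have -> : sin (2 * pi) = 0 :> R by rewrite mulr_natl sin2pi.
by rewrite mulr0 addr0 mulr1.
Qed.

(* The integral over a circle |w| = e^x of a holomorphic function on the disk does
   not depend on x: apply Goursat to the rectangle [x, 0] x [0, 2 pi] in the
   coordinate log w, whose horizontal sides cancel. *)
Lemma circle_mean (phi : C -> C) z : (forall w, uhp w -> chol phi w) -> uhp z ->
  cintg mu `[0, 2 * pi] (fun x => phi (mobius (crot (x / 2)) z)) /\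
  cint mu `[0, 2 * pi] (fun x => phi (mobius (crot (x / 2)) z)) = (2 * pi)%:C * phi I.
Proof.
move=> hphi zu; set w0 := cay z.
pose psi u := phi (ckay (cexp u * w0)).
have small u : complex.Re u <= 0 -> cabs (cexp u * w0) < 1.
  move=> u0; rewrite cabsM cabs_cexp (le_lt_trans _ (cabs_cay zu))//.
  by rewrite ler_piMl ?cabs_ge0// -expR0 ler_expR.
have hpsi u : complex.Re u <= 0 -> chol psi u.
  move=> u0; apply: chol_comp; last by apply: hphi; apply: uhp_ckay; exact: small.
  apply: (@chol_comp _ (fun u => cexp u * w0) ckay); last by apply: ckay_chol; exact: small.
  by apply: cholM; [exact: cexp_chol|exact: chol_cst].
have p0 : 0 <= 2 * pi :> R by rewrite mulr_ge0// pi_ge0.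
have mI : measurable (`[0, 2 * pi]%classic : set (measurableTypeR R)) by exact: measurable_itv.
have iP x : x <= 0 -> cintg mu `[0, 2 * pi] (fun t => psi (x +i* t)).
  by move=> x0; apply: cintg_seg => t _; apply: ccvg_vert; apply: chol_ccont; exact: hpsi.
have E0 : (fun x : measurableTypeR R => phi (mobius (crot (x / 2)) z)) = fun t => psi (0 +i* t).
  apply/funext => x; rewrite mobius_crot// /psi; congr (phi (ckay (cexp (_ +i* _) * _))).
  by rewrite mulrC divfK.
rewrite E0; split; first exact: iP.
have inv A : 0 <= A -> cint mu `[0, 2 * pi] (fun t => psi (0 +i* t)) =
    cint mu `[0, 2 * pi] (fun t => psi (- A +i* t)).
  move=> A0; have := @goursat R psi (- A) 0 0 (2 * pi).
  rewrite oppr_le0 => /(_ A0 p0) H.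
  have : rbnd psi (- A) 0 0 (2 * pi) = 0 by apply: H => u [/andP[_ h] _]; exact: hpsi.
  rewrite /rbnd (@eq_cint _ _ _ mu `[- A, 0] _ (fun=> 0)); last first.
    move=> t _; rewrite /psi -(cexp_2pi (t +i* 0)).
    rewrite (_ : t +i* 0 + _ = t +i* (2 * pi)) ?subrr//.
    by apply: ceqP; rewrite ?cReD ?cImD/=; ring.
  rewrite (cint0 mu (measurable_itv _)) subr0 (cintB mI (iP _ (lexx _))); last by apply: iP; rewrite oppr_le0.
  move=> /eqP; rewrite mulf_eq0 => /orP[/eqP/(congr1 (@complex.Im R))/=/eqP|].
    by rewrite oner_eq0.
  by rewrite subr_eq0 => /eqP.
(* The integral is now that over arbitrarily small circles |w| <= e^(-A), where the integrand is
   uniformly close to phi(i) by continuity. *)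
apply/eqP; rewrite -subr_eq0 -cabs_eq0 eq_le cabs_ge0 andbT.
apply/ler_addgt0Pr => e e0; rewrite add0r.
have pi20 : 0 < 2 * pi :> R by rewrite mulr_gt0// pi_gt0.
have c0 : ccvg (cnbhs 0) (fun w => phi (ckay w)) (phi I).
  rewrite -ckay0; apply: (@chol_ccont _ (fun w => phi (ckay w))); apply: chol_comp.
    by apply: ckay_chol; rewrite cabs0.
  by apply: hphi; rewrite ckay0; exact: uhp_i.
have := c0 (e / (2 * pi)) (divr_gt0 e0 pi20) => /cnbhsP[del del0 Hd].
pose A := `|ln del| + 1.
have A0 : 0 <= A by rewrite addr_ge0.
have eA : expR (- A) < del.
  by rewrite -[ltRHS]lnK ?posrE// ltr_expR /A; have := ler_norm (- ln del); rewrite normrN; lra.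
rewrite (inv A A0) (_ : (2 * pi)%:C * phi I = cint mu `[0, 2 * pi] (fun=> phi I)); last first.
  by rewrite cint_cst_itv// subr0 mulrC.
have iA : cintg mu `[0, 2 * pi] (fun t => psi (- A +i* t)) by apply: iP; rewrite oppr_le0.
have ic : cintg mu `[0, 2 * pi] (fun=> phi I) by apply: cintg_seg => t _; exact: ccvg_cst.
rewrite -(cintB mI iA ic).
have -> : e = \int[mu]_(t in `[0, 2 * pi]) (e / (2 * pi)).
  by rewrite Rintegral_cst_itv// subr0 divfK// lt0r_neq0.
apply: cabs_cint_le => //.
- exact: cintgB.
- move=> t _; rewrite cabsC; apply/ltW/Hd; rewrite subr0 cabsM cabs_cexp/=.
  by rewrite (le_lt_trans _ eA)// ler_piMr ?expR_ge0// ltW// cabs_cay.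
by rewrite integral_cst//= lebesgue_itvcc// -EFinM ltry.
Qed.

End CircleMean.

(** * Derivatives integrated over the real line *)

Section LineFTC.
Context {R : realType}.
Local Notation mu := (@lebesgue_measure R).
Implicit Types (x y : R) (f g : R -> R).

Lemma deriv_cst x (c : R) : is_derive x 1 (fun=> c) 0.
Proof. exact: is_derive_cst. Qed.

Lemma deriv_id x : is_derive x 1 (fun x => x) 1.
Proof. exact: is_derive_id. Qed.

Lemma derivD x f g (a b : R) : is_derive x 1 f a -> is_derive x 1 g b ->
  is_derive x 1 (fun x => f x + g x) (a + b).
Proof. by move=> F G; exact: is_deriveD. Qed.

Lemma deriv_eq x f (a b : R) : is_derive x 1 f a -> a = b -> is_derive x 1 f b.
Proof. by move=> F <-. Qed.

Lemma derivM x f g (a b : R) : is_derive x 1 f a -> is_derive x 1 g b ->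
  is_derive x 1 (fun x => f x * g x) (a * g x + f x * b).
Proof.
move=> F G; apply: (deriv_eq (is_deriveM F G)).
by rewrite /GRing.scale/= addrC mulrC.
Qed.

Lemma derivN x f (a : R) : is_derive x 1 f a -> is_derive x 1 (fun x => - f x) (- a).
Proof. by move=> F; exact: is_deriveN. Qed.

Lemma derivB x f g (a b : R) : is_derive x 1 f a -> is_derive x 1 g b ->
  is_derive x 1 (fun x => f x - g x) (a - b).
Proof. by move=> F G; apply: derivD F (derivN G). Qed.

Lemma derivZ x (c : R) f (a : R) : is_derive x 1 f a ->
  is_derive x 1 (fun x => c * f x) (c * a).
Proof.
by move=> F; have := derivM (deriv_cst x c) F; rewrite mul0r add0r.
Qed.

Lemma deriv_comp x f g (a b : R) : is_derive x 1 f a -> is_derive (f x) 1 g b ->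
  is_derive x 1 (fun x => g (f x)) (a * b).
Proof. by move=> F G; rewrite mulrC; exact: (is_derive1_comp (f := g) (g := f)). Qed.

Lemma deriv_exp x f (a : R) : is_derive x 1 f a ->
  is_derive x 1 (fun x => expR (f x)) (a * expR (f x)).
Proof. by move=> F; exact: deriv_comp F (is_derive_expR _). Qed.

Lemma deriv_ln x f (a : R) : is_derive x 1 f a -> 0 < f x ->
  is_derive x 1 (fun x => ln (f x)) (a / f x).
Proof. by move=> F f0; exact: deriv_comp F (is_derive1_ln f0). Qed.

Lemma deriv_continuous f : (forall x, exists a : R, is_derive x 1 f a) -> continuous f.
Proof.
move=> H x; have [a [F _]] := H x.
by apply: differentiable_continuous; apply/derivable1_diffP.
Qed.

Let Fn (n : nat) := `[(- n%:R), n%:R]%classic : set (measurableTypeR R).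

Let FnU : \bigcup_n Fn n = setT.
Proof.
apply/seteqP; split => // x _.
have [n nx] : exists n : nat, `|x| <= n%:R.
  by exists (Num.truncn `|x|).+1; rewrite ltW// truncnS_gt.
by exists n => //; rewrite /Fn/= in_itv/= -ler_norml.
Qed.

Let FnS n m : (n <= m)%N -> Fn n `<=` Fn m.
Proof.
move=> nm x; rewrite /Fn/= !in_itv/= => /andP[h1 h2].
have nm' : n%:R <= m%:R :> R by rewrite ler_nat.
by rewrite (le_trans _ h1) ?lerN2//= (le_trans h2).
Qed.

Lemma FTC_sym (G g : R -> R) (n : nat) : (forall x, is_derive x 1 G (g x)) -> continuous g ->
  (\int[mu]_(x in Fn n) (g x)%:E = (G n%:R - G (- n%:R))%:E)%E.
Proof.
move=> dG cg; have cG : continuous G by apply: deriv_continuous => x; exists (g x).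
case: n => [|n].
  by rewrite /Fn oppr0 set_itv1 integral_set1 subrr.
rewrite /Fn (@continuous_FTC2 _ g G)//.
- by rewrite (@lt_le_trans _ _ 0)// oppr_lt0 ltr0n.
- by apply: continuous_in_subspaceT => x _; exact: cg.
- split; first by move=> x _; have [] := dG x.
  + by apply: cvg_at_right_filter; exact: cG.
  + by apply: cvg_at_left_filter; exact: cG.
- by move=> x _; rewrite derive1E; have [_ ->] := dG x.
Qed.

Lemma FTC_bound (G g : R -> R) (M : R) : (forall x, is_derive x 1 G (g x)) -> continuous g ->
  (forall x, 0 <= g x) -> (forall x, `|G x| <= M) -> (\int[mu]_x (g x)%:E < +oo)%E.
Proof.
move=> dG cg g0 GM; rewrite -FnU.
have mg : measurable_fun setT (fun x : R => (g x)%:E).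
  by apply/measurable_EFinP; exact: continuous_measurable_fun.
have L : (\int[mu]_(x in Fn n) (g x)%:E @[n --> \oo] --> \int[mu]_(x in \bigcup_n Fn n) (g x)%:E)%E.
  apply: ge0_nondecreasing_set_cvg_integral.
  - by move=> n m nm; rewrite subsetEset; exact: FnS.
  - by move=> n; exact: measurable_itv.
  - by move=> n; exact: measurable_funTS.
  - by move=> n x _; rewrite lee_fin.
rewrite -(cvg_lim _ L)//; apply: (@le_lt_trans _ _ (M + M)%:E); last by rewrite ltry.
apply: lime_le; first by apply/cvg_ex; eexists; exact: L.
apply: nearW => n; rewrite (FTC_sym n dG cg) lee_fin.
by have := GM n%:R; have := GM (- n%:R); rewrite !ler_norml => /andP[? ?] /andP[? ?]; lra.
Qed.

(** Takes the place of integration by parts in the recursions of [massA] and [massB]. *)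
Lemma FTC_line0 (G g : R -> R) : (forall x, is_derive x 1 G (g x)) -> continuous g ->
  mu.-integrable setT (EFin \o g) ->
  G n%:R @[n --> \oo] --> (0 : R) -> G (- n%:R) @[n --> \oo] --> (0 : R) ->
  \int[mu]_x g x = 0.
Proof.
move=> dG cg ig G1 G2.
have mg : measurable_fun setT g by exact: continuous_measurable_fun.
pose f_ (n : nat) (x : R) : \bar R := ((EFin \o g) \_ (Fn n)) x.
have [] := @dominated_convergence _ _ R mu setT measurableT f_ (EFin \o g)
    (fun x => `|(g x)%:E|%E).
- move=> n; apply/(measurable_restrict _ _ measurableT) => //; first exact: measurable_itv.
  by rewrite setTI; apply: measurable_funTS; exact/measurable_EFinP.
- exact/measurable_EFinP.
- apply: aeW => x _; have : (\bigcup_n Fn n) x by rewrite FnU.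
  move=> [n _ xn]; apply: cvg_near_cst; exists n => // m /= nm.
  by rewrite /f_ patchE mem_set//; exact: (FnS nm).
- exact: integrable_abse.
- apply: aeW => x n _; rewrite /f_ patchE; case: ifP => //.
  by rewrite abse0 abse_ge0.
move=> _ _; rewrite (_ : [sequence _]_n = fun n => ((G n%:R - G (- n%:R))%:E)); last first.
  by apply/funext => n; rewrite -(FTC_sym n dG cg) [RHS]integral_mkcond.
move=> L.
have L' : (fun n => ((G n%:R - G (- n%:R))%:E)) @ \oo --> (0 : R)%:E.
  apply: cvg_EFin; first exact: nearW.
  by rewrite -[X in _ --> X](subr0 (0 : R)); apply: cvgB.
by rewrite /Rintegral (cvg_unique _ L L').
Qed.

End LineFTC.

(** * The mass of the kernel *)

Section KernelMass.
Context {R : realType}.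
Local Notation mu := (@lebesgue_measure R).
Implicit Types (t x : R).

Definition lexp x : R := ln (1 + expR x).
(** [mA] and [mB] are the integrands of the Beta integrals B(t - 1, t) and B(1/2, t - 1/2), that is
    e^((t - 1) x) / (1 + e^x)^(2 t - 1) and (1 + x^2)^(-t), written as exponentials so that powers
    become linear in t. *)
Definition mA t x : R := expR ((t - 1) * x - (2 * t - 1) * lexp x).
Definition mB t x : R := expR (- t * ln (1 + x ^+ 2)).

Lemma onepexp_gt0 x : 0 < 1 + expR x.
Proof. by rewrite addr_gt0// expR_gt0. Qed.

Lemma onepsqr_gt0 x : 0 < 1 + x ^+ 2.
Proof. by rewrite ltr_pwDl// sqr_ge0. Qed.

Lemma expR_lexp x : expR (lexp x) = 1 + expR x.
Proof. by rewrite lnK// posrE onepexp_gt0. Qed.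

Lemma deriv_lexp x : is_derive x 1 lexp (expR x / (1 + expR x)).
Proof.
apply: deriv_ln; last exact: onepexp_gt0.
by have := derivD (deriv_cst x 1) (is_derive_expR x); rewrite add0r.
Qed.

Lemma deriv_lsq x : is_derive x 1 (fun x => ln (1 + x ^+ 2)) (2 * x / (1 + x ^+ 2)).
Proof.
apply: (@deriv_ln _ _ (fun x => 1 + x ^+ 2)); last exact: onepsqr_gt0.
have := derivD (deriv_cst x 1) (derivM (deriv_id x) (deriv_id x)).
by move/deriv_eq; apply; ring.
Qed.

Lemma mA_continuous t : continuous (mA t).
Proof.
apply: deriv_continuous => x; eexists.
exact: (deriv_exp (derivB (derivZ (t - 1) (deriv_id x)) (derivZ (2 * t - 1) (deriv_lexp x)))).
Qed.

Lemma mB_continuous t : continuous (mB t).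
Proof.
apply: deriv_continuous => x; eexists.
exact: (deriv_exp (derivZ (- t) (deriv_lsq x))).
Qed.

Lemma lexp_ge0 x : 0 <= lexp x.
Proof. by rewrite ln_ge0// lerDl expR_ge0. Qed.

Lemma lexp_ge x : x <= lexp x.
Proof. by rewrite -ler_expR expR_lexp lerDr. Qed.

Lemma mA_fin t : 1 < t -> (\int[mu]_x (mA t x)%:E < +oo)%E.
Proof.
move=> t1.
(* G is (e^x / (1 + e^x))^(t - 1) / (t - 1), whose derivative e^((t - 1) x) / (1 + e^x)^t dominates
   [mA t] since 2 t - 1 >= t. *)
pose G x := (t - 1)^-1 * expR ((t - 1) * (x - lexp x)).
pose g x := expR ((t - 1) * (x - lexp x) - lexp x).
have dG x : is_derive x 1 G (g x).
  have := derivZ (t - 1)^-1 (deriv_exp (derivZ (t - 1) (derivB (deriv_id x) (deriv_lexp x)))).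
  move/deriv_eq; apply; rewrite /g expRB expR_lexp.
  have := onepexp_gt0 x => /lt0r_neq0 h; have h1 : t - 1 != 0 by rewrite subr_eq0 gt_eqF.
  by field; rewrite ?h ?h1 ?lt0r_neq0 ?expR_gt0.
have cg : continuous g.
  apply: deriv_continuous => x; eexists.
  exact: (deriv_exp (derivB (derivZ (t - 1) (derivB (deriv_id x) (deriv_lexp x))) (deriv_lexp x))).
apply: le_lt_trans (FTC_bound (M := (t - 1)^-1) dG cg _ _).
- apply: ge0_le_integral => //.
  + by move=> x _; rewrite lee_fin expR_ge0.
  + by apply/measurable_EFinP; apply: continuous_measurable_fun; exact: mA_continuous.
  + by apply/measurable_EFinP; exact: continuous_measurable_fun.
  move=> x _; rewrite lee_fin ler_expR; have := lexp_ge0 x; nra.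
- by move=> x; rewrite expR_ge0.
have t0 : 0 <= (t - 1)^-1 by rewrite invr_ge0 subr_ge0 ltW.
move=> x; rewrite ger0_norm ?mulr_ge0 ?expR_ge0//.
rewrite /G ler_piMr// expR_le1.
by rewrite mulr_ge0_le0 ?subr_ge0 ?(ltW t1)// subr_le0 lexp_ge.
Qed.

Lemma mB_fin t : 1 <= t -> (\int[mu]_x (mB t x)%:E < +oo)%E.
Proof.
move=> t1.
pose g x : R := (1 + x ^+ 2)^-1.
have cg : continuous g.
  move=> x; apply: cvgV; first by rewrite lt0r_neq0// onepsqr_gt0.
  by apply: cvgD; [exact: cvg_cst|apply: (@exprn_continuous R 2)].
have dG x : is_derive x 1 (@atan R) (g x) by exact: is_derive1_atan.
apply: le_lt_trans (FTC_bound (M := pi / 2) dG cg _ _).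
- apply: ge0_le_integral => //.
  + by move=> x _; rewrite lee_fin expR_ge0.
  + by apply/measurable_EFinP; apply: continuous_measurable_fun; exact: mB_continuous.
  + by apply/measurable_EFinP; exact: continuous_measurable_fun.
  move=> x _; rewrite lee_fin /g -[X in X^-1]lnK ?posrE ?onepsqr_gt0// -expRN ler_expR.
  have : 0 <= ln (1 + x ^+ 2) by rewrite ln_ge0// lerDl sqr_ge0.
  by nra.
- by move=> x; rewrite invr_ge0 ltW// onepsqr_gt0.
move=> x; rewrite ler_norml; apply/andP; split; rewrite ltW//.
  exact: atan_gtNpi2.
exact: atan_ltpi2.
Qed.

Lemma integrable_mA t : 1 < t -> mu.-integrable setT (EFin \o mA t).
Proof.
move=> t1; apply/integrableP; split.
  by apply/measurable_EFinP; apply: continuous_measurable_fun; exact: mA_continuous.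
under eq_integral => x _ do rewrite /= ger0_norm ?expR_ge0//.
exact: mA_fin.
Qed.

Lemma integrable_mB t : 1 <= t -> mu.-integrable setT (EFin \o mB t).
Proof.
move=> t1; apply/integrableP; split.
  by apply/measurable_EFinP; apply: continuous_measurable_fun; exact: mB_continuous.
under eq_integral => x _ do rewrite /= ger0_norm ?expR_ge0//.
exact: mB_fin.
Qed.

End KernelMass.

HB.lock Definition massA (R : realType) (t : R) : R := \int[@lebesgue_measure R]_x mA t x.
HB.lock Definition massB (R : realType) (t : R) : R := \int[@lebesgue_measure R]_x mB t x.
Arguments massA {R} t.
Arguments massB {R} t.

(* The closed form of the integral of |Dk t p e|^2 in e. *)
HB.lock Definition mass (R : realType) (t : R) : R := expR (t * ln 4) * massA t * massB t.
Arguments mass {R} t.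

Section KernelMassTheory.
Context {R : realType}.
Local Notation mu := (@lebesgue_measure R).
Local Notation mu2 := (@lebesgue_measure R \x @lebesgue_measure R)%E.
Implicit Types (t x : R).

Lemma cvg_expn_bound (u : nat -> R) (c : R) : 0 < c ->
  (forall n, `|u n| <= expR (- c * n%:R)) -> u n @[n --> \oo] --> (0 : R).
Proof.
move=> c0 uc; apply/norm_cvg0P.
apply: (@squeeze_cvgr _ _ _ _ (fun=> 0) (fun n => expR (- c) ^+ n)).
- by apply: nearW => n; rewrite normr_ge0/= (le_trans (uc n))// expRM_natr.
- exact: cvg_cst.
apply: cvg_expr; rewrite ger0_norm ?expR_ge0// -expR0 ltr_expR; lra.
Qed.

(** G is a total derivative's primitive that vanishes at both ends; the coefficient b = (t - 1) / t
    is chosen so that its derivative is a combination of [mA t] and [mA (t + 1)] alone. *)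
Lemma massA_rec t : 1 < t -> 2 * (2 * t - 1) * massA (t + 1) = (t - 1) * massA t.
Proof.
move=> t1; have t11 : 1 < t + 1 by lra.
pose b := (t - 1) / t.
pose G x := expR ((t - 1) * x - 2 * t * lexp x) * (1 - b * expR x).
pose g x := (t - 1) * mA t x - 2 * (2 * t - 1) * mA (t + 1) x.
have dG x : is_derive x 1 G (g x).
  have := derivM (deriv_exp (derivB (derivZ (t - 1) (deriv_id x)) (derivZ (2 * t) (deriv_lexp x))))
     (derivB (deriv_cst x 1) (derivZ b (is_derive_expR x))).
  move/deriv_eq; apply; rewrite /g /mA.
  have -> : (t - 1) * x - (2 * t - 1) * lexp x = (t - 1) * x - 2 * t * lexp x + lexp x by ring.
  have -> : (t + 1 - 1) * x - (2 * (t + 1) - 1) * lexp x =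
     (t - 1) * x - 2 * t * lexp x + (x - lexp x) by ring.
  set e := (t - 1) * x - 2 * t * lexp x.
  rewrite !expRD !expRN expR_lexp /b.
  have h := lt0r_neq0 (onepexp_gt0 x); have h1 : t != 0 by rewrite lt0r_neq0//; lra.
  by field; rewrite ?h ?h1 ?lt0r_neq0 ?expR_gt0.
have cg : continuous g.
  move=> x; apply: cvgB; apply: cvgM; [exact: cvg_cst|exact: mA_continuous|exact: cvg_cst|exact: mA_continuous].
have GA x : `|G x| <= mA t x.
  have -> : mA t x = expR ((t - 1) * x - 2 * t * lexp x) * (1 + expR x).
    by rewrite -expR_lexp -expRD; congr expR; ring.
  rewrite normrM (ger0_norm (expR_ge0 _)) ler_wpM2l ?expR_ge0//.
  have b0 : 0 <= b by rewrite divr_ge0//; lra.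
  have b1 : b <= 1 by rewrite ler_pdivrMr; lra.
  by have := expR_gt0 x; rewrite ler_norml; nra.
have := FTC_line0 dG cg _ _ _.
have i1 := integrable_mA t1; have i2 := integrable_mA t11.
have iZ (c : R) h : mu.-integrable setT (EFin \o h) -> mu.-integrable setT (EFin \o (fun x => c * h x)).
  move=> ih; have := integrableZl measurableT c ih; apply: eq_integrable => // x _.
have -> : \int[mu]_x g x = (t - 1) * massA t - 2 * (2 * t - 1) * massA (t + 1).
  rewrite /g RintegralB//; [|exact: iZ|exact: iZ].
  by rewrite !RintegralZl// massA.unlock.
move=> H; apply/esym/eqP; rewrite -subr_eq0; apply/eqP; apply: H.
- have := integrableB measurableT (iZ (t - 1) _ i1) (iZ (2 * (2 * t - 1)) _ i2).
  by apply: eq_integrable.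
- apply: (@cvg_expn_bound _ (t - 1)); first by lra.
  move=> n; rewrite (le_trans (GA _))// ler_expR.
  have := lexp_ge (n%:R : R); have n0 := ler0n R n; nra.
- apply: (@cvg_expn_bound _ (t - 1)); first by lra.
  move=> n; rewrite (le_trans (GA _))// ler_expR.
  have := lexp_ge0 (- n%:R : R); have n0 := ler0n R n; nra.
Qed.

(** The derivative of x (1 + x^2)^(-t) is 2 t (1 + x^2)^(- t - 1) - (2 t - 1) (1 + x^2)^(-t), and
    its integral vanishes. *)
Lemma massB_rec t : 1 < t -> 2 * t * massB (t + 1) = (2 * t - 1) * massB t.
Proof.
move=> t1; have t11 : 1 <= t + 1 by lra.
pose G x := x * mB t x.
pose g x := 2 * t * mB (t + 1) x - (2 * t - 1) * mB t x.
have mBS x : mB (t + 1) x = mB t x / (1 + x ^+ 2).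
  rewrite /mB -[X in _ / X]lnK ?posrE ?onepsqr_gt0// -expRN -expRD; congr expR; ring.
have dG x : is_derive x 1 G (g x).
  have := derivM (deriv_id x) (deriv_exp (derivZ (- t) (deriv_lsq x))).
  move/deriv_eq; apply; rewrite /g mBS -/(mB t x).
  have h := lt0r_neq0 (onepsqr_gt0 x).
  by field.
have cg : continuous g.
  move=> x; apply: cvgB; apply: cvgM; [exact: cvg_cst|exact: mB_continuous|exact: cvg_cst|exact: mB_continuous].
have GB x : `|G x| <= `|x| / (1 + x ^+ 2).
  rewrite normrM (ger0_norm (expR_ge0 _)) ler_wpM2l//.
  rewrite -[X in _ <= X^-1]lnK ?posrE ?onepsqr_gt0// -expRN ler_expR.
  have : 0 <= ln (1 + x ^+ 2) by rewrite ln_ge0// lerDl sqr_ge0.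
  by nra.
have lim (u : nat -> R) : (forall n, `|u n| <= n%:R / (1 + n%:R ^+ 2)) -> u n @[n --> \oo] --> (0 : R).
  move=> hu; apply/norm_cvg0P.
  apply: (@squeeze_cvgr _ _ _ _ (fun=> 0) (fun n => 2 * n.+1%:R^-1)).
  - apply: nearW => n; rewrite normr_ge0/= (le_trans (hu n))//.
    rewrite ler_pdivrMr ?onepsqr_gt0// mulrAC ler_pdivlMr// -natr1; have := ler0n R n; nra.
  - exact: cvg_cst.
  rewrite -[X in _ --> X](mulr0 (2 : R)); apply: cvgM; [exact: cvg_cst|exact: cvg_harmonic].
have := FTC_line0 dG cg _ _ _.
have i1 := integrable_mB (ltW t1); have i2 := integrable_mB t11.
have iZ (c : R) h : mu.-integrable setT (EFin \o h) -> mu.-integrable setT (EFin \o (fun x => c * h x)).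
  move=> ih; have := integrableZl measurableT c ih; apply: eq_integrable => // x _.
have -> : \int[mu]_x g x = 2 * t * massB (t + 1) - (2 * t - 1) * massB t.
  rewrite /g RintegralB//; [|exact: iZ|exact: iZ].
  by rewrite !RintegralZl// massB.unlock.
move=> H; apply/eqP; rewrite -subr_eq0; apply/eqP; apply: H.
- have := integrableB measurableT (iZ (2 * t) _ i2) (iZ (2 * t - 1) _ i1).
  by apply: eq_integrable.
- by apply: lim => n; rewrite (le_trans (GB _))// ger0_norm.
- by apply: lim => n; rewrite (le_trans (GB _))// normrN ger0_norm// sqrrN.
Qed.

Lemma int_pos (h : R -> R) (c : R) : continuous h -> (forall x, 0 <= h x) ->
  mu.-integrable setT (EFin \o h) -> 0 < c -> (forall x, 0 <= x <= 1 -> c <= h x) ->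
  0 < \int[mu]_x h x.
Proof.
move=> ch h0 ih c0 hc; apply: (lt_le_trans c0).
have -> : c = \int[mu]_(x in `[0, 1]) c by rewrite Rintegral_cst_itv// subr0 mulr1.
have ih' : mu.-integrable `[0, 1] (EFin \o h) by apply: integrableS ih => //; exact: measurable_itv.
apply: (@le_trans _ _ (\int[mu]_(x in `[0, 1]) h x)).
  apply: le_Rintegral => //.
    apply: continuous_compact_integrable; first exact: segment_compact.
    by apply: continuous_in_subspaceT => x _; exact: cvg_cst.
rewrite /Rintegral fine_le//.
- exact: integrable_fin_num.
- exact: integrable_fin_num.
apply: ge0_subset_integral => //; first by have /measurable_int := ih.
by move=> x _; rewrite lee_fin.
Qed.

Lemma massA_gt0 t : 1 < t -> 0 < massA t.
Proof.
move=> t1; rewrite massA.unlock; apply: (@int_pos _ (expR (- (2 * t - 1) * 2))).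
- exact: mA_continuous.
- by move=> x; exact: expR_ge0.
- exact: integrable_mA.
- exact: expR_gt0.
move=> x /andP[x0 x1]; rewrite ler_expR.
have : lexp x <= 2.
  rewrite -ler_expR expR_lexp.
  have h : 1 + 1 <= expR 1 :> R by exact: expR_ge1Dx.
  have h1 : expR x <= expR 1 :> R by rewrite ler_expR.
  by rewrite (_ : 2 = 1 + 1 :> R) ?expRD//; nra.
by nra.
Qed.

Lemma massB_gt0 t : 1 < t -> 0 < massB t.
Proof.
move=> t1; rewrite massB.unlock; apply: (@int_pos _ (expR (- t))).
- exact: mB_continuous.
- by move=> x; exact: expR_ge0.
- by apply: integrable_mB; exact: ltW.
- exact: expR_gt0.
move=> x /andP[x0 x1]; rewrite ler_expR.
have : ln (1 + x ^+ 2) <= 1.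
  rewrite -ler_expR lnK ?posrE ?onepsqr_gt0// (le_trans _ (expR_ge1Dx 1))//.
  by rewrite lerD2l expr_le1.
by nra.
Qed.

Lemma mass_gt0 t : 1 < t -> 0 < mass t.
Proof. by move=> t1; rewrite mass.unlock; apply: mulr_gt0 (massB_gt0 t1); apply: mulr_gt0 (massA_gt0 t1); exact: expR_gt0. Qed.

Lemma mass_rec t : 1 < t -> t * mass (t + 1) = (t - 1) * mass t.
Proof.
move=> t1; have A := massA_rec t1; have B := massB_rec t1.
rewrite mass.unlock mulrDl mul1r expRD lnK ?posrE//.
have h : 2 * (2 * t - 1) != 0 by rewrite mulf_neq0// lt0r_neq0//; lra.
apply: (mulfI h).
transitivity (2 * expR (t * ln 4) * (2 * (2 * t - 1) * massA (t + 1)) * (2 * t * massB (t + 1))); first by ring.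
by rewrite A B; ring.
Qed.

(* dX ((0, 0), p) in the coordinates in which the mass integral factors *)
Lemma dX_mass t (p : R * R) : dX (0, 0) p `^ (2 * t) =
  expR (t * ln 4) * (mA t p.2 * (expR p.2 / (1 + expR p.2)) *
     mB t (expR p.2 / (1 + expR p.2) * p.1)).
Proof.
rewrite {1}/powR gt_eqF ?dX_gt0// ln_dX /= add0r.
set y := expR p.2; set c := y / (1 + y).
have y0 : 0 < 1 + y by exact: onepexp_gt0.
have cE : c = expR (p.2 - lexp p.2) by rewrite expRB expR_lexp.
have q2 : cabs (qz (0, 0) p) ^+ 2 = (1 + y) ^+ 2 * (1 + (c * p.1) ^+ 2) / 4.
  by rewrite qzE sqr_cabs/= expR0 mulr0 sub0r -/y /c; field; rewrite lt0r_neq0.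
have lq : 2 * ln (cabs (qz (0, 0) p)) = 2 * lexp p.2 + ln (1 + (c * p.1) ^+ 2) - ln 4.
  rewrite mulr_natl -lnXn ?cabs_qz_gt0// q2 ln_div ?posrE ?mulr_gt0 ?exprn_gt0 ?onepsqr_gt0//.
  by rewrite lnM ?posrE ?exprn_gt0 ?onepsqr_gt0// lnXn// mulr_natl.
rewrite {1}cE /mA /mB -!expRD; congr expR.
rewrite (_ : 2 * t * _ = t * p.2 - t * (2 * ln (cabs (qz (0, 0) p)))); last by field.
by rewrite lq; ring.
Qed.

Lemma mass_int t : 1 < t -> (\int[mu2]_p (dX (0, 0) p `^ (2 * t))%:E = (mass t)%:E)%E.
Proof.
move=> t1.
have mf : measurable_fun (setT : set (MX R)) (fun p : MX R => (dX (0, 0) p `^ (2 * t))%:E).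
  apply/measurable_EFinP.
  have := measurable_cabs (cmeas_Dk2 (2 * t) ((0, 0) : R * R)).
  by under eq_fun do rewrite cabs_Dk.
rewrite (fubini_tonelli2 (fun p : MX R => (dX (0, 0) p `^ (2 * t))%:E))//; last first.
  by move=> p; rewrite lee_fin powR_ge0.
rewrite /fubini_G.
have iA := mA_fin t1; have iB := mB_fin (ltW t1).
have B0 : (\int[mu]_x (mB t x)%:E)%E = (massB t)%:E.
  rewrite massB.unlock /Rintegral fineK// ge0_fin_numE// integral_ge0// => x _.
  by rewrite lee_fin expR_ge0.
have A0 : (\int[mu]_x (mA t x)%:E)%E = (massA t)%:E.
  rewrite massA.unlock /Rintegral fineK// ge0_fin_numE// integral_ge0// => x _.
  by rewrite lee_fin expR_ge0.
transitivity (\int[mu]_y ((expR (t * ln 4) * massB t)%:E * (mA t y)%:E))%E.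
  apply: eq_integral => y _ /=.
  pose c := expR y / (1 + expR y).
  have c0 : 0 < c by rewrite divr_gt0 ?expR_gt0 ?onepexp_gt0.
  transitivity (\int[mu]_x ((expR (t * ln 4) * mA t y)%:E * (c * mB t (c * x))%:E))%E.
    by apply: eq_integral => x _; rewrite dX_mass/= -EFinM; congr EFin; rewrite -/c; ring.
  rewrite ge0_integralZl//; last 2 first.
  - by move=> x _; rewrite lee_fin mulr_ge0// ?expR_ge0// ltW.
  - by rewrite lee_fin mulr_ge0// expR_ge0.
  - rewrite -(@integral_scale R c (mB t) c0 (@mB_continuous R t) (fun x => expR_ge0 _)) B0.
    by rewrite -!EFinM; congr EFin; ring.
  apply/measurable_EFinP; apply: measurable_funM => //.
  apply: measurableT_comp; first by apply: continuous_measurable_fun; exact: mB_continuous.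
  exact: measurable_funM.
rewrite ge0_integralZl//.
- by rewrite A0 -EFinM mass.unlock; congr EFin; ring.
- by apply/measurable_EFinP; apply: continuous_measurable_fun; exact: mA_continuous.
- by move=> x _; rewrite lee_fin expR_ge0.
- by rewrite lee_fin mulr_ge0 ?expR_ge0// ltW// massB_gt0.
Qed.

Lemma dX_pow_le t t' p p' : t <= t' -> dX p p' `^ t' <= dX p p' `^ t.
Proof.
move=> tt; rewrite /powR gt_eqF ?dX_gt0// ler_expR ler_wnM2r//.
by rewrite -ln1 ler_ln ?posrE ?dX_gt0// dX_le1.
Qed.

Lemma mass_le t t' : 1 < t -> t <= t' -> mass t' <= mass t.
Proof.
move=> t1 tt; have t1' := lt_le_trans t1 tt; rewrite -lee_fin -(mass_int t1) -(mass_int t1').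
have mf (u : R) : measurable_fun (setT : set (MX R)) (fun p : MX R => (dX (0, 0) p `^ (2 * u))%:E).
  apply/measurable_EFinP.
  have := measurable_cabs (cmeas_Dk2 (2 * u) ((0, 0) : R * R)).
  by under eq_fun do rewrite cabs_Dk.
apply: ge0_le_integral => //.
- by move=> p _; rewrite lee_fin powR_ge0.
- by move=> p _; rewrite lee_fin dX_pow_le// ler_wpM2l.
Qed.

(* (t - 1) mass t is 1-periodic by mass_rec, and mass is nonincreasing. *)
Lemma mass_const t t' : 1 < t -> 1 < t' -> (t - 1) * mass t = (t' - 1) * mass t'.
Proof.
pose h (u : R) := (u - 1) * mass u.
have per u (n : nat) : 1 < u -> h (u + n%:R) = h u.
  move=> u1; elim: n => [|n IH]; first by rewrite addr0.
  rewrite -IH -natr1 addrA /h addrK mass_rec//.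
  by rewrite (lt_le_trans u1)// lerDl.
suff le u v : 1 < u -> 1 < v -> h u <= h v.
  by move=> t1 t1'; apply/eqP; rewrite eq_le !le.
suff le2 : forall u v, 1 < u -> u <= v -> h v <= h u.
  (* By periodicity u may be moved above v, where [le2] applies in the other direction. *)
  move=> u1 v1; have [n nP] : exists n : nat, v <= u + n%:R.
    exists (Num.truncn `|v - u|).+1.
    have := truncnS_gt `|v - u|; have := ler_norm (v - u); lra.
  by rewrite -(per u n u1); exact: le2.
move=> {u v} u v u1 uv; apply/ler_addgt0Pr => e e0.
have hu : 0 < h u by rewrite mulr_gt0 ?mass_gt0// subr_gt0.
(* Periodicity and monotonicity give h v <= h u + (v - u) mass(u + n), and mass(u + n) = h u / (u +
   n - 1) with u + n - 1 >= n; this n makes the last term at most e. *)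
pose n := (Num.truncn ((v - u) * h u / e)).+1.
have nP : (v - u) * h u < e * n%:R.
  by rewrite (mulrC e) -ltr_pdivrMr// truncnS_gt.
have n0 := ler0n R n.
have v1 : 1 < v by exact: lt_le_trans uv.
have un1 : 1 < u + n%:R by lra.
have uvn : u + n%:R <= v + n%:R by lra.
have m0 := mass_gt0 un1.
have k0 : 0 < u + n%:R - 1 by lra.
have E : (u + n%:R - 1) * mass (u + n%:R) = h u by exact: per.
rewrite -(per v n v1) {1}/h.
apply: (le_trans (ler_wpM2l _ (mass_le un1 uvn))); first by lra.
rewrite -E; set m := mass _ in m0 E *; set k := u + n%:R - 1 in k0 E *.
suff H : (v - u) * m <= e.
  by rewrite (_ : (v + n%:R - 1) * m = k * m + (v - u) * m) ?lerD2l// /k; ring.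
rewrite -(ler_pM2l k0) mulrCA E; apply: (le_trans (ltW nP)); rewrite mulrC ler_pM2r//.
by rewrite /k; lra.
Qed.

End KernelMassTheory.

(** * Behaviour of the kernels under Moebius and affine maps *)

Section Invariance.
Context {R : realType}.
Local Notation C := R[i].
Local Notation X := (R * R)%type.
Implicit Types (g : 'M[R]_2) (p : X) (t : R).

Lemma cJV (z : C) : (z^-1)^* = (z^*)^-1.
Proof. exact: fmorphV. Qed.

Lemma qker_mobius g z w : \det g = 1 -> uhp z -> uhp w ->
  qker ((mobius g z)^*) (mobius g w) = qker (z^*) w / ((cfac g z)^* * cfac g w).
Proof.
move=> dg zu wu; have jz := cfac_neq0 dg zu; have jw := cfac_neq0 dg wu.
have jz' : (cfac g z)^* != 0 by rewrite conjc_eq0.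
have i2 : (0 -i* 2 : C) != 0.
  by apply/eqP => /(congr1 (@complex.Im R))/= /eqP; rewrite oppr_eq0 (eqr_nat _ 2 0).
have E : (cfac g z)^* = (g 1 0)%:C * z^* + (g 1 1)%:C by rewrite /cfac cJD cJM !cJR.
have -> : (mobius g z)^* = ((g 0 0)%:C * z^* + (g 0 1)%:C) / (cfac g z)^*.
  by rewrite /mobius -/(cfac g z) cJM cJV cJD cJM !cJR.
rewrite /qker /mobius -/(cfac g w); rewrite E in jz' *; rewrite /cfac in jw *.
set a := (g 0 0)%:C; set b := (g 0 1)%:C; set c := (g 1 0)%:C in jz' jw *; set d := (g 1 1)%:C in jz' jw *.
have D : a * d = 1 + b * c.
  have : g 0 0 * g 1 1 = 1 + g 0 1 * g 1 0 by rewrite -dg det2E; ring.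
  by move=> /(congr1 (fun x : R => x%:C)); rewrite rmorphD !rmorphM.
transitivity ((a * d - b * c) * (z^* - w) / ((c * z^* + d) * (c * w + d) * (0 -i* 2))).
  by field; rewrite jw jz' i2.
by rewrite D addrK mul1r; field; rewrite jw jz' i2.
Qed.

Lemma Im_mobius g z : \det g = 1 -> uhp z ->
  complex.Im (mobius g z) = complex.Im z / cabs (cfac g z) ^+ 2.
Proof.
move=> dg zu; have := qker_mobius dg zu zu; rewrite !qkerE.
have -> : ((cfac g z)^* * cfac g z)^-1 = ((cabs (cfac g z) ^+ 2)^-1)%:C.
  by rewrite mulrC mulcJ fmorphV.
move=> /(congr1 (@complex.Re R)); rewrite cReMr/=.
by move: (complex.Im (mobius g z)) (complex.Im z) => a b; set k := (cabs _ ^+ 2)^-1; lra.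
Qed.

Lemma mob_snd g p : \det g = 1 -> (mob g p).2 = p.2 - 2 * ln (cabs (cfac g (hpt p))).
Proof.
move=> dg; have j0 : 0 < cabs (cfac g (hpt p)) by rewrite cabs_gt0 cfac_neq0//; exact: hpt_uhp.
rewrite -[LHS]/(ln (complex.Im (mobius g (hpt p)))) Im_mobius//; last exact: hpt_uhp.
by rewrite ln_div ?posrE ?exprn_gt0 ?expR_gt0// expRK lnXn// mulr_natl.
Qed.

Lemma qz_mob g p p' : \det g = 1 ->
  qz (mob g p) (mob g p') = qz p p' / ((cfac g (hpt p))^* * cfac g (hpt p')).
Proof. by move=> dg; rewrite !qz.unlock !hpt_mob// qker_mobius//; exact: hpt_uhp. Qed.

(* the unimodular part of (c z + d)^t *)
Definition eps g t p : C := cexp (0 +i* (t * carg (cfac g (hpt p)))).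

Lemma cabs_eps g t p : cabs (eps g t p) = 1.
Proof. by rewrite /eps cabs_cexp expR0. Qed.

Lemma epsJ g t p : (eps g t p)^* * eps g t p = 1.
Proof. by rewrite mulrC mulcJ cabs_eps expr1n. Qed.

(** The imaginary part of c z + d has the sign of c on the whole upper half-plane, so both arguments
    lie in [0, pi] or both in [- pi, 0]; if c = 0 they coincide. *)
Lemma carg_cfac_dist g z w : \det g = 1 -> uhp z -> uhp w ->
  `|carg (cfac g w) - carg (cfac g z)| <= pi.
Proof.
move=> dg zu wu.
have I v : complex.Im (cfac g v) = g 1 0 * complex.Im v.
  by rewrite /cfac cImD cImMl/= addr0.
have B v := carg_bound (cfac g v); have Bz := B z; have Bw := B w.
move: Bz Bw => /andP[z1 z2] /andP[w1 w2].
have [c0|c0|c0] := ltgtP (g 1 0) 0.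
- have iz : complex.Im (cfac g z) < 0 by rewrite I nmulr_rlt0.
  have iw : complex.Im (cfac g w) < 0 by rewrite I nmulr_rlt0.
  by have := carg_le0 iz; have := carg_le0 iw; rewrite ler_norml => ? ?; apply/andP; split; lra.
- have iz : 0 <= complex.Im (cfac g z) by rewrite I mulr_ge0// ltW.
  have iw : 0 <= complex.Im (cfac g w) by rewrite I mulr_ge0// ltW.
  by have := carg_ge0 iz; have := carg_ge0 iw; rewrite ler_norml => ? ?; apply/andP; split; lra.
have -> : cfac g w = cfac g z by rewrite /cfac c0 !mul0r.
by rewrite subrr normr0 pi_ge0.
Qed.

(** The argument of q is below pi / 2 and those of the two automorphy factors differ by at most pi,
    so that log q transforms additively by [clog_unique]. Their moduli are absorbed by the change of
    the heights, and only phases remain. *)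
Lemma Dk_mob g t p p' : \det g = 1 ->
  Dk t (mob g p) (mob g p') = (eps g t p)^* * Dk t p p' * eps g t p'.
Proof.
move=> dg; have hp := hpt_uhp p; have hp' := hpt_uhp p'.
have j0 := cfac_neq0 dg hp; have j0' := cfac_neq0 dg hp'.
set j := cfac g (hpt p) in j0 *; set j' := cfac g (hpt p') in j0' *.
have lq : clog (qz (mob g p) (mob g p')) = clog (qz p p') - (clog j)^* - clog j'.
  apply/esym/clog_unique; first exact: Re_qz.
    rewrite !cexpD !cexpN cexpJ !cexp_clog ?qz_neq0// qz_mob// -/j -/j'.
    by rewrite invfM mulrA.
  rewrite !cImD !cImN cImJ opprK.
  have := carg_pi2 (Re_qz p p'); have := carg_cfac_dist dg hp hp'.
  rewrite -/j -/j' !ler_norml ltr_norml => /andP[a1 a2] /andP[b1 b2].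
  by apply/andP; split; rewrite /clog/=; lra.
rewrite !DkE lq /eps -cexpJ -!cexpD !mob_snd// -/j -/j'; congr cexp.
by apply: ceqP; rewrite ?cReD ?cImD ?cReMl ?cImMl ?cReJ ?cImJ ?cReD ?cImD ?cReN ?cImN
  ?cReD ?cImD ?cReN ?cImN ?cReJ ?cImJ/= ?cReJ ?cImJ/=; field.
Qed.

Lemma dX_mob g p p' : \det g = 1 -> dX (mob g p) (mob g p') = dX p p'.
Proof.
move=> dg; have := congr1 cabs (Dk_mob 1 p p' dg).
by rewrite !cabsM cabsJ !cabs_eps mul1r mulr1 !cabs_Dk !powRr1// ltW// dX_gt0.
Qed.

(* The unitary H_t -> L^2(ds dr): the weight (Im z)^(t-2) dx dy becomes ds dr. *)
Definition shp t (f : C -> C) p : C := f (hpt p) * (expR (t / 2 * p.2))%:C.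

(** The factor |c z + d|^(-t) is exactly the change of the weight e^(t r / 2) under g; the phase of
    the automorphy factor is what is left. *)
Lemma shp_slash g t f p : \det g = 1 ->
  shp t (slash t g f) p = (eps g t p)^* * shp t f (mob g p).
Proof.
move=> dg; have hp := hpt_uhp p; have j0 := cfac_neq0 dg hp.
rewrite /shp /slash -/(cfac g (hpt p)) hpt_mob// mob_snd// cpowE// /eps.
have -> : (expR (t / 2 * (p.2 - 2 * ln (cabs (cfac g (hpt p))))))%:C =
  (expR (t / 2 * p.2))%:C * cexp ((- t * ln (cabs (cfac g (hpt p))))%:C).
  rewrite mulrBr expRD rmorphM; congr (_ * _).
  by apply: ceqP; rewrite ?cReCexp ?cImCexp/= ?cos0 ?sin0 ?mulr1 ?mulr0//; congr expR; field.
set E := (expR _)%:C; set w := f _; set v := cexp (- t * _)%:C.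
have -> : cexp ((- t)%:C * clog (cfac g (hpt p))) = (cexp (0 +i* (t * carg (cfac g (hpt p)))))^* * v.
  rewrite -cexpJ -cexpD; congr cexp.
  by apply: ceqP; rewrite ?cReD ?cImD ?cReMl ?cImMl/=; ring.
ring.
Qed.

(** The affine map z |-> e^r z + e^r s for p0 = (s, r). It takes the point (0, 0) to p0 and leaves
    [Dk] invariant without a phase, so that integrals can be recentred at any point. *)
Definition affX (p0 p : X) : X := mtrans (expR p0.2 * p0.1) (mscal p0.2 p).

Lemma hpt_affX p0 p : hpt (affX p0 p) = (expR p0.2)%:C * hpt p + (expR p0.2 * p0.1)%:C.
Proof. by rewrite /affX hpt_mtrans hpt_mscal. Qed.

Lemma affX0 p0 : affX p0 (0, 0) = p0.
Proof.
by rewrite /affX /mtrans /mscal/= !add0r mulrAC -expRD subrr expR0 mul1r -surjective_pairing.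
Qed.

Lemma affX_snd p0 p : (affX p0 p).2 = p.2 + p0.2.
Proof. by []. Qed.

Lemma mpreserving_affX p0 : mpreserving (affX p0 : MX R -> MX R).
Proof. by apply: mpreserving_comp; [exact: mpreserving_mtrans|exact: mpreserving_mscal]. Qed.

Lemma qz_affX p0 p p' : qz (affX p0 p) (affX p0 p') = (expR p0.2)%:C * qz p p'.
Proof.
rewrite !qz.unlock !hpt_affX /qker cJD cJM !cJR.
by rewrite opprD addrACA subrr addr0 -mulrBr -mulrA.
Qed.

Lemma Dk_affX t p0 p p' : Dk t (affX p0 p) (affX p0 p') = Dk t p p'.
Proof.
rewrite !DkE qz_affX; congr (cexp (_ * _)).
have e0 := expR_gt0 p0.2.
have -> : clog ((expR p0.2)%:C * qz p p') = p0.2%:C + clog (qz p p').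
  rewrite /clog cabsM cabs_real ger0_norm ?ltW// lnM ?posrE ?cabs_qz_gt0// expRK.
  rewrite !carg_atan ?Re_qz//; last by rewrite cReMl mulr_gt0// Re_qz.
  rewrite cReMl cImMl -mulf_div divff ?lt0r_neq0// mul1r.
  by apply: ceqP; rewrite ?cReD ?cImD/= ?add0r.
by rewrite !affX_snd; apply: ceqP; rewrite ?cReD ?cImD ?cReN ?cImN ?cReD ?cImD/=; field.
Qed.

Lemma dX_affX p0 p p' : dX (affX p0 p) (affX p0 p') = dX p p'.
Proof.
have := congr1 cabs (Dk_affX 1 p0 p p').
by rewrite !cabs_Dk !powRr1// ltW// dX_gt0.
Qed.

Local Notation mu2 := (@lebesgue_measure R \x @lebesgue_measure R)%E.

Lemma measurable_dXpow r p : measurable_fun (setT : set (MX R)) (fun p' : MX R => dX p p' `^ r).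
Proof.
have := measurable_cabs (cmeas_Dk2 r p).
by under eq_fun do rewrite cabs_Dk.
Qed.

Lemma mass_int_at t p : 1 < t -> (\int[mu2]_p' (dX p p' `^ (2 * t))%:E = (mass t)%:E)%E.
Proof.
move=> t1; rewrite -(mass_int t1); have [_ H] := mpreserving_affX p.
rewrite -(H (fun p' => (dX p p' `^ (2 * t))%:E)).
- by apply: eq_integral => p' _; rewrite -{1}(affX0 p) dX_affX.
- by apply/measurable_EFinP; exact: measurable_dXpow.
- by move=> p'; rewrite lee_fin powR_ge0.
Qed.

End Invariance.

Section PlaneFubini.
Context {R : realType}.
Local Notation C := R[i].
Local Notation mu := (@lebesgue_measure R).
Local Notation mu2 := (@lebesgue_measure R \x @lebesgue_measure R)%E.

Lemma plane_sigma_finite : sigma_finite (setT : set (MX R)) mu2.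
Proof.
have /sigma_finiteP[F [TF ndF Foo]] := @sigma_finiteT _ _ _ mu.
exists (fun n => F n `*` F n); last first.
  move=> n; have [mF iF] := Foo n; split; first exact: measurableX.
  by rewrite product_measure1E// lte_mul_pinfty// ge0_fin_numE.
apply/seteqP; split => // -[x y] _.
have : [set: measurableTypeR R] x by []. have : [set: measurableTypeR R] y by [].
rewrite TF => -[n _ Fn] [m _ Fm]; exists (maxn n m) => //; split => /=.
  by move: x Fm; exact/subsetPset/ndF/leq_maxr.
by move: y Fn; exact/subsetPset/ndF/leq_maxl.
Qed.

(* The library's sigma-finite instance for products is shadowed by the one for
   subprobabilities. *)
Definition plane_measure : set (MX R) -> \bar R := mu2.
HB.instance Definition _ := Measure.on plane_measure.
HB.instance Definition _ := Measure_isSigmaFinite.Build _ _ _ plane_measure plane_sigma_finite.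
Definition leb2 : {sigma_finite_measure set (MX R) -> \bar R} := plane_measure.

Lemma cfubini12 (f : measurableTypeR R -> MX R -> C) : cmeas setT (fun p => f p.1 p.2) ->
  (\int[mu]_x \int[mu2]_y (cabs (f x y))%:E < +oo)%E ->
  cint mu setT (fun x => cint mu2 setT (f x)) =
  cint mu2 setT (fun y => cint mu setT (f ^~ y)).
Proof. exact: (@cfubini _ _ _ _ R mu leb2 f). Qed.

Lemma cfubini22 (f : MX R -> MX R -> C) : cmeas setT (fun p => f p.1 p.2) ->
  (\int[mu2]_x \int[mu2]_y (cabs (f x y))%:E < +oo)%E ->
  cint mu2 setT (fun x => cint mu2 setT (f x)) =
  cint mu2 setT (fun y => cint mu2 setT (f ^~ y)).
Proof. exact: (@cfubini _ _ _ _ R leb2 leb2 f). Qed.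

Lemma tonelli_cabs22 (f : MX R -> MX R -> C) : cmeas setT (fun p => f p.1 p.2) ->
  (\int[mu2]_x \int[mu2]_y (cabs (f x y))%:E = \int[mu2]_y \int[mu2]_x (cabs (f x y))%:E)%E.
Proof. exact: (@tonelli_cabs _ _ _ _ R leb2 leb2 f). Qed.

Lemma cmeas_cint22 (f : MX R -> MX R -> C) : cmeas setT (fun p => f p.1 p.2) ->
  cmeas setT (fun x => cint mu2 setT (f x)).
Proof. exact: (@cmeas_cint1 _ _ _ _ R leb2 f). Qed.

Lemma cintg_cint22 (f : MX R -> MX R -> C) : cmeas setT (fun p => f p.1 p.2) ->
  (\int[mu2]_x \int[mu2]_y (cabs (f x y))%:E < +oo)%E ->
  cintg mu2 setT (fun x => cint mu2 setT (f x)).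
Proof. exact: (@cintg_cint1 _ _ _ _ R leb2 leb2 f). Qed.

End PlaneFubini.

(** * The reproducing property *)

Section SquareIntegrable.
Context {R : realType}.
Local Notation C := R[i].
Local Notation X := (R * R)%type.
Local Notation mu2 := (@lebesgue_measure R \x @lebesgue_measure R)%E.
Implicit Types (F G : MX R -> C) (p : X) (t : R).

Definition cl2 F := cmeas (setT : set (MX R)) F /\
  (\int[mu2]_p (cabs (F p) ^+ 2)%:E < +oo)%E.

Lemma measurable_cabs2 F : cmeas setT F -> measurable_fun setT (fun p : MX R => (cabs (F p) ^+ 2)%:E).
Proof.
move=> mF; apply/measurable_EFinP; apply: measurable_funM; exact: measurable_cabs.
Qed.

Lemma cl2M F G : cl2 F -> cl2 G -> cintg mu2 setT (fun p => F p * G p).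
Proof.
move=> [mF iF] [mG iG]; apply: (@cintg_le _ _ _ mu2 setT measurableT _ (fun p => cabs (F p) ^+ 2 + cabs (G p) ^+ 2)).
- exact: cmeasM.
- by apply: measurable_funD; apply/measurable_EFinP; exact: measurable_cabs2.
- move=> p _; rewrite cabsM; have := cabs_ge0 (F p); have := cabs_ge0 (G p).
  by have := sqr_ge0 (cabs (F p) - cabs (G p)); nra.
under eq_integral do rewrite EFinD.
rewrite ge0_integralD//; [exact: lte_add_pinfty|..].
- by move=> p _; rewrite lee_fin sqr_ge0.
- exact: measurable_cabs2.
- by move=> p _; rewrite lee_fin sqr_ge0.
- exact: measurable_cabs2.
Qed.

Lemma cl2J F : cl2 F -> cl2 (fun p => (F p)^*).
Proof.
move=> [mF iF]; split; first exact: cmeasJ.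
by under eq_integral do rewrite cabsJ.
Qed.

Lemma cl2_le F (G : MX R -> R) : cmeas setT F -> measurable_fun setT G ->
  (forall p, cabs (F p) ^+ 2 <= G p) -> (\int[mu2]_p (G p)%:E < +oo)%E -> cl2 F.
Proof.
move=> mF mG FG iG; split => //; apply: le_lt_trans iG; apply: ge0_le_integral => //.
- by move=> p _; rewrite lee_fin sqr_ge0.
- exact: measurable_cabs2.
- exact/measurable_EFinP.
- by move=> p _; rewrite lee_fin.
Qed.

Lemma cl2D F G : cl2 F -> cl2 G -> cl2 (fun p => F p + G p).
Proof.
move=> [mF iF] [mG iG].
have mF2 := measurable_cabs2 mF; have mG2 := measurable_cabs2 mG.
apply: (@cl2_le _ (fun p => 2 * (cabs (F p) ^+ 2 + cabs (G p) ^+ 2))).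
- exact: cmeasD.
- apply: measurable_funM => //; apply: measurable_funD; exact/measurable_EFinP.
- move=> p; have := cabsD (F p) (G p); have := cabs_ge0 (F p + G p).
  by have := sqr_ge0 (cabs (F p) - cabs (G p)); nra.
under eq_integral do rewrite EFinM.
have m2 : measurable_fun setT (fun p : MX R => (cabs (F p) ^+ 2 + cabs (G p) ^+ 2)%:E).
  by apply/measurable_EFinP/measurable_funD; exact/measurable_EFinP.
rewrite ge0_integralZl//; last by move=> p _; rewrite lee_fin addr_ge0// sqr_ge0.
under eq_integral do rewrite EFinD.
rewrite ge0_integralD//; [|by move=> p _; rewrite lee_fin sqr_ge0..].
by rewrite lte_mul_pinfty// lte_add_pinfty.
Qed.

Lemma cl2Z (c : C) F : cl2 F -> cl2 (fun p => c * F p).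
Proof.
move=> [mF iF]; split; first by apply: cmeasM => //; exact: cmeas_cst.
under eq_integral do rewrite cabsM exprMn EFinM.
rewrite ge0_integralZl//; [|exact: measurable_cabs2|by move=> p _; rewrite lee_fin sqr_ge0|by rewrite lee_fin sqr_ge0].
by rewrite lte_mul_pinfty// lee_fin sqr_ge0.
Qed.

Lemma cl20 : cl2 (fun=> 0).
Proof.
split; first exact: cmeas_cst.
by under eq_integral do rewrite cabs0 expr0n; rewrite integral0 ltry.
Qed.

Lemma sqr_cabs_Dk t p p' : cabs (Dk t p p') ^+ 2 = dX p p' `^ (2 * t).
Proof. by rewrite cabs_Dk -powR_mulrn ?powR_ge0// -powRrM mulrC. Qed.

Lemma cl2_Dk t p : 1 < t -> cl2 (Dk t p).
Proof.
move=> t1; split; first exact: cmeas_Dk2.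
under eq_integral do rewrite sqr_cabs_Dk.
by rewrite (mass_int_at p t1) ltry.
Qed.

Lemma cl2_Dk' t p : 1 < t -> cl2 (Dk t ^~ p).
Proof.
move=> t1; rewrite (_ : Dk t ^~ p = fun p' => (Dk t p p')^*); first exact: cl2J (cl2_Dk p t1).
by apply/funext => p'; rewrite DkJ.
Qed.

Lemma mpreserving_cl2 phi F : mpreserving phi -> cl2 F -> cl2 (F \o phi).
Proof.
move=> [mphi h] [mF iF]; split; first exact: cmeas_comp.
rewrite (h (fun p => (cabs (F p) ^+ 2)%:E))//; first exact: measurable_cabs2.
by move=> p; rewrite lee_fin sqr_ge0.
Qed.

End SquareIntegrable.

Section Reproducing.
Context {R : realType}.
Local Notation C := R[i].
Local Notation X := (R * R)%type.
Local Notation mu := (@lebesgue_measure R).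
Local Notation mu2 := (@lebesgue_measure R \x @lebesgue_measure R)%E.
Local Notation I := ('i%C : C).
Implicit Types (p : X) (t : R) (f : C -> C).

Lemma ccvg_shp t f p : (forall z, uhp z -> ccont f z) -> ccvg (nbhs p) (shp t f) (shp t f p).
Proof.
move=> cf; apply: ccvgM.
  apply: (@ccvg_comp _ _ _ _ (@hpt R) f (hpt p)); last by apply: cf; exact: hpt_uhp.
  by apply: ccvg_hpt; exact: cvg_id.
apply: ccvg_real; exact: (@continuous_expR2 R (t / 2) p).
Qed.

Lemma cmeas_shp t f : (forall z, uhp z -> ccont f z) -> cmeas (setT : set (MX R)) (shp t f).
Proof. by move=> cf; apply: ccvg_cmeas => p; exact: ccvg_shp. Qed.

Lemma cint_indic (D : set (measurableTypeR R)) (f : measurableTypeR R -> C) :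
  measurable D ->
  cint mu setT (fun x => (\1_D x)%:C * f x) = cint mu D f.
Proof.
move=> mD; apply: ceqP => /=; rewrite [RHS]Rintegral_mkcond; apply: eq_Rintegral => x _;
  by rewrite ?cReMl ?cImMl patchE indicE; case: (x \in D); rewrite ?mul1r ?mul0r.
Qed.

Lemma cexp_real (x : R) : cexp (x%:C) = (expR x)%:C.
Proof.
by apply: ceqP; rewrite ?cReCexp ?cImCexp/= ?cos0 ?sin0 ?mulr1 ?mulr0.
Qed.

Lemma hpt0 : hpt (0, 0) = I.
Proof. by apply: ceqP; rewrite /= expR0 ?mulr0. Qed.

Lemma mobius_crot_i (x : R) : mobius (crot x) I = I.
Proof.
rewrite mobius_crot; last exact: uhp_i.
by rewrite /cay subrr mul0r mulr0 ckay0.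
Qed.

Lemma mob_crot0 (x : R) : mob (crot x) (0, 0) = (0, 0).
Proof. by rewrite /mob hpt0 mobius_crot_i -hpt0 hptK. Qed.

(** All rotates of phi about i have the same integral against the invariant weight. Averaging over
    the angle under the integral sign replaces phi by its circle means, which are phi(i) by
    [circle_mean]. *)
Lemma rotation_average (phi : C -> C) (w : MX R -> R) : (forall z, uhp z -> chol phi z) ->
  measurable_fun setT w -> (forall (x : R) p, w (mob (crot x) p) = w p) ->
  cintg mu2 setT (fun p => phi (hpt p) * (w p)%:C) ->
  cintg mu2 setT (fun p => (w p)%:C) ->
  cint mu2 setT (fun p => phi (hpt p) * (w p)%:C) = phi I * cint mu2 setT (fun p => (w p)%:C).
Proof.
move=> hphi mw winv iH iw.
set H := fun p => phi (hpt p) * (w p)%:C; set J := cint mu2 setT H.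
pose D := `[0, 2 * pi]%classic : set (measurableTypeR R).
have mD : measurable D by exact: measurable_itv.
(* The indicator of one full turn makes the angular integral one over the line, as Fubini's theorem
   requires; [crot (x / 2)] rotates the disk by x. *)
pose Phi (x : measurableTypeR R) (p : MX R) : C :=
  (\1_D x)%:C * (phi (mobius (crot (x / 2)) (hpt p)) * (w p)%:C).
have rot x : cintg mu2 setT (fun p => phi (mobius (crot x) (hpt p)) * (w p)%:C) /\
    cint mu2 setT (fun p => phi (mobius (crot x) (hpt p)) * (w p)%:C) = J.
  have [h1 h2] := mpreserving_cint (mpreserving_mob (det_crot x)) iH.
  have E : H \o mob (crot x) = (fun p => phi (mobius (crot x) (hpt p)) * (w p)%:C).
    by apply/funext => p; rewrite /H/= winv hpt_mob// det_crot.
  by rewrite -E.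
have mPhi : cmeas setT (fun u : measurableTypeR R * MX R => Phi u.1 u.2).
  apply: cmeasM.
    by apply: cmeas_real; apply: (measurableT_comp (measurable_indic mD)); exact: measurable_fst.
  apply: cmeasM; last first.
    by apply: cmeas_real; apply: (measurableT_comp mw); exact: measurable_snd.
  (* The angle is padded to a point of the plane, so that joint measurability follows from joint
     continuity on pairs of plane points. *)
  pose k (v : X) (p : X) : C := phi (mobius (crot (v.1 / 2)) (hpt p)).
  have mk : cmeas (setT : set (MX R * MX R)) (fun u => k u.1 u.2).
    apply: ccvg_cmeas2 => v p; rewrite /k.
    have hv : (fun u : X * X => u.1.1 / 2) @ (v, p) --> v.1 / 2.
      apply: cvgM; last exact: cvg_cst.
      apply: (@cvg_comp _ _ _ (fun u : X * X => u.1) fst _ (nbhs v)); [exact: cvg_fst|exact: cvg_fst].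
    have cc : ccvg (nbhs (v, p)) (fun u : X * X => (cos (u.1.1 / 2))%:C) ((cos (v.1 / 2))%:C).
      by apply: ccvg_real; apply: (@continuous_cvg _ _ _ _ _ _ (@cos R)) => //; exact: continuous_cos.
    have cs : ccvg (nbhs (v, p)) (fun u : X * X => (sin (u.1.1 / 2))%:C) ((sin (v.1 / 2))%:C).
      by apply: ccvg_real; apply: (@continuous_cvg _ _ _ _ _ _ (@sin R)) => //; exact: continuous_sin.
    have ch : ccvg (nbhs (v, p)) (fun u : X * X => hpt u.2) (hpt p).
      by apply: ccvg_hpt; exact: cvg_snd.
    apply: (@ccvg_comp _ _ _ _ (fun u : X * X => mobius (crot (u.1.1 / 2)) (hpt u.2)) phi
        (mobius (crot (v.1 / 2)) (hpt p))); last first.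
      by apply/chol_ccont/hphi/mobius_uhp; [exact: det_crot|exact: hpt_uhp].
    have mE (x : R) z : mobius (crot x) z =
        ((cos x)%:C * z + (sin x)%:C) / (- (sin x)%:C * z + (cos x)%:C).
      by rewrite /mobius !mxE/= rmorphN.
    under [X in ccvg _ X]eq_fun do rewrite mE; rewrite mE.
    apply: ccvgM; first by apply: ccvgD => //; exact: ccvgM.
    apply: ccvgV; first by apply: ccvgD => //; apply: ccvgM => //; exact: ccvgN.
    have := cfac_neq0 (det_crot (v.1 / 2)) (hpt_uhp p).
    by rewrite /cfac !mxE/= rmorphN.
  pose h (u : measurableTypeR R * MX R) : MX R * MX R := ((u.1, 0), u.2).
  have mh : measurable_fun setT h.
    apply: measurable_fun_pair; last exact: measurable_snd.
    by apply: measurable_fun_pair; [exact: measurable_fst|exact: measurable_cst].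
  exact: (cmeas_comp (h := h) mh mk).
have iPhi : (\int[mu]_x \int[mu2]_p (cabs (Phi x p))%:E < +oo)%E.
  pose K := (\int[mu2]_p (cabs (H p))%:E)%E.
  have K0 : (0 <= K)%E by apply: integral_ge0 => p _; rewrite lee_fin cabs_ge0.
  have KE x : (\int[mu2]_p (cabs (Phi x p))%:E = (\1_D x)%:E * K)%E.
    rewrite /Phi; under eq_integral do rewrite cabsM EFinM.
    rewrite ge0_integralZl//.
    - rewrite cabs_real ger0_norm; last by rewrite indicE; case: (_ \in _).
      congr (_ * _)%E; have [_ hm] := mpreserving_mob (det_crot (x / 2)).
      rewrite /K -(hm (fun p => (cabs (H p))%:E)).
      + by apply: eq_integral => p _; rewrite /H winv hpt_mob// det_crot.
      + by apply: measurable_ecabs; case: iH.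
      + by move=> p; rewrite lee_fin cabs_ge0.
    - by apply: measurable_ecabs; have [[]] := rot (x / 2).
    - by move=> p _; rewrite lee_fin cabs_ge0.
    - by rewrite lee_fin cabs_ge0.
  under eq_integral do rewrite KE.
  have [_ Kfin] := iH.
  rewrite ge0_integralZr//.
  - have -> : (\int[mu]_x (\1_D x)%:E)%E = (2 * pi)%:E.
      rewrite integral_indic// setIT -[RHS]/((2 * pi)%:E) -[2 * pi in RHS]subr0.
      by apply: lebesgue_itvcc; rewrite mulr_ge0// pi_ge0.
    by rewrite lte_mul_pinfty// lee_fin mulr_ge0// pi_ge0.
  - by apply/measurable_EFinP; exact: measurable_indic.
have := cfubini12 mPhi iPhi.
have -> : cint mu setT (fun x => cint mu2 setT (Phi x)) = (2 * pi)%:C * J.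
  have E x : cint mu2 setT (Phi x) = (\1_D x)%:C * J.
    by rewrite /Phi; have [h1 h2] := rot (x / 2); rewrite cintZ// h2.
  rewrite (@eq_cint _ _ _ mu _ _ (fun x => (\1_D x)%:C * J)); last by move=> x _; exact: E.
  by rewrite cint_indic// /D cint_cst_itv ?mulr_ge0 ?pi_ge0// subr0 mulrC.
have -> : cint mu2 setT (fun p => cint mu setT (Phi ^~ p)) =
    (2 * pi)%:C * (phi I * cint mu2 setT (fun p => (w p)%:C)).
  rewrite mulrA -cintZ//; apply: eq_cint => p _.
  rewrite /Phi cint_indic//.
  have [i1 E1] := circle_mean hphi (hpt_uhp p).
  by rewrite (cintZr mD _ i1) E1.
move=> E; apply: (mulfI _ E).
by rewrite fmorph_eq0 lt0r_neq0// mulr_gt0// pi_gt0.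
Qed.

(** Dividing f by the conjugate of the kernel's weight exposes a holomorphic function: f D_t(p, i)
    is phi = f q(i^*, z)^t times |D_t(i, p)|^2, a weight invariant under rotations about i. *)
Lemma reproducing0 t f : 1 < t -> (forall z, uhp z -> chol f z) -> cl2 (shp t f) ->
  cint mu2 setT (fun p => shp t f p * Dk t p (0, 0)) = (mass t)%:C * shp t f (0, 0).
Proof.
move=> t1 hf if2.
pose phi z := f z * cpow (qker (I^*) z) t.
have hphi z : uhp z -> chol phi z.
  by move=> zu; apply: cholM; [exact: hf|apply: cpow_qker_chol => //; exact: uhp_i].
have fE p : shp t f p = phi (hpt p) * Dk t (0, 0) p.
  have qE : qker I^* (hpt p) = qz (0, 0) p by rewrite qz.unlock hpt0.
  rewrite /phi qE DkE add0r cpowE ?qz_neq0// -mulrA -cexpD /shp; congr (_ * _).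
  by rewrite mulrBr addrC subrK -rmorphM cexp_real; congr (expR _)%:C; field.
pose w p := dX (0, 0) p `^ (2 * t).
have HE p : shp t f p * Dk t p (0, 0) = phi (hpt p) * (w p)%:C.
  by rewrite fE -(DkJ t (0, 0) p) -mulrA mulcJ sqr_cabs_Dk.
have iw : cintg mu2 setT (fun p => (w p)%:C).
  have := cl2M (cl2_Dk (0, 0) t1) (cl2_Dk' (0, 0) t1).
  by under [X in cintg _ _ X -> _]eq_fun do rewrite -(DkJ t (0, 0)) mulcJ sqr_cabs_Dk.
have iH : cintg mu2 setT (fun p => phi (hpt p) * (w p)%:C).
  have := cl2M if2 (cl2_Dk' (0, 0) t1).
  by under [X in cintg _ _ X -> _]eq_fun do rewrite HE.
under [X in cint _ _ X = _]eq_fun do rewrite HE.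
rewrite rotation_average//.
- have -> : cint mu2 setT (fun p => (w p)%:C) = (mass t)%:C.
    have E : \int[mu2]_(p in setT) w p = mass t by exact: (congr1 fine (mass_int t1)).
    by rewrite -E; exact: (cint_real mu2 measurableT w).
  by rewrite mulrC fE Dkxx mulr1 hpt0.
- exact: measurable_dXpow.
- by move=> x p; rewrite /w -{1}(mob_crot0 x) dX_mob// det_crot.
Qed.

(** The affine map taking (0, 0) to p' reduces this to [reproducing0]. *)
Theorem reproducing t f p' : 1 < t -> (forall z, uhp z -> chol f z) -> cl2 (shp t f) ->
  cint mu2 setT (fun p => shp t f p * Dk t p p') = (mass t)%:C * shp t f p'.
Proof.
move=> t1 hf if2.
pose a := (expR p'.2)%:C : C; pose b := (expR p'.2 * p'.1)%:C : C.
pose f1 z := (expR (t / 2 * p'.2))%:C * f (a * z + b).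
have hf1 z : uhp z -> chol f1 z.
  move=> zu; apply: cholZ; apply: (@chol_comp _ (fun z => a * z + b) f).
    by apply: cholD; [apply: cholZ; exact: chol_id|exact: chol_cst].
  by apply: hf; rewrite /uhp/= cImD cImMl/= addr0 mulr_gt0// expR_gt0.
have fE p : shp t f1 p = shp t f (affX p' p).
  rewrite /shp hpt_affX affX_snd /f1 -/a -/b mulrDr expRD [in RHS]rmorphM/=; ring.
have := @reproducing0 t f1 t1 hf1; rewrite fE affX0 => <-; last first.
  rewrite (_ : shp t f1 = shp t f \o affX p'); last by apply/funext => p; rewrite fE.
  exact: mpreserving_cl2 (mpreserving_affX p') if2.
have := mpreserving_cint (mpreserving_affX p') (cl2M if2 (cl2_Dk' p' t1)) => -[_ <-].
apply: eq_cint => p _; rewrite fE /=; congr (_ * _).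
by rewrite -{2}(affX0 p') Dk_affX.
Qed.

End Reproducing.

(** * Positivity of the kernel *)

Section GammaKernel.
Context {R : realType}.
Local Notation C := R[i].
Local Notation X := (R * R)%type.
Local Notation mu := (@lebesgue_measure R).
Implicit Types (x y u a d th : R) (p q : X).

(** The Gamma integrand x^d e^(- a x) dx / x after the substitution x = e^u. *)
Definition gE d a u : R := expR (d * u - a * expR u).

(** The inequality log y <= y - 1 at y = (a / n) (1 + e^u) bounds e^(- a e^u) by a constant times (1
    + e^u)^(- n), where n = 2 d + 1 is the exponent in [mA (d + 1)]. *)
Lemma gE_bound d a : 0 < d -> 0 < a -> exists2 K : R, 0 < K & forall u, gE d a u <= K * mA (d + 1) u.
Proof.
move=> d0 a0; pose n := 2 * (d + 1) - 1; have n0 : 0 < n by rewrite /n; lra.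
exists (expR (a - n - n * ln (a / n))); first exact: expR_gt0.
move=> u; rewrite /gE /mA -/n -expRD ler_expR addrK.
have c0 : 0 < a / n by rewrite divr_gt0.
have k0 : 0 < a / n * (1 + expR u) by rewrite mulr_gt0// onepexp_gt0.
have : ln (a / n * (1 + expR u)) <= a / n * (1 + expR u) - 1.
  have h := expR_ge1Dx (a / n * (1 + expR u) - 1).
  rewrite -ler_expR lnK ?posrE//.
  by move: h; rewrite addrC subrK.
rewrite lnM ?posrE ?onepexp_gt0// -/(lexp u) => h.
have := ler_wpM2l (ltW n0) h.
have -> : n * (a / n * (1 + expR u) - 1) = a * (1 + expR u) - n by field; rewrite lt0r_neq0.
lra.
Qed.

Lemma gE_continuous d a : continuous (gE d a).
Proof.
apply: deriv_continuous => u; eexists.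
exact: (deriv_exp (derivB (derivZ d (deriv_id u)) (derivZ a (is_derive_expR u)))).
Qed.

Lemma gE_fin d a : 0 < d -> 0 < a -> (\int[mu]_u (gE d a u)%:E < +oo)%E.
Proof.
move=> d0 a0; have [K K0 hK] := gE_bound d0 a0.
have d1 : 1 < d + 1 by lra.
apply: (@le_lt_trans _ _ (\int[mu]_u (K%:E * (mA (d + 1) u)%:E))%E).
  apply: ge0_le_integral => //.
  - by move=> u _; rewrite lee_fin expR_ge0.
  - by apply/measurable_EFinP; apply: continuous_measurable_fun; exact: gE_continuous.
  - apply/measurable_EFinP; apply: continuous_measurable_fun => u.
    by apply: cvgM; [exact: cvg_cst|exact: mA_continuous].
  - by move=> u _; rewrite lee_fin.
rewrite ge0_integralZl//.
- by rewrite lte_mul_pinfty ?mA_fin// lee_fin ltW.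
- by apply/measurable_EFinP; apply: continuous_measurable_fun; exact: mA_continuous.
- by move=> u _; rewrite lee_fin expR_ge0.
- by rewrite lee_fin ltW.
Qed.

Lemma gE_cvg0 d a : 0 < d -> 0 < a -> gE d a n%:R @[n --> \oo] --> (0 : R).
Proof.
move=> d0 a0; have [K K0 hK] := gE_bound d0 a0.
apply/norm_cvg0P.
apply: (@squeeze_cvgr _ _ _ _ (fun=> 0) (fun n => K * expR (- d) ^+ n)).
- apply: nearW => n; rewrite normr_ge0/= ger0_norm ?expR_ge0// (le_trans (hK _))//.
  rewrite ler_wpM2l ?(ltW K0)// /mA -expRM_natr ler_expR.
  by have := lexp_ge (n%:R : R); have := ler0n R n; nra.
- exact: cvg_cst.
rewrite -[X in _ --> X](mulr0 K); apply: cvgM; first exact: cvg_cst.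
apply: cvg_expr; rewrite ger0_norm ?expR_ge0// -expR0 ltr_expR; lra.
Qed.

(** Holomorphic extension of [gE d 1]; moving the line of integration up by th rotates the ray of
    the Gamma integral by that angle. *)
Definition gF d (z : C) : C := cexp (d%:C * z - cexp z).

Lemma gF_chol d z : chol (gF d) z.
Proof.
apply: (@chol_comp _ (fun z => d%:C * z - cexp z) cexp); last exact: cexp_chol.
by apply: cholB; [apply: cholZ; exact: chol_id|exact: cexp_chol].
Qed.

Lemma cabs_gF d x y : cabs (gF d (x +i* y)) = gE d (cos y) x.
Proof. by rewrite cabs_cexp cReD cReN cReMl cReCexp/= (mulrC (expR x)). Qed.

Lemma cintg_gF d y : 0 < d -> 0 < cos y -> cintg mu setT (fun u => gF d (u +i* y)).
Proof.
move=> d0 y0; split; last by under eq_integral do rewrite cabs_gF; exact: gE_fin.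
by split; apply: continuous_measurable_fun => x; [apply: ccvg_Re|apply: ccvg_Im];
  apply: ccvg_horiz; apply: chol_ccont; exact: gF_chol.
Qed.

Lemma cint_sym_cvg (f : measurableTypeR R -> C) : cintg mu setT f ->
  ccvg \oo (fun n : nat => cint mu `[(- n%:R), n%:R] f) (cint mu setT f).
Proof.
move=> ifm; have [mf ff] := ifm.
have mI (n : nat) : measurable (`[(- n%:R), n%:R]%classic : set (measurableTypeR R)).
  exact: measurable_itv.
have := @cint_dominated _ _ R mu setT measurableT
  (fun n x => (\1_(`[(- n%:R), n%:R]%classic : set (measurableTypeR R)) x)%:C * f x) f (fun x => cabs (f x)).
case=> //.
- by move=> n; apply: cmeasM => //; apply: cmeas_real; exact: measurable_indic.
- move=> x _; have [n nx] : exists n : nat, `|x| <= n%:R.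
    by exists (Num.truncn `|x|).+1; rewrite ltW// truncnS_gt.
  apply: (@ccvg_near _ _ _ _ (fun=> f x)); last exact: ccvg_cst.
  exists n => // m /= nm; rewrite indicE mem_set ?mul1r//= in_itv/= -ler_norml.
  by rewrite (le_trans nx)// ler_nat.
- exact: measurable_cabs.
- move=> n x _; rewrite cabsM cabs_real ler_piMl ?cabs_ge0//.
  by rewrite indicE; case: (_ \in _); rewrite ?normr1 ?normr0.
move=> _; rewrite (_ : (fun n => cint _ setT _) = fun n : nat => cint mu `[(- n%:R), n%:R] f)//.
by apply/funext => n; exact: cint_indic.
Qed.

Definition Gam d : R := \int[mu]_u gE d 1 u.

Lemma Gam_gt0 d : 0 < d -> 0 < Gam d.
Proof.
move=> d0; apply: (@int_pos _ _ (expR (- expR 1))).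
- exact: gE_continuous.
- by move=> u; exact: expR_ge0.
- apply/integrableP; split.
    by apply/measurable_EFinP; apply: continuous_measurable_fun; exact: gE_continuous.
  by under eq_integral => u _ do rewrite /= ger0_norm ?expR_ge0//; exact: gE_fin.
- exact: expR_gt0.
move=> u /andP[u0 u1]; rewrite ler_expR mul1r.
have h : expR u <= expR 1 by rewrite ler_expR.
by have := mulr_ge0 (ltW d0) u0; lra.
Qed.

(* The integral does not depend on th: Goursat on the rectangle [-n, n] x [0, th]. *)
Lemma gF_rot0 d th : 0 < d -> 0 <= th < pi / 2 ->
  cint mu setT (fun u => gF d (u +i* th)) = (Gam d)%:C.
Proof.
move=> d0 /andP[t0 t1].
have cth y : 0 <= y <= th -> cos th <= cos y.
  move=> /andP[y0 y1]; have := pi_gt0 R => p0.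
  move: y1; rewrite le_eqVlt => /orP[/eqP->//|y1].
  by apply: ltW; rewrite ltr_cos// in_itv/=; apply/andP; split; lra.
have cpos : 0 < cos th by apply: cos_gt0_pihalf; have := pi_gt0 R; lra.
have i0 := cintg_gF d0 (_ : 0 < cos 0); have {}i0 := i0 (eq_ind_r (fun x => 0 < x) ltr01 (@cos0 R)).
have it := cintg_gF d0 cpos.
have G0 : cint mu setT (fun u => gF d (u +i* 0)) = (Gam d)%:C.
  rewrite -(cint_real mu measurableT (gE d 1)); apply: eq_cint => u _.
  rewrite /gF -cexp_real; congr cexp; apply: ceqP; rewrite ?cReD ?cReN ?cReMl ?cImD ?cImN ?cImMl.
    by rewrite cReCexp/= cos0 mulr1 mul1r.
  by rewrite cImCexp/= sin0 !mulr0 subrr.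
rewrite -G0.
have mI a b : measurable (`[a, b]%classic : set (measurableTypeR R)) by exact: measurable_itv.
(* By Goursat the difference equals the integrals over the two vertical sides. On the right side the
   decay is uniform because cos y >= cos th, on the left side it comes from e^(- d n). *)
have key n : cabs (cint mu `[(- n%:R), n%:R] (fun u => gF d (u +i* th)) -
    cint mu `[(- n%:R), n%:R] (fun u => gF d (u +i* 0))) <= (gE d (cos th) n%:R + expR (- d) ^+ n) * th.
  have nn : - n%:R <= n%:R :> R by have := ler0n R n; lra.
  have := goursat nn t0 (fun z _ => gF_chol d z).
  have H y : cintg mu `[(- n%:R), n%:R] (fun u => gF d (u +i* y)).
    by apply: cintg_seg => u _; apply: ccvg_horiz; apply: chol_ccont; exact: gF_chol.
  have V x : cintg mu `[0, th] (fun u => gF d (x +i* u)).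
    by apply: cintg_seg => u _; apply: ccvg_vert; apply: chol_ccont; exact: gF_chol.
  rewrite /rbnd (cintB (mI _ _) (H th) (H 0)) => /eqP; rewrite subr_eq0 => /eqP <-.
  rewrite cabsM (_ : cabs _ = 1); last by rewrite cabsE/= expr0n expr1n add0r sqrtr1.
  rewrite mul1r.
  have -> : (gE d (cos th) n%:R + expR (- d) ^+ n) * th =
      \int[mu]_(x in `[0, th]) (gE d (cos th) n%:R + expR (- d) ^+ n).
    by rewrite Rintegral_cst_itv// subr0.
  apply: cabs_cint_le => //.
  - exact: cintgB.
  - move=> u; rewrite /= in_itv/= => u1; rewrite (le_trans (cabsB _ _))// !cabs_gF lerD//.
      rewrite ler_expR lerD2l lerN2 ler_wpM2r ?expR_ge0// cth//.
    rewrite -expRM_natr ler_expR mulrN mulNr lerBlDl lerDr mulr_ge0 ?expR_ge0//.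
    by rewrite (le_trans (ltW cpos))// cth.
  by rewrite integral_cst//= lebesgue_itvcc// -EFinM ltry.
have L : ccvg \oo (fun n : nat => cint mu `[(- n%:R), n%:R] (fun u => gF d (u +i* th)) -
    cint mu `[(- n%:R), n%:R] (fun u => gF d (u +i* 0))) (cint mu setT (fun u => gF d (u +i* th)) -
    cint mu setT (fun u => gF d (u +i* 0))).
  by apply: ccvgB; exact: cint_sym_cvg.
apply/eqP; rewrite -subr_eq0 -cabs_eq0 eq_le cabs_ge0 andbT.
have B : (gE d (cos th) n%:R + expR (- d) ^+ n) * th @[n --> \oo] --> (0 : R).
  rewrite -[X in _ --> X](mul0r th) -[X in X * th](addr0 (0 : R)); apply: cvgM; last exact: cvg_cst.
  apply: cvgD; first exact: gE_cvg0.
  apply: cvg_expr; rewrite ger0_norm ?expR_ge0// -expR0 ltr_expR; lra.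
by apply: (ler_cvg_to (ccvg_cabs L) B); exact: nearW.
Qed.

Lemma gF_rot d th : 0 < d -> `|th| < pi / 2 ->
  cint mu setT (fun u => gF d (u +i* th)) = (Gam d)%:C.
Proof.
move=> d0; have [t0|t0] := leP 0 th.
  by rewrite ger0_norm// => t1; apply: gF_rot0; rewrite ?t0.
rewrite ltr0_norm// => t1.
have E := @gF_rot0 d (- th) d0; rewrite t1 oppr_ge0 (ltW t0) in E.
rewrite -[RHS](cJR (Gam d)) -(E isT) -cintJ//.
  apply: eq_cint => u _; rewrite /gF -cexpJ cJB cJM cJR -cexpJ.
  by have -> : (u +i* - th)^* = u +i* th by apply: ceqP; rewrite ?cReJ ?cImJ/= ?opprK.
by apply: cintg_gF => //; apply: cos_gt0_pihalf; lra.
Qed.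

Lemma Rintegral_shift (c : R) (h : measurableTypeR R -> R) : mu.-integrable setT (EFin \o h) ->
  \int[mu]_x h (x + c) = \int[mu]_x h x.
Proof.
move=> jf; have mf := measurable_int _ jf.
rewrite /Rintegral; congr fine.
rewrite [LHS]integralE [RHS]integralE; congr (_ - _)%E.
  rewrite -(lebesgue_shift c (F := ((EFin \o h)^\+)%E))//; last exact: measurable_funepos.
  by apply: eq_integral => x _; rewrite !funeposE.
rewrite -(lebesgue_shift c (F := ((EFin \o h)^\-)%E))//; last exact: measurable_funeneg.
by apply: eq_integral => x _; rewrite !funenegE.
Qed.

Lemma cint_shift (c : R) (f : measurableTypeR R -> C) : cintg mu setT f ->
  cint mu setT (fun x => f (x + c)) = cint mu setT f.
Proof.
move=> ih; apply: ceqP => /=.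
  exact: (Rintegral_shift c (cintg_Re measurableT ih)).
exact: (Rintegral_shift c (cintg_Im measurableT ih)).
Qed.

(* int (phiG d u p)^* (phiG d u q) du = Gamma(d) D_d(p, q). *)
Definition phiG d u p : C := cexp ((d * (u + p.2) / 2)%:C + (0 +i* (expR u / 2)) * hpt p).

Lemma phiGJM d u p q : (phiG d u p)^* * phiG d u q =
  Dk d p q * gF d (u%:C + clog (qz p q)).
Proof.
rewrite /phiG /gF DkE -cexpJ -!cexpD; congr cexp.
rewrite cexpD cexp_clog ?qz_neq0// cexp_real qzE cJD cJM cJR.
have -> : (d * (u + p.2) / 2)%:C + (0 +i* (expR u / 2))^* * (hpt p)^* +
  ((d * (u + q.2) / 2)%:C + (0 +i* (expR u / 2)) * hpt q) =
  d%:C * (u%:C + ((p.2 + q.2) / 2)%:C) - (expR u)%:C *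
   (((expR p.2 + expR q.2) / 2) +i* ((expR p.2 * p.1 - expR q.2 * q.1) / 2)).
  by apply: ceqP; rewrite !(cReD, cImD, cReN, cImN, cReMl, cImMl, cReM, cImM, cReJ, cImJ)/=; field.
ring.
Qed.

Lemma cabs_phiG d u p : cabs (phiG d u p) ^+ 2 = gE d 1 (u + p.2).
Proof.
rewrite /phiG cabs_cexp -expRM_natr; congr expR.
by rewrite cReD cReM/= expRD; field.
Qed.

(** By [phiGJM] the integrand is D_d(p, q) times the Gamma integrand on the horizontal line of
    height arg q, shifted by log |q|; neither the shift nor the height affects the integral. *)
Lemma int_phiG d p q : 0 < d ->
  cint mu setT (fun u => (phiG d u p)^* * phiG d u q) = (Gam d)%:C * Dk d p q.
Proof.
move=> d0; rewrite (@eq_cint _ _ _ mu _ _ (fun u => Dk d p q * gF d ((u + ln (cabs (qz p q))) +i* carg (qz p q)))); last first.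
  move=> u _; rewrite phiGJM; congr (_ * gF d _).
  by apply: ceqP; rewrite ?cReD ?cImD/= ?add0r.
have ag := carg_pi2 (Re_qz p q).
have ig : cintg mu setT (fun u => gF d (u +i* carg (qz p q))).
  by apply: cintg_gF => //; apply: cos_gt0_pihalf; move: ag; rewrite ltr_norml.
have := cint_shift (ln (cabs (qz p q))) ig; rewrite gF_rot// => E.
rewrite cintZ ?E 1?mulrC//.
have [mg fg] := ig; split.
  apply: (cmeas_comp (h := fun u : measurableTypeR R => u + ln (cabs (qz p q))) _ mg).
  exact: measurable_funD.
rewrite (lebesgue_shift _ (F := fun u => (cabs (gF d (u +i* carg (qz p q))))%:E))//.
- exact: measurable_ecabs.
- by move=> u; rewrite lee_fin cabs_ge0.
Qed.

Lemma int_phiG2 d p : 0 < d -> (\int[mu]_u (cabs (phiG d u p) ^+ 2)%:E = (Gam d)%:E)%E.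
Proof.
move=> d0; under eq_integral do rewrite cabs_phiG.
rewrite (lebesgue_shift _ (F := fun u => (gE d 1 u)%:E))//.
- rewrite /Gam /Rintegral fineK// ge0_fin_numE; first exact: gE_fin.
  by apply: integral_ge0 => u _; rewrite lee_fin expR_ge0.
- by apply/measurable_EFinP; apply: continuous_measurable_fun; exact: gE_continuous.
- by move=> u; rewrite lee_fin expR_ge0.
Qed.

Lemma cmeas_phiG d : cmeas (setT : set (measurableTypeR R * MX R)) (fun v => phiG d v.1 v.2).
Proof.
pose h (v : measurableTypeR R * MX R) : MX R * MX R := ((v.1, 0), v.2).
have mh : measurable_fun setT h.
  apply: measurable_fun_pair; last exact: measurable_snd.
  by apply: measurable_fun_pair; [exact: measurable_fst|exact: measurable_cst].
apply: (cmeas_comp (h := h) (f := fun w : MX R * MX R => phiG d w.1.1 w.2) mh).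
apply: (@ccvg_cmeas2 R (fun w p => phiG d w.1 p)) => w p.
apply: (@ccvg_comp _ _ _ _ (fun u : X * X => (d * (u.1.1 + u.2.2) / 2)%:C + (0 +i* (expR u.1.1 / 2)) * hpt u.2) cexp
  ((d * (w.1 + p.2) / 2)%:C + (0 +i* (expR w.1 / 2)) * hpt p)); last by apply: chol_ccont; exact: cexp_chol.
have c11 : (fun u : X * X => u.1.1) @ (w, p) --> w.1.
  by apply: (@cvg_comp _ _ _ (fun u : X * X => u.1) fst _ (nbhs w)); [exact: cvg_fst|exact: cvg_fst].
have c22 : (fun u : X * X => u.2.2) @ (w, p) --> p.2.
  by apply: (@cvg_comp _ _ _ (fun u : X * X => u.2) snd _ (nbhs p)); [exact: cvg_snd|exact: cvg_snd].
apply: ccvgD; first apply: ccvg_real.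
  apply: cvgM; last exact: cvg_cst.
  by apply: cvgM; [exact: cvg_cst|exact: cvgD].
apply: ccvgM; last by apply: ccvg_hpt; exact: cvg_snd.
apply/ccvg_ReIm; split => /=; first exact: cvg_cst.
apply: cvgM; last exact: cvg_cst.
by apply: (@continuous_cvg _ _ _ _ _ _ (@expR R)) => //; exact: continuous_expR.
Qed.

End GammaKernel.

Section NonnegIntegral.
Context d (T : measurableType d) (R : realType) (m : {measure set T -> \bar R}).
Implicit Types (f g : T -> R).
Local Open Scope ereal_scope.

Lemma eI_ge0 f : (forall x, (0 <= f x)%R) -> 0 <= \int[m]_x (f x)%:E.
Proof. by move=> f0; apply: integral_ge0 => x _; rewrite lee_fin. Qed.

Lemma eI_le f g : measurable_fun setT f -> measurable_fun setT g -> (forall x, (0 <= f x)%R) ->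
  (forall x, (f x <= g x)%R) -> \int[m]_x (f x)%:E <= \int[m]_x (g x)%:E.
Proof.
move=> mf mg f0 fg; apply: ge0_le_integral => //.
- by move=> x _; rewrite lee_fin.
- exact/measurable_EFinP.
- exact/measurable_EFinP.
- by move=> x _; rewrite lee_fin.
Qed.

Lemma eI_Z (c : R) f : (0 <= c)%R -> measurable_fun setT f -> (forall x, (0 <= f x)%R) ->
  \int[m]_x (c * f x)%:E = c%:E * \int[m]_x (f x)%:E.
Proof.
move=> c0 mf f0; rewrite -ge0_integralZl//.
- exact/measurable_EFinP.
- by move=> x _; rewrite lee_fin.
Qed.

Lemma eI_D f g : measurable_fun setT f -> measurable_fun setT g -> (forall x, (0 <= f x)%R) ->
  (forall x, (0 <= g x)%R) ->
  \int[m]_x (f x + g x)%:E = \int[m]_x (f x)%:E + \int[m]_x (g x)%:E.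
Proof.
move=> mf mg f0 g0; rewrite -ge0_integralD//.
- by move=> x _; rewrite lee_fin.
- exact/measurable_EFinP.
- by move=> x _; rewrite lee_fin.
- exact/measurable_EFinP.
Qed.

End NonnegIntegral.

Section ProductMeasurability.
Context d1 d2 (T1 : measurableType d1) (T2 : measurableType d2) (R : realType).
Local Notation C := R[i].

Lemma cmeas_fst (h : T1 -> C) : cmeas setT h -> cmeas (setT : set (T1 * T2)) (fun v => h v.1).
Proof. by move=> mH; apply: (cmeas_comp (h := fst) _ mH); exact: measurable_fst. Qed.

Lemma cmeas_snd (h : T2 -> C) : cmeas setT h -> cmeas (setT : set (T1 * T2)) (fun v => h v.2).
Proof. by move=> mH; apply: (cmeas_comp (h := snd) _ mH); exact: measurable_snd. Qed.

Lemma cmeas_sec1 (f : T1 -> T2 -> C) x : cmeas (setT : set (T1 * T2)) (fun v => f v.1 v.2) ->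
  cmeas setT (f x).
Proof.
move=> mf; apply: (cmeas_comp (h := fun y : T2 => (x, y)) _ mf).
by apply: measurable_fun_pair => //; exact: measurable_cst.
Qed.

Lemma cmeas_sec2 (f : T1 -> T2 -> C) y : cmeas (setT : set (T1 * T2)) (fun v => f v.1 v.2) ->
  cmeas setT (f ^~ y).
Proof.
move=> mf; apply: (cmeas_comp (h := fun x : T1 => (x, y)) _ mf).
by apply: measurable_fun_pair => //; exact: measurable_cst.
Qed.

Lemma cmeas_swap (f : T1 -> T2 -> C) : cmeas (setT : set (T1 * T2)) (fun v => f v.1 v.2) ->
  cmeas (setT : set (T2 * T1)) (fun v => f v.2 v.1).
Proof.
move=> mf; apply: (cmeas_comp (h := fun v : T2 * T1 => (v.2, v.1)) _ mf).
by apply: measurable_fun_pair; [exact: measurable_snd|exact: measurable_fst].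
Qed.

Lemma measurable_eint1 (m2 : {sigma_finite_measure set T2 -> \bar R}) (f : T1 -> T2 -> C) :
  cmeas (setT : set (T1 * T2)) (fun v => f v.1 v.2) ->
  measurable_fun setT (fun x => \int[m2]_y (cabs (f x y))%:E)%E.
Proof.
move=> mf; apply: (@measurable_fun_fubini_tonelli_F _ _ _ _ _ m2 (fun v => (cabs (f v.1 v.2))%:E)).
  exact: measurable_ecabs.
by move=> v; rewrite lee_fin cabs_ge0.
Qed.

End ProductMeasurability.

Section CauchySchwarz.
Context d (T : measurableType d) (R : realType) (m : {measure set T -> \bar R}).
Implicit Types (a b : T -> R).
Local Open Scope ereal_scope.

(** Cauchy-Schwarz for the weight a. Integrating a (l b - 1)^2 / l >= 0 gives 2 I <= l B + A / l for
    every l > 0, and l = A / I is the best choice. In extended reals B may be infinite. *)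
Lemma CS_weight a b (A : R) : measurable_fun setT a -> measurable_fun setT b ->
  (forall x, (0 <= a x)%R) -> (forall x, (0 <= b x)%R) -> (0 < A)%R ->
  \int[m]_x (a x)%:E <= A%:E ->
  (\int[m]_x (a x * b x)%:E) * (\int[m]_x (a x * b x)%:E) <=
    A%:E * \int[m]_x (a x * b x ^+ 2)%:E.
Proof.
move=> ma mb a0 b0 A0 iA.
set I := \int[m]_x (a x * b x)%:E; set B := \int[m]_x (a x * b x ^+ 2)%:E.
have mab : measurable_fun setT (fun x => (a x * b x)%:E).
  by apply/measurable_EFinP; exact: measurable_funM.
have mab2 : measurable_fun setT (fun x => (a x * b x ^+ 2)%:E).
  by apply/measurable_EFinP; apply: measurable_funM => //; exact: measurable_funX.
have mae : measurable_fun setT (fun x => (a x)%:E) by exact/measurable_EFinP.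
have I0 : 0 <= I by apply: integral_ge0 => x _; rewrite lee_fin mulr_ge0.
have B0 : 0 <= B by apply: integral_ge0 => x _; rewrite lee_fin mulr_ge0// exprn_ge0.
have [Boo|Bfin] := eqVneq B +oo; first by rewrite Boo gt0_muley ?lte_fin// leey.
have mb2 : measurable_fun setT (fun x => a x * b x ^+ 2)%R.
  by apply: measurable_funM => //; exact: measurable_funX.
have mab' : measurable_fun setT (fun x => a x * b x)%R by exact: measurable_funM.
have key (l : R) : (0 < l)%R -> 2%:E * I <= l%:E * B + (A / l)%:E.
  move=> l0; have l1 : (0 <= l^-1)%R by rewrite invr_ge0 ltW.
  rewrite -eI_Z//; last by move=> x; rewrite mulr_ge0.
  apply: (@le_trans _ _ (\int[m]_x (l * (a x * b x ^+ 2) + l^-1 * a x)%:E)).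
    apply: eI_le.
    - exact: measurable_funM.
    - by apply: measurable_funD; exact: measurable_funM.
    - by move=> x; rewrite !mulr_ge0.
    move=> x; have h : (0 <= a x * l^-1 * (l * b x - 1) ^+ 2)%R by apply: mulr_ge0 (sqr_ge0 _); exact: mulr_ge0.
    rewrite -subr_ge0 (_ : (_ - _ = a x * l^-1 * (l * b x - 1) ^+ 2)%R)//.
    by field; rewrite lt0r_neq0.
  rewrite eI_D; [|exact: measurable_funM|exact: measurable_funM|by move=> x; apply: mulr_ge0 (ltW l0) _; apply: mulr_ge0 => //; exact: exprn_ge0|by move=> x; rewrite mulr_ge0].
  rewrite !eI_Z//; [|exact: ltW|by move=> x; rewrite mulr_ge0// exprn_ge0].
  by rewrite leeD2l// (mulrC A) EFinM lee_wpmul2l.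
have Bf : B \is a fin_num by rewrite ge0_fin_numE// ltey.
have If : I \is a fin_num.
  rewrite ge0_fin_numE//; have := key 1%R ltr01; rewrite mul1e divr1 => h.
  apply: (@le_lt_trans _ _ (2%:E * I)).
    rewrite -[leLHS]mul1e lee_wpmul2r// lee_fin; lra.
  by apply: (le_lt_trans h); rewrite lte_add_pinfty ?ltry// ltey.
rewrite -(fineK If) -(fineK Bf) -!EFinM lee_fin.
have {}key (l : R) : (0 < l -> 2 * fine I <= l * fine B + A / l)%R.
  by move=> /key; rewrite -{1}(fineK If) -{1}(fineK Bf) -!EFinM -EFinD lee_fin.
have i0 : (0 <= fine I)%R by exact: fine_ge0.
have b0' : (0 <= fine B)%R by exact: fine_ge0.
move: i0; rewrite le_eqVlt => /orP[/eqP <-|i0]; first by rewrite mul0r mulr_ge0// ltW.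
have /key := divr_gt0 A0 i0.
set i := fine I in i0 *; set b' := fine B in b0' *.
have -> : (A / (A / i) = i)%R by field; rewrite !lt0r_neq0.
move=> h; have {}h : (i <= A / i * b')%R by lra.
by rewrite -(ler_pM2r i0) in h; apply: (le_trans h); rewrite mulrAC divfK ?lt0r_neq0.
Qed.

End CauchySchwarz.

Section KernelPositivity.
Context {R : realType}.
Local Notation C := R[i].
Local Notation X := (R * R)%type.
Local Notation mu := (@lebesgue_measure R).
Local Notation mu2 := (@lebesgue_measure R \x @lebesgue_measure R)%E.
Implicit Types (H h : MX R -> C) (p q : MX R) (d s t : R).

Lemma tonelli_cabs12 (f : measurableTypeR R -> MX R -> C) :
  cmeas (setT : set (measurableTypeR R * MX R)) (fun v => f v.1 v.2) ->
  (\int[mu]_x \int[mu2]_y (cabs (f x y))%:E = \int[mu2]_y \int[mu]_x (cabs (f x y))%:E)%E.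
Proof. exact: (@tonelli_cabs _ _ _ _ R mu leb2 f). Qed.

Lemma cmeas_cint12 (f : measurableTypeR R -> MX R -> C) :
  cmeas (setT : set (measurableTypeR R * MX R)) (fun v => f v.1 v.2) ->
  cmeas setT (fun x => cint mu2 setT (f x)).
Proof. exact: (@cmeas_cint1 _ _ _ _ R leb2 f). Qed.

Lemma cintg_cint21 (f : measurableTypeR R -> MX R -> C) :
  cmeas (setT : set (measurableTypeR R * MX R)) (fun v => f v.1 v.2) ->
  (\int[mu]_x \int[mu2]_y (cabs (f x y))%:E < +oo)%E ->
  cintg mu2 setT (fun y => cint mu setT (f ^~ y)).
Proof.
move=> mf; rewrite (tonelli_cabs12 mf) => ff.
exact: (@cintg_cint1 _ _ _ _ R leb2 mu (fun y x => f x y) (cmeas_swap mf)).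
Qed.

Lemma measurable_eint12 (f : measurableTypeR R -> MX R -> C) :
  cmeas (setT : set (measurableTypeR R * MX R)) (fun v => f v.1 v.2) ->
  measurable_fun setT (fun x => \int[mu2]_y (cabs (f x y))%:E)%E.
Proof. exact: (@measurable_eint1 _ _ _ _ R leb2 f). Qed.

Lemma measurable_eint22 (f : MX R -> MX R -> C) :
  cmeas (setT : set (MX R * MX R)) (fun v => f v.1 v.2) ->
  measurable_fun setT (fun x => \int[mu2]_y (cabs (f x y))%:E)%E.
Proof. exact: (@measurable_eint1 _ _ _ _ R leb2 f). Qed.

Lemma ge0_mulcJ (z : C) : 0 <= z * z^*.
Proof. by rewrite mulcJ lecR sqr_ge0. Qed.

Lemma phiG_bounded d : 0 < d -> exists2 K : R, 0 < K & forall u p, cabs (phiG d u p) <= K.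
Proof.
move=> d0; have [K K0 hK] := gE_bound d0 (ltr01 : 0 < 1 :> R).
exists (K + 1); first lra.
move=> u p; have : cabs (phiG d u p) ^+ 2 <= K.
  rewrite cabs_phiG (le_trans (hK _))// ler_piMr ?(ltW K0)// /mA expR_le1.
  by have := lexp_ge (u + p.2); have := lexp_ge0 (u + p.2); nra.
by have := cabs_ge0 (phiG d u p); nra.
Qed.

Lemma cintg_phiG d p q : 0 < d -> cintg mu setT (fun u => (phiG d u p)^* * phiG d u q).
Proof.
move=> d0.
have m1 r : cmeas setT (fun u : measurableTypeR R => phiG d u r) by exact: (cmeas_sec2 r (cmeas_phiG d)).
have m2 r : measurable_fun setT (fun u : measurableTypeR R => cabs (phiG d u r) ^+ 2).
  by apply: measurable_funX; exact: measurable_cabs.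
apply: (@cintg_le _ _ _ mu setT measurableT _ (fun u => cabs (phiG d u p) ^+ 2 + cabs (phiG d u q) ^+ 2)).
- by apply: cmeasM => //; exact: cmeasJ.
- exact: measurable_funD.
- move=> u _; rewrite cabsM cabsJ; have := cabs_ge0 (phiG d u p); have := cabs_ge0 (phiG d u q).
  by have := sqr_ge0 (cabs (phiG d u p) - cabs (phiG d u q)); nra.
rewrite eI_D//; [|by move=> u; rewrite sqr_ge0..].
by rewrite !int_phiG2// -EFinD ltry.
Qed.

(** By the Gamma integral for D_d the form equals 1 / Gamma(d) times the integral of |a(u)|^2, where
    a(u) is the integral of (H q)^* [phiG d u q] in q. *)
Lemma pd_int H d : 0 < d -> cintg mu2 setT H ->
  0 <= cint mu2 setT (fun p => cint mu2 setT (fun q => H p * (H q)^* * Dk d p q)).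
Proof.
move=> d0 iH; have [mH fH] := iH.
have G0 := Gam_gt0 d0; have [K K0 hK] := phiG_bounded d0.
have mph := cmeas_phiG d (R := R).
pose g u q := (H q)^* * phiG d u q.
have mg : cmeas (setT : set (measurableTypeR R * MX R)) (fun v => g v.1 v.2).
  by apply: cmeasM => //; apply: cmeasJ; exact: cmeas_snd.
have ig u : cintg mu2 setT (g u).
  apply: (@cintg_le _ _ _ mu2 setT measurableT _ (fun q => K * cabs (H q))).
  - exact: (cmeas_sec1 u mg).
  - by apply: measurable_funM => //; exact: measurable_cabs.
  - by move=> q _; rewrite cabsM cabsJ mulrC ler_wpM2r// cabs_ge0.
  rewrite eI_Z ?(ltW K0)//; [|exact: measurable_cabs|by move=> ?; exact: cabs_ge0].
  by rewrite lte_mul_pinfty// lee_fin ltW.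
pose a u := cint mu2 setT (g u).
have ma : cmeas setT a by exact: (cmeas_cint12 mg).
pose n1 u := fine (\int[mu2]_q (cabs (g u q))%:E)%E.
have n1E u : (\int[mu2]_q (cabs (g u q))%:E)%E = (n1 u)%:E.
  by rewrite fineK// ge0_fin_numE ?eI_ge0// => [|q]; [case: (ig u)|exact: cabs_ge0].
have n10 u : 0 <= n1 u by rewrite fine_ge0// eI_ge0// => q; exact: cabs_ge0.
have mn1 : measurable_fun setT n1 by apply: measurableT_comp => //; exact: measurable_eint12.
have an1 u : cabs (a u) <= n1 u.
  by rewrite -lee_fin -n1E; apply: ecabs_cint => //; case: (ig u).
(* H is merely integrable, so the exchanges of integrals need this bound: [CS_weight] with the
   weight |H| followed by Tonelli, the integral of |phiG|^2 in u being Gamma(d) at every point. *)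
have n1fin : (\int[mu]_u (n1 u ^+ 2)%:E < +oo)%E.
  pose S := fine (\int[mu2]_p (cabs (H p))%:E)%E + 1.
  have S0 : 0 < S by rewrite /S ltr_wpDl// fine_ge0// eI_ge0// => p; exact: cabs_ge0.
  have SE : (\int[mu2]_p (cabs (H p))%:E <= S%:E)%E.
    rewrite /S EFinD fineK ?leeDl// ge0_fin_numE// eI_ge0// => p; exact: cabs_ge0.
  pose f u q := (H q)^* * (phiG d u q * phiG d u q).
  have mf : cmeas (setT : set (measurableTypeR R * MX R)) (fun v => f v.1 v.2).
    by apply: cmeasM; [apply: cmeasJ; exact: cmeas_snd|exact: cmeasM].
  apply: (@le_lt_trans _ _ (\int[mu]_u (S%:E * \int[mu2]_q (cabs (f u q))%:E))%E).
    apply: ge0_le_integral => //.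
    - by move=> u _; rewrite lee_fin sqr_ge0.
    - by apply/measurable_EFinP; exact: measurable_funX.
    - by apply: measurable_funeM; exact: (measurable_eint12 mf).
    move=> u _; have := @CS_weight _ _ _ mu2 (fun q => cabs (H q)) (fun q => cabs (phiG d u q)) S.
    have Ef : (\int[mu2]_q (cabs (f u q))%:E = \int[mu2]_q (cabs (H q) * cabs (phiG d u q) ^+ 2)%:E)%E.
      by apply: eq_integral => q _; rewrite /f cabsM cabsJ cabsM expr2.
    have Eg : (\int[mu2]_q (cabs (g u q))%:E = \int[mu2]_q (cabs (H q) * cabs (phiG d u q))%:E)%E.
      by apply: eq_integral => q _; rewrite /g cabsM cabsJ.
    rewrite Ef expr2 EFinM -n1E Eg.
    apply => //; [exact: measurable_cabs|apply: measurable_cabs; exact: (cmeas_sec1 u mph)|by move=> ?; exact: cabs_ge0..].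
  rewrite ge0_integralZl//; last 3 first.
  - exact: (measurable_eint12 mf).
  - by move=> u _; rewrite eI_ge0// => q; exact: cabs_ge0.
  - by rewrite lee_fin ltW.
  rewrite lte_mul_pinfty ?lee_fin ?(ltW S0)// (tonelli_cabs12 mf).
  have E q : (\int[mu]_u (cabs (f u q))%:E = (Gam d * cabs (H q))%:E)%E.
    under eq_integral do rewrite /f cabsM cabsJ cabsM -expr2.
    rewrite eI_Z ?cabs_ge0//; [|apply: measurable_funX; apply: measurable_cabs; exact: (cmeas_sec2 q mph)|by move=> u; rewrite sqr_ge0].
    by rewrite int_phiG2// -EFinM mulrC.
  under eq_integral do rewrite E.
  rewrite eI_Z ?(ltW G0)//; [|exact: measurable_cabs|by move=> ?; exact: cabs_ge0].
  by rewrite lte_mul_pinfty// lee_fin ltW.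
have mphp p : cmeas setT (fun u : measurableTypeR R => (phiG d u p)^*).
  by apply: cmeasJ; exact: (cmeas_sec2 p mph).
have inner p : cint mu2 setT (fun q => H p * (H q)^* * Dk d p q) =
    H p * ((Gam d)^-1)%:C * cint mu setT (fun u => (phiG d u p)^* * a u).
  pose f u q := (phiG d u p)^* * g u q.
  have mf : cmeas (setT : set (measurableTypeR R * MX R)) (fun v => f v.1 v.2).
    apply: cmeasM; last exact: mg.
    exact: (@cmeas_fst _ _ (measurableTypeR R) (MX R) R (fun u => (phiG d u p)^*) (mphp p)).
  have fin : (\int[mu]_u \int[mu2]_q (cabs (f u q))%:E < +oo)%E.
    have E u : (\int[mu2]_q (cabs (f u q))%:E = (cabs (phiG d u p) * n1 u)%:E)%E.
      under eq_integral do rewrite /f cabsM cabsJ.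
      rewrite eI_Z ?cabs_ge0 ?n1E//; [by apply: measurable_cabs; case: (ig u)|by move=> ?; exact: cabs_ge0].
    under eq_integral do rewrite E.
    have mp2 : measurable_fun setT (fun u : measurableTypeR R => cabs (phiG d u p)).
      by apply: measurable_cabs; exact: (cmeas_sec2 p mph).
    apply: (@le_lt_trans _ _ (\int[mu]_u (cabs (phiG d u p) ^+ 2 + n1 u ^+ 2)%:E)%E).
      apply: eI_le; [exact: measurable_funM|by apply: measurable_funD; exact: measurable_funX|by move=> u; rewrite mulr_ge0 ?cabs_ge0|].
      move=> u; have := sqr_ge0 (cabs (phiG d u p) - n1 u); have := n10 u; have := cabs_ge0 (phiG d u p); nra.
    rewrite eI_D; [|exact: measurable_funX|exact: measurable_funX|by move=> u; rewrite sqr_ge0..].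
    by rewrite int_phiG2// lte_add_pinfty// ltry.
  have := cfubini12 mf fin.
  have -> : cint mu setT (fun u => cint mu2 setT (f u)) = cint mu setT (fun u => (phiG d u p)^* * a u).
    by apply: eq_cint => u _; rewrite /f (cintZ measurableT _ (ig u)).
  move=> ->; have iD : cintg mu2 setT (fun q => (H q)^* * Dk d p q).
    apply: (@cintg_le _ _ _ mu2 setT measurableT _ (fun q => cabs (H q))) => //.
    - by apply: cmeasM; [exact: cmeasJ|exact: cmeas_Dk2].
    - exact: measurable_cabs.
    - by move=> q _; rewrite cabsM cabsJ cabs_Dk ler_piMr ?cabs_ge0// dX_powR_le1// ltW.
  rewrite (@eq_cint _ _ _ mu2 _ (fun q => cint mu setT (f ^~ q)) (fun q => (Gam d)%:C * ((H q)^* * Dk d p q))); last first.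
    move=> q _; rewrite mulrCA -int_phiG// -(cintZ measurableT _ (cintg_phiG p q d0)).
    by apply: eq_cint => u _; rewrite /f /g; ring.
  rewrite (cintZ measurableT _ iD) mulrA -(mulrA (H p)) -rmorphM/= mulVf ?lt0r_neq0// mulr1.
  rewrite -(cintZ measurableT _ iD); apply: eq_cint => q _; rewrite mulrA//.
under [X in 0 <= cint _ _ X]eq_fun do rewrite inner.
pose f u p := H p * ((phiG d u p)^* * a u).
have mf : cmeas (setT : set (measurableTypeR R * MX R)) (fun v => f v.1 v.2).
  apply: cmeasM; first exact: cmeas_snd.
  by apply: cmeasM; [exact: cmeasJ|exact: cmeas_fst].
have fE u p : f u p = a u * (g u p)^* by rewrite /f /g rmorphM/= conjcK; ring.
have fin : (\int[mu]_u \int[mu2]_q (cabs (f u q))%:E < +oo)%E.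
  have E u : (\int[mu2]_q (cabs (f u q))%:E = (cabs (a u) * n1 u)%:E)%E.
    under eq_integral do rewrite fE cabsM cabsJ.
    rewrite eI_Z ?cabs_ge0 ?n1E//; [by apply: measurable_cabs; case: (ig u)|by move=> ?; exact: cabs_ge0].
  under eq_integral do rewrite E.
  apply: le_lt_trans n1fin; apply: eI_le.
  - by apply: measurable_funM => //; exact: measurable_cabs.
  - exact: measurable_funX.
  - by move=> u; rewrite mulr_ge0// cabs_ge0.
  - by move=> u; rewrite expr2 ler_wpM2r.
have iu p : cintg mu setT (fun u => (phiG d u p)^* * a u).
  apply: (@cintg_le _ _ _ mu setT measurableT _ (fun u => cabs (phiG d u p) ^+ 2 + n1 u ^+ 2)).
  - by apply: cmeasM.
  - by apply: measurable_funD; apply: measurable_funX => //; apply: measurable_cabs; exact: (cmeas_sec2 p mph).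
  - move=> u _; rewrite cabsM cabsJ; have := sqr_ge0 (cabs (phiG d u p) - n1 u).
    by have := n10 u; have := an1 u; have := cabs_ge0 (phiG d u p); have := cabs_ge0 (a u); nra.
  rewrite eI_D; [|apply: measurable_funX; apply: measurable_cabs; exact: (cmeas_sec2 p mph)|exact: measurable_funX|by move=> u; rewrite sqr_ge0..].
  by rewrite int_phiG2// lte_add_pinfty// ltry.
have -> : cint mu2 setT (fun p => H p * ((Gam d)^-1)%:C * cint mu setT (fun u => (phiG d u p)^* * a u)) =
   ((Gam d)^-1)%:C * cint mu setT (fun u => a u * (a u)^*).
  rewrite (@eq_cint _ _ _ mu2 _ _ (fun p => ((Gam d)^-1)%:C * cint mu setT (f ^~ p))); last first.
    by move=> p _; rewrite /f (cintZ measurableT _ (iu p)); ring.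
  rewrite (cintZ measurableT); last first.
    by have [] := cintg_cint21 mf fin.
  congr (_ * _); rewrite -(cfubini12 mf fin); apply: eq_cint => u _.
  rewrite (@eq_cint _ _ _ mu2 _ (f u) (fun p => a u * (g u p)^*)); last by move=> p _; exact: fE.
  by rewrite (cintZ measurableT _ (cintgJ (ig u))) (cintJ measurableT (ig u)).
rewrite mulr_ge0//; first by rewrite lecR invr_ge0 ltW.
by apply: cint_ge0 => // u _; exact: ge0_mulcJ.
Qed.

End KernelPositivity.

HB.lock Definition N1 (R : realType) (V : MX R -> MX R -> R[i]) (e : MX R) : R :=
  fine (\int[@lebesgue_measure R \x @lebesgue_measure R]_x (cabs (V x e))%:E)%E.
Arguments N1 {R} V e.

(** * The restriction inequality *)

Section GoodKernels.
Context {R : realType}.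
Local Notation C := R[i].
Local Notation X := (R * R)%type.
Local Notation mu2 := (@lebesgue_measure R \x @lebesgue_measure R)%E.
Implicit Types (V W B : MX R -> MX R -> C) (h : MX R -> C) (p q e x y : MX R) (s t : R).

Definition cmeas2 V := cmeas (setT : set (MX R * MX R)) (fun v => V v.1 v.2).

(** A mixed-norm class: square integrable in e of the integral norm in x. It makes V(x, e) W(y, e)^*
    B(x, y) absolutely integrable for every bounded B, while the square integrable rows make each
    inner integral over e exist. *)
Definition kgood V := [/\ cmeas2 V, forall x, cl2 (V x), forall e, cintg mu2 setT (V ^~ e) &
  (\int[mu2]_e (N1 V e ^+ 2)%:E < +oo)%E].

Lemma N1E V e : cintg mu2 setT (V ^~ e) -> (\int[mu2]_x (cabs (V x e))%:E)%E = (N1 V e)%:E.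
Proof.
move=> [_ ff]; rewrite N1.unlock fineK// ge0_fin_numE// eI_ge0// => x; exact: cabs_ge0.
Qed.

Lemma N1_ge0 V e : 0 <= N1 V e.
Proof. by rewrite N1.unlock fine_ge0// eI_ge0// => x; exact: cabs_ge0. Qed.

Lemma measurable_N1 V : cmeas2 V -> measurable_fun setT (N1 V).
Proof.
move=> mV; rewrite N1.unlock; apply: measurableT_comp => //.
exact: (@measurable_eint22 _ (fun e x => V x e) (cmeas_swap mV)).
Qed.

Lemma kgood_sec V e : cmeas2 V -> cmeas setT (V ^~ e).
Proof. exact: cmeas_sec2. Qed.

Lemma kgood_cl2_cint V : kgood V -> cl2 (fun e => cint mu2 setT (V ^~ e)) /\
  forall e, cabs (cint mu2 setT (V ^~ e)) <= N1 V e.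
Proof.
move=> [mV _ iV nV].
have b e : cabs (cint mu2 setT (V ^~ e)) <= N1 V e.
  by rewrite -lee_fin -N1E//; apply: ecabs_cint => //; exact: (kgood_sec e mV).
split => //; apply: cl2_le nV.
- exact: (@cmeas_cint22 _ (fun e x => V x e) (cmeas_swap mV)).
- by apply: measurable_funX; exact: measurable_N1.
- by move=> e; rewrite ler_pXn2r ?nnegrE ?cabs_ge0 ?N1_ge0.
Qed.

Lemma cmeas2_comp (f : MX R -> MX R -> C) d (T : measurableType d) (a b : T -> MX R) :
  cmeas2 f -> measurable_fun setT a -> measurable_fun setT b -> cmeas setT (fun v => f (a v) (b v)).
Proof.
move=> mf ma mb; apply: (cmeas_comp (h := fun v => (a v, b v)) _ mf).
exact: measurable_fun_pair.
Qed.

Lemma kgood_le V W (nW : MX R -> R) : cmeas2 V -> (forall x, cl2 (V x)) ->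
  (forall e, cintg mu2 setT (V ^~ e)) -> measurable_fun setT nW ->
  (\int[mu2]_e (nW e)%:E < +oo)%E -> (forall e, N1 V e ^+ 2 <= nW e) -> kgood V.
Proof.
move=> mV lV iV mW fW VW; split => //; apply: le_lt_trans fW; apply: eI_le => //.
- by apply: measurable_funX; exact: measurable_N1.
- by move=> e; exact: sqr_ge0.
Qed.

Lemma kgoodD V W : kgood V -> kgood W -> kgood (fun x e => V x e + W x e).
Proof.
move=> [mV lV iV nV] [mW lW iW nW].
have iVW e : cintg mu2 setT (fun x => V x e + W x e) by exact: (cintgD measurableT (iV e) (iW e)).
have mN U : cmeas2 U -> measurable_fun setT (fun e => N1 U e ^+ 2).
  by move=> mU; apply: measurable_funX; exact: measurable_N1.
apply: (@kgood_le _ V (fun e => 2 * (N1 V e ^+ 2 + N1 W e ^+ 2))).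
- exact: cmeasD.
- by move=> x; exact: cl2D.
- exact: iVW.
- by apply: measurable_funM => //; apply: measurable_funD; exact: mN.
- rewrite eI_Z//; [|by apply: measurable_funD; exact: mN|by move=> e; rewrite addr_ge0// sqr_ge0].
  rewrite eI_D; [|exact: mN|exact: mN|by move=> e; rewrite sqr_ge0..].
  by rewrite lte_mul_pinfty// lte_add_pinfty.
move=> e; have : N1 (fun x e => V x e + W x e) e <= N1 V e + N1 W e.
  rewrite -lee_fin EFinD -(N1E (iVW e)) -(N1E (iV e)) -(N1E (iW e)) -eI_D.
  - apply: eI_le.
    + by apply: measurable_cabs; case: (iVW e).
    + by apply: measurable_funD; apply: measurable_cabs; [case: (iV e)|case: (iW e)].
    + by move=> x; exact: cabs_ge0.
    + by move=> x; exact: cabsD.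
  - by apply: measurable_cabs; case: (iV e).
  - by apply: measurable_cabs; case: (iW e).
  - by move=> x; exact: cabs_ge0.
  - by move=> x; exact: cabs_ge0.
have := N1_ge0 (fun x e => V x e + W x e) e; have := N1_ge0 V e; have := N1_ge0 W e.
by have := sqr_ge0 (N1 V e - N1 W e); nra.
Qed.

Lemma kgoodZ (c : C) V : kgood V -> kgood (fun x e => c * V x e).
Proof.
move=> [mV lV iV nV].
have iZ e : cintg mu2 setT (fun x => c * V x e) by exact: (cintgZ measurableT c (iV e)).
have mN : measurable_fun setT (fun e => N1 V e ^+ 2).
  by apply: measurable_funX; exact: measurable_N1.
apply: (@kgood_le _ V (fun e => cabs c ^+ 2 * N1 V e ^+ 2)).
- by apply: cmeasM => //; exact: cmeas_cst.
- by move=> x; exact: cl2Z.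
- exact: iZ.
- exact: measurable_funM.
- rewrite eI_Z//; [|exact: sqr_ge0|by move=> e; exact: sqr_ge0].
  by rewrite lte_mul_pinfty// lee_fin sqr_ge0.
move=> e; rewrite -exprMn ler_pXn2r ?nnegrE ?N1_ge0 ?mulr_ge0 ?cabs_ge0 ?N1_ge0//.
rewrite -lee_fin EFinM -(N1E (iZ e)) -(N1E (iV e)) -eI_Z ?cabs_ge0//.
- apply: eI_le.
  + by apply: measurable_cabs; case: (iZ e).
  + by apply: measurable_funM => //; apply: measurable_cabs; case: (iV e).
  + by move=> x; exact: cabs_ge0.
  + by move=> x; rewrite cabsM.
- by apply: measurable_cabs; case: (iV e).
- by move=> x; exact: cabs_ge0.
Qed.

Lemma kgood_sum (I : Type) (r : seq I) (V : I -> MX R -> MX R -> C) : (forall i, kgood (V i)) ->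
  kgood (fun x e => \sum_(i <- r) V i x e).
Proof.
move=> kV; elim: r => [|i r IH].
  have -> : (fun x e => \sum_(i <- [::]) V i x e) = fun _ _ => 0.
    by apply/funext => x; apply/funext => e; rewrite big_nil.
  have c0 : cintg mu2 setT (fun _ : MX R => 0 : C) by exact: cintg0.
  split; [exact: cmeas_cst|by move=> x; exact: cl20|by move=> e; exact: c0|].
  have E e : N1 (fun _ _ => 0) e = 0 by rewrite N1.unlock; under eq_integral do rewrite cabs0; rewrite integral0.
  by under eq_integral do rewrite E expr0n/=; rewrite integral0 ltry.
have -> : (fun x e => \sum_(j <- i :: r) V j x e) = fun x e => V i x e + \sum_(j <- r) V j x e.
  by apply/funext => x; apply/funext => e; rewrite big_cons.
exact: kgoodD.
Qed.

Lemma int_mul_fin (a b : MX R -> R) : measurable_fun setT a -> measurable_fun setT b ->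
  (forall x, 0 <= a x) -> (forall x, 0 <= b x) ->
  (\int[mu2]_x (a x ^+ 2)%:E < +oo)%E -> (\int[mu2]_x (b x ^+ 2)%:E < +oo)%E ->
  (\int[mu2]_x (a x * b x)%:E < +oo)%E.
Proof.
move=> ma mb a0 b0 fa fb.
apply: (@le_lt_trans _ _ (\int[mu2]_x (a x ^+ 2 + b x ^+ 2)%:E)%E).
  apply: eI_le; [exact: measurable_funM|by apply: measurable_funD; exact: measurable_funX|by move=> x; rewrite mulr_ge0|].
  by move=> x; have := sqr_ge0 (a x - b x); have := a0 x; have := b0 x; nra.
rewrite eI_D; [|exact: measurable_funX|exact: measurable_funX|by move=> x; exact: sqr_ge0..].
by rewrite lte_add_pinfty.
Qed.

(** Two exchanges: e with y for fixed x, dominated by |V(x, e)| times [N1 W e], and then e with x,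
    dominated by [N1 V e] times [N1 W e]. *)
Lemma triple_swap V W B : kgood V -> kgood W -> cmeas2 B -> (forall x y, cabs (B x y) <= 1) ->
  [/\ cint mu2 setT (fun e => cint mu2 setT (fun x => cint mu2 setT (fun y => V x e * (W y e)^* * B x y))) =
    cint mu2 setT (fun x => cint mu2 setT (fun y => B x y * cint mu2 setT (fun e => V x e * (W y e)^*))),
    forall x, cintg mu2 setT (fun y => B x y * cint mu2 setT (fun e => V x e * (W y e)^*)) &
    cintg mu2 setT (fun x => cint mu2 setT (fun y => B x y * cint mu2 setT (fun e => V x e * (W y e)^*)))].
Proof.
move=> kV kW mB B1; have [mV lV iV nV] := kV; have [mW lW iW nW] := kW.
pose f x e y := V x e * (W y e)^* * B x y.
pose g e x := cint mu2 setT (f x e).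
have p1 d1 d2 (T1 : measurableType d1) (T2 : measurableType d2) := @measurable_fst _ _ T1 T2.
have p2 d1 d2 (T1 : measurableType d1) (T2 : measurableType d2) := @measurable_snd _ _ T1 T2.
have mf x : cmeas2 (f x).
  apply: cmeasM; first apply: cmeasM.
  - by apply: (cmeas2_comp mV) => //; exact: measurable_cst.
  - by apply: cmeasJ; apply: (cmeas2_comp mW).
  - by apply: (cmeas2_comp mB) => //; exact: measurable_cst.
have bf x e : (\int[mu2]_y (cabs (f x e y))%:E <= (cabs (V x e) * N1 W e)%:E)%E.
  rewrite EFinM -(N1E (iW e)) -eI_Z ?cabs_ge0//; last first.
  - by move=> y; exact: cabs_ge0.
  - by apply: measurable_cabs; case: (iW e).
  apply: eI_le.
  - by apply: measurable_cabs; exact: (cmeas_sec1 e (mf x)).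
  - by apply: measurable_funM => //; apply: measurable_cabs; case: (iW e).
  - by move=> y; exact: cabs_ge0.
  - by move=> y; rewrite !cabsM cabsJ ler_piMr// mulr_ge0 ?cabs_ge0.
have fin1 x : (\int[mu2]_e \int[mu2]_y (cabs (f x e y))%:E < +oo)%E.
  apply: (@le_lt_trans _ _ (\int[mu2]_e (cabs (V x e) * N1 W e)%:E)%E).
    apply: ge0_le_integral => //.
    - by move=> e _; rewrite eI_ge0// => y; exact: cabs_ge0.
    - exact: (measurable_eint22 (mf x)).
    - apply/measurable_EFinP; apply: measurable_funM; last exact: measurable_N1.
      by apply: measurable_cabs; case: (lV x).
  apply: int_mul_fin => //.
  - by apply: measurable_cabs; case: (lV x).
  - exact: measurable_N1.
  - by move=> e; exact: cabs_ge0.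
  - by move=> e; exact: N1_ge0.
  - by case: (lV x).
have mg : cmeas2 g.
  apply: (@cmeas_cint1 _ _ (MX R * MX R)%type (MX R) R leb2 (fun v y => f v.2 v.1 y)).
  apply: cmeasM; first apply: cmeasM.
  - by apply: (cmeas2_comp mV); apply: measurableT_comp.
  - by apply: cmeasJ; apply: (cmeas2_comp mW) => //; apply: measurableT_comp.
  - by apply: (cmeas2_comp mB) => //; apply: measurableT_comp.
have fin2 : (\int[mu2]_e \int[mu2]_x (cabs (g e x))%:E < +oo)%E.
  apply: (@le_lt_trans _ _ (\int[mu2]_e (N1 V e * N1 W e)%:E)%E); last first.
    by apply: int_mul_fin => //; [exact: measurable_N1|exact: measurable_N1|move=> e; exact: N1_ge0..].
  apply: ge0_le_integral => //.
  - by move=> e _; rewrite eI_ge0// => y; exact: cabs_ge0.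
  - exact: (measurable_eint22 mg).
  - by apply/measurable_EFinP; apply: measurable_funM; exact: measurable_N1.
  move=> e _; rewrite mulrC EFinM -(N1E (iV e)) -eI_Z ?N1_ge0//; last first.
  - by move=> y; exact: cabs_ge0.
  - by apply: measurable_cabs; case: (iV e).
  apply: eI_le.
  - by apply: measurable_cabs; exact: (cmeas_sec1 e mg).
  - by apply: measurable_funM => //; apply: measurable_cabs; case: (iV e).
  - by move=> x; exact: cabs_ge0.
  - move=> x; rewrite mulrC -lee_fin; apply: le_trans (bf x e); apply: ecabs_cint => //.
    exact: (cmeas_sec1 e (mf x)).
have E x y : B x y * cint mu2 setT (fun e => V x e * (W y e)^*) = cint mu2 setT (fun e => f x e y).
  rewrite -(cintZ measurableT); first by apply: eq_cint => e _; rewrite /f mulrC.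
  by apply: cl2M => //; exact: cl2J.
have E2 x : cint mu2 setT (fun y => B x y * cint mu2 setT (fun e => V x e * (W y e)^*)) =
    cint mu2 setT (fun e => g e x).
  by rewrite /g (cfubini22 (mf x) (fin1 x)); apply: eq_cint => y _.
split.
- rewrite -/g (cfubini22 mg fin2); apply: eq_cint => x _; rewrite -E2.
  by apply: eq_cint => y _.
- move=> x; have := fin1 x; rewrite (tonelli_cabs22 (mf x)) => h.
  have := @cintg_cint22 _ (fun y e => f x e y) (cmeas_swap (mf x)) h.
  by under [X in cintg _ _ X -> _]eq_fun do rewrite -E.
- move: fin2; rewrite (tonelli_cabs22 mg) => h.
  have := @cintg_cint22 _ (fun x e => g e x) (cmeas_swap mg) h.
  by under [X in cintg _ _ X -> _]eq_fun do rewrite -E2.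
Qed.

End GoodKernels.

Section Contraction.
Context {R : realType}.
Local Notation C := R[i].
Local Notation mu2 := (@lebesgue_measure R \x @lebesgue_measure R)%E.
Implicit Types (V W B : MX R -> MX R -> C) (h : MX R -> C) (p q e x y : MX R) (s t d : R).

(** The reproducing vector at [hpt x] without the constant [c_nu], scaled so that [shp s] turns it
    into [Dk s x]. *)
Definition evX s x : C -> C := fun z =>
  cpow (qker ((hpt x)^*) z) (- s) * (expR (s / 2 * x.2))%:C.

Lemma evX_chol s x z : uhp z -> chol (evX s x) z.
Proof.
move=> zu; apply: cholM; last exact: chol_cst.
by apply: cpow_qker_chol => //; exact: hpt_uhp.
Qed.

Lemma shp_evX s x e : shp s (evX s x) e = Dk s x e.
Proof.
rewrite /shp /evX -mulrA -rmorphM/= -expRD.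
have -> : qker ((hpt x)^*) (hpt e) = qz x e by rewrite qz.unlock.
rewrite DkE cpowE ?qz_neq0// -cexp_real -cexpD; congr cexp.
rewrite mulrBr rmorphN/= mulNr addrC; congr (_ - _); by rewrite -rmorphM/=; congr (_%:C); field.
Qed.

Lemma Dk_repro s x y : 1 < s ->
  cint mu2 setT (fun e => Dk s x e * Dk s e y) = (mass s)%:C * Dk s x y.
Proof.
move=> s1; have E : shp s (evX s x) = Dk s x by apply/funext => e; exact: shp_evX.
have := @reproducing R s (evX s x) y s1 (fun z => @evX_chol s x z).
by rewrite E; apply; exact: cl2_Dk.
Qed.

Lemma cabs_Dk_le1 s x y : 0 <= s -> cabs (Dk s x y) <= 1.
Proof. by move=> s0; rewrite cabs_Dk dX_powR_le1. Qed.

(** Cauchy-Schwarz with the weight |h| bounds the square of [N1] by a multiple of the integral of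
    |h(x)| |D_s(x, e)|^2, whose integral in e is the mass times that of |h|. *)
Lemma kgood_Dk s h : 1 < s -> cintg mu2 setT h -> kgood (fun x e => h x * Dk s x e).
Proof.
move=> s1 ih; have [mh fh] := ih; have s0 : 0 <= s by lra.
pose V x e := h x * Dk s x e.
have mV : cmeas2 V by apply: cmeasM; [exact: cmeas_fst|exact: cmeas_Dk].
have iV e : cintg mu2 setT (V ^~ e).
  apply: (@cintg_le _ _ _ mu2 setT measurableT _ (fun x => cabs (h x))) => //.
  - exact: (kgood_sec e mV).
  - exact: measurable_cabs.
  - by move=> x _; rewrite cabsM ler_piMr ?cabs_ge0// cabs_Dk_le1.
pose S := fine (\int[mu2]_p (cabs (h p))%:E)%E + 1.
have S0 : 0 < S by rewrite /S ltr_wpDl// fine_ge0// eI_ge0// => p; exact: cabs_ge0.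
have SE : (\int[mu2]_p (cabs (h p))%:E <= S%:E)%E.
  rewrite /S EFinD fineK ?leeDl// ge0_fin_numE// eI_ge0// => p; exact: cabs_ge0.
pose f e x := h x * (Dk s x e * Dk s x e).
have mf : cmeas2 f.
  apply: cmeasM; first exact: cmeas_snd.
  have mD : cmeas2 (fun e x => Dk s x e) by exact: (cmeas_swap (cmeas_Dk s)).
  exact: cmeasM.
have fE e x : cabs (f e x) = cabs (h x) * cabs (Dk s x e) ^+ 2 by rewrite /f !cabsM expr2.
have mfe e : measurable_fun setT (fun x => cabs (f e x)).
  by apply: measurable_cabs; exact: (cmeas_sec1 e mf).
have ff e : (\int[mu2]_x (cabs (f e x))%:E < +oo)%E.
  apply: le_lt_trans fh; apply: eI_le => //; first exact: measurable_cabs.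
    by move=> x; exact: cabs_ge0.
  move=> x; rewrite fE ler_piMr ?cabs_ge0// expr_le1 ?cabs_ge0//.
  exact: cabs_Dk_le1.
pose nW e := S * N1 (fun x e => f e x) e.
have iF e : cintg mu2 setT ((fun x e => f e x) ^~ e).
  by split => //; exact: (cmeas_sec1 e mf).
have mN : measurable_fun setT (N1 (fun x e => f e x)).
  by apply: measurable_N1; exact: (cmeas_swap mf).
apply: (@kgood_le _ V (fun=> fun=> 0) nW) => //.
- by move=> x; apply: cl2Z; exact: cl2_Dk.
- exact: measurable_funM.
- rewrite eI_Z ?(ltW S0)//; last by move=> e; exact: N1_ge0.
  rewrite lte_mul_pinfty ?lee_fin ?(ltW S0)//.
  under eq_integral => e _ do rewrite -(N1E (iF e)).
  rewrite (tonelli_cabs22 mf).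
  have E x : (\int[mu2]_e (cabs (f e x))%:E = (mass s * cabs (h x))%:E)%E.
    under eq_integral do rewrite fE sqr_cabs_Dk.
    rewrite eI_Z ?cabs_ge0//; [|exact: measurable_dXpow|by move=> e; exact: powR_ge0].
    by rewrite (mass_int_at x s1) -EFinM mulrC.
  under eq_integral do rewrite E.
  rewrite eI_Z ?(ltW (mass_gt0 s1))//; [|exact: measurable_cabs|by move=> x; exact: cabs_ge0].
  by rewrite lte_mul_pinfty// lee_fin ltW// mass_gt0.
move=> e; rewrite -lee_fin expr2 /nW !EFinM -(N1E (iF e)) -(N1E (iV e)).
have := @CS_weight _ _ _ mu2 (fun x => cabs (h x)) (fun x => cabs (Dk s x e)) S.
have -> : (\int[mu2]_x (cabs (V x e))%:E = \int[mu2]_x (cabs (h x) * cabs (Dk s x e))%:E)%E.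
  by apply: eq_integral => x _; rewrite /V cabsM.
have -> : (\int[mu2]_x (cabs (f e x))%:E = \int[mu2]_x (cabs (h x) * cabs (Dk s x e) ^+ 2)%:E)%E.
  by apply: eq_integral => x _; rewrite fE.
apply => //; [exact: measurable_cabs|apply: measurable_cabs; exact: cmeas_Dk1|by move=> ?; exact: cabs_ge0..].
Qed.

Definition n2 h : R := \int[mu2]_x (cabs (h x) ^+ 2).

Lemma cint_mulJ h : cint mu2 setT (fun x => h x * (h x)^*) = (n2 h)%:C.
Proof.
rewrite -(cint_real mu2 measurableT (fun x => cabs (h x) ^+ 2)).
by apply: eq_cint => x _; rewrite mulcJ.
Qed.

(** [Dk s] divided by the mass m is the kernel of an orthogonal projection. For P(e) the integral of
    h(x) D_s(x, e), the form B on the left satisfies <P, h> = B and <P, P> = m B, and expanding the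
    squared norm of h - P / m >= 0 gives the bound. *)
Lemma contraction s h : 1 < s -> cintg mu2 setT h -> cl2 h ->
  cint mu2 setT (fun x => cint mu2 setT (fun y => h x * (h y)^* * Dk s x y)) <= (mass s * n2 h)%:C.
Proof.
move=> s1 ih lh; have s0 : 0 <= s by lra.
have [mh fh] := ih; have m0 := mass_gt0 s1.
pose V x e := h x * Dk s x e.
have kV : kgood V by exact: kgood_Dk.
have [mV lV iV _] := kV.
pose P e := cint mu2 setT (V ^~ e).
have [lP _] := kgood_cl2_cint kV.
pose g x y := h x * (h y)^* * Dk s x y.
have mg : cmeas2 g.
  apply: cmeasM; last exact: cmeas_Dk.
  by apply: cmeasM; [exact: cmeas_fst|apply: cmeasJ; exact: cmeas_snd].
have gle x y : cabs (g x y) <= cabs (h x) * cabs (h y).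
  by rewrite !cabsM cabsJ ler_piMr ?mulr_ge0 ?cabs_ge0// cabs_Dk_le1.
pose S := fine (\int[mu2]_p (cabs (h p))%:E)%E.
have SE : (\int[mu2]_p (cabs (h p))%:E)%E = S%:E.
  by rewrite /S fineK// ge0_fin_numE// eI_ge0// => p; exact: cabs_ge0.
have ig x : cintg mu2 setT (g x).
  apply: (@cintg_le _ _ _ mu2 setT measurableT _ (fun y => cabs (h x) * cabs (h y))) => //.
  - exact: (cmeas_sec1 x mg).
  - by apply: measurable_funM => //; exact: measurable_cabs.
  rewrite eI_Z ?cabs_ge0//; [|exact: measurable_cabs|by move=> y; exact: cabs_ge0].
  by rewrite SE -EFinM ltry.
have fin : (\int[mu2]_x \int[mu2]_y (cabs (g x y))%:E < +oo)%E.
  apply: (@le_lt_trans _ _ (\int[mu2]_x (S * cabs (h x))%:E)%E).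
    apply: ge0_le_integral => //.
    - by move=> x _; rewrite eI_ge0// => y; exact: cabs_ge0.
    - exact: (measurable_eint22 mg).
    - by apply/measurable_EFinP; apply: measurable_funM => //; exact: measurable_cabs.
    move=> x _; rewrite mulrC EFinM -SE -eI_Z ?cabs_ge0//; [|exact: measurable_cabs|by move=> y; exact: cabs_ge0].
    apply: eI_le => //.
    + by apply: measurable_cabs; exact: (cmeas_sec1 x mg).
    + by apply: measurable_funM => //; exact: measurable_cabs.
    + by move=> y; exact: cabs_ge0.
  have S0 : 0 <= S by rewrite fine_ge0// eI_ge0// => p; exact: cabs_ge0.
  rewrite eI_Z//; [|exact: measurable_cabs|by move=> y; exact: cabs_ge0].
  by rewrite SE -EFinM ltry.
have iB := cintg_cint22 mg fin.
set B := cint mu2 setT (fun x => cint mu2 setT (g x)) in iB *.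
rewrite -/(g _ _) -/B.
have PP : cint mu2 setT (fun e => P e * (P e)^*) = (mass s)%:C * B.
  have m1 : cmeas2 (fun _ _ : MX R => 1 : C) by exact: cmeas_cst.
  have [|E _ _] := triple_swap kV kV m1; first by move=> x y; rewrite cabs1.
  rewrite -(cintZ measurableT _ iB); transitivity (cint mu2 setT (fun e => cint mu2 setT (fun x =>
      cint mu2 setT (fun y => V x e * (V y e)^* * 1)))).
    apply: eq_cint => e _; rewrite -(cintZr measurableT _ (iV e)); apply: eq_cint => x _.
    rewrite -(cintJ measurableT (iV e)) -(cintZ measurableT _ (cintgJ (iV e))).
    by apply: eq_cint => y _; rewrite mulr1.
  rewrite E; apply: eq_cint => x _; rewrite -(cintZ measurableT _ (ig x)); apply: eq_cint => y _.
  rewrite mul1r /g mulrCA -(Dk_repro x y s1) -(cintZ measurableT).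
    by apply: eq_cint => e _; rewrite /V rmorphM/= DkJ; ring.
  by apply: cl2M; [exact: cl2_Dk|exact: cl2_Dk'].
have Ph : cint mu2 setT (fun e => P e * (h e)^*) = B.
  rewrite /B (cfubini22 mg fin); apply: eq_cint => e _.
  rewrite -(cintZr measurableT _ (iV e)); apply: eq_cint => x _.
  by rewrite /V /g; ring.
pose c := (mass s)^-1.
have c0 : 0 < c by rewrite invr_gt0.
have cm : c%:C * (mass s)%:C = 1 :> C by rewrite -rmorphM/= mulVf// lt0r_neq0.
have BE : B = (c * n2 P)%:C by rewrite rmorphM/= -cint_mulJ PP mulrA cm mul1r.
have BJ : B^* = B by rewrite BE cJR.
have lJ := cl2J lh; have lPJ := cl2J lP.
have i1 := cl2M lh lJ; have i2 := cl2M lh lPJ; have i3 := cl2M lP lJ; have i4 := cl2M lP lPJ.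
have hP : cint mu2 setT (fun e => h e * (P e)^*) = B.
  rewrite -BJ -Ph -(cintJ measurableT i3); apply: eq_cint => e _.
  by rewrite rmorphM/= conjcK mulrC.
have : 0 <= cint mu2 setT (fun e => (h e - c%:C * P e) * (h e - c%:C * P e)^*).
  by apply: cint_ge0 => // e _; exact: ge0_mulcJ.
rewrite (@eq_cint _ _ _ mu2 _ _ (fun e => h e * (h e)^* - c%:C * (h e * (P e)^*) -
   c%:C * (P e * (h e)^*) + c%:C * (c%:C * (P e * (P e)^*)))); last first.
  by move=> e _; rewrite cJB cJM cJR; ring.
have z2 := cintgZ measurableT c%:C i2; have z3 := cintgZ measurableT c%:C i3.
have z4 := cintgZ measurableT c%:C i4; have z44 := cintgZ measurableT c%:C z4.
have b1 := cintgB measurableT i1 z2; have b2 := cintgB measurableT b1 z3.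
rewrite (cintD measurableT b2 z44) (cintB measurableT b1 z3) (cintB measurableT i1 z2).
rewrite !(cintZ measurableT) // PP hP Ph cint_mulJ (mulrA c%:C (mass s)%:C) cm mul1r addrNK.
rewrite subr_ge0 => H.
have := ler_wpM2l (_ : 0 <= (mass s)%:C) H; rewrite lecR (ltW m0) => /(_ isT).
by rewrite mulrA (mulrC (mass s)%:C) cm mul1r rmorphM.
Qed.

End Contraction.

Section MainInequality.
Context {R : realType}.
Local Notation C := R[i].
Local Notation X := (R * R)%type.
Local Notation mu := (@lebesgue_measure R).
Local Notation mu2 := (@lebesgue_measure R \x @lebesgue_measure R)%E.
Implicit Types (V W B : MX R -> MX R -> C) (h F : MX R -> C) (p q e x y : MX R) (s t d : R).

Lemma cmeas2_swap V : cmeas2 V -> cmeas2 (fun q p => V p q).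
Proof. exact: (@cmeas_swap _ _ (MX R) (MX R) R V). Qed.

Lemma cmeas2_fst h : cmeas setT h -> cmeas2 (fun p _ => h p).
Proof. exact: (@cmeas_fst _ _ (MX R) (MX R) R h). Qed.

Lemma ccvg_le (f : nat -> C) (l b : C) : ccvg \oo f l -> (forall n, f n <= b) -> l <= b.
Proof.
move=> fl fb.
have H n : complex.Im (f n) = complex.Im b /\ complex.Re (f n) <= complex.Re b.
  by have := fb n; rewrite lecE => /andP[/eqP <- ->].
rewrite lecE; apply/andP; split; last first.
  by apply: (ler_cvg_to (ccvg_Re fl) (cvg_cst _)); apply: nearW => n; case: (H n).
apply/eqP; apply: (@cvg_unique _ (@Rhausdorff R) (complex.Im (f n) @[n --> \oo])).
  rewrite (_ : (fun n => complex.Im (f n)) = fun=> complex.Im b); first exact: cvg_cst.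
  by apply/funext => n; case: (H n).
exact: ccvg_Im.
Qed.

(** Square integrable functions are truncated to these boxes to become integrable, as [kgood_Dk] and
    [contraction] require; the limit is taken at the end. *)
Definition box (n : nat) : set (MX R) := `[(- n%:R), n%:R]%classic `*` `[(- n%:R), n%:R]%classic.

Lemma measurable_box n : measurable (box n).
Proof. by apply: measurableX; exact: measurable_itv. Qed.

Lemma box_fin n : (mu2 (box n) < +oo)%E.
Proof.
have nn : - n%:R <= n%:R :> R by have := ler0n R n; lra.
pose J : set (measurableTypeR R) := `[(- n%:R), n%:R]%classic.
have mJ : measurable J by exact: measurable_itv.
have E : (mu J = (n%:R - - n%:R)%:E)%E by exact: lebesgue_itvcc.
rewrite [X in (X < _)%E](product_measure1E mu mu mJ mJ).
rewrite [X in (X * _)%E]E [X in (_ * X)%E]E; apply: ltry.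
Qed.

Lemma box_cover x : exists n, forall m, (n <= m)%N -> box m x.
Proof.
pose n := maxn (Num.truncn `|x.1|).+1 (Num.truncn `|x.2|).+1.
exists n => m nm; split; rewrite /= in_itv/= -ler_norml.
  rewrite (le_trans (ltW (truncnS_gt _)))// ler_nat (leq_trans _ nm)// leq_maxl//.
by rewrite (le_trans (ltW (truncnS_gt _)))// ler_nat (leq_trans _ nm)// leq_maxr//.
Qed.

Definition ibox (n : nat) x : C := (\1_(box n) x)%:C.

Lemma ibox01 n x : ibox n x = 0 \/ ibox n x = 1.
Proof. by rewrite /ibox indicE; case: (_ \in _); [right|left]. Qed.

Lemma cmeas_ibox n : cmeas setT (ibox n).
Proof. by apply: cmeas_real; apply: measurable_indic; exact: measurable_box. Qed.

Lemma cl2_ibox n : cl2 (ibox n).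
Proof.
split; first exact: cmeas_ibox.
have -> : (\int[mu2]_x (cabs (ibox n x) ^+ 2)%:E = \int[mu2]_x (\1_(box n) x)%:E)%E.
  apply: eq_integral => x _; rewrite /ibox cabs_real indicE.
  by case: (_ \in _); rewrite ?normr1 ?normr0 ?expr1n ?expr0n.
rewrite integral_indic//; [by rewrite setIT; exact: box_fin|exact: measurable_box].
Qed.

Lemma cl2_mul_ibox n F : cl2 F -> cl2 (fun x => F x * ibox n x) /\
  cintg mu2 setT (fun x => F x * ibox n x).
Proof.
move=> lF; split; last by apply: cl2M => //; exact: cl2_ibox.
have [mF fF] := lF; apply: (@cl2_le _ _ (fun x => cabs (F x) ^+ 2)) => //.
- by apply: cmeasM => //; exact: cmeas_ibox.
- by apply: measurable_funX; exact: measurable_cabs.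
- by move=> x; case: (ibox01 n x) => ->; rewrite ?mulr1// mulr0 cabs0 expr0n sqr_ge0.
Qed.

Lemma cint_ibox_cvg (G : MX R -> C) : cintg mu2 setT G ->
  ccvg \oo (fun n => cint mu2 setT (fun x => G x * ibox n x)) (cint mu2 setT G).
Proof.
move=> [mG fG].
have [] := @cint_dominated _ _ R mu2 setT measurableT (fun n x => G x * ibox n x) G (fun x => cabs (G x)).
- by move=> n; apply: cmeasM => //; exact: cmeas_ibox.
- move=> x _; have [n hn] := box_cover x.
  apply: (@ccvg_near _ _ _ _ (fun=> G x)); last exact: ccvg_cst.
  by exists n => // m /= nm; rewrite /ibox indicE mem_set ?mulr1//; exact: hn.
- exact: measurable_cabs.
- exact: fG.
- by move=> n x _; case: (ibox01 n x) => ->; rewrite ?mulr1// mulr0 cabs0 cabs_ge0.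
by [].
Qed.

Lemma cint_lin4 (c : C) (f1 f2 f3 f4 : MX R -> C) : cintg mu2 setT f1 -> cintg mu2 setT f2 ->
  cintg mu2 setT f3 -> cintg mu2 setT f4 ->
  cint mu2 setT (fun x => f1 x - c * f2 x - c * f3 x + c * (c * f4 x)) =
  cint mu2 setT f1 - c * cint mu2 setT f2 - c * cint mu2 setT f3 + c * (c * cint mu2 setT f4).
Proof.
move=> i1 i2 i3 i4.
have z2 := cintgZ measurableT c i2; have z3 := cintgZ measurableT c i3.
have z4 := cintgZ measurableT c i4; have z44 := cintgZ measurableT c z4.
have b1 := cintgB measurableT i1 z2; have b2 := cintgB measurableT b1 z3.
rewrite (cintD measurableT b2 z44) (cintB measurableT b1 z3) (cintB measurableT i1 z2).
by rewrite (cintZ measurableT _ z4) (cintZ measurableT _ i2) (cintZ measurableT _ i3) (cintZ measurableT _ i4).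
Qed.

(** Completing the square: the cross terms contribute - 2 a N / b and the last term at most a N / b,
    so that positivity leaves A >= a N / b. *)
Lemma quadratic_conclusion (A N S2 S3 S4 H : C) (a b : R) : 0 < a -> 0 < b -> 0 <= H ->
  H = A - (b^-1)%:C * S2 - (b^-1)%:C * S3 + (b^-1)%:C * ((b^-1)%:C * S4) ->
  S2 = a%:C * N -> S3 = a%:C * N -> S4 <= a%:C * (b%:C * N) -> a%:C * N <= b%:C * A.
Proof.
move=> a0 b0 pos HE e2 e3 E4; rewrite HE e2 e3 in pos; set c := b^-1 in pos *.
have c0 : 0 < c by rewrite invr_gt0.
have cm : c%:C * b%:C = 1 :> C by rewrite -rmorphM/= mulVf// lt0r_neq0.
have cc0 : 0 <= c%:C :> C by rewrite lecR ltW.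
have := ler_wpM2l cc0 (ler_wpM2l cc0 E4).
have -> : c%:C * (c%:C * (a%:C * (b%:C * N))) = c%:C * b%:C * (c%:C * (a%:C * N)) by ring.
rewrite cm mul1r => E5.
have {}pos := le_trans pos (lerD (lexx _) E5).
rewrite addrNK subr_ge0 in pos.
have ms0 : 0 <= b%:C :> C by rewrite lecR ltW.
have := ler_wpM2l ms0 pos.
have -> : b%:C * (c%:C * (a%:C * N)) = c%:C * b%:C * (a%:C * N) by ring.
by rewrite cm mul1r.
Qed.

(* Comparison of the weights t and t + d; the test kernel is
   V(p, e) - mass(t + d)^-1 F(p) Dk t p e. *)
Lemma restriction_inequality t d V F : 1 < t -> 0 < d -> kgood V ->
  (forall p x, cint mu2 setT (fun e => V p e * Dk t e x) = (mass t)%:C * V p x) ->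
  (forall e, F e = cint mu2 setT (fun p => V p e * Dk d p e)) ->
  (mass t)%:C * cint mu2 setT (fun e => F e * (F e)^*) <=
  (mass (t + d))%:C *
    cint mu2 setT (fun p => cint mu2 setT (fun q => Dk d p q * cint mu2 setT (fun e => V p e * (V q e)^*))).
Proof.
move=> t1 d0 kV rV FE; have d0' := ltW d0; have s1 : 1 < t + d by lra.
have mt := mass_gt0 t1; have ms := mass_gt0 s1.
have [mV lV iV nV] := kV.
have mD : cmeas2 (fun p q : MX R => Dk d p q) by exact: cmeas_Dk.
have D1 (p q : MX R) : cabs (Dk d p q) <= 1 by exact: cabs_Dk_le1.
have [_ iA1 iA2] := triple_swap kV kV mD D1.
set A := cint mu2 setT (fun p => cint mu2 setT (fun q => _)).
have mVD : cmeas2 (fun p e => V p e * Dk d p e) by exact: cmeasM.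
have iVD e : cintg mu2 setT (fun p => V p e * Dk d p e).
  apply: (@cintg_le _ _ _ mu2 setT measurableT _ (fun x => cabs (V x e))) => //.
  - exact: (@kgood_sec _ (fun p e => V p e * Dk d p e) e mVD).
  - by apply: measurable_cabs; case: (iV e).
  - by move=> x _; rewrite cabsM ler_piMr ?cabs_ge0.
  - by case: (iV e).
have FN e : cabs (F e) <= N1 V e.
  rewrite FE -lee_fin -(N1E (iV e)); apply: (@le_trans _ _ (\int[mu2]_p (cabs (V p e * Dk d p e))%:E)%E).
    by apply: ecabs_cint => //; case: (iVD e).
  apply: eI_le.
  - by apply: measurable_cabs; case: (iVD e).
  - by apply: measurable_cabs; case: (iV e).
  - by move=> x; exact: cabs_ge0.
  - by move=> x; rewrite cabsM ler_piMr ?cabs_ge0.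
have lF : cl2 F.
  apply: cl2_le nV.
  - rewrite (_ : F = fun e => cint mu2 setT (fun p => V p e * Dk d p e)); last exact/funext.
    exact: (@cmeas_cint22 _ (fun e x => V x e * Dk d x e) (cmeas2_swap mVD)).
  - by apply: measurable_funX; exact: measurable_N1.
  - by move=> e; rewrite ler_pXn2r ?nnegrE ?cabs_ge0 ?N1_ge0.
pose c := (mass (t + d))^-1.
have c0 : 0 < c by rewrite invr_gt0.
have cm : c%:C * (mass (t + d))%:C = 1 :> C by rewrite -rmorphM/= mulVf// lt0r_neq0.
suff key n : (mass t)%:C * cint mu2 setT (fun e => F e * (F e)^* * ibox n e) <= (mass (t + d))%:C * A.
  apply: (@ccvg_le (fun n => (mass t)%:C * cint mu2 setT (fun e => F e * (F e)^* * ibox n e))) => //.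
  apply: ccvgM; first exact: ccvg_cst.
  by apply: cint_ibox_cvg; apply: cl2M => //; exact: cl2J.
(* The test kernel is built from the truncation of F. As the indicator is its own square, F F^*, G
   F^* and G G^* agree after truncation, and all terms lead to the same N. *)
pose G e := F e * ibox n e.
have [lG iG] := cl2_mul_ibox n lF.
have iJ e : (ibox n e)^* = ibox n e by rewrite /ibox cJR.
have FG : (fun e => F e * (F e)^* * ibox n e) = fun e => G e * (F e)^*.
  by apply/funext => e; rewrite /G; ring.
have GG : (fun e => F e * (F e)^* * ibox n e) = fun e => G e * (G e)^*.
  by apply/funext => e; rewrite /G cJM iJ; case: (ibox01 n e) => ->; ring.
set N := cint mu2 setT (fun e => F e * (F e)^* * ibox n e).
have NE : N = (n2 G)%:C by rewrite /N GG cint_mulJ.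
pose Y p e := G p * Dk t p e.
have kY : kgood Y by exact: kgood_Dk.
have [mY lY iY nY] := kY.
pose H p e := V p e + (- c)%:C * Y p e.
have kH : kgood H by exact: (kgoodD kV (kgoodZ (- c)%:C kY)).
have [mH lH iH nH] := kH.
(* For every fixed e the form is that of D_d at the integrable function [H ^~ e], to which [pd_int]
   applies. *)
have pos : 0 <= cint mu2 setT (fun p => cint mu2 setT (fun q => Dk d p q * cint mu2 setT (fun e => H p e * (H q e)^*))).
  have [<- _ _] := triple_swap kH kH mD D1; apply: cint_ge0 => // e _.
  by apply: (pd_int (H := fun p => H p e)) => //; exact: iH.
have VY p q : cint mu2 setT (fun e => V p e * (Y q e)^*) = (mass t)%:C * (V p q * (G q)^*).
  rewrite (@eq_cint _ _ _ mu2 _ _ (fun e => (G q)^* * (V p e * Dk t e q))); last first.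
    by move=> e _; rewrite /Y cJM DkJ; ring.
  rewrite (cintZ measurableT); first by rewrite rV; ring.
  by apply: cl2M => //; exact: cl2_Dk'.
have YV p q : cint mu2 setT (fun e => Y p e * (V q e)^*) = (mass t)%:C * (G p * (V q p)^*).
  have := VY q p; move=> /(congr1 (fun z : C => z^*)).
  rewrite -(cintJ measurableT); last by apply: cl2M => //; exact: cl2J.
  rewrite (cJM (mass t)%:C) cJR (cJM (V q p)) conjcK => E; rewrite (mulrC (G p)) -E; apply: eq_cint => e _.
  by rewrite cJM conjcK mulrC.
have YY p q : cint mu2 setT (fun e => Y p e * (Y q e)^*) = (mass t)%:C * (G p * (G q)^* * Dk t p q).
  rewrite (@eq_cint _ _ _ mu2 _ _ (fun e => (G p * (G q)^*) * (Dk t p e * Dk t e q))); last first.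
    by move=> e _; rewrite /Y cJM DkJ; ring.
  rewrite (cintZ measurableT); first by rewrite (Dk_repro _ _ t1); ring.
  by apply: cl2M; [exact: cl2_Dk|exact: cl2_Dk'].
have HH p q : cint mu2 setT (fun e => H p e * (H q e)^*) =
    cint mu2 setT (fun e => V p e * (V q e)^*) - c%:C * cint mu2 setT (fun e => V p e * (Y q e)^*) -
    c%:C * cint mu2 setT (fun e => Y p e * (V q e)^*) +
    c%:C * (c%:C * cint mu2 setT (fun e => Y p e * (Y q e)^*)).
  have i1 := cl2M (lV p) (cl2J (lV q)); have i2 := cl2M (lV p) (cl2J (lY q)).
  have i3 := cl2M (lY p) (cl2J (lV q)); have i4 := cl2M (lY p) (cl2J (lY q)).
  rewrite -(cint_lin4 c%:C i1 i2 i3 i4); apply: eq_cint => e _.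
  by rewrite /H cJD cJM cJR rmorphN/=; ring.
have [_ iB1 iB2] := triple_swap kV kY mD D1.
have [_ iC1 iC2] := triple_swap kY kV mD D1.
have [_ iD1 iD2] := triple_swap kY kY mD D1.
pose T1 p q := Dk d p q * cint mu2 setT (fun e => V p e * (V q e)^*).
pose T2 p q := Dk d p q * cint mu2 setT (fun e => V p e * (Y q e)^*).
pose T3 p q := Dk d p q * cint mu2 setT (fun e => Y p e * (V q e)^*).
pose T4 p q := Dk d p q * cint mu2 setT (fun e => Y p e * (Y q e)^*).
have lin : cint mu2 setT (fun p => cint mu2 setT (fun q => Dk d p q * cint mu2 setT (fun e => H p e * (H q e)^*))) =
   A - c%:C * cint mu2 setT (fun p => cint mu2 setT (T2 p))
     - c%:C * cint mu2 setT (fun p => cint mu2 setT (T3 p))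
     + c%:C * (c%:C * cint mu2 setT (fun p => cint mu2 setT (T4 p))).
  have L1 p : cint mu2 setT (fun q => Dk d p q * cint mu2 setT (fun e => H p e * (H q e)^*)) =
      cint mu2 setT (T1 p) - c%:C * cint mu2 setT (T2 p) -
      c%:C * cint mu2 setT (T3 p) + c%:C * (c%:C * cint mu2 setT (T4 p)).
    apply: etrans (cint_lin4 c%:C (iA1 p : cintg mu2 setT (T1 p)) (iB1 p : cintg mu2 setT (T2 p))
      (iC1 p : cintg mu2 setT (T3 p)) (iD1 p : cintg mu2 setT (T4 p))).
    by apply: eq_cint => q _; rewrite HH /T1 /T2 /T3 /T4; ring.
  apply: etrans (cint_lin4 c%:C (iA2 : cintg mu2 setT (fun p => cint mu2 setT (T1 p)))
      (iB2 : cintg mu2 setT (fun p => cint mu2 setT (T2 p)))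
      (iC2 : cintg mu2 setT (fun p => cint mu2 setT (T3 p)))
      (iD2 : cintg mu2 setT (fun p => cint mu2 setT (T4 p)))).
  by apply: eq_cint => p _; exact: L1.
have E3 : cint mu2 setT (fun p => cint mu2 setT (T3 p)) = (mass t)%:C * N.
  rewrite /N FG -(cintZ measurableT); last by apply: cl2M => //; exact: cl2J.
  apply: eq_cint => p _; rewrite FE -(cintJ measurableT (iVD p)) mulrA.
  rewrite -(cintZ measurableT _ (cintgJ (iVD p))); apply: eq_cint => q _.
  by rewrite /T3 YV cJM DkJ; ring.
(* Unlike in [E3], the integral defining F runs over the outer variable p here, so the order of
   integration has to be exchanged. *)
have E2 : cint mu2 setT (fun p => cint mu2 setT (T2 p)) = (mass t)%:C * N.
  pose g p q := (mass t)%:C * ((G q)^* * (V p q * Dk d p q)).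
  have mg : cmeas2 (fun q p => g p q).
    apply: cmeasM; first exact: cmeas_cst.
    exact: (cmeasM (cmeas2_fst (cmeasJ iG.1))
      (cmeas2_swap mVD)).
  have mN := measurable_N1 mV.
  have mGa : measurable_fun setT (fun q => cabs (G q)) by apply: measurable_cabs; case: iG.
  have fin : (\int[mu2]_q \int[mu2]_p (cabs (g p q))%:E < +oo)%E.
    apply: (@le_lt_trans _ _ (\int[mu2]_q (mass t * (cabs (G q) * N1 V q))%:E)%E).
      apply: ge0_le_integral => //.
      - by move=> q _; rewrite eI_ge0// => p; exact: cabs_ge0.
      - exact: (@measurable_eint22 _ (fun q p => g p q) mg).
      - by apply/measurable_EFinP; apply: measurable_funM => //; exact: measurable_funM.
      move=> q _; rewrite mulrA EFinM -(N1E (iV q)) -eI_Z ?mulr_ge0 ?cabs_ge0 ?(ltW mt)//; last first.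
      - by move=> p; exact: cabs_ge0.
      - by apply: measurable_cabs; case: (iV q).
      apply: eI_le.
      - by apply: measurable_cabs; exact: (@cmeas_sec1 _ _ _ _ _ (fun q p => g p q) q mg).
      - by apply: measurable_funM => //; apply: measurable_cabs; case: (iV q).
      - by move=> p; exact: cabs_ge0.
      move=> p; rewrite (cabsM (mass t)%:C) (cabsM (G q)^*) (cabsM (V p q)) cabsJ cabs_real.
      rewrite ger0_norm ?(ltW mt)// -mulrA ler_wpM2l ?(ltW mt)// ler_wpM2l ?cabs_ge0//.
      by rewrite ler_piMr ?cabs_ge0// D1.
    rewrite eI_Z ?(ltW mt)//; [|exact: measurable_funM|by move=> q; rewrite mulr_ge0 ?cabs_ge0 ?N1_ge0].
    rewrite lte_mul_pinfty ?lee_fin ?(ltW mt)//; apply: int_mul_fin => //.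
    - by move=> q; exact: cabs_ge0.
    - by move=> q; exact: N1_ge0.
    - by case: lG.
  have := @cfubini22 _ (fun q p => g p q) mg fin.
  have -> : cint mu2 setT (fun q => cint mu2 setT (fun p => g p q)) = (mass t)%:C * N.
    have -> : N = cint mu2 setT (fun q => (G q)^* * F q).
      rewrite /N; apply: eq_cint => q _.
      by rewrite /G cJM iJ; ring.
    rewrite -(cintZ measurableT); last by apply: cl2M => //; exact: cl2J.
    apply: eq_cint => q _; rewrite FE /g.
    by rewrite (cintZ measurableT) ?(cintZ measurableT)//; exact: cintgZ.
  move=> ->; apply: eq_cint => p _; apply: eq_cint => q _.
  by rewrite /T2 VY /g; ring.
(* The integral over e gives D_t(p, q), and D_t D_d = D_(t+d); the bound is then [contraction] in
   weight t + d. This is where mass(t + d) enters. *)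
have E4 : cint mu2 setT (fun p => cint mu2 setT (T4 p)) <= (mass t)%:C * ((mass (t + d))%:C * N).
  have := contraction s1 iG lG; rewrite -/G => H4.
  have -> : cint mu2 setT (fun p => cint mu2 setT (T4 p)) =
     (mass t)%:C * cint mu2 setT (fun p => cint mu2 setT (fun q => G p * (G q)^* * Dk (t + d) p q)).
    have T4E p q : T4 p q = (mass t)%:C * (G p * (G q)^* * Dk (t + d) p q).
      by rewrite /T4 YY DkD; ring.
    have mt1 : (((mass t)^-1)%:C * (mass t)%:C = 1 :> C) by rewrite -rmorphM/= mulVf// lt0r_neq0.
    have T4E' p q : G p * (G q)^* * Dk (t + d) p q = ((mass t)^-1)%:C * T4 p q.
      by rewrite T4E mulrA mt1 mul1r.
    have i1 p : cintg mu2 setT (fun q => G p * (G q)^* * Dk (t + d) p q).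
      rewrite (_ : (fun q => _) = fun q => ((mass t)^-1)%:C * T4 p q); last by apply/funext.
      exact: (cintgZ measurableT ((mass t)^-1)%:C (iD1 p : cintg mu2 setT (T4 p))).
    have E p : cint mu2 setT (T4 p) = (mass t)%:C * cint mu2 setT (fun q => G p * (G q)^* * Dk (t + d) p q).
      by rewrite -(cintZ measurableT _ (i1 p)); apply: eq_cint => q _.
    rewrite -(cintZ measurableT); first by apply: eq_cint => p _.
    rewrite (_ : (fun p => _) = fun p => ((mass t)^-1)%:C * cint mu2 setT (T4 p)); last first.
      by apply/funext => p; rewrite E mulrA mt1 mul1r.
    exact: (cintgZ measurableT ((mass t)^-1)%:C (iD2 : cintg mu2 setT (fun p => cint mu2 setT (T4 p)))).
  apply: ler_wpM2l; first by rewrite lecR ltW.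
  by rewrite (_ : (mass (t + d))%:C * N = (mass (t + d) * n2 G)%:C)// NE rmorphM.
exact: (quadratic_conclusion mt ms pos lin E2 E3 E4).
Qed.

End MainInequality.

(** * Differentiation of the inequality at d = 0 *)

Section LogInequality.
Context {R : realType}.
Local Notation C := R[i].
Local Notation X := (R * R)%type.
Local Notation mu2 := (@lebesgue_measure R \x @lebesgue_measure R)%E.
Implicit Types (V W B : MX R -> MX R -> C) (h F : MX R -> C) (p q e x y : MX R) (s t d : R).

Lemma cmeas2_snd h : cmeas setT h -> cmeas2 (fun _ p => h p).
Proof. exact: (@cmeas_snd _ _ (MX R) (MX R) R h). Qed.

Lemma kgood_abs V : kgood V -> kgood (fun p e => (cabs (V p e))%:C).
Proof.
move=> [mV lV iV nV].
have mC (dd : measure_display) (T : measurableType dd) (f : T -> C) : cmeas setT f -> cmeas setT (fun z => (cabs (f z))%:C).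
  by move=> mf; apply: cmeas_real; exact: measurable_cabs.
have E e : N1 (fun p e => (cabs (V p e))%:C) e = N1 V e.
  rewrite N1.unlock; congr fine; apply: eq_integral => x _.
  by rewrite cabs_real ger0_norm// cabs_ge0.
split.
- exact: mC.
- move=> x; have [m f] := lV x; split; first exact: mC.
  by under eq_integral do rewrite cabs_real ger0_norm ?cabs_ge0//.
- move=> e; have [m f] := iV e; split; first exact: mC.
  by under eq_integral do rewrite cabs_real ger0_norm ?cabs_ge0//.
by under eq_integral do rewrite E.
Qed.

Lemma cint_prodJ h F : cintg mu2 setT h -> cintg mu2 setT F ->
  cint mu2 setT h * (cint mu2 setT F)^* = cint mu2 setT (fun x => cint mu2 setT (fun y => h x * (F y)^*)).
Proof.
move=> ih iF; have iJ := cintgJ iF.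
rewrite -(cintJ measurableT iF) -(cintZr measurableT _ ih).
by apply: eq_cint => x _; rewrite (cintZ measurableT _ iJ).
Qed.

Lemma cmeas2_sec V p : cmeas2 V -> cmeas setT (V p).
Proof. exact: (@cmeas_sec1 _ _ (MX R) (MX R) R V p). Qed.

Lemma kgood_dom V V' : kgood V -> cmeas2 V' -> (forall p e, cabs (V' p e) <= cabs (V p e)) -> kgood V'.
Proof.
move=> [mV lV iV nV] mV' le.
have iV' e : cintg mu2 setT (V' ^~ e).
  apply: (@cintg_le _ _ _ mu2 setT measurableT _ (fun p => cabs (V p e))) => //; first exact: kgood_sec.
  - by apply: measurable_cabs; case: (iV e).
  - by case: (iV e).
split => //.
- move=> x; apply: (@cl2_le _ _ (fun e => cabs (V x e) ^+ 2)) => //.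
  + exact: cmeas2_sec.
  + by apply: measurable_funX; apply: measurable_cabs; case: (lV x).
  + by move=> e; rewrite ler_sqr ?nnegrE ?cabs_ge0.
  + by case: (lV x).
apply: le_lt_trans nV; apply: eI_le.
- by apply: measurable_funX; exact: measurable_N1.
- by apply: measurable_funX; exact: measurable_N1.
- by move=> e; exact: sqr_ge0.
move=> e; rewrite ler_sqr ?nnegrE ?N1_ge0// -lee_fin -!N1E//; apply: eI_le => //.
- by apply: measurable_cabs; case: (iV' e).
- by apply: measurable_cabs; case: (iV e).
- by move=> p; exact: cabs_ge0.
Qed.

Definition cmeas3 (G : MX R -> MX R -> MX R -> C) :=
  cmeas (setT : set ((MX R * MX R) * MX R)) (fun v => G v.1.1 v.1.2 v.2).

Lemma cmeas3_sec1 G p : cmeas3 G -> cmeas2 (G p).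
Proof.
move=> mG; apply: (cmeas_comp (h := fun v : MX R * MX R => ((p, v.1), v.2)) _ mG).
apply: measurable_fun_pair; last exact: measurable_snd.
by apply: measurable_fun_pair; [exact: measurable_cst|exact: measurable_fst].
Qed.

Lemma cmeas3_cint G : cmeas3 G -> cmeas2 (fun p q => cint mu2 setT (G p q)).
Proof.
move=> mG.
exact: (@cmeas_cint1 _ _ (MX R * MX R)%type (MX R) R leb2 (fun v e => G v.1 v.2 e) mG).
Qed.

Lemma triple_integrable V : kgood V ->
  let J p q := cint mu2 setT (fun e => (cabs (V p e))%:C * (cabs (V q e))%:C) in
  [/\ forall p q, cintg mu2 setT (fun e => (cabs (V p e))%:C * (cabs (V q e))%:C),
      forall p, cintg mu2 setT (J p) & cintg mu2 setT (fun p => cint mu2 setT (J p))].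
Proof.
move=> /kgood_abs kV J; have [mV lV iV nV] := kV.
have m1 : cmeas2 (fun _ _ : MX R => 1 : C) by exact: cmeas_cst.
have [|_ i1 i2] := triple_swap kV kV m1; first by move=> x y; rewrite cabs1.
have JE p q : 1 * cint mu2 setT (fun e => (cabs (V p e))%:C * ((cabs (V q e))%:C)^*) = J p q.
  by rewrite mul1r; apply: eq_cint => e _; rewrite cJR.
split.
- by move=> p q; apply: cl2M.
- move=> p; rewrite (_ : J p = fun q => 1 * cint mu2 setT (fun e => (cabs (V p e))%:C * ((cabs (V q e))%:C)^*)).
    exact: i1.
  by apply/funext => q; rewrite JE.
rewrite (_ : (fun p => cint mu2 setT (J p)) = fun p => cint mu2 setT (fun q =>
    1 * cint mu2 setT (fun e => (cabs (V p e))%:C * ((cabs (V q e))%:C)^*)))//.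
by apply/funext => p; apply: eq_cint => q _; rewrite JE.
Qed.

Lemma cabs_cint_dom (f : MX R -> C) (g : MX R -> R) : cmeas setT f ->
  cintg mu2 setT (fun x => (g x)%:C) -> (forall x, cabs (f x) <= g x) ->
  cintg mu2 setT f /\ cabs (cint mu2 setT f) <= complex.Re (cint mu2 setT (fun x => (g x)%:C)).
Proof.
move=> mf [mg fg] fle.
have g0 x : 0 <= g x by rewrite (le_trans (cabs_ge0 _) (fle x)).
have fg' : (\int[mu2]_x (g x)%:E < +oo)%E.
  by move: fg; under eq_integral do rewrite cabs_real ger0_norm//.
have iF : cintg mu2 setT f by apply: (@cintg_le _ _ _ mu2 setT measurableT _ g) => //; case: mg.
split => //; apply: (@cabs_cint_le _ _ _ mu2 setT measurableT f g) => //.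
by case: mg.
Qed.

Lemma cint_dom_cvg (f_ : nat -> MX R -> C) f (g : MX R -> R) :
  (forall n, cmeas setT (f_ n)) -> (forall x, ccvg \oo (fun n => f_ n x) (f x)) ->
  cintg mu2 setT (fun x => (g x)%:C) -> (forall n x, cabs (f_ n x) <= g x) ->
  ccvg \oo (fun n => cint mu2 setT (f_ n)) (cint mu2 setT f).
Proof.
move=> mf cf [mg fg] fle.
have g0 x : 0 <= g x by rewrite (le_trans (cabs_ge0 _) (fle 0%N x)).
have fg' : (\int[mu2]_x (g x)%:E < +oo)%E.
  by move: fg; under eq_integral do rewrite cabs_real ger0_norm//.
have [] := @cint_dominated _ _ R mu2 setT measurableT f_ f g mf (fun x _ => cf x) _ fg' (fun n x _ => fle n x).
  by case: mg.
by [].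
Qed.

(** Dominated convergence three times, from the inside out; the dominating functions are the
    iterated integrals of |V(p, e)| |V(q, e)|. *)
Lemma triple_dominated V (G_ : nat -> MX R -> MX R -> MX R -> C) G : kgood V ->
  (forall n, cmeas3 (G_ n)) -> (forall p q e, ccvg \oo (fun n => G_ n p q e) (G p q e)) ->
  (forall n p q e, cabs (G_ n p q e) <= cabs (V p e) * cabs (V q e)) ->
  ccvg \oo (fun n => cint mu2 setT (fun p => cint mu2 setT (fun q => cint mu2 setT (G_ n p q))))
    (cint mu2 setT (fun p => cint mu2 setT (fun q => cint mu2 setT (G p q)))).
Proof.
move=> kV mG cG bG; have [i0 i1 i2] := triple_integrable kV.
set J := (J in forall p, cintg mu2 setT (J p)) in i1 i2.
have eJ p q : (fun e => (cabs (V p e))%:C * (cabs (V q e))%:C) = (fun e => (cabs (V p e) * cabs (V q e))%:C) :> (MX R -> C).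
  by apply/funext => e; rewrite -rmorphM.
have JR p q : J p q = (complex.Re (J p q))%:C.
  by rewrite /J eJ (cint_real mu2 measurableT (fun e : MX R => cabs (V p e) * cabs (V q e))).
have eJ1 p : J p = (fun q => (complex.Re (J p q))%:C) by apply/funext => q; exact: JR.
have J2R p : cint mu2 setT (J p) = (complex.Re (cint mu2 setT (J p)))%:C.
  by rewrite eJ1 (cint_real mu2 measurableT (fun q : MX R => complex.Re (J p q))).
have eJ2 : (fun p => cint mu2 setT (J p)) = (fun p => (complex.Re (cint mu2 setT (J p)))%:C).
  by apply/funext => p; exact: J2R.
have i0' p q : cintg mu2 setT (fun e => (cabs (V p e) * cabs (V q e))%:C) by rewrite -eJ.
have i1' p : cintg mu2 setT (fun q => (complex.Re (J p q))%:C) by have := i1 p; rewrite (eJ1 p).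
have i2' : cintg mu2 setT (fun p => (complex.Re (cint mu2 setT (J p)))%:C) by move: i2; rewrite eJ2.
have mG1 n p q : cmeas setT (G_ n p q).
  by apply: cmeas2_sec; exact: cmeas3_sec1.
have mG2 n p : cmeas setT (fun q => cint mu2 setT (G_ n p q)).
  by apply: (@cmeas2_sec (fun p q => cint mu2 setT (G_ n p q))); exact: cmeas3_cint.
have mG3 n : cmeas setT (fun p => cint mu2 setT (fun q => cint mu2 setT (G_ n p q))).
  exact: (@cmeas_cint22 _ (fun p q => cint mu2 setT (G_ n p q)) (cmeas3_cint (mG n))).
have b1 n p q : cabs (cint mu2 setT (G_ n p q)) <= complex.Re (J p q).
  have [_] := @cabs_cint_dom (G_ n p q) (fun e => cabs (V p e) * cabs (V q e)) (mG1 n p q) (i0' p q) (bG n p q).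
  by rewrite -eJ.
have b2 n p : cabs (cint mu2 setT (fun q => cint mu2 setT (G_ n p q))) <= complex.Re (cint mu2 setT (J p)).
  have [_] := @cabs_cint_dom (fun q => cint mu2 setT (G_ n p q)) (fun q => complex.Re (J p q)) (mG2 n p) (i1' p) (b1 n p).
  by rewrite -(eJ1 p).
have c1 p q : ccvg \oo (fun n => cint mu2 setT (G_ n p q)) (cint mu2 setT (G p q)).
  exact: (@cint_dom_cvg (fun n => G_ n p q) (G p q) (fun e => cabs (V p e) * cabs (V q e)) (fun n => mG1 n p q) (cG p q) (i0' p q) (fun n => bG n p q)).
have c2 p := @cint_dom_cvg (fun n q => cint mu2 setT (G_ n p q)) (fun q => cint mu2 setT (G p q))
  (fun q => complex.Re (J p q)) (fun n => mG2 n p) (c1 p) (i1' p) (fun n => b1 n p).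
exact: (@cint_dom_cvg (fun n p => cint mu2 setT (fun q => cint mu2 setT (G_ n p q)))
  (fun p => cint mu2 setT (fun q => cint mu2 setT (G p q)))
  (fun p => complex.Re (cint mu2 setT (J p))) mG3 c2 i2' b2).
Qed.

Lemma cmeas_clog_qz : cmeas2 (fun p q => clog (qz p q)).
Proof.
apply: (@ccvg_cmeas2 R (fun p q => clog (qz p q))) => p q.
apply: (@ccvg_comp _ _ _ _ (fun u : X * X => qz u.1 u.2) (@clog R) (qz p q)); last first.
  by apply: clog_ccont; exact: Re_qz.
rewrite qz.unlock; apply: ccvg_qker.
  by apply: ccvgJ; apply: ccvg_hpt; exact: cvg_fst.
by apply: ccvg_hpt; exact: cvg_snd.
Qed.

Let m11 : measurable_fun setT (fun v : (MX R * MX R) * MX R => v.1.1).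
Proof. by apply: measurableT_comp; exact: measurable_fst. Qed.
Let m12 : measurable_fun setT (fun v : (MX R * MX R) * MX R => v.1.2).
Proof. by apply: measurableT_comp; [exact: measurable_snd|exact: measurable_fst]. Qed.
Let m2 : measurable_fun setT (fun v : (MX R * MX R) * MX R => v.2).
Proof. exact: measurable_snd. Qed.

Lemma cmeas3_12 V : cmeas2 V -> cmeas3 (fun p q _ => V p q).
Proof. by move=> mV; exact: (cmeas2_comp mV m11 m12). Qed.
Lemma cmeas3_13 V : cmeas2 V -> cmeas3 (fun p _ e => V p e).
Proof. by move=> mV; exact: (cmeas2_comp mV m11 m2). Qed.
Lemma cmeas3_23 V : cmeas2 V -> cmeas3 (fun _ q e => V q e).
Proof. by move=> mV; exact: (cmeas2_comp mV m12 m2). Qed.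
Lemma cmeas3_3 h : cmeas setT h -> cmeas3 (fun _ _ e => h e).
Proof. by move=> mh; apply: (cmeas_comp (h := fun v : (MX R * MX R) * MX R => v.2) _ mh). Qed.

Lemma cmeas3_lbX : cmeas3 (fun p q e => lbX p e q).
Proof.
have mq := cmeas_clog_qz.
apply: cmeasB; last exact: (cmeas3_23 (cmeas2_swap mq)).
apply: cmeasB; last exact: (cmeas3_13 mq).
apply: cmeasD; first exact: (cmeas3_12 mq).
apply: (@cmeas3_3 (fun e => (e.2)%:C)); apply: cmeas_real; exact: measurable_snd.
Qed.

Lemma Dk_lbX d p e q : Dk d p e * Dk d e q = cexp (d%:C * lbX p e q) * Dk d p q.
Proof. by rewrite -cpow_bX_Dk cpowE ?bX_neq0// clog_bX. Qed.

(* (t - 1 + d) e^(d L) - (t - 1) = d (1 + (t - 1) L) + O(d^2) *)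
Lemma weight_taylor t d p e q : 1 < t -> 0 < d -> d <= 1 / 2 ->
  cabs ((d^-1)%:C * ((t - 1 + d)%:C * cexp (d%:C * lbX p e q) - (t - 1)%:C) - (1 + (t - 1)%:C * lbX p e q))
    <= d * (2 * t * 3 * (1 + cabs (lbX p e q) + cabs (lbX p e q) ^+ 2)).
Proof.
move=> t1 d0 d2.
have Rel : complex.Re (lbX p e q) <= 1.
  by rewrite -clog_bX; exact: ln_cabs_bX.
move: (lbX p e q) Rel => l Rel.
set w := (d^-1)%:C * _; set L := cabs l; have L0 : 0 <= L by exact: cabs_ge0.
have Re2 : complex.Re (d%:C * l) <= 1 / 2 by rewrite cReMl; nra.
have := cexp_taylor1 Re2; rewrite cabsM cabs_real (ger0_norm (ltW d0)) -/L.
set z := cexp _ - 1 - _ => hz.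
have ez : cexp (d%:C * l) = z + 1 + d%:C * l by rewrite /z; ring.
have dd : (d^-1)%:C * d%:C = 1 :> C by rewrite -rmorphM/= mulVf// lt0r_neq0.
have wE : w - (1 + (t - 1)%:C * l) = d%:C * l + (d^-1)%:C * ((t - 1 + d)%:C * z).
  rewrite /w ez rmorphD/=.
  transitivity ((d^-1)%:C * d%:C * (1 + (t - 1)%:C * l + d%:C * l) + (d^-1)%:C * (((t - 1)%:C + d%:C) * z) -
      (1 + (t - 1)%:C * l)); first by ring.
  by rewrite dd; ring.
rewrite wE (le_trans (cabsD _ _))// !cabsM !cabs_real !ger0_norm ?invr_ge0 ?(ltW d0)//; last by lra.
rewrite -/L.
have : d^-1 * ((t - 1 + d) * cabs z) <= (t - 1 + d) * (3 * d * L ^+ 2).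
  rewrite mulrCA ler_wpM2l//; first by lra.
  rewrite mulrC ler_pdivrMr//; apply: (le_trans hz); rewrite exprMn; nra.
have : (t - 1 + d) * (3 * d * L ^+ 2) <= t * (3 * d * L ^+ 2).
  by apply: ler_wpM2r; [rewrite mulr_ge0 ?sqr_ge0//; lra|lra].
have : 0 <= d * L ^+ 2 by rewrite mulr_ge0 ?sqr_ge0 ?(ltW d0).
have : 0 <= d * L by rewrite mulr_ge0 // (ltW d0).
move=> h1 h2 h3 h4.
have h5 : t * (3 * d * L ^+ 2) <= 2 * t * 3 * (d * L ^+ 2) by nra.
have h6 : d * L <= 2 * t * 3 * (d * L) by nra.
nra.
Qed.

Lemma scaled_le (A B : C) (m m' a b c : R) : 0 < m' -> 0 <= a -> 0 <= c -> a * m = b * m' ->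
  m%:C * A <= m'%:C * B -> c%:C * (b%:C * A - a%:C * B) <= 0.
Proof.
move=> m'0 a0 c0 e h; rewrite mulr_ge0_le0 ?lecR// subr_le0.
rewrite -(@ler_pM2l _ m'%:C) ?ltcR// mulrA -rmorphM/= (mulrC m') -e rmorphM/= -mulrA.
rewrite (mulrCA m'%:C); apply: ler_wpM2l => //; by rewrite lecR.
Qed.

(** The logarithm is unbounded, so V does not dominate its own differentiated form. The kernel W
    absorbs the first two powers of the logarithm, the second one being needed for the Taylor
    remainder, and thus gives a dominating function uniform in d. *)
Theorem log_inequality t V W : 1 < t -> kgood V -> kgood W ->
  (forall p x, cint mu2 setT (fun e => V p e * Dk t e x) = (mass t)%:C * V p x) ->
  (forall p q e, cabs (V p e) * cabs (V q e) * (1 + cabs (lbX p e q) + cabs (lbX p e q) ^+ 2)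
     <= cabs (W p e) * cabs (W q e)) ->
  cint mu2 setT (fun p => cint mu2 setT (fun q => cint mu2 setT (fun e =>
     V p e * (V q e)^* * (1 + (t - 1)%:C * lbX p e q)))) <= 0.
Proof.
move=> t1 kV kW rV VW; have [mV lV iV nV] := kV.
(* Starting at 1/2 keeps d in the range of [weight_taylor]. *)
pose dn n : R := (n.+2%:R)^-1.
have dn0 n : 0 < dn n by rewrite invr_gt0 ltr0n.
have dn2 n : dn n <= 1 / 2.
  by rewrite /dn div1r lef_pV2 ?posrE ?ltr0n// ler_nat.
pose w n p q e := (dn n)^-1%:C * ((t - 1 + dn n)%:C * cexp ((dn n)%:C * lbX p e q) - (t - 1)%:C).
pose G_ n p q e := V p e * (V q e)^* * w n p q e * Dk (dn n) p q.
(* A generous constant: the Taylor error at d <= 1/2 contributes at most 3 t and the main term 1 +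
   (t - 1) L at most t. That K >= 1 matters because [W'] enters the bound twice. *)
pose K : R := 12 * t + 2.
have K0 : 0 < K by rewrite /K; lra.
pose W' p e := (K%:C : C) * W p e.
have kW' : kgood W' by exact: kgoodZ.
have mL := cmeas3_lbX.
(* Measurability comes from writing the exponential as a product of kernels [Dk]. *)
have mexp n : cmeas3 (fun p q e => cexp ((dn n)%:C * lbX p e q)).
  have mD := cmeas_Dk (dn n) (R := R).
  have E : (fun p q e => cexp ((dn n)%:C * lbX p e q)) =
      fun p q e => Dk (dn n) p e * (Dk (dn n) q e)^* * (Dk (- dn n) p q).
    apply/funext => p; apply/funext => q; apply/funext => e.
    rewrite DkJ Dk_lbX -mulrA -DkD subrr (_ : Dk 0 p q = 1) ?mulr1//.
    by rewrite DkE mul0r cexp0.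
  rewrite E; apply: cmeasM; last exact: (cmeas3_12 (cmeas_Dk _)).
  by apply: cmeasM; [exact: (cmeas3_13 mD)|apply: cmeasJ; exact: (cmeas3_23 mD)].
have mG n : cmeas3 (G_ n).
  apply: cmeasM; last exact: (cmeas3_12 (cmeas_Dk _)).
  apply: cmeasM; first by apply: cmeasM; [exact: (cmeas3_13 mV)|apply: cmeasJ; exact: (cmeas3_23 mV)].
  apply: cmeasM; first exact: (@cmeas_cst _ _ _ _ ((dn n)^-1%:C : C)).
  apply: cmeasB; last exact: (@cmeas_cst _ _ _ _ ((t - 1)%:C : C)).
  apply: cmeasM; last exact: mexp.
  exact: (@cmeas_cst _ _ _ _ ((t - 1 + dn n)%:C : C)).
have wle n p q e : cabs (w n p q e) <= K * (1 + cabs (lbX p e q) + cabs (lbX p e q) ^+ 2).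
  have := weight_taylor p e q t1 (dn0 n) (dn2 n); rewrite -/(w n p q e).
  set L := cabs (lbX p e q) => h; have L0 : 0 <= L by exact: cabs_ge0.
  have -> : w n p q e = (w n p q e - (1 + (t - 1)%:C * lbX p e q)) + (1 + (t - 1)%:C * lbX p e q) by ring.
  rewrite (le_trans (cabsD _ _))//.
  have h2 : cabs (1 + (t - 1)%:C * lbX p e q) <= 1 + (t - 1) * L.
    rewrite (le_trans (cabsD _ _))// cabs1 cabsM cabs_real ger0_norm//; lra.
  have S0 : 0 <= 2 * t * 3 * (1 + L + L ^+ 2) by have := sqr_ge0 L; nra.
  have h3 := ler_wpM2r S0 (dn2 n).
  apply: (le_trans (lerD (le_trans h h3) h2)).
  rewrite /K; have := sqr_ge0 L; nra.
have bG n p q e : cabs (G_ n p q e) <= cabs (W' p e) * cabs (W' q e).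
  have -> : cabs (G_ n p q e) = cabs (V p e) * cabs (V q e) * cabs (w n p q e) * cabs (Dk (dn n) p q).
    rewrite /G_ cabsM; congr (_ * _); rewrite cabsM; congr (_ * _).
    by rewrite cabsM cabsJ.
  rewrite /W' !(cabsM _ (W _ _)) cabs_real (ger0_norm (ltW K0)).
  have d1 := cabs_Dk_le1 p q (ltW (dn0 n)).
  have h := VW p q e; have hw := wle n p q e.
  have v0 : 0 <= cabs (V p e) * cabs (V q e) by rewrite mulr_ge0 ?cabs_ge0.
  apply: (@le_trans _ _ (cabs (V p e) * cabs (V q e) * cabs (w n p q e))).
    by apply: ler_piMr => //; rewrite mulr_ge0 ?cabs_ge0.
  apply: (le_trans (ler_wpM2l v0 hw)).
  rewrite mulrCA; apply: (le_trans (ler_wpM2l (ltW K0) h)).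
  have : 0 <= cabs (W p e) * cabs (W q e) by rewrite mulr_ge0 ?cabs_ge0.
  have : 1 <= K by rewrite /K; lra.
  move=> K1 w0; rewrite mulrACA -expr2 ler_wpM2r// expr2 ler_peMr// (ltW K0)//.
have dncvg : dn n @[n --> \oo] --> (0 : R).
  have := @cvg_harmonic R; rewrite -(cvg_shiftS (harmonic : nat -> R)); exact.
have cG p q e : ccvg \oo (fun n => G_ n p q e) (V p e * (V q e)^* * (1 + (t - 1)%:C * lbX p e q)).
  rewrite -[X in ccvg _ _ X]mulr1; apply: ccvgM; first (apply: ccvgM; first exact: ccvg_cst).
    move=> eps eps0; set S := 2 * t * 3 * (1 + cabs (lbX p e q) + cabs (lbX p e q) ^+ 2).
    have S0 : 0 < S.
      have := cabs_ge0 (lbX p e q); have := sqr_ge0 (cabs (lbX p e q)); rewrite /S; nra.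
    have /cvgrPdist_lt/(_ (eps / S)) := dncvg.
    rewrite divr_gt0// => /(_ isT); apply: filterS => n.
    rewrite sub0r normrN ger0_norm ?(ltW (dn0 n))// => hn.
    rewrite cabsC; apply: (le_lt_trans (weight_taylor p e q t1 (dn0 n) (dn2 n))).
    by rewrite -ltr_pdivlMr.
  rewrite (_ : 1 = Dk 0 p q); last by rewrite DkE mul0r cexp0.
  under [X in ccvg _ X]eq_fun do rewrite DkE; rewrite DkE.
  apply: (@ccvg_comp _ _ _ _ (fun n => (dn n)%:C * (((p.2 + q.2) / 2)%:C - clog (qz p q))) cexp
     (0%:C * (((p.2 + q.2) / 2)%:C - clog (qz p q)))); last by apply: chol_ccont; exact: cexp_chol.
  by apply: ccvgM; [exact: ccvg_real|exact: ccvg_cst].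
apply: (ccvg_le (triple_dominated kW' mG cG bG)) => n.
set d := dn n; have d0 : 0 < d := dn0 n; have d0' := ltW d0.
have mD := cmeas_Dk d (R := R).
have D1 (p q : MX R) : cabs (Dk d p q) <= 1 by exact: cabs_Dk_le1.
pose VD p e := V p e * Dk d p e.
have kVD : kgood VD.
  apply: (kgood_dom kV); first by apply: cmeasM => //; exact: mD.
  by move=> p e; rewrite /VD cabsM ler_piMr ?cabs_ge0.
have m1 : cmeas2 (fun _ _ : MX R => 1 : C) by exact: (@cmeas_cst _ _ _ _ (1 : C)).
have [|sw1 i11 i12] := triple_swap kVD kVD m1; first by move=> x y; rewrite cabs1.
have [|_ i21 i22] := triple_swap kV kV mD; first exact: D1.
have [mVD lVD iVD nVD] := kVD.
pose a p q := cint mu2 setT (fun e => VD p e * (VD q e)^*).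
pose b p q := Dk d p q * cint mu2 setT (fun e => V p e * (V q e)^*).
have a1 : (fun p q => 1 * cint mu2 setT (fun e => VD p e * (VD q e)^*)) = a.
  by apply/funext => p; apply/funext => q; rewrite mul1r.
have {}i11 p : cintg mu2 setT (a p) by rewrite -a1; exact: i11.
have {}i12 : cintg mu2 setT (fun p => cint mu2 setT (a p)) by rewrite -a1; exact: i12.
have {}i21 p : cintg mu2 setT (b p) by exact: i21.
have {}i22 : cintg mu2 setT (fun p => cint mu2 setT (b p)) by exact: i22.
have RI := @restriction_inequality _ t d V (fun e => cint mu2 setT (fun p => VD p e)) t1 d0 kV rV (fun=> erefl).
have FE : cint mu2 setT (fun e => cint mu2 setT (fun p => VD p e) * (cint mu2 setT (fun p => VD p e))^*) =
    cint mu2 setT (fun p => cint mu2 setT (a p)).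
  rewrite -a1 -sw1; apply: eq_cint => e _.
  rewrite (cint_prodJ (iVD e) (iVD e)).
  by apply: eq_cint => x _; apply: eq_cint => y _; rewrite mulr1.
rewrite FE -/b in RI.
set c1 : C := (t - 1 + d)%:C; set c2 : C := (t - 1)%:C; set c3 : C := (d^-1)%:C.
have GE p q : cint mu2 setT (G_ n p q) = c3 * (c1 * a p q - c2 * b p q).
  have i1 : cintg mu2 setT (fun e => VD p e * (VD q e)^*) by exact: (cl2M (lVD p) (cl2J (lVD q))).
  have i2 : cintg mu2 setT (fun e => V p e * (V q e)^*) by exact: (cl2M (lV p) (cl2J (lV q))).
  have E e : G_ n p q e = c3 * (c1 * (VD p e * (VD q e)^*) - c2 * (Dk d p q * (V p e * (V q e)^*))).
    have : (VD p e * (VD q e)^*) = V p e * (V q e)^* * (cexp (d%:C * lbX p e q) * Dk d p q).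
      rewrite -Dk_lbX /VD (cJM (V q e)) -(DkJ d q e); move: (V q e)^* (Dk d q e)^* => u v; ring.
    by move=> ->; rewrite /G_ /w -/d -/c1 -/c2 -/c3; ring.
  rewrite (_ : G_ n p q = fun e => c3 * (c1 * (VD p e * (VD q e)^*) - c2 * (Dk d p q * (V p e * (V q e)^*)))); last by apply/funext; exact: E.
  have j1 := cintgZ measurableT c1 i1.
  have j2 := cintgZ measurableT (Dk d p q) i2.
  have j3 := cintgZ measurableT c2 j2.
  have j4 := cintgB measurableT j1 j3.
  rewrite (cintZ measurableT c3 j4) (cintB measurableT j1 j3).
  by rewrite (cintZ measurableT c1 i1) (cintZ measurableT c2 j2) (cintZ measurableT (Dk d p q) i2).
have -> : (fun p => cint mu2 setT (fun q => cint mu2 setT (G_ n p q))) =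
    fun p => c3 * (c1 * cint mu2 setT (a p) - c2 * cint mu2 setT (b p)).
  apply/funext => p.
  rewrite (_ : (fun q => cint mu2 setT (G_ n p q)) = fun q => c3 * (c1 * a p q - c2 * b p q)); last first.
    by apply/funext => q; exact: GE.
  have j1 := cintgZ measurableT c1 (i11 p).
  have j2 := cintgZ measurableT c2 (i21 p).
  rewrite (cintZ measurableT c3 (cintgB measurableT j1 j2)) (cintB measurableT j1 j2).
  by rewrite (cintZ measurableT c1 (i11 p)) (cintZ measurableT c2 (i21 p)).
have j1 := cintgZ measurableT c1 i12.
have j2 := cintgZ measurableT c2 i22.
rewrite (cintZ measurableT c3 (cintgB measurableT j1 j2)) (cintB measurableT j1 j2).
rewrite (cintZ measurableT c1 i12) (cintZ measurableT c2 i22).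
move: RI; rewrite -/(b).
have s1 : 1 < t + d by lra.
apply: (scaled_le (mass_gt0 s1)); [by rewrite subr_ge0 ltW|by rewrite invr_ge0|].
by rewrite (mass_const t1 s1); congr (_ * _); ring.
Qed.

End LogInequality.

(** * Operators and symbols *)

Section PositiveKernels.
Context {R : realType}.
Local Notation C := R[i].
Local Notation mu2 := (@lebesgue_measure R \x @lebesgue_measure R)%E.
Implicit Types (K : MX R -> MX R -> C) (h F : MX R -> C) (p q e x y : MX R) (s t : R).

Definition qform K (v : seq (C * MX R)) : C := \sum_(a <- v) \sum_(b <- v) a.1 * (b.1)^* * K a.2 b.2.

Lemma qform_cons K c y v : (forall x z, K z x = (K x z)^*) ->
  qform K ((c, y) :: v) = c * c^* * K y y + (\sum_(a <- v) a.1 * c^* * K a.2 y) +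
    (\sum_(a <- v) a.1 * c^* * K a.2 y)^* + qform K v.
Proof.
move=> hK; rewrite /qform big_cons big_cons /=.
under [X in _ + X]eq_bigr do rewrite big_cons/=.
rewrite big_split/= cJ_sum.
have -> : \sum_(b <- v) c * (b.1)^* * K y b.2 = \sum_(b <- v) (b.1 * c^* * K b.2 y)^*.
  by apply: eq_bigr => b _; rewrite !cJM conjcK (hK b.2 y); ring.
by ring.
Qed.

Lemma qform_scale K (r : R) v :
  qform K [seq (r%:C * a.1, a.2) | a <- v] = (r ^+ 2)%:C * qform K v.
Proof.
rewrite /qform big_map mulr_sumr; apply: eq_bigr => a _.
rewrite big_map mulr_sumr; apply: eq_bigr => b _ /=.
by rewrite !cJM cJR expr2 rmorphM/=; ring.
Qed.

Lemma bin2E (n : nat) : ('C(n, 2)%:R : R) = n%:R * (n%:R - 1) / 2.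
Proof.
elim: n => [|n IH]; first by rewrite mul0r mul0r.
by rewrite binS bin1 natrD IH -natr1; field.
Qed.

Section Iteration.
Variables (K : MX R -> MX R -> C) (u : MX R -> C) (w : MX R -> R) (A U B : R).
Hypotheses (A0 : 0 < A) (mw : measurable_fun setT w) (w0 : forall x, 0 <= w x).
Hypothesis wA : (\int[mu2]_x (w x)%:E = A%:E)%E.
Hypotheses (mu_ : cmeas setT u) (uU : forall x, cabs (u x) <= U).
Hypotheses (mK : cmeas2 K) (KB : forall x y, cabs (K x y) <= B).
Hypotheses (hK : forall x y, K y x = (K x y)^*) (posK : forall v, 0 <= qform K v).

Let U0 : 0 <= U. Proof. exact: le_trans (cabs_ge0 _) (uU (0, 0)). Qed.
Let B0 : 0 <= B. Proof. exact: le_trans (cabs_ge0 _) (KB (0, 0) (0, 0)). Qed.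

Let cw (f : MX R -> C) (c : R) : cmeas setT f -> (forall x, cabs (f x) <= c) ->
  cintg mu2 setT (fun x => f x * (w x)%:C) /\ cabs (cint mu2 setT (fun x => f x * (w x)%:C)) <= c * A.
Proof.
move=> mf fc; have c0 : 0 <= c := le_trans (cabs_ge0 _) (fc (0, 0)).
have mcw : measurable_fun setT (fun x => c * w x) by exact: measurable_funM.
have fin : (\int[mu2]_x (c * w x)%:E = (c * A)%:E)%E by rewrite eI_Z// wA EFinM.
have le x : cabs (f x * (w x)%:C) <= c * w x.
  by rewrite cabsM cabs_real ger0_norm// ler_wpM2r.
have mfw : cmeas setT (fun x => f x * (w x)%:C) by apply: cmeasM => //; exact: cmeas_real.
have i : cintg mu2 setT (fun x => f x * (w x)%:C).
  apply: (@cintg_le _ _ _ mu2 setT measurableT _ (fun x => c * w x)) => //.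
  by rewrite fin ltry.
split => //; rewrite -lee_fin -fin; apply: le_trans (@ecabs_cint _ _ _ mu2 setT measurableT _ mfw) _.
by apply: eI_le => //; [exact: measurable_cabs|move=> x; exact: cabs_ge0].
Qed.

Definition pbeta y : C := cint mu2 setT (fun x => (u x)^* * K y x * (w x)%:C).
Definition plin v y : C := \sum_(a <- v) a.1 * (u y)^* * K a.2 y.
Definition pcross v : C := cint mu2 setT (fun y => plin v y * (w y)%:C).
Definition pdiag : C := cint mu2 setT (fun y => u y * (u y)^* * K y y * (w y)%:C).
Definition pdouble : C := cint mu2 setT (fun y => u y * pbeta y * (w y)%:C).

Let mplin v : cmeas setT (plin v).
Proof.
apply: cmeas_sum => a; apply: cmeasM; last exact: cmeas2_sec.
by apply: cmeasM; [exact: (@cmeas_cst _ _ _ _ (a.1 : C))|exact: cmeasJ].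
Qed.

Let bplin v y : cabs (plin v y) <= \sum_(a <- v) cabs a.1 * U * B.
Proof.
rewrite (le_trans (cabs_sum _ _ _))//; apply: ler_sum => a _.
by rewrite !cabsM cabsJ ler_pM// ?mulr_ge0 ?cabs_ge0// ler_wpM2l ?cabs_ge0.
Qed.

Let mbeta : cmeas setT pbeta.
Proof.
apply: (@cmeas_cint22 _ (fun y x => (u x)^* * K y x * (w x)%:C)).
apply: (@cmeasM _ _ _ setT (fun v : MX R * MX R => (u v.2)^* * K v.1 v.2) (fun v => (w v.2)%:C)).
  apply: (@cmeasM _ _ _ setT (fun v : MX R * MX R => (u v.2)^*)) => //.
  exact: (@cmeas2_snd _ (fun p => (u p)^*) (cmeasJ mu_)).
exact: (@cmeas2_snd _ (fun p => (w p)%:C) (cmeas_real mw)).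
Qed.

Let uK y x : cabs ((u x)^* * K y x) <= U * B.
Proof. by rewrite cabsM cabsJ ler_pM ?cabs_ge0. Qed.

Let muK y : cmeas setT (fun x => (u x)^* * K y x).
Proof. by apply: cmeasM; [exact: cmeasJ|exact: cmeas2_sec]. Qed.

Let ibeta y : cintg mu2 setT (fun x => (u x)^* * K y x * (w x)%:C).
Proof. by case: (cw (muK y) (uK y)). Qed.

Let bbeta y : cabs (pbeta y) <= U * B * A.
Proof. by case: (cw (muK y) (uK y)). Qed.

Let iw : cintg mu2 setT (fun x => (w x)%:C) /\ cint mu2 setT (fun x => (w x)%:C) = A%:C.
Proof.
split.
  split; first exact: cmeas_real.
  under eq_integral do rewrite cabs_real ger0_norm//.
  by rewrite wA ltry.
by rewrite (cint_real mu2 measurableT) /Rintegral wA.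
Qed.

Let ilin v : cintg mu2 setT (fun y => plin v y * (w y)%:C).
Proof. by case: (cw (mplin v) (bplin v)). Qed.

Let idiag : cintg mu2 setT (fun y => u y * (u y)^* * K y y * (w y)%:C).
Proof.
apply: (proj1 (cw (c := U * U * B) _ _)).
  apply: cmeasM; first by apply: cmeasM => //; exact: cmeasJ.
  exact: (cmeas2_comp mK (@measurable_id _ _ _) (@measurable_id _ _ _)).
by move=> x; rewrite !cabsM cabsJ ler_pM ?mulr_ge0 ?cabs_ge0// ler_pM ?cabs_ge0.
Qed.

Let idouble : cintg mu2 setT (fun y => u y * pbeta y * (w y)%:C).
Proof.
apply: (proj1 (cw (c := U * (U * B * A)) _ _)); first exact: cmeasM.
by move=> x; rewrite cabsM ler_pM ?cabs_ge0.
Qed.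

(** A^2 times the mean of the quadratic form at v together with n independent points y of density w
    / A, each with coefficient u y. There are n cross terms with v, n diagonal terms and one term
    for each pair of added points. *)
Definition pE (n : nat) v : C := (A ^+ 2)%:C * qform K v + (n%:R * A)%:C * (pcross v + (pcross v)^*) +
  (n%:R * A)%:C * pdiag + ('C(n, 2)%:R)%:C * (pdouble + pdouble^*).

Let pcross_cons c y v : pcross ((c, y) :: v) = c * pbeta y + pcross v.
Proof.
rewrite /pcross /pbeta -(cintZ measurableT _ (ibeta y)) -(cintD measurableT); last exact: ilin.
  by apply: eq_cint => x _; rewrite /plin big_cons/=; ring.
exact: (cintgZ measurableT).
Qed.

Let pE_step n v : A%:C * pE n.+1 v = cint mu2 setT (fun y => pE n ((u y, y) :: v) * (w y)%:C).
Proof.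
have [iw1 iw2] := iw; have il := ilin v; have ilJ := cintgJ il; have ijJ := cintgJ idouble.
pose f1 y := pE n v * (w y)%:C.
pose f2 y := (A ^+ 2)%:C * (u y * (u y)^* * K y y * (w y)%:C + plin v y * (w y)%:C + (plin v y * (w y)%:C)^*).
pose f3 y := (n%:R * A)%:C * (u y * pbeta y * (w y)%:C + (u y * pbeta y * (w y)%:C)^*).
have -> : (fun y => pE n ((u y, y) :: v) * (w y)%:C) = fun y => f1 y + f2 y + f3 y.
  apply/funext => y; rewrite /f1 /f2 /f3 /pE qform_cons// pcross_cons -/(plin v y).
  rewrite !cJM !cJD !cJM cJR; ring.
have i20 := cintgD measurableT idiag il; have i21 := cintgD measurableT i20 ilJ.
have i2 := cintgZ measurableT (A ^+ 2)%:C i21.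
have i30 := cintgD measurableT idouble ijJ; have i3 := cintgZ measurableT (n%:R * A)%:C i30.
have i1 := cintgZ measurableT (pE n v) iw1.
rewrite (cintD measurableT (cintgD measurableT i1 i2) i3) (cintD measurableT i1 i2).
rewrite (cintZ measurableT _ iw1) (cintZ measurableT _ i21) (cintZ measurableT _ i30).
rewrite (cintD measurableT i20 ilJ) (cintD measurableT idiag il) (cintD measurableT idouble ijJ).
rewrite (cintJ measurableT il) (cintJ measurableT idouble) iw2 -/(pcross v) -/pdiag -/pdouble.
have e1 : (n.+1%:R * A)%:C = (n%:R * A)%:C + A%:C :> C by rewrite -rmorphD/= -natr1 mulrDl mul1r.
have e2 : ('C(n.+1, 2)%:R)%:C = ('C(n, 2)%:R)%:C + (n%:R)%:C :> C by rewrite -rmorphD/= binS bin1 natrD.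
have e3 : (A ^+ 2)%:C = A%:C * A%:C :> C by rewrite -rmorphM.
have e4 : (n%:R * A)%:C = (n%:R)%:C * A%:C :> C by rewrite -rmorphM.
rewrite /pE e1 e2 e3 e4; ring.
Qed.

Lemma pE_ge0 n v : 0 <= pE n v.
Proof.
elim: n v => [|n IH] v.
  by rewrite /pE !mul0r !addr0 mulr_ge0// lecR sqr_ge0.
rewrite -(@pmulr_rge0 _ A%:C) ?ltcR// pE_step; apply: cint_ge0 => // y _.
by rewrite mulr_ge0// lecR.
Qed.

(* Positivity of K at v together with n points of weight proportional to u, averaged
   over their positions with density w; the diagonal terms vanish as n grows. *)
Lemma psd_int v : 0 <= qform K v + (pcross v + (pcross v)^*) + (2^-1)%:C * (pdouble + pdouble^*).
Proof.
pose P := qform K v + (pcross v + (pcross v)^*) + (2^-1)%:C * (pdouble + pdouble^*).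
pose Q := A%:C * pdiag - (2^-1)%:C * (pdouble + pdouble^*).
have cv : ccvg \oo (fun n => - (P + ((n.+1%:R)^-1)%:C * Q)) (- P).
  rewrite (_ : - P = - (P + 0%:C * Q)); last by rewrite mul0r addr0.
  apply: ccvgN.
  apply: ccvgD; first exact: ccvg_cst.
  apply: ccvgM; last exact: ccvg_cst.
  by apply: (@ccvg_real _ _ _ _ (fun n => (n.+1%:R)^-1 : R) 0); exact: cvg_harmonic.
rewrite -/P -oppr_le0; apply: (ccvg_le cv) => n.
rewrite oppr_le0; set r : R := n.+1%:R; have r0 : 0 < r by rewrite ltr0n.
(* Scaling v by r / A makes its terms grow like r^2, as the number of pairs does; after division by
   r^2 the diagonal terms are of order 1 / r. *)
have := pE_ge0 n.+1 [seq ((r / A)%:C * a.1, a.2) | a <- v].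
rewrite /pE qform_scale -/r.
have -> : pcross [seq ((r / A)%:C * a.1, a.2) | a <- v] = (r / A)%:C * pcross v.
  rewrite /pcross -(cintZ measurableT _ (ilin v)); apply: eq_cint => y _.
  rewrite mulrA; congr (_ * _); rewrite /plin big_map mulr_sumr; apply: eq_bigr => a _ /=; ring.
rewrite cJM cJR bin2E -/r => h.
have e1 : (A ^+ 2)%:C * ((r / A) ^+ 2)%:C = (r ^+ 2)%:C :> C.
  by rewrite -rmorphM/=; congr (_%:C); field; exact: lt0r_neq0.
have e2 : (r * A)%:C * (r / A)%:C = (r ^+ 2)%:C :> C.
  by rewrite -rmorphM/=; congr (_%:C); field; exact: lt0r_neq0.
rewrite -(@pmulr_rge0 _ (r ^+ 2)%:C) ?ltcR ?exprn_gt0//.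
move: h; rewrite mulrA e1 -mulrDr mulrA e2 => h; apply: le_trans h _.
rewrite le_eqVlt; apply/orP; left; apply/eqP.
have e3 : (r ^+ 2)%:C * (r^-1)%:C = r%:C :> C.
  by rewrite -rmorphM/=; congr (_%:C); field; exact: lt0r_neq0.
have e4 : (r * (r - 1) / 2)%:C = (r ^+ 2)%:C * (2^-1)%:C - r%:C * (2^-1)%:C :> C.
  by rewrite -!rmorphM -rmorphB/=; congr (_%:C); ring.
have -> : (r ^+ 2)%:C * (P + (r^-1)%:C * Q) = (r ^+ 2)%:C * P + ((r ^+ 2)%:C * (r^-1)%:C) * Q by ring.
have e5 : (r * A)%:C = r%:C * A%:C :> C by rewrite -rmorphM.
rewrite /P /Q e3 e4 e5; ring.
Qed.

End Iteration.

Lemma mu2_box n : mu2 (box n) = ((2 * n%:R) ^+ 2)%:E.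
Proof.
have nn : - n%:R <= n%:R :> R by have := ler0n R n; lra.
pose J : set (measurableTypeR R) := `[(- n%:R), n%:R]%classic.
have mJ : measurable J by exact: measurable_itv.
have E : (lebesgue_measure J = (n%:R - - n%:R)%:E)%E by exact: lebesgue_itvcc.
rewrite [LHS](product_measure1E lebesgue_measure lebesgue_measure mJ mJ).
rewrite [X in (X * _)%E]E [X in (_ * X)%E]E -EFinM; congr (_%:E); ring.
Qed.

End PositiveKernels.

(** * Functionals that are bounded on the reproducing vectors *)

Section Functionals.
Context {R : realType}.
Local Notation C := R[i].
Local Notation mu2 := (@lebesgue_measure R \x @lebesgue_measure R)%E.
Implicit Types (K : MX R -> MX R -> C) (h F Phi u : MX R -> C) (p q e x y : MX R) (s t M : R).

Lemma ccvgS (f : nat -> C) l : ccvg \oo f l -> ccvg \oo (fun n => f n.+1) l.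
Proof. by move=> cf e e0; have [N _ hN] := cf e e0; exists N => // m /= Nm; apply: hN => /=; exact: leqW. Qed.

Lemma ibox_sqr n x : ibox n x * (ibox n x)^* = ibox n x :> C.
Proof. by case: (ibox01 n x) => ->; rewrite ?mul0r// cJR mul1r. Qed.

Lemma cmeas2_Dk s : cmeas2 (@Dk R s). Proof. exact: cmeas_Dk. Qed.

Lemma cJ0 : (0 : C)^* = 0. Proof. exact: rmorph0. Qed.

Lemma lec_real (z : C) (r : R) : z <= r%:C -> z^* = z.
Proof.
case: z => a b; rewrite lecE/= => /andP[/eqP e _].
by rewrite /conjc -e oppr0.
Qed.

Lemma qform1 K b x : qform K [:: (b, x)] = b * b^* * K x x.
Proof. by rewrite /qform !big_seq1. Qed.

Section Kernel.
Variables (s M : R) (Phi : MX R -> C).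
Hypotheses (s1 : 1 < s) (M0 : 0 <= M) (mPhi : cmeas setT Phi).
(** The positivity of K says that the assignment of Phi x to [Dk s x] extends to a bounded
    functional on the span of these vectors. Boundedness, square integrability and the reproducing
    formula for Phi are all derived from this. *)
Let K x y : C := (M ^+ 2)%:C * Dk s x y - Phi x * (Phi y)^*.
Hypothesis posK : forall v, 0 <= qform K v.

Lemma functional_bound x : cabs (Phi x) <= M.
Proof.
have := posK [:: (1, x)].
rewrite qform1 mulcJ cabs1 expr1n mul1r /K Dkxx mulr1 mulcJ -rmorphB/= lecR.
by rewrite subr_ge0 ler_sqr ?nnegrE ?cabs_ge0.
Qed.

Let hK x y : K y x = (K x y)^*.
Proof. by rewrite /K cJB !cJM conjcK cJR DkJ; ring. Qed.

Let KB x y : cabs (K x y) <= M ^+ 2 + M * M.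
Proof.
rewrite (le_trans (cabsB _ _))// !cabsM cabsJ cabs_real ger0_norm ?sqr_ge0//.
apply: lerD; last by rewrite ler_pM ?cabs_ge0 ?functional_bound.
by apply: ler_piMr; [exact: sqr_ge0|apply: cabs_Dk_le1; exact: (ltW (lt_trans ltr01 s1))].
Qed.

Let mK : cmeas2 K.
Proof.
apply: (@cmeasB _ _ _ setT (fun v : MX R * MX R => (M ^+ 2)%:C * Dk s v.1 v.2) (fun v => Phi v.1 * (Phi v.2)^*)).
  apply: (@cmeasM _ _ _ setT (fun=> (M ^+ 2)%:C)); [exact: cmeas_cst|exact: cmeas2_Dk].
apply: (@cmeasM _ _ _ setT (fun v : MX R * MX R => Phi v.1) (fun v => (Phi v.2)^*)).
  exact: (@cmeas2_fst _ Phi).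
exact: (@cmeas2_snd _ (fun p => (Phi p)^*) (cmeasJ mPhi)).
Qed.

(** By [psd_int] the bound on the functional passes from finite combinations to b D(x, .) plus an
    integral of h(y) D(y, .), for h bounded and supported in a box; [contraction] estimates the
    double integral of h. *)
Let box_inequality n u U b x h (I E : C) : cmeas setT u -> (forall y, cabs (u y) <= U) ->
  h = (fun y => u y * ibox n.+1 y) ->
  I = cint mu2 setT (fun y => h y * Phi y) ->
  E = cint mu2 setT (fun y => Dk s x y * (h y)^*) ->
  (b * Phi x + I) * (b * Phi x + I)^* <=
  (M ^+ 2)%:C * (b * b^* + (b * E + (b * E)^*) + (mass s * n2 h)%:C).
Proof.
move=> mu_ uU hE IE EE; have s0 : 0 <= s := ltW (lt_trans ltr01 s1).
pose w : MX R -> R := \1_(box n.+1).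
(* The index n + 1 keeps the area of the box positive. *)
have A0 : 0 < (2 * n.+1%:R) ^+ 2 :> R by rewrite exprn_gt0// mulr_gt0// ltr0n.
have mw : measurable_fun setT w by apply: measurable_indic; exact: measurable_box.
have w0 y : 0 <= w y by rewrite /w indicE; case: (_ \in _).
have wA : (\int[mu2]_x (w x)%:E = ((2 * n.+1%:R) ^+ 2)%:E)%E.
  rewrite integral_indic//; last exact: measurable_box.
  by rewrite setIT; exact: mu2_box.
have U0 : 0 <= U := le_trans (cabs_ge0 _) (uU (0, 0)).
have lh : cl2 h /\ cintg mu2 setT h.
  have mh : cmeas setT h by rewrite hE; apply: cmeasM => //; exact: cmeas_ibox.
  have [mU iU] : cl2 (fun y => U%:C * ibox n.+1 y) by apply: cl2Z; exact: cl2_ibox.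
  have iU1 : cintg mu2 setT (fun y => U%:C * ibox n.+1 y).
    apply: (cintgZ measurableT); split; first exact: cmeas_ibox.
    under eq_integral do rewrite /ibox cabs_real ger0_norm//.
    by rewrite wA ltry.
  have le y : cabs (h y) <= cabs (U%:C * ibox n.+1 y :> C).
    by rewrite hE !cabsM ler_wpM2r ?cabs_ge0// cabs_real ger0_norm.
  split.
    apply: (@cl2_le _ _ (fun y => cabs (U%:C * ibox n.+1 y :> C) ^+ 2)) => //.
      by apply: measurable_funX; exact: measurable_cabs.
    by move=> y; rewrite ler_sqr ?nnegrE ?cabs_ge0.
  case: iU1 => m1 f1; apply: (@cintg_le _ _ _ mu2 setT measurableT _ (fun y => cabs (U%:C * ibox n.+1 y :> C))) => //.
  exact: measurable_cabs.
have [{}lh ih] := lh; have lhJ := cl2J lh; have ihJ := cintgJ ih.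
have mh : cmeas setT h by case: ih.
have iPhi : cintg mu2 setT (fun y => h y * Phi y).
  have [ _ fh] := ih.
  apply: (@cintg_le _ _ _ mu2 setT measurableT _ (fun y => M * cabs (h y))) => //.
  - exact: cmeasM.
  - by apply: measurable_funM => //; exact: measurable_cabs.
  - by move=> y _; rewrite cabsM mulrC ler_wpM2r ?cabs_ge0// functional_bound.
  - rewrite eI_Z//; [by rewrite lte_mul_pinfty|exact: measurable_cabs|by move=> y; exact: cabs_ge0].
have iD y : cintg mu2 setT (fun z => Dk s y z * (h z)^*) by apply: cl2M => //; exact: cl2_Dk.
have hw y : u y * (w y)%:C = h y by rewrite hE.
have hwJ y : (u y)^* * (w y)%:C = (h y)^* by rewrite hE cJM /ibox cJR.
have bE y : pbeta K u w y = (M ^+ 2)%:C * cint mu2 setT (fun z => Dk s y z * (h z)^*) - Phi y * I^*.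
  rewrite IE -(cintJ measurableT iPhi) -(cintZ measurableT _ (iD y)) -(cintZ measurableT _ (cintgJ iPhi)).
  rewrite -(cintB measurableT (cintgZ measurableT _ (iD y)) (cintgZ measurableT _ (cintgJ iPhi))).
  by apply: eq_cint => z _; rewrite mulrAC hwJ /K cJM; ring.
pose DJ := cint mu2 setT (fun y => cint mu2 setT (fun z => h y * (h z)^* * Dk s y z)).
have DJle : DJ <= (mass s * n2 h)%:C by exact: contraction.
have DJr : DJ^* = DJ := lec_real DJle.
have dE : pdouble K u w = (M ^+ 2)%:C * DJ - I * I^*.
  have kh : kgood (fun y z => h y * Dk s y z) by exact: kgood_Dk.
  have DE y : cint mu2 setT (fun z => h y * (h z)^* * Dk s y z) = h y * cint mu2 setT (fun z => Dk s y z * (h z)^*).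
    by rewrite -(cintZ measurableT _ (iD y)); apply: eq_cint => z _; ring.
  have iDJ : cintg mu2 setT (fun y => h y * cint mu2 setT (fun z => Dk s y z * (h z)^*)).
    have mD : cmeas2 (fun y z => Dk s y z * (h z)^*).
      apply: (@cmeasM _ _ _ setT (fun v : MX R * MX R => Dk s v.1 v.2)); first exact: cmeas2_Dk.
      exact: (@cmeas2_snd _ (fun p => (h p)^*) (cmeasJ mh)).
    have mc := @cmeas_cint22 _ (fun y z => Dk s y z * (h z)^*) mD.
    have [_ fh] := ih.
    have [c c0 cb] : exists2 c : R, 0 <= c & forall y, cabs (cint mu2 setT (fun z => Dk s y z * (h z)^*)) <= c.
      exists (\int[mu2]_z cabs (h z)); first by apply: Rintegral_ge0 => z _; exact: cabs_ge0.
      move=> y; apply: (@cabs_cint_le _ _ _ mu2 setT measurableT _ (fun z => cabs (h z))) => //.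
        exact: measurable_cabs.
      by move=> z _; rewrite cabsM cabsJ ler_piMl ?cabs_ge0// cabs_Dk_le1.
    apply: (@cintg_le _ _ _ mu2 setT measurableT _ (fun y => c * cabs (h y))) => //.
    - exact: cmeasM.
    - by apply: measurable_funM => //; exact: measurable_cabs.
    - by move=> y _; rewrite cabsM mulrC ler_wpM2r ?cabs_ge0.
    - rewrite eI_Z//; [by rewrite lte_mul_pinfty|exact: measurable_cabs|by move=> y; exact: cabs_ge0].
  rewrite /pdouble /DJ.
  rewrite (_ : (fun y => cint mu2 setT (fun z => h y * (h z)^* * Dk s y z)) =
    fun y => h y * cint mu2 setT (fun z => Dk s y z * (h z)^*)); last by apply/funext.
  rewrite -(cintZ measurableT _ iDJ) [X in _ = _ - X * _]IE -(cintZr measurableT _ iPhi).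
  rewrite -(cintB measurableT (cintgZ measurableT _ iDJ) (cintgZr measurableT _ iPhi)).
  by apply: eq_cint => y _; rewrite mulrAC hw bE; ring.
have cE : pcross K u w [:: (b, x)] = b * ((M ^+ 2)%:C * E - Phi x * I^*).
  rewrite EE -bE -(cintZ measurableT); last first.
    have := cintgB measurableT (cintgZ measurableT (M ^+ 2)%:C (iD x)) (cintgZ measurableT (Phi x) (cintgJ iPhi)).
    rewrite (_ : (fun z => _ - _) = fun z => (u z)^* * K x z * (w z)%:C)//.
    by apply/funext => z; rewrite mulrAC hwJ /K cJM; ring.
  by apply: eq_cint => z _; rewrite /plin big_seq1/=; ring.
have h0 := psd_int A0 mw w0 wA mu_ uU mK KB hK posK [:: (b, x)].
have JE : (2^-1)%:C * (pdouble K u w + (pdouble K u w)^*) = (M ^+ 2)%:C * DJ - I * I^*.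
  have e2 : (2^-1)%:C + (2^-1)%:C = 1 :> C by rewrite -rmorphD/=; congr (_%:C); field.
  rewrite dE cJB !cJM conjcK cJR DJr (mulrC I^*).
  by rewrite mulrDr -mulrDl e2 mul1r.
rewrite JE cE qform1 /K Dkxx in h0.
have M2 : 0 <= (M ^+ 2)%:C :> C by rewrite lecR sqr_ge0.
have h1 : 0 <= (mass s * n2 h)%:C - DJ by rewrite subr_ge0.
have h2 := addr_ge0 h0 (mulr_ge0 M2 h1).
rewrite -subr_ge0; apply: le_trans h2 _.
rewrite le_eqVlt; apply/orP; left; apply/eqP.
rewrite !cJM !cJB !cJD !cJM !conjcK !cJR; ring.
Qed.

(** With b = 0 and h the truncation of Phi^* the inequality reads n2(h)^2 <= M^2 mass(s) n2(h);
    dividing by n2(h) gives a bound uniform in the box. *)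
Lemma functional_cl2 : cl2 Phi /\ (\int[mu2]_x (cabs (Phi x) ^+ 2)%:E <= (M ^+ 2 * mass s)%:E)%E.
Proof.
have mP2 : measurable_fun setT (fun x => (cabs (Phi x) ^+ 2)%:E) by exact: measurable_cabs2.
have bn n : (\int[mu2]_(x in box n.+1) (cabs (Phi x) ^+ 2)%:E <= (M ^+ 2 * mass s)%:E)%E.
  pose h y := (Phi y)^* * ibox n.+1 y.
  have mh : cmeas setT h by apply: cmeasM; [exact: cmeasJ|exact: cmeas_ibox].
  have lh : cl2 h.
    have [mU iU] : cl2 (fun y => M%:C * ibox n.+1 y) by apply: cl2Z; exact: cl2_ibox.
    apply: (@cl2_le _ _ (fun y => cabs (M%:C * ibox n.+1 y :> C) ^+ 2)) => //.
      by apply: measurable_funX; exact: measurable_cabs.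
    move=> y; rewrite ler_sqr ?nnegrE ?cabs_ge0// !cabsM ler_wpM2r ?cabs_ge0//.
    by rewrite cabsJ cabs_real ger0_norm// functional_bound.
  have -> : (\int[mu2]_(x in box n.+1) (cabs (Phi x) ^+ 2)%:E = (n2 h)%:E)%E.
    have nE : (\int[mu2]_x (cabs (h x) ^+ 2)%:E)%E = (n2 h)%:E.
      rewrite /n2 /Rintegral fineK// ge0_fin_numE; first by case: lh.
      by apply: integral_ge0 => x _; rewrite lee_fin sqr_ge0.
    rewrite -nE integral_mkcond; apply: eq_integral => x _.
    rewrite patchE /h /ibox indicE cabsM cabsJ cabs_real.
    by case: ifP => _; rewrite ?normr1 ?mulr1// normr0 mulr0 expr0n.
  rewrite lee_fin; have h0 : 0 <= n2 h by apply: Rintegral_ge0 => x _; exact: sqr_ge0.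
  pose I := cint mu2 setT (fun y => h y * Phi y).
  have IE : I = (n2 h)%:C.
    rewrite -cint_mulJ; apply: eq_cint => y _; rewrite /h cJM conjcK.
    by case: (ibox01 n.+1 y) => ->; rewrite ?mulr0 ?mul0r// cJR !mulr1.
  have := @box_inequality n (fun y => (Phi y)^*) M 0 (0, 0) h I _ (cmeasJ mPhi) _ erefl erefl erefl.
  rewrite !mul0r cJ0 !add0r IE cJR -!rmorphM/= => H.
  have {}H : (n2 h * n2 h)%:C <= (M ^+ 2 * (mass s * n2 h))%:C.
    by apply: H => y; rewrite cabsJ functional_bound.
  move: H; rewrite lecR mulrA.
  case: (ltgtP 0 (n2 h)) h0 => // [h0 _|<- _ _]; last by rewrite mulr_ge0 ?sqr_ge0// ltW// mass_gt0.
  by rewrite ler_pM2r.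
have le : (\int[mu2]_x (cabs (Phi x) ^+ 2)%:E <= (M ^+ 2 * mass s)%:E)%E.
  have U : \bigcup_n box (R := R) n.+1 = setT.
    apply/seteqP; split => // x _; have [n hn] := box_cover x; exists n => //.
    by apply: hn; exact: leqnSn.
  have L : (\int[mu2]_(x in box n.+1) (cabs (Phi x) ^+ 2)%:E @[n --> \oo] -->
      \int[mu2]_(x in \bigcup_n box n.+1) (cabs (Phi x) ^+ 2)%:E)%E.
    apply: ge0_nondecreasing_set_cvg_integral.
    - move=> n m nm; rewrite subsetEset => x [].
      have nm' : n.+1%:R <= m.+1%:R :> R by rewrite ler_nat.
      rewrite /= !in_itv/= => /andP[a1 a2] /andP[a3 a4].
      by split; rewrite /= in_itv/=; apply/andP; split; lra.
    - by move=> n; exact: measurable_box.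
    - by move=> n; exact: measurable_funTS.
    - by move=> n x _; rewrite lee_fin sqr_ge0.
  rewrite U in L; rewrite -(cvg_lim _ L)//.
  apply: lime_le; first by apply/cvg_ex; eexists; exact: L.
  by apply: nearW => n.
split => //; split => //; exact: le_lt_trans le (ltry _).
Qed.

(** The vector mass(s) D(x, .) minus the integral of D(x, y) D(y, .) in y is zero by [Dk_repro]. For
    its truncations to boxes the right side of [box_inequality] tends to 0, hence so does the left
    side. *)
Lemma functional_repr x : cint mu2 setT (fun y => Dk s x y * Phi y) = (mass s)%:C * Phi x.
Proof.
have [lP _] := functional_cl2.
have lD := cl2_Dk x s1; have lDJ := cl2J lD.
have iG := cl2M lD lDJ; have iP := cl2M lD lP.
pose G y := Dk s x y * (Dk s x y)^*.
have GE : cint mu2 setT G = (mass s)%:C.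
  have := Dk_repro x x s1; rewrite Dkxx mulr1 => <-.
  by apply: eq_cint => y _; rewrite /G DkJ.
pose h n y := - Dk s x y * ibox n.+1 y.
have mD : cmeas setT (fun y => - Dk s x y) by apply: cmeasN; exact: cmeas_Dk2.
have b1 y : cabs (- Dk s x y) <= 1 by rewrite cabsN cabs_Dk_le1// (ltW (lt_trans ltr01 s1)).
have := fun n => @box_inequality n _ 1 (mass s)%:C x (h n) _ _ mD b1 erefl erefl erefl.
set b := (mass s)%:C => H.
pose m n := cint mu2 setT (fun y => G y * ibox n.+1 y).
pose I n := cint mu2 setT (fun y => (Dk s x y * Phi y) * ibox n.+1 y).
have iGn n : cintg mu2 setT (fun y => G y * ibox n.+1 y).
  have [mG fG] := iG; apply: (@cintg_le _ _ _ mu2 setT measurableT _ (fun y => cabs (G y))) => //.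
  - by apply: cmeasM => //; exact: cmeas_ibox.
  - exact: measurable_cabs.
  - by move=> y _; case: (ibox01 n.+1 y) => ->; rewrite ?mulr1// mulr0 cabs0 cabs_ge0.
have iPn n : cintg mu2 setT (fun y => Dk s x y * Phi y * ibox n.+1 y).
  have [mG fG] := iP; apply: (@cintg_le _ _ _ mu2 setT measurableT _ (fun y => cabs (Dk s x y * Phi y))) => //.
  - by apply: cmeasM => //; exact: cmeas_ibox.
  - exact: measurable_cabs.
  - by move=> y _; case: (ibox01 n.+1 y) => ->; rewrite ?mulr1// mulr0 cabs0 cabs_ge0.
have n2E n : (n2 (h n))%:C = m n.
  rewrite -cint_mulJ; apply: eq_cint => y _; rewrite /h /G cJM cJN.
  by rewrite -[in RHS](ibox_sqr n.+1 y); ring.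
have EE n : cint mu2 setT (fun y => Dk s x y * (h n y)^*) = - m n.
  rewrite -(cintN measurableT (iGn n)); apply: eq_cint => y _.
  rewrite /h /G cJM cJN (_ : (ibox n.+1 y)^* = ibox n.+1 y); first by ring.
  by rewrite /ibox cJR.
have IE n : cint mu2 setT (fun y => h n y * Phi y) = - I n.
  by rewrite -(cintN measurableT (iPn n)); apply: eq_cint => y _; rewrite /h; ring.
have mJ n : (m n)^* = m n by rewrite -n2E cJR.
have {}H n : (b * Phi x - I n) * (b * Phi x - I n)^* - (M ^+ 2)%:C * (b * b^* - (b * m n + (b * m n)^*) + b * m n) <= 0.
  have := H n; rewrite EE IE (_ : (mass s * n2 (h n))%:C = b * m n); last by rewrite -n2E -rmorphM.
  rewrite -subr_le0 => h0; apply: le_trans h0.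
  by rewrite le_eqVlt; apply/orP; left; apply/eqP; rewrite !mulrN cJN; ring.
have cm : ccvg \oo m b.
  rewrite -[b]/((mass s)%:C) -GE; apply: (@ccvgS (fun n => cint mu2 setT (fun y => G y * ibox n y))); exact: cint_ibox_cvg.
pose I0 := cint mu2 setT (fun y => Dk s x y * Phi y).
have cI : ccvg \oo I I0.
  by apply: (@ccvgS (fun n => cint mu2 setT (fun y => Dk s x y * Phi y * ibox n y))); exact: cint_ibox_cvg.
have cZ : ccvg \oo (fun n => b * Phi x - I n) (b * Phi x - I0) by apply: ccvgB => //; exact: ccvg_cst.
have cbm : ccvg \oo (fun n => b * m n) (b * b) by apply: ccvgM => //; exact: ccvg_cst.
have lim : ccvg \oo (fun n => (b * Phi x - I n) * (b * Phi x - I n)^* - (M ^+ 2)%:C * (b * b^* - (b * m n + (b * m n)^*) + b * m n))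
   ((b * Phi x - I0) * (b * Phi x - I0)^* - (M ^+ 2)%:C * (b * b^* - (b * b + (b * b)^*) + b * b)).
  apply: ccvgB; first by apply: ccvgM => //; exact: ccvgJ.
  apply: ccvgM; first exact: ccvg_cst.
  apply: ccvgD => //; apply: ccvgB; first exact: ccvg_cst.
  by apply: ccvgD => //; exact: ccvgJ.
have := ccvg_le lim H; rewrite cJM (_ : b^* = b); last by rewrite /b cJR.
rewrite (_ : b * b - (b * b + b * b) + b * b = 0); last by ring.
rewrite mulr0 subr0 mulcJ lecR => le0.
have : cabs (b * Phi x - I0) ^+ 2 == 0 by rewrite eq_le le0 sqr_ge0.
by rewrite sqrf_eq0 cabs_eq0 subr_eq0 => /eqP ->.
Qed.

End Kernel.
End Functionals.

(** * Holomorphic functions from the reproducing formula *)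

Section Bergman.
Context {R : realType}.
Local Notation C := R[i].
Local Notation X := (R * R)%type.
Local Notation mu2 := (@lebesgue_measure R \x @lebesgue_measure R)%E.
Implicit Types (h F : MX R -> C) (f g : C -> C) (p q e x y : MX R) (s t M : R).

Lemma cpow_mul (z w : C) (r : R) : 0 < complex.Re z -> 0 < complex.Re w -> 0 < complex.Re (z * w) ->
  cpow (z * w) r = cpow z r * cpow w r.
Proof.
move=> z0 w0 zw0; rewrite !cpowE ?Re_gt0_neq0// -cexpD -mulrDr.
congr (cexp (_ * _)); apply/esym/clog_unique => //.
  by rewrite cexpD !cexp_clog ?Re_gt0_neq0.
rewrite cImD (le_trans (ler_normD _ _))//.
have := carg_pi2 z0; have := carg_pi2 w0; have := @pi_gt0 R; rewrite /clog /=.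
by move: `|carg w| `|carg z| pi => a b c; lra.
Qed.

Lemma cpow1 (r : R) : cpow (1 : C) r = 1.
Proof.
rewrite cpowE ?oner_neq0// -(@clog_unique R 0 1) ?mulr0 ?cexp0//=.
by rewrite normr0; have := @pi_gt0 R; move: pi => c; lra.
Qed.

Lemma evX_Dk s e x : evX s e (hpt x) = Dk s e x * ((expR (s / 2 * x.2))^-1)%:C.
Proof.
rewrite -shp_evX /shp -mulrA -rmorphM/= mulfV ?mulr1//.
by rewrite lt0r_neq0// expR_gt0.
Qed.

Lemma cintg_evX s F z : 1 < s -> cl2 F -> uhp z -> cintg mu2 setT (fun e => F e * evX s e z).
Proof.
move=> s1 lF uz; rewrite -(hcoordK uz).
have := cintgZr measurableT ((expR (s / 2 * (hcoord z).2))^-1)%:C (cl2M lF (cl2_Dk' (hcoord z) s1)).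
by under [X in cintg _ _ X -> _]eq_fun do rewrite -mulrA -evX_Dk.
Qed.

(** Differentiation under the integral by a uniform expansion: q(z + h) = q(z) (1 + w) with |w| <=
    |h| / Im z whatever e is, so that one first-order expansion of (1 + w)^(- s) at w = 0 serves all
    e. *)
Lemma bergman_chol s F z : 1 < s -> cl2 F -> uhp z ->
  chol (fun w => cint mu2 setT (fun e => F e * evX s e w)) z.
Proof.
move=> s1 lF uz; set y0 := complex.Im z; have y00 : 0 < y0 by exact: uz.
have [D hD] := @cpow_chol R (- s) 1 ltr01.
have {hD}hD := cderivable_epsP hD.
pose q e : C := qker (hpt e)^* z.
pose k : C := - (0 -i* 2)^-1.
have kE : cabs k = 2^-1.
  by rewrite /k cabsN cabsV cabsE/= expr0n/= add0r sqrrN sqrtr_sqr ger0_norm.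
have qRe e : y0 / 2 <= complex.Re (q e).
  by rewrite /q qkerE/= ler_pM2r// lerDr ltW// hpt_uhp.
have q0 e : q e != 0 by apply: Re_gt0_neq0; apply: lt_le_trans (qRe e); rewrite divr_gt0.
have qabs e : y0 / 2 <= cabs (q e).
  by rewrite (le_trans (qRe e))// (le_trans (ler_norm _))// ger_Re_cabs.
pose N := \int[mu2]_e cabs (F e * evX s e z).
have iN := cintg_evX s1 lF uz.
have N0 : 0 <= N by apply: Rintegral_ge0 => e _; exact: cabs_ge0.
have mq : cmeas setT (fun e => (q e)^-1).
  apply: ccvg_cmeas => p; apply: ccvgV => //; apply: ccvg_qker; last exact: ccvg_cst.
  by apply: ccvgJ; apply: ccvg_hpt; exact: cvg_id.
have finN : (\int[mu2]_e (cabs (F e * evX s e z))%:E < +oo)%E by case: iN.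
have iW : cintg mu2 setT (fun e => F e * evX s e z * (D * (k * (q e)^-1))).
  have mN : cmeas setT (fun e => F e * evX s e z) by case: iN.
  apply: (@cintg_le _ _ _ mu2 setT measurableT _ (fun e => cabs D * (2^-1 * (2 / y0)) * cabs (F e * evX s e z))).
  - apply: cmeasM => //; apply: (@cmeasM _ _ _ setT (fun=> D)); first exact: cmeas_cst.
    by apply: (@cmeasM _ _ _ setT (fun=> k)) => //; exact: cmeas_cst.
  - by apply: measurable_funM => //; exact: measurable_cabs.
  - move=> e _; rewrite cabsM mulrC ler_wpM2r ?cabs_ge0// !cabsM ler_wpM2l ?cabs_ge0// kE.
    rewrite ler_wpM2l ?invr_ge0// cabsV -[2 / y0]invf_div lef_pV2 ?posrE ?divr_gt0//.
    by rewrite cabs_gt0.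
  - rewrite eI_Z; [by rewrite lte_mul_pinfty// lee_fin !mulr_ge0 ?cabs_ge0 ?invr_ge0// ltW| |exact: measurable_cabs|by move=> e; exact: cabs_ge0].
    by rewrite !mulr_ge0 ?cabs_ge0 ?invr_ge0// ltW.
exists (cint mu2 setT (fun e => F e * evX s e z * (D * (k * (q e)^-1)))).
apply: cderivable_eps => eps eps0.
have P0 : 0 < eps * y0 / (N + 1) by rewrite divr_gt0 ?mulr_gt0// ltr_wpDl.
have [r r0 hr] := hD _ P0.
(* The first bound gives |w| < r, the second gives |w| <= 1/2 and keeps z + h in the upper
   half-plane. *)
exists (Num.min (r * y0) (y0 / 2)).
  by rewrite lt_min divr_gt0// mulr_gt0.
move=> h; rewrite lt_min => /andP[h1 h2].
have uzh : uhp (z + h).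
  rewrite /uhp/= cImD -/y0; have := ger_Im_cabs h; rewrite ler_norml => /andP[a _]; lra.
have iNh := cintg_evX s1 lF uzh.
pose w e := k * h / q e.
have wle e : cabs (w e) <= cabs h / y0.
  rewrite /w !cabsM cabsV kE ler_pdivrMr ?cabs_gt0//.
  rewrite (le_trans (y := cabs h / y0 * (y0 / 2)))//; last by rewrite ler_wpM2l// divr_ge0 ?cabs_ge0// ltW.
  rewrite le_eqVlt; apply/orP; left; apply/eqP; field; exact: lt0r_neq0.
have qh e : qker (hpt e)^* (z + h) = q e * (1 + w e).
  have -> : q e * (1 + w e) = q e + k * h by rewrite mulrDr mulr1 /w [q e * _]mulrC divfK.
  by rewrite /q /k /qker; ring.
have w12 e : cabs (w e) <= 1 / 2.
  rewrite (le_trans (wle e))// ler_pdivrMr//; lra.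
have Re1 e : 0 < complex.Re (1 + w e).
  rewrite cReD; have := ger_Re_cabs (w e); rewrite ler_norml => /andP[a _]; have := w12 e; rewrite /=; lra.
have ev e : evX s e (z + h) = evX s e z * cpow (1 + w e) (- s).
  rewrite /evX qh cpow_mul//; first by rewrite -/(q e); ring.
  - by apply: lt_le_trans (qRe e); rewrite divr_gt0.
  - by rewrite -qh; exact: Re_qker (hpt_uhp e) uzh.
have -> : cint mu2 setT (fun e => F e * evX s e (z + h)) - cint mu2 setT (fun e => F e * evX s e z) -
    cint mu2 setT (fun e => F e * evX s e z * (D * (k * (q e)^-1))) * h =
    cint mu2 setT (fun e => F e * evX s e z * (cpow (1 + w e) (- s) - 1 - D * w e)).
  rewrite -(cintZr measurableT h iW) -(cintB measurableT iNh iN).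
  rewrite -(cintB measurableT (cintgB measurableT iNh iN) (cintgZr measurableT h iW)).
  by apply: eq_cint => e _; rewrite ev /w; ring.
have iR : cintg mu2 setT (fun e => F e * evX s e z * (cpow (1 + w e) (- s) - 1 - D * w e)).
  have := cintgB measurableT (cintgB measurableT iNh iN) (cintgZr measurableT h iW).
  rewrite (_ : (fun e => _ - _) = fun e => F e * evX s e z * (cpow (1 + w e) (- s) - 1 - D * w e))//.
  by apply/funext => e; rewrite ev /w; ring.
have mN : measurable_fun setT (fun e => cabs (F e * evX s e z)) by apply: measurable_cabs; case: iN.
pose c := eps * y0 / (N + 1) * (cabs h / y0).
have c0 : 0 <= c by rewrite mulr_ge0 ?divr_ge0 ?cabs_ge0 ?mulr_ge0 ?addr_ge0// ltW.
apply: (le_trans (@cabs_cint_le _ _ _ mu2 setT measurableT _ (fun e => c * cabs (F e * evX s e z)) iR _ _ _)).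
- exact: measurable_funM.
- move=> e _; rewrite cabsM mulrC ler_wpM2r ?cabs_ge0//.
  have hw : cabs (w e) < r by rewrite (le_lt_trans (wle e))// ltr_pdivrMr.
  have := hr (w e) hw; rewrite cpow1 => H; apply: (le_trans H).
  by rewrite /c ler_wpM2l// divr_ge0 ?mulr_ge0 ?addr_ge0// ltW.
- rewrite eI_Z//; [by rewrite lte_mul_pinfty|by move=> e; exact: cabs_ge0].
have -> : \int[mu2]_e (c * cabs (F e * evX s e z)) = c * N.
  rewrite /N /Rintegral eI_Z//; last by move=> e; exact: cabs_ge0.
  by rewrite fineM// ge0_fin_numE//; apply: eI_ge0 => e; exact: cabs_ge0.
have -> : c * N = eps * cabs h * (N / (N + 1)).
  by rewrite /c; field; rewrite !lt0r_neq0// ltr_wpDl.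
by rewrite ler_piMr ?mulr_ge0 ?cabs_ge0 ?(ltW eps0)// ler_pdivrMr ?ltr_wpDl// mul1r lerDl.
Qed.

(** The hypothesis displays F as a superposition of the functions [evX s e], which are holomorphic
    on the upper half-plane. *)
Lemma hol_repr s F : 1 < s -> cl2 F -> (forall x, cint mu2 setT (fun e => F e * Dk s e x) = (mass s)%:C * F x) ->
  exists2 g, forall z, uhp z -> chol g z & forall x, shp s g x = F x.
Proof.
move=> s1 lF RP; exists (fun w => ((mass s)^-1)%:C * cint mu2 setT (fun e => F e * evX s e w)).
  by move=> z uz; apply: cholZ; exact: bergman_chol.
move=> x; rewrite /shp -mulrA -(cintZr measurableT _ (cintg_evX s1 lF (hpt_uhp x))).
have -> : cint mu2 setT (fun e => F e * evX s e (hpt x) * (expR (s / 2 * x.2))%:C) = (mass s)%:C * F x.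
  by rewrite -RP; apply: eq_cint => e _; rewrite -mulrA -/(shp s (evX s e) x) shp_evX.
by rewrite mulrA -rmorphM/= mulVf ?mul1r// lt0r_neq0// mass_gt0.
Qed.

End Bergman.

Section BergmanSpace.
Context {R : realType}.
Local Notation C := R[i].
Local Notation X := (R * R)%type.
Local Notation mu2 := (@lebesgue_measure R \x @lebesgue_measure R)%E.
Implicit Types (h F : MX R -> C) (f g : C -> C) (p q e x y : X) (s t M : R).

Lemma ccvg_hpt_comp f p : (forall z, uhp z -> chol f z) -> ccvg (nbhs p) (f \o @hpt R) (f (hpt p)).
Proof.
move=> hf; apply: (@ccvg_comp _ _ _ _ (@hpt R) f (hpt p)).
  by apply: ccvg_hpt; exact: cvg_id.
by apply: chol_ccont; apply: hf; exact: hpt_uhp.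
Qed.

Lemma continuous_sqr_cabs f : (forall z, uhp z -> chol f z) ->
  continuous ((fun z => cabs (f z) ^+ 2) \o @hpt R).
Proof.
move=> hf p; have c := ccvg_cabs (ccvg_hpt_comp p hf).
exact: (cvgM (c _) (c _)).
Qed.

Lemma sqr_cabs_shp s f p : cabs (shp s f p) ^+ 2 = cabs (f (hpt p)) ^+ 2 * expR (s * p.2).
Proof.
rewrite /shp cabsM cabs_real exprMn (ger0_norm (expR_ge0 _)); congr (_ * _).
by rewrite expr2 -expRD; congr expR; field.
Qed.

(** From here on vectors of H_s are handled through their images under [shp s], in square integrable
    functions for ds dr. *)
Lemma HspaceP s f : Hspace s f <->
  [/\ forall z, ~ uhp z -> f z = 0, forall z, uhp z -> chol f z & cl2 (shp s f)].
Proof.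
have fin : (forall z, uhp z -> chol f z) ->
    (\int[mu2]_(p in (@toC R) @^-1` uhp) (cabs (f (toC p)) ^+ 2 * p.2 `^ (s - 2))%:E =
     \int[mu2]_p (cabs (shp s f p) ^+ 2)%:E)%E.
  move=> hf; have := @eint_nuE R s (fun z => cabs (f z) ^+ 2) (continuous_sqr_cabs hf) (fun p => sqr_ge0 _).
  rewrite /eint_nu setIid => ->; apply: eq_integral => p _; by rewrite sqr_cabs_shp.
have ge0 p : (0 <= (cabs (f (toC p)) ^+ 2 * p.2 `^ (s - 2))%:E)%E.
  by rewrite lee_fin mulr_ge0 ?sqr_ge0 ?powR_ge0.
split=> [[f0 df /integrableP[mf ff]]|[f0 df [mf ff]]].
  have hf z : uhp z -> chol f z by move=> /df /derivable_chol.
  split => //; split.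
    by apply: cmeas_shp => z uz; apply: chol_ccont; exact: hf.
  rewrite -(fin hf); apply: le_lt_trans ff; rewrite le_eqVlt; apply/orP; left; apply/eqP.
  by apply: eq_integral => p _; rewrite gee0_abs.
split => //; first by move=> z /df hz; apply/derivable_chol.
apply/integrableP; split; last first.
  rewrite -(fin df) in ff; apply: le_lt_trans ff; rewrite le_eqVlt; apply/orP; left; apply/eqP.
  by apply: eq_integral => p _; rewrite gee0_abs.
apply/measurable_EFinP.
pose phi (q : X) : R := cabs (f (hpt q)) ^+ 2 * expR ((s - 2) * q.2).
have cphi : continuous phi.
  move=> q; apply: cvgM; first exact: continuous_sqr_cabs.
  exact: continuous_expR2.
apply: (eq_measurable_fun (fun p : MX R => phi (hcoord (toC p)))).
  move=> p; rewrite inE/= => up; rewrite /phi hpt_toC// powR_toC//.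
apply: measurable_funTS; apply: measurableT_comp; last exact: measurable_hcoord.
exact: continuous_measurable_plane.
Qed.

Lemma innerE s f g : (forall z, uhp z -> chol f z) -> (forall z, uhp z -> chol g z) ->
  inner s f g = cint mu2 setT (fun p => shp s f p * (shp s g p)^*).
Proof.
move=> hf hg; rewrite /inner cint_nuE.
  apply: eq_cint => p _; rewrite /shp cJM cJR num_conjE.
  have -> : (expR (s * p.2))%:C = (expR (s / 2 * p.2))%:C * (expR (s / 2 * p.2))%:C :> C.
    by rewrite -rmorphM/= -expRD; congr (expR _)%:C; field.
  ring.
by move=> p; apply: ccvgM; [|apply: ccvgJ]; exact: ccvg_hpt_comp.
Qed.

Lemma normHE s f : (forall z, uhp z -> chol f z) -> normH s f = Num.sqrt (n2 (shp s f)).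
Proof. by move=> hf; rewrite /normH innerE// cint_mulJ. Qed.

Lemma n2_ge0 h : 0 <= n2 h.
Proof. by apply: Rintegral_ge0 => x _; exact: sqr_ge0. Qed.

Lemma n2E h : cl2 h -> (\int[mu2]_x (cabs (h x) ^+ 2)%:E)%E = (n2 h)%:E.
Proof.
move=> [mh fh]; rewrite /n2 /Rintegral fineK// ge0_fin_numE//.
by apply: integral_ge0 => x _; rewrite lee_fin sqr_ge0.
Qed.

Lemma cint_cl2_bound h F : cl2 h -> cl2 F -> cabs (cint mu2 setT (fun x => h x * F x)) ^+ 2 <= n2 h * n2 F.
Proof.
move=> lh lF; have lhJ := cl2J lh; have lFJ := cl2J lF.
set z := cint _ _ _; have ih := cl2M lh lF.
have H (a : C) : 0 <= (n2 h)%:C * (a * a^*) - (a * z + (a * z)^*) + (n2 F)%:C.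
  have i1 := cl2M lh lhJ; have i2 := cl2M lF lFJ.
  have <- : cint mu2 setT (fun x => (a^* * (h x)^* - F x) * (a^* * (h x)^* - F x)^*) =
     (n2 h)%:C * (a * a^*) - (a * z + (a * z)^*) + (n2 F)%:C.
    have j1 := cintgZr measurableT (a * a^*) i1.
    have j3 := cintgZ measurableT a ih; have j4 := cintgJ j3; have j5 := cintgD measurableT j3 j4.
    rewrite -!cint_mulJ -(cintZr measurableT _ i1) /z -(cintZ measurableT a ih) -(cintJ measurableT j3).
    rewrite -(cintD measurableT j3 j4) -(cintB measurableT j1 j5) -(cintD measurableT (cintgB measurableT j1 j5) i2).
    by apply: eq_cint => x _; rewrite cJB !cJM !conjcK; ring.
  by apply: cint_ge0 => // x _; exact: ge0_mulcJ.
have [h0|h0] := eqVneq (n2 h) 0.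
  have [->|z0] := eqVneq z 0; first by rewrite cabs0 expr0n/= mulr_ge0 ?n2_ge0.
  (* If n2 h = 0, the inequality is linear in a, and this multiple of z^* contradicts z <> 0. *)
  have := H (((n2 F + 1) / cabs z ^+ 2)%:C * z^*).
  have -> : ((n2 F + 1) / cabs z ^+ 2)%:C * z^* * z = (n2 F + 1)%:C.
    by rewrite -mulrA (mulrC z^*) mulcJ -rmorphM/= divfK// sqrf_eq0 cabs_eq0.
  rewrite h0 mul0r add0r cJR -rmorphD -rmorphN -rmorphD lecR; have := n2_ge0 F; lra.
have hp : 0 < n2 h by rewrite lt_def h0 n2_ge0.
pose c := (n2 h)^-1; have c0 : 0 <= c by rewrite invr_ge0 ltW.
have := H (c%:C * z^*).
have -> : c%:C * z^* * z = (c * cabs z ^+ 2)%:C by rewrite -mulrA (mulrC z^*) mulcJ -rmorphM.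
rewrite mulcJ cJR -rmorphM -rmorphD -rmorphN -!rmorphD lecR cabsM cabsJ cabs_real ger0_norm// exprMn expr2 -/c -!mulrA.
rewrite /c.
set Z := cabs z ^+ 2 => h1.
have : 0 <= n2 h * (n2 h * ((n2 h)^-1 * ((n2 h)^-1 * Z)) - ((n2 h)^-1 * Z + (n2 h)^-1 * Z) + n2 F).
  by rewrite mulr_ge0// ltW.
have -> : n2 h * (n2 h * ((n2 h)^-1 * ((n2 h)^-1 * Z)) - ((n2 h)^-1 * Z + (n2 h)^-1 * Z) + n2 F) = n2 h * n2 F - Z.
  by field.
by rewrite subr_ge0.
Qed.

End BergmanSpace.

(** * Integral kernels of bounded operators *)

Section Operators.
Context {R : realType}.
Local Notation C := R[i].
Local Notation X := (R * R)%type.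
Local Notation mu2 := (@lebesgue_measure R \x @lebesgue_measure R)%E.
Implicit Types (h F : MX R -> C) (f g : C -> C) (p q e x y : X) (s t M : R).

(** [evX] set to 0 off the upper half-plane, to comply with the convention for vectors of
    [Hspace]. *)
Definition evH s x : C -> C := fun z => if 0 < complex.Im z then evX s x z else 0.

Lemma shp_evH s x e : shp s (evH s x) e = Dk s x e.
Proof. by rewrite -shp_evX /shp /evH/= expR_gt0. Qed.

Lemma evH_chol s x z : uhp z -> chol (evH s x) z.
Proof.
move=> uz; apply: (@chol_near _ (evX s x)); last exact: evX_chol.
exists (complex.Im z) => // w hw; rewrite /evH ifT//.
have := le_lt_trans (ger_Im_cabs _) hw; rewrite cImD cImN ltr_norml => /andP[a _]; lra.
Qed.

Lemma Hspace_evH s x : 1 < s -> Hspace s (evH s x).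
Proof.
move=> s1; apply/HspaceP; split.
- by move=> z uz; rewrite /evH; case: ifP => // /uz.
- by move=> z; exact: evH_chol.
- by rewrite (_ : shp s (evH s x) = Dk s x); [exact: cl2_Dk|apply/funext => e; exact: shp_evH].
Qed.

Lemma Hspace0 s : Hspace s (fun _ : C => 0).
Proof.
apply/HspaceP; split=> // [z _|]; first exact: chol_cst.
rewrite (_ : shp s _ = fun=> 0); first exact: cl20.
by apply/funext => p; rewrite /shp mul0r.
Qed.

Lemma shpL s (a : C) f g x : shp s (fun z => a * f z + g z) x = a * shp s f x + shp s g x.
Proof. by rewrite /shp; ring. Qed.

Lemma HspaceL s (a : C) f g : Hspace s f -> Hspace s g -> Hspace s (fun z => a * f z + g z).
Proof.
move=> /HspaceP[f0 hf lf] /HspaceP[g0 hg lg]; apply/HspaceP; split.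
- by move=> z uz; rewrite f0// g0// mulr0 addr0.
- by move=> z uz; apply: cholD; [apply: cholZ; exact: hf|exact: hg].
rewrite (_ : shp s _ = fun x => a * shp s f x + shp s g x); last by apply/funext => x; exact: shpL.
by apply: cl2D => //; exact: cl2Z.
Qed.

Lemma n2_Dk s x : 1 < s -> n2 (Dk s x) = mass s.
Proof.
move=> s1; have := mass_int_at x s1; rewrite /n2 /Rintegral => h.
rewrite -[RHS]/(fine (mass s)%:E) -h; congr fine.
by apply: eq_integral => p _; rewrite sqr_cabs_Dk.
Qed.

Lemma n2J h : n2 (fun x => (h x)^*) = n2 h.
Proof. by apply: eq_Rintegral => x _; rewrite cabsJ. Qed.

Lemma point_eval s f x : 1 < s -> Hspace s f -> mass s * cabs (shp s f x) ^+ 2 <= n2 (shp s f).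
Proof.
move=> s1 /HspaceP[_ hf lf]; have m0 := mass_gt0 s1.
have := cint_cl2_bound lf (cl2_Dk' x s1); rewrite reproducing// cabsM cabs_real ger0_norm ?(ltW m0)//.
have -> : n2 (Dk s ^~ x) = mass s.
  by rewrite -(n2_Dk x s1) -n2J; apply: eq_Rintegral => p _; rewrite DkJ.
by rewrite exprMn expr2 -mulrA mulrC ler_pM2r.
Qed.

Lemma qform2 (K : MX R -> MX R -> C) b x c y : qform K [:: (b, x); (c, y)] =
  b * b^* * K x x + b * c^* * K x y + (c * b^* * K y x + c * c^* * K y y).
Proof. by rewrite /qform !big_cons !big_nil !addr0. Qed.

Section Operator.
Variables (s : R) (A : @operator R) (k : @symbol R).
Hypotheses (s1 : 1 < s) (bA : bounded_operator s A) (sA : is_symbol s A k).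

Let HA f : Hspace s f -> Hspace s (A f). Proof. by case: bA => h _ _; exact: h. Qed.
Let linA (a : C) f g : Hspace s f -> Hspace s g -> A (fun z => a * f z + g z) = fun z => a * A f z + A g z.
Proof. by case: bA => _ h _; exact: h. Qed.

Lemma op0 : A (fun _ => 0) = fun _ => 0.
Proof.
have := linA (-1) (Hspace0 s) (Hspace0 s).
rewrite (_ : (fun z => -1 * _ + _) = fun _ => 0); last by apply/funext => z; rewrite mulr0 addr0.
by move=> ->; apply/funext => z; rewrite mulN1r addNr.
Qed.

Lemma op_norm : exists2 M : R, 0 <= M & forall f, Hspace s f -> n2 (shp s (A f)) <= M ^+ 2 * n2 (shp s f).
Proof.
case: bA => _ _ [M hM]; exists `|M| => // f Hf.
have := hM f Hf; have /HspaceP[_ h1 _] := HA Hf; have /HspaceP[_ h2 _] := Hf.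
rewrite !normHE// => h.
have {}h : Num.sqrt (n2 (shp s (A f))) <= `|M| * Num.sqrt (n2 (shp s f)).
  by rewrite (le_trans h)// ler_wpM2r ?sqrtr_ge0// ler_norm.
rewrite -[n2 (shp s (A f))]sqr_sqrtr ?n2_ge0// -[n2 (shp s f)]sqr_sqrtr ?n2_ge0// -exprMn.
by rewrite ler_sqr ?nnegrE ?mulr_ge0 ?sqrtr_ge0.
Qed.

Definition comb (v : seq (C * MX R)) : C -> C := fun z => \sum_(a <- v) a.1 * evH s a.2 z.

Lemma comb_op v : Hspace s (comb v) /\ forall x, shp s (A (comb v)) x = \sum_(a <- v) a.1 * shp s (A (evH s a.2)) x.
Proof.
elim: v => [|[a p] v [IH1 IH2]].
  have -> : comb [::] = fun _ => 0 by apply/funext => z; rewrite /comb big_nil.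
  split; first exact: Hspace0.
  by move=> x; rewrite big_nil op0 /shp mul0r.
have -> : comb ((a, p) :: v) = fun z => a * evH s p z + comb v z.
  by apply/funext => z; rewrite /comb big_cons.
split; first by apply: HspaceL => //; exact: Hspace_evH.
by move=> x; rewrite linA//; [rewrite shpL big_cons IH2|exact: Hspace_evH].
Qed.

Definition Kop x y : C := shp s (A (evH s x)) y.

Lemma cnu_gt0 t : 1 < t -> 0 < c_nu t.
Proof. by move=> t1; rewrite divr_gt0 ?subr_gt0// mulr_gt0// pi_gt0. Qed.

Lemma evec_evH x : evec s (hpt x) = fun z => (c_nu s * expR (- (s / 2 * x.2)))%:C * evH s x z + 0.
Proof.
apply/funext => z; rewrite /evec /evH addr0; case: ifP => _; last by rewrite mulr0.
rewrite /evX; set a := s / 2 * x.2; set P := cpow _ _.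
have -> : (c_nu s * expR (- a))%:C = (c_nu s)%:C * (expR (- a))%:C :> C by rewrite -rmorphM.
have e : (expR (- a))%:C * (expR a)%:C = 1 :> C by rewrite -rmorphM -expRD addNr expR0.
by rewrite -mulrA (mulrCA _ P) e mulr1.
Qed.

(** [evec] is a positive multiple of [evH]. The multiples and the mass occur both in the numerator
    and in the denominator of the symbol and cancel. *)
Lemma symbol_kernel x y : k (hpt x)^* (hpt y) * Dk s x y = Kop x y.
Proof.
pose c p : R := c_nu s * expR (- (s / 2 * p.2)).
have c0 p : (c p)%:C != 0 :> C.
  by rewrite eq_complex/= eqxx andbT lt0r_neq0// mulr_gt0 ?expR_gt0// cnu_gt0.
have He p := Hspace_evH p s1; have H0 := Hspace0 s.
have m0 : (mass s)%:C != 0 :> C by rewrite eq_complex/= eqxx andbT lt0r_neq0// mass_gt0.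
have key f : Hspace s f -> inner s (fun z => (c x)%:C * f z + 0) (evec s (hpt y)) =
    (c x)%:C * (c y)%:C * ((mass s)%:C * shp s f y).
  move=> Hf; have Hf' := HspaceL (c x)%:C Hf H0; have Hy := HspaceL (c y)%:C (He y) H0.
  have /HspaceP[_ h1 _] := Hf'; have /HspaceP[_ h2 _] := Hy; have /HspaceP[_ h3 l3] := Hf.
  rewrite evec_evH innerE// -reproducing//.
  rewrite -(cintZ measurableT _ (cl2M l3 (cl2_Dk' y s1))); apply: eq_cint => p _.
  by rewrite !shpL shp_evH /shp !mul0r !addr0 cJM cJR DkJ -/(c y); ring.
have H : k (hpt x)^* (hpt y) = inner s (A (evec s (hpt x))) (evec s (hpt y)) / inner s (evec s (hpt x)) (evec s (hpt y)) := sA (hpt_uhp x) (hpt_uhp y).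
rewrite {}H.
rewrite [in A _]evec_evH linA// op0 key; last exact: HA.
rewrite [in X in _ / inner _ X _]evec_evH key// shp_evH -/(Kop x y).
by field; rewrite Dk_neq0 m0 !c0.
Qed.

Variable M : R.
Hypotheses (M0 : 0 <= M) (hM : forall f, Hspace s f -> n2 (shp s (A f)) <= M ^+ 2 * n2 (shp s f)).

Lemma n2_comb v : (n2 (shp s (comb v)))%:C = (mass s)%:C * qform (Dk s) v.
Proof.
rewrite -cint_mulJ.
have E p : shp s (comb v) p = \sum_(a <- v) a.1 * Dk s a.2 p.
  by rewrite /shp /comb mulr_suml; apply: eq_bigr => a _; rewrite -mulrA -/(shp s (evH s a.2) p) shp_evH.
pose G (a b : C * MX R) p := a.1 * (b.1)^* * (Dk s a.2 p * Dk s p b.2).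
have iG a b : cintg mu2 setT (G a b) by apply: cintgZ => //; apply: cl2M; [exact: cl2_Dk|exact: cl2_Dk'].
transitivity (cint mu2 setT (fun p => \sum_(a <- v) \sum_(b <- v) G a b p)).
  apply: eq_cint => p _; rewrite E cJ_sum mulr_suml; apply: eq_bigr => a _.
  by rewrite mulr_sumr; apply: eq_bigr => b _; rewrite /G cJM DkJ; ring.
rewrite (cint_sum measurableT); last by move=> a; exact: (cintg_sum measurableT).
rewrite /qform mulr_sumr; apply: eq_bigr => a _.
rewrite (cint_sum measurableT)// mulr_sumr; apply: eq_bigr => b _.
rewrite /G (cintZ measurableT); last by apply: cl2M; [exact: cl2_Dk|exact: cl2_Dk'].
by rewrite Dk_repro//; ring.
Qed.

(** Evaluating A f at y is a bounded functional of f, by [point_eval] and the norm of A; its values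
    on reproducing vectors are [Kop x y]. The results on functionals thus give regularity in x
    without an adjoint of A. *)
Lemma Kop_psd y v : 0 <= qform (fun x z => (M ^+ 2)%:C * Dk s x z - Kop x y * (Kop z y)^*) v.
Proof.
have m0 := mass_gt0 s1.
have [Hv Av] := comb_op v.
have -> : qform (fun x z => (M ^+ 2)%:C * Dk s x z - Kop x y * (Kop z y)^*) v =
    (M ^+ 2)%:C * qform (Dk s) v - shp s (A (comb v)) y * (shp s (A (comb v)) y)^*.
  rewrite Av cJ_sum mulr_suml /qform mulr_sumr -sumrB; apply: eq_bigr => a _.
  rewrite !mulr_sumr -sumrB; apply: eq_bigr => b _.
  by rewrite (cJM b.1) /Kop; ring.
have := point_eval y s1 (HA Hv); have := hM Hv => h1 h2.
have {}h1 := le_trans h2 h1.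
have qE : qform (Dk s) v = ((mass s)^-1 * n2 (shp s (comb v)))%:C.
  by rewrite rmorphM/= n2_comb mulrA -rmorphM/= mulVf ?mul1r// lt0r_neq0.
rewrite qE mulcJ -rmorphM -rmorphB/= lecR subr_ge0 -(ler_pM2l m0) (le_trans h1)//.
by rewrite mulrCA (mulrA (mass s)) mulfV ?mul1r// lt0r_neq0.
Qed.

(** Positivity at the two points x' and x with coefficients 1 and -1. The bound does not depend on
    y, so that continuity in each variable becomes joint continuity. *)
Lemma Kop_dist x x' y : cabs (Kop x' y - Kop x y) ^+ 2 <= M ^+ 2 * cabs (2 - Dk s x x' - Dk s x' x).
Proof.
have := Kop_psd y [:: (1, x'); (-1, x)].
rewrite qform2 !Dkxx.
set a := Kop x' y; set b := Kop x y; set D1 := Dk s x x'; set D2 := Dk s x' x.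
have E1 : (1 : C)^* = 1 by exact: rmorph1.
have E2 : (-1 : C)^* = -1 by rewrite cJN E1.
rewrite E1 E2 => h.
have : 0 <= (M ^+ 2)%:C * (2 - D1 - D2) - (a - b) * (a - b)^*.
  apply: le_trans h _; rewrite le_eqVlt; apply/orP; left; apply/eqP.
  by rewrite cJB; ring.
rewrite mulcJ subr_ge0 => H; rewrite -lecR (le_trans H)//.
have D12 : (2 - D1 - D2)^* = 2 - D1 - D2.
  rewrite !cJB !DkJ (_ : (2 : C)^* = 2); first by rewrite /D1 /D2; ring.
  by rewrite -[2]/(1 + 1) cJD E1.
have -> : 2 - D1 - D2 = (complex.Re (2 - D1 - D2))%:C.
  by apply: ceqP => //=; have := congr1 (@complex.Im R) D12; rewrite cImJ /=; lra.
rewrite -rmorphM lecR ler_wpM2l ?sqr_ge0// cabs_real ler_norm//.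
Qed.

Lemma Kop_ccvg x y : ccvg (nbhs (x, y)) (fun u : X * X => Kop u.1 u.2) (Kop x y).
Proof.
move=> eps eps0.
have /HspaceP[_ hf _] := HA (Hspace_evH x s1).
have c2 : ccvg (nbhs (x, y)) (fun u : X * X => Kop x u.2) (Kop x y).
  have c0 : ccvg (nbhs y) (Kop x) (Kop x y) by apply: ccvg_shp => z uz; apply: chol_ccont; exact: hf.
  move=> r r0; have := c0 r r0 => h; exact: (@cvg_snd _ _ (nbhs x) (nbhs y) _ _ h).
have c1 : (M ^+ 2 * cabs (2 - Dk s x u.1 - Dk s u.1 x)) @[u --> nbhs (x, y)] --> (0 : R).
  rewrite (_ : 0 = M ^+ 2 * cabs (2 - Dk s x x - Dk s x x)); last first.
    by rewrite !Dkxx (_ : 2 - 1 - 1 = 0 :> C) ?cabs0 ?mulr0//; ring.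
  apply: cvgM; first exact: cvg_cst.
  apply: ccvg_cabs; apply: ccvgB; first (apply: ccvgB; first exact: ccvg_cst).
    by apply: ccvg_Dk; [exact: cvg_cst|exact: cvg_fst].
  by apply: ccvg_Dk; [exact: cvg_fst|exact: cvg_cst].
have e2 : 0 < eps / 2 by rewrite divr_gt0.
have /cvgrPdist_lt/(_ ((eps / 2) ^+ 2)) := c1; rewrite exprn_gt0// => /(_ isT) n1.
have n2 := c2 _ e2.
apply: filterS2 n1 n2 => u; rewrite sub0r normrN ger0_norm ?mulr_ge0 ?sqr_ge0 ?cabs_ge0// => a1 a2.
have := le_lt_trans (Kop_dist x u.1 u.2) a1; rewrite ltr_sqr ?nnegrE ?cabs_ge0 ?(ltW e2)// => a3.
have -> : Kop x y - Kop u.1 u.2 = (Kop x y - Kop x u.2) + (Kop x u.2 - Kop u.1 u.2) by ring.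
rewrite (le_lt_trans (cabsD _ _))// (cabsC (Kop x u.2)); lra.
Qed.

Lemma Kop_cmeas2 : cmeas2 Kop.
Proof. by apply: (@ccvg_cmeas2 R Kop) => p q; exact: Kop_ccvg. Qed.

Let mKy y : cmeas setT (Kop ^~ y). Proof. by apply: kgood_sec; exact: Kop_cmeas2. Qed.

Lemma Kop_bound x y : cabs (Kop x y) <= M.
Proof. exact: (functional_bound M0 (Kop_psd y)). Qed.

Lemma Kop_col y : cl2 (Kop ^~ y) /\ n2 (Kop ^~ y) <= M ^+ 2 * mass s.
Proof.
have [l b] := functional_cl2 s1 M0 (mKy y) (Kop_psd y).
by split => //; rewrite -lee_fin -n2E.
Qed.

Lemma Kop_row x : cl2 (Kop x) /\ n2 (Kop x) <= M ^+ 2 * mass s.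
Proof.
have Hx := Hspace_evH x s1; have /HspaceP[_ _ l] := HA Hx; split => //.
rewrite -(n2_Dk x s1) (_ : Dk s x = shp s (evH s x)); first exact: hM.
by apply/funext => e; rewrite shp_evH.
Qed.

Lemma Kop_repr1 x y : cint mu2 setT (fun e => Dk s x e * Kop e y) = (mass s)%:C * Kop x y.
Proof. exact: (functional_repr s1 M0 (mKy y) (Kop_psd y)). Qed.

End Operator.
End Operators.

(** * Kernels of the elements of the algebras *)

Section SymbolKernels.
Context {R : realType}.
Local Notation C := R[i].
Local Notation X := (R * R)%type.
Local Notation mu2 := (@lebesgue_measure R \x @lebesgue_measure R)%E.
Implicit Types (h F : MX R -> C) (f : C -> C) (p q e x y : X) (s t M : R) (K : MX R -> MX R -> C) (k : @symbol R) (g : 'M[R]_2).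

Definition kap k x y : C := k (hpt x)^* (hpt y).

Lemma kap_adj k x y : kap (adj k) x y = (kap k y x)^*.
Proof. by apply: (congr1 (fun z => (k (hpt y)^* z)^*)); exact: conjcK. Qed.

Lemma Hspace_ext s f1 f2 : (forall z, ~ uhp z -> f1 z = 0) -> (forall z, ~ uhp z -> f2 z = 0) ->
  (forall x, shp s f1 x = shp s f2 x) -> f1 = f2.
Proof.
move=> z1 z2 e; apply/funext => z.
have [uz|/negP uz] := boolP (0 < complex.Im z); last by rewrite z1// z2.
have := e (hcoord z); rewrite /shp hcoordK// => /mulIf; apply.
by rewrite eq_complex/= eqxx andbT lt0r_neq0// expR_gt0.
Qed.

Lemma mobius_conj g (z : C) : mobius g z^* = (mobius g z)^*.
Proof. by rewrite /mobius cJM cJV !cJD !cJM !cJR. Qed.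

(** Vectors vanish off the upper half-plane, and [slash] has to preserve this. For real z the image
    is real by conjugation symmetry, which also covers the pole, where division by 0 gives 0. *)
Lemma mobius_nuhp g (z : C) : \det g = 1 -> ~ uhp z -> ~ uhp (mobius g z).
Proof.
move=> dg nz uz.
have [z0|z0|z0] := ltgtP (complex.Im z) 0; last first.
- have zr : z^* = z by apply: ceqP; rewrite ?cReJ ?cImJ// z0 oppr0.
  have := mobius_conj g z; rewrite zr => e.
  have : complex.Im (mobius g z) = 0.
    by have := congr1 (@complex.Im R) e; rewrite cImJ; move: (complex.Im _) => a; lra.
  by move: uz; rewrite /uhp/= => + e2; rewrite e2 ltxx.
- exact: nz.
- have uJ : uhp (z^*) by rewrite /uhp/= cImJ oppr_gt0.
  have := mobius_uhp dg uJ; rewrite mobius_conj /uhp/= cImJ.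
  by move: uz; rewrite /uhp/=; move: (complex.Im _) => a; lra.
Qed.

Lemma slash_nuhp s g f : \det g = 1 -> (forall z, ~ uhp z -> f z = 0) ->
  forall z, ~ uhp z -> slash s g f z = 0.
Proof. by move=> dg f0 z nz; rewrite /slash f0 ?mulr0//; exact: mobius_nuhp. Qed.

Lemma eps_neq0 g s x : eps g s x != 0.
Proof. by rewrite -cabs_gt0 cabs_eps. Qed.

Lemma shpZ0 s (a : C) f x : shp s (fun z => a * f z + 0) x = a * shp s f x.
Proof. by rewrite /shp addr0 mulrA. Qed.

(** [slash s g] maps the reproducing vector at the image of x to a phase times the one at x.
    Commuting A with it makes the kernel covariant with the same phases as [Dk], so the quotient,
    which is the symbol, is invariant. *)
Lemma kap_mob G s k g x y : 1 < s -> sym_alg G s k -> G g -> \det g = 1 ->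
  kap k (mob g x) (mob g y) = kap k x y.
Proof.
move=> s1 [A [bA cA] sA] Gg dg.
have H0 := Hspace0 s (R := R); have Hx := Hspace_evH x s1; have Hm := Hspace_evH (mob g x) s1.
have E : slash s g (evH s (mob g x)) = fun z => (eps g s x)^* * evH s x z + 0.
  apply: (@Hspace_ext s).
  - by apply: slash_nuhp => //; have /HspaceP[] := Hm.
  - by move=> z nz; have /HspaceP[e _ _] := Hx; rewrite (e z nz) mulr0 addr0.
  move=> p; rewrite shp_slash// shp_evH Dk_mob// shpZ0 shp_evH.
  rewrite -!mulrA (mulrC (Dk _ _ _)) !mulrA (mulrAC _ _ (eps g s p)) epsJ mul1r//.
have := cA _ _ Gg Hm; rewrite E; have [_ linA _] := bA; rewrite linA// (op0 bA) => /(congr1 (fun f => shp s f y)).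
rewrite shpZ0 shp_slash// -/(Kop s A x y) -/(Kop s A (mob g x) (mob g y)).
rewrite -!(symbol_kernel s1 bA sA) -/(kap k x y) -/(kap k (mob g x) (mob g y)) Dk_mob// => H.
have eJ := epsJ g s y.
have d0 := Dk_neq0 s x y; have e0 : (eps g s x)^* != 0 by rewrite conjc_eq0 eps_neq0.
apply: (mulIf d0); apply: (mulfI e0); rewrite H.
rewrite (_ : (eps g s y)^* * (kap k (mob g x) (mob g y) * ((eps g s x)^* * Dk s x y * eps g s y)) =
  ((eps g s y)^* * eps g s y) * ((eps g s x)^* * (kap k (mob g x) (mob g y) * Dk s x y))); last by ring.
by rewrite eJ mul1r.
Qed.

(* Holomorphic in the second variable and antiholomorphic in the first, up to the
   weights of shp. *)
Definition holK s K :=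
  (forall x, exists2 f, forall z, uhp z -> chol f z & forall e, shp s f e = K x e) /\
  (forall y, exists2 f, forall z, uhp z -> chol f z & forall e, shp s f e = (K e y)^*).

(** The row at x is the image of a vector of H_s, hence holomorphic. For the columns, antiholomorphy
    comes from the reproducing formula [Kop_repr1] through [hol_repr]. *)
Lemma sym_kernel G s k : 1 < s -> sym_alg G s k ->
  let K x y := kap k x y * Dk s x y in
  exists2 M, 0 <= M & [/\ forall x y, ccvg (nbhs (x, y)) (fun u : X * X => K u.1 u.2) (K x y),
    forall x y, cabs (K x y) <= M, holK s K,
    forall x, cl2 (K x) /\ n2 (K x) <= M ^+ 2 * mass s &
    forall y, cl2 (K ^~ y) /\ n2 (K ^~ y) <= M ^+ 2 * mass s].
Proof.
move=> s1 [A [bA _] sA] K; have [M M0 hM] := op_norm bA.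
have KE : K = Kop s A.
  by apply/funext => x; apply/funext => y; exact: (symbol_kernel s1 bA sA).
have HA f : Hspace s f -> Hspace s (A f) by case: bA => h _ _; exact: h.
exists M => //; rewrite KE; split.
- by move=> x y; exact: (Kop_ccvg s1 bA M0 hM).
- by move=> x y; exact: (Kop_bound s1 bA M0 hM).
- split=> [x|y].
    have /HspaceP[_ hf _] := HA _ (Hspace_evH x s1).
    by exists (A (evH s x)).
  have [lc _] := Kop_col s1 bA M0 hM y.
  apply: hol_repr => //; first exact: cl2J.
  move=> x; have lD := cl2_Dk x s1.
  rewrite -[(mass s)%:C]cJR -cJM -(Kop_repr1 s1 bA M0 hM) -(cintJ measurableT (cl2M lD lc)).
  by apply: eq_cint => e _; rewrite (cJM (Dk s x e)) DkJ mulrC.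
- by move=> x; exact: (Kop_row s1 bA hM).
- by move=> y; exact: (Kop_col s1 bA M0 hM).
Qed.

Lemma ccvg_sec2 K x y : ccvg (nbhs (x, y)) (fun u : X * X => K u.1 u.2) (K x y) ->
  ccvg (nbhs y) (K x) (K x y).
Proof.
move=> c r r0; have := c r r0.
move=> [[U V] [nU nV] UV]; apply: filterS nV => q Vq.
by apply: (UV (x, q)); split => //; exact: nbhs_singleton.
Qed.

Lemma ccvg_sec1 K x y : ccvg (nbhs (x, y)) (fun u : X * X => K u.1 u.2) (K x y) ->
  ccvg (nbhs x) (K ^~ y) (K x y).
Proof.
move=> c r r0; have := c r r0.
move=> [[U V] [nU nV] UV]; apply: filterS nU => q Uq.
by apply: (UV (q, y)); split => //; exact: nbhs_singleton.
Qed.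

Definition schurK M K := [/\ cmeas2 K, forall x, cl2 (K x), forall y, cl2 (K ^~ y),
  forall x, (\int[mu2]_e (cabs (K x e))%:E <= M%:E)%E & forall y, (\int[mu2]_e (cabs (K e y))%:E <= M%:E)%E].

Lemma ereal_sup_fin (T : Type) (D : set T) (F : T -> \bar R) (a : T) : D a -> (forall z, D z -> 0 <= F z)%E ->
  (ereal_sup [set F z | z in D] < +oo)%E -> exists M, forall z, D z -> (F z <= M%:E)%E.
Proof.
move=> Da F0; set S := ereal_sup _ => Sfin.
have le z : D z -> (F z <= S)%E by move=> Dz; apply: ereal_sup_ubound; exists z.
have S0 : (0 <= S)%E := le_trans (F0 a Da) (le a Da).
by exists (fine S) => z Dz; rewrite fineK ?ge0_fin_numE//; exact: le.
Qed.

(** The weight d^(t0) in the definition of [hat_alg] is |D_t0|, so the two suprema are Schur bounds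
    for the kernel K. *)
Lemma hat_kernel G t0 k : 1 < t0 -> hat_alg G t0 k ->
  let K x y := kap k x y * Dk t0 x y in
  exists2 M, 0 < M & [/\ holK t0 K, schurK M K &
    forall x y, ccvg (nbhs (x, y)) (fun u : X * X => K u.1 u.2) (K x y)].
Proof.
move=> t1 [sk S1 S2] K; have [M0 _ [cK bK hK rK lK]] := sym_kernel t1 sk.
rewrite -/K in cK bK hK rK lK.
have cabsK x y : cabs (k (hpt x)^* (hpt y)) * dker (hpt x) (hpt y) `^ t0 = cabs (K x y).
  by rewrite dkerE /K cabsM cabs_Dk.
have ui : uhp (hpt (0, 0) : C) by exact: hpt_uhp.
have nn z w : uhp z -> uhp w -> (0 <= cabs (k z^* w) * dker z w `^ t0)%R.
  by move=> _ _; rewrite mulr_ge0 ?cabs_ge0 ?powR_ge0.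
have e1 x : eint_nu 0 uhp (fun eta => cabs (k (hpt x)^* eta) * dker (hpt x) eta `^ t0) =
    (\int[mu2]_e (cabs (K x e))%:E)%E.
  rewrite eint_nuE.
  - by apply: eq_integral => e _; rewrite cabsK mul0r expR0 mulr1.
  - move=> p; rewrite (_ : _ \o _ = fun y => cabs (K x y)); last by apply/funext => y; exact: cabsK.
    exact: (ccvg_cabs (ccvg_sec2 (cK x p))).
  - by move=> p; rewrite cabsK cabs_ge0.
have e2 y : eint_nu 0 uhp (fun z => cabs (k z^* (hpt y)) * dker z (hpt y) `^ t0) =
    (\int[mu2]_e (cabs (K e y))%:E)%E.
  rewrite eint_nuE.
  - by apply: eq_integral => e _; rewrite cabsK mul0r expR0 mulr1.
  - move=> p; rewrite (_ : _ \o _ = fun x => cabs (K x y)); last by apply/funext => x; exact: cabsK.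
    exact: (ccvg_cabs (ccvg_sec1 (cK p y))).
  - by move=> p; rewrite cabsK cabs_ge0.
have [|A hA] := ereal_sup_fin ui _ S1.
  by move=> z uz; rewrite -(hcoordK uz) e1; apply: eI_ge0 => e; exact: cabs_ge0.
have [|B hB] := ereal_sup_fin ui _ S2.
  by move=> z uz; rewrite -(hcoordK uz) e2; apply: eI_ge0 => e; exact: cabs_ge0.
exists (`|A| + `|B| + 1); first by rewrite ltr_wpDl// addr_ge0.
split => //; split.
- by apply: (@ccvg_cmeas2 R K) => p q; exact: cK.
- by move=> x; case: (rK x).
- by move=> y; case: (lK y).
- move=> x; have := hA _ (hpt_uhp x); rewrite e1 => h; apply: (le_trans h).
  by rewrite lee_fin (le_trans (ler_norm A))// -addrA lerDl addr_ge0.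
- move=> y; have := hB _ (hpt_uhp y); rewrite e2 => h; apply: (le_trans h).
  rewrite lee_fin; have := ler_norm B; have := normr_ge0 A; move: `|A| `|B| => a b; lra.
Qed.

End SymbolKernels.

(** * The inequality for the derived kernel *)

Section Schur.
Context {R : realType}.
Local Notation C := R[i].
Local Notation mu2 := (@lebesgue_measure R \x @lebesgue_measure R)%E.
Implicit Types (h F : MX R -> C) (f : C -> C) (p q e x y : MX R) (s t M : R) (K U V : MX R -> MX R -> C).

(** Schur's test: Cauchy-Schwarz with the weight |K(., e)|, of total mass at most M, and then
    integration in e, which costs another M. *)
Lemma kgood_schur h K V M : 0 < M -> cl2 h -> schurK M K -> cmeas2 V ->
  (forall p e, cabs (V p e) <= cabs (h p) * cabs (K p e)) ->
  kgood V /\ (\int[mu2]_e (N1 V e ^+ 2)%:E <= (M ^+ 2 * n2 h)%:E)%E.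
Proof.
move=> M0 lh [mK rK cK iK1 iK2] mV le; have [mh fh] := lh.
have mhK : cmeas2 (fun e p => K p e * (h p) ^+ 2).
  apply: (@cmeasM _ _ _ setT (fun v : MX R * MX R => K v.2 v.1) (fun v => h v.2 ^+ 2)).
    exact: (@cmeas2_swap _ K).
  apply: (@cmeasM _ _ _ setT (fun v : MX R * MX R => h v.2) (fun v => h v.2)); exact: (@cmeas2_snd _ h).
have iV e : cintg mu2 setT (V ^~ e).
  have [m f] := cl2M lh (cK e).
  apply: (@cintg_le _ _ _ mu2 setT measurableT _ (fun p => cabs (h p * K p e))) => //; first exact: kgood_sec.
    exact: measurable_cabs.
  by move=> p _; rewrite cabsM.
have lV p : cl2 (V p).
  have [m f] := cl2Z (h p) (rK p).
  apply: (@cl2_le _ _ (fun e => cabs (h p * K p e) ^+ 2)) => //.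
  - exact: cmeas2_sec.
  - by apply: measurable_funX; exact: measurable_cabs.
  - by move=> e; rewrite ler_sqr ?nnegrE ?cabs_ge0// cabsM.
have mcK e : measurable_fun setT (fun p => cabs (K p e)) by apply: measurable_cabs; case: (cK e).
have mch := measurable_cabs mh.
pose Q e := (\int[mu2]_p (cabs (K p e * h p ^+ 2))%:E)%E.
have Q0 e : (0 <= Q e)%E by apply: eI_ge0 => p; exact: cabs_ge0.
have pt e : ((N1 V e ^+ 2)%:E <= M%:E * Q e)%E.
  have := @CS_weight _ _ _ mu2 (fun p => cabs (K p e)) (fun p => cabs (h p)) M (mcK e) mch
    (fun p => cabs_ge0 _) (fun p => cabs_ge0 _) M0 (iK2 e).
  have -> : (\int[mu2]_x (cabs (K x e) * cabs (h x) ^+ 2)%:E = Q e)%E.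
    by apply: eq_integral => p _; rewrite cabsM cabsX.
  apply: le_trans; rewrite expr2 EFinM -N1E//.
  have le1 : (\int[mu2]_x (cabs (V x e))%:E <= \int[mu2]_x (cabs (K x e) * cabs (h x))%:E)%E.
    apply: eI_le; [by apply: measurable_cabs; case: (iV e)|exact: measurable_funM|by move=> p; exact: cabs_ge0|].
    by move=> p; rewrite mulrC.
  by apply: lee_pmul => //; apply: eI_ge0 => p; exact: cabs_ge0.
have mQ : measurable_fun setT Q := measurable_eint22 mhK.
have IQ : (\int[mu2]_e Q e <= (M * n2 h)%:E)%E.
  rewrite /Q (tonelli_cabs22 mhK) (EFinM M) -(n2E lh) -eI_Z ?(ltW M0)//; last first.
  - by move=> p; exact: sqr_ge0.
  - by apply: measurable_funX.
  apply: ge0_le_integral => //.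
  - by move=> p _; apply: eI_ge0 => e; exact: cabs_ge0.
  - exact: (measurable_eint22 (@cmeas2_swap _ (fun e p => K p e * h p ^+ 2) mhK)).
  - by apply/measurable_EFinP; apply: measurable_funM => //; exact: measurable_funX.
  move=> p _; have mKp : measurable_fun setT (fun e => cabs (K p e)) by apply: measurable_cabs; case: (rK p).
  rewrite (eq_integral (fun e => (cabs (h p) ^+ 2 * cabs (K p e))%:E)); last first.
    by move=> e _; rewrite cabsM cabsX mulrC.
  rewrite eI_Z ?sqr_ge0//; last by move=> e; exact: cabs_ge0.
  by rewrite (mulrC M) (EFinM _ M); apply: lee_pmul => //; [by rewrite lee_fin sqr_ge0|apply: eI_ge0 => e; exact: cabs_ge0].
have bound : (\int[mu2]_e (N1 V e ^+ 2)%:E <= (M ^+ 2 * n2 h)%:E)%E.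
  apply: (@le_trans _ _ (\int[mu2]_e (M%:E * Q e))%E).
    apply: ge0_le_integral => //.
    - by move=> e _; rewrite lee_fin sqr_ge0.
    - by apply/measurable_EFinP; apply: measurable_funX; exact: measurable_N1.
    - by apply: emeasurable_funM.
  rewrite ge0_integralZl ?lee_fin ?(ltW M0)//.
  rewrite expr2 -mulrA (EFinM M); apply: lee_pmul => //; first by rewrite lee_fin ltW.
  by apply: integral_ge0 => e _.
split => //; split => //; exact: le_lt_trans bound (ltry _).
Qed.

Lemma int_cintg_real (g : MX R -> R) : (forall x, 0 <= g x) -> cintg mu2 setT (fun x => (g x)%:C) ->
  (\int[mu2]_x (g x)%:E = (complex.Re (cint mu2 setT (fun x => (g x)%:C)))%:E)%E.
Proof.
move=> g0 [_ fg]; rewrite (cint_real mu2 measurableT)/= /Rintegral fineK// ge0_fin_numE.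
  by move: fg; under eq_integral do rewrite cabs_real ger0_norm//.
by apply: integral_ge0 => x _; rewrite lee_fin.
Qed.

Lemma triple_fubini U (G : MX R -> MX R -> MX R -> C) : kgood U -> cmeas3 G ->
  (forall p q e, cabs (G p q e) <= cabs (U p e) * cabs (U q e)) ->
  [/\ forall p q, cintg mu2 setT (G p q),
      forall p, cintg mu2 setT (fun q => cint mu2 setT (G p q)),
      cintg mu2 setT (fun p => cint mu2 setT (fun q => cint mu2 setT (G p q))),
      cint mu2 setT (fun p => cint mu2 setT (fun q => cint mu2 setT (G p q))) =
        cint mu2 setT (fun q => cint mu2 setT (fun p => cint mu2 setT (G p q))) &
      forall p, cint mu2 setT (fun q => cint mu2 setT (G p q)) =
        cint mu2 setT (fun e => cint mu2 setT (fun q => G p q e))].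
Proof.
move=> kU mG bG; have [i0 i1 i2] := triple_integrable kU.
have mG1 p q : cmeas setT (G p q) by apply: cmeas2_sec; exact: cmeas3_sec1.
have mG2 := cmeas3_cint mG.
have [mU lU iU _] := kU.
pose j p q := complex.Re (cint mu2 setT (fun e => (cabs (U p e))%:C * (cabs (U q e))%:C)).
have eJ p q : (fun e => (cabs (U p e))%:C * (cabs (U q e))%:C) = (fun e => (cabs (U p e) * cabs (U q e))%:C) :> (MX R -> C).
  by apply/funext => e; rewrite -rmorphM.
have g0 p q e : 0 <= cabs (U p e) * cabs (U q e) by rewrite mulr_ge0 ?cabs_ge0.
have jE p q : (\int[mu2]_e (cabs (U p e) * cabs (U q e))%:E = (j p q)%:E)%E.
  by rewrite int_cintg_real//; [rewrite /j eJ|rewrite -eJ; exact: i0].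
have jC p : (fun q => cint mu2 setT (fun e => (cabs (U p e))%:C * (cabs (U q e))%:C)) = (fun q => (j p q)%:C).
  apply/funext => q; rewrite /j eJ (cint_real mu2 measurableT (fun e : MX R => cabs (U p e) * cabs (U q e))).
  by [].
have j0 p q : 0 <= j p q.
  by rewrite -lee_fin -jE; apply: eI_ge0 => e; exact: g0.
have i1' p : cintg mu2 setT (fun q => (j p q)%:C) by have := i1 p; rewrite (jC p).
pose jj p := complex.Re (cint mu2 setT (fun q => (j p q)%:C)).
have jjE p : (\int[mu2]_q (j p q)%:E = (jj p)%:E)%E by rewrite int_cintg_real.
have jj0 p : 0 <= jj p by rewrite -lee_fin -jjE; apply: eI_ge0 => q; exact: j0.
have jjC : (fun p => cint mu2 setT (fun q => cint mu2 setT (fun e => (cabs (U p e))%:C * (cabs (U q e))%:C))) =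
    (fun p => (jj p)%:C).
  apply/funext => p; rewrite (jC p) /jj.
  by rewrite (cint_real mu2 measurableT (fun q : MX R => j p q)).
have i2' : cintg mu2 setT (fun p => (jj p)%:C) by move: i2; rewrite jjC.
have bnd p q : (\int[mu2]_e (cabs (G p q e))%:E <= (j p q)%:E)%E.
  rewrite -jE; apply: eI_le => //; first by apply: measurable_cabs.
    by apply: measurable_funM; apply: measurable_cabs; [case: (lU p)|case: (lU q)].
  by move=> e; exact: cabs_ge0.
have mjp p : measurable_fun setT (j p) by case: (i1' p) => -[].
have mjj : measurable_fun setT jj by case: i2' => -[].
have iG p q : cintg mu2 setT (G p q) by split => //; exact: le_lt_trans (bnd p q) (ltry _).
have bJ p q : cabs (cint mu2 setT (G p q)) <= j p q.
  by rewrite -lee_fin (le_trans _ (bnd p q))// (@ecabs_cint _ _ _ mu2 setT measurableT).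
have mJp p : cmeas setT (fun q => cint mu2 setT (G p q)).
  exact: (@cmeas2_sec _ (fun p q => cint mu2 setT (G p q)) p mG2).
have bnd2 p : (\int[mu2]_q (cabs (cint mu2 setT (G p q)))%:E <= (jj p)%:E)%E.
  rewrite -jjE; apply: eI_le => //; first exact: measurable_cabs.
  by move=> q; exact: cabs_ge0.
have iJ p : cintg mu2 setT (fun q => cint mu2 setT (G p q)).
  by split => //; exact: le_lt_trans (bnd2 p) (ltry _).
have finjj : (\int[mu2]_p (jj p)%:E < +oo)%E by rewrite int_cintg_real ?ltry.
have fin2 : (\int[mu2]_p \int[mu2]_q (cabs (cint mu2 setT (G p q)))%:E < +oo)%E.
  apply: le_lt_trans finjj; apply: ge0_le_integral => //.
  - by move=> p _; apply: eI_ge0 => q; exact: cabs_ge0.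
  - exact: (measurable_eint22 mG2).
  - exact/measurable_EFinP.
split; [exact: iG|exact: iJ| | |].
- exact: (@cintg_cint22 _ (fun p q => cint mu2 setT (G p q))).
- exact: (@cfubini22 _ (fun p q => cint mu2 setT (G p q))).
move=> p; apply: (@cfubini22 _ (G p)); first exact: cmeas3_sec1.
apply: (@le_lt_trans _ _ (\int[mu2]_q (j p q)%:E)%E); last by rewrite jjE ltry.
apply: ge0_le_integral => //.
- by move=> q _; apply: eI_ge0 => e; exact: cabs_ge0.
- by apply: (measurable_eint22 (f := G p)); exact: cmeas3_sec1.
- exact/measurable_EFinP.
Qed.

End Schur.

Section MainInequality.
Context {R : realType}.
Local Notation C := R[i].
Local Notation mu2 := (@lebesgue_measure R \x @lebesgue_measure R)%E.
Implicit Types (h F : MX R -> C) (f : C -> C) (p q e x y : MX R) (s t d M : R) (K U V : MX R -> MX R -> C).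

(** [log_bound] between the exponents 0 and d, because |D_d(p, e) D_d(q, e)| = |b^d| |D_d(p, q)|. *)
Lemma weight_bound d : 0 < d -> exists2 M, 0 < M & forall p e q,
  cabs (Dk d p e) * cabs (Dk d q e) * (1 + cabs (lbX p e q) + cabs (lbX p e q) ^+ 2) <= M.
Proof.
move=> d0; have [M M0 hM] := log_bound d0; exists M => // p e q.
have := hM p e q; rewrite cpowr0 ?bX_neq0// cabs1 mulr1 => h.
have -> : cabs (Dk d p e) * cabs (Dk d q e) = cabs (cpow (bX p e q) d) * cabs (Dk d p q).
  by rewrite -(cabsJ (Dk d q e)) DkJ -!cabsM cpow_bX_Dk.
rewrite mulrAC; apply: le_trans h; rewrite ler_piMr ?cabs_Dk_le1 ?(ltW d0)//.
by rewrite mulr_ge0 ?cabs_ge0// !addr_ge0 ?cabs_ge0 ?sqr_ge0.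
Qed.

Lemma weight_bound1 d t p e q : 1 < t -> cabs (Dk d p e) * cabs (Dk d q e) * cabs (1 + (t - 1)%:C * lbX p e q) <=
  t * (cabs (Dk d p e) * cabs (Dk d q e) * (1 + cabs (lbX p e q) + cabs (lbX p e q) ^+ 2)).
Proof.
move=> t1; rewrite mulrCA ler_wpM2l ?mulr_ge0 ?cabs_ge0//.
rewrite (le_trans (cabsD _ _))// cabs1 cabsM cabs_real ger0_norm; last by lra.
have := cabs_ge0 (lbX p e q); have := sqr_ge0 (cabs (lbX p e q)).
by move: (cabs _) => L; nra.
Qed.

(** If K is the kernel of a symbol k in weight s, this is k(e, p)^* [Dk (s + d) p e]. Splitting off
    [Dk d] keeps apart the decay that absorbs the logarithm from the part with Schur bounds. *)
Definition vker d K p e : C := (K e p)^* * Dk d p e.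

Lemma cmeas2_vker d K : cmeas2 K -> cmeas2 (vker d K).
Proof.
move=> mK; apply: (@cmeasM _ _ _ setT (fun v : MX R * MX R => (K v.2 v.1)^*) (fun v => Dk d v.1 v.2)).
  exact: (cmeasJ (@cmeas2_swap _ K mK)).
exact: cmeas2_Dk.
Qed.

Lemma schurK_T M K : schurK M K -> schurK M (fun p e => K e p).
Proof. by case=> mK a b c d'; split => //; exact: (@cmeas2_swap _ K). Qed.

Lemma shp_evX_mul s d f x e : shp (s + d) (fun z => f z * evX d x z) e = shp s f e * Dk d x e.
Proof.
rewrite -shp_evX /shp.
have -> : (expR ((s + d) / 2 * e.2))%:C = (expR (s / 2 * e.2))%:C * (expR (d / 2 * e.2))%:C :> C.
  by rewrite -rmorphM -expRD; congr (expR _)%:C; field.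
ring.
Qed.

Lemma cl2_mulDk F d x : 0 <= d -> cl2 F -> cl2 (fun e => F e * Dk d x e).
Proof.
move=> d0 [mF fF]; apply: (@cl2_le _ _ (fun e => cabs (F e) ^+ 2)) => //.
- by apply: cmeasM => //; exact: cmeas_Dk2.
- by apply: measurable_funX; exact: measurable_cabs.
- by move=> e; rewrite ler_sqr ?nnegrE ?cabs_ge0// cabsM ler_piMr ?cabs_ge0// cabs_Dk_le1.
Qed.

(** As a function of e, (K e p)^* comes from a holomorphic function in weight s, and multiplying it
    by [evX d p] gives one in weight s + d. *)
Lemma vker_repr s d K p x : 1 < s -> 0 <= d -> holK s K -> cl2 (K ^~ p) ->
  cint mu2 setT (fun e => vker d K p e * Dk (s + d) e x) = (mass (s + d))%:C * vker d K p x.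
Proof.
move=> s1 d0 [_ hK] lK; have [f hf fE] := hK p.
have E e : vker d K p e = shp (s + d) (fun z => f z * evX d p z) e.
  by rewrite shp_evX_mul fE.
rewrite E -reproducing.
- by apply: eq_cint => e _; rewrite E.
- by rewrite (lt_le_trans s1)// lerDl.
- by move=> z uz; apply: cholM; [exact: hf|exact: evX_chol].
rewrite (_ : shp _ _ = fun e => (K e p)^* * Dk d p e); first by apply: cl2_mulDk => //; exact: cl2J.
by apply/funext => e; rewrite -E.
Qed.

Lemma cmeas_wgt t : cmeas3 (fun p q e => 1 + (t - 1)%:C * lbX p e q : C).
Proof.
apply: (@cmeasD _ _ _ setT (fun=> 1) (fun v : (MX R * MX R) * MX R => (t - 1)%:C * lbX v.1.1 v.2 v.1.2)).
  exact: cmeas_cst.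
apply: (@cmeasM _ _ _ setT (fun=> (t - 1)%:C)); first exact: cmeas_cst.
exact: cmeas3_lbX.
Qed.

(** Up to the factor 1 / (4 pi), the kernel in weight s + d of the derived symbol, by
    [Cderiv_kernel]. *)
Definition dker2 (s d : R) K K' p q : C :=
  cint mu2 setT (fun e => vker d K p e * (vker d K' q e)^* * (1 + (s + d - 1)%:C * lbX p e q)).

Lemma dker2_int s d K K' : 1 < s -> 0 < d -> cmeas2 K -> cmeas2 K' ->
  (forall y, cl2 (K ^~ y)) -> (forall y, cl2 (K' ^~ y)) -> forall p q,
  cintg mu2 setT (fun e => vker d K p e * (vker d K' q e)^* * (1 + (s + d - 1)%:C * lbX p e q)).
Proof.
move=> s1 d0 mK mK' lK lK' p q; have [B B0 hB] := weight_bound d0.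
have t1 : 1 < s + d by rewrite (lt_le_trans s1)// lerDl ltW.
have [m f] := cl2M (lK p) (lK' q).
have mw : cmeas setT (fun e => 1 + (s + d - 1)%:C * lbX p e q).
  exact: (@cmeas2_sec _ (fun q e => 1 + (s + d - 1)%:C * lbX p e q) q (cmeas3_sec1 p (cmeas_wgt (s + d)))).
have c0 : 0 <= (s + d) * B by rewrite mulr_ge0 ?(ltW B0)//; lra.
have m' := measurable_cabs m.
apply: (@cintg_le _ _ _ mu2 setT measurableT _ (fun e => (s + d) * B * cabs (K e p * K' e q))).
- apply: cmeasM => //; apply: cmeasM; first exact: (cmeas2_sec p (cmeas2_vker d mK)).
  by apply: cmeasJ; exact: (cmeas2_sec q (cmeas2_vker d mK')).
- exact: measurable_funM.
- move=> e _; have wb := weight_bound1 d p e q t1.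
  have {}wb := le_trans wb (ler_wpM2l (ltW (lt_trans ltr01 t1)) (hB p e q)).
  rewrite /vker !cabsM !cabsJ ?cabsM ?cabsJ.
  rewrite (_ : _ * _ * _ * _ = (cabs (Dk d p e) * cabs (Dk d q e) * cabs (1 + (s + d - 1)%:C * lbX p e q)) *
     (cabs (K e p) * cabs (K' e q))); last by ring.
  by rewrite ler_wpM2r// mulr_ge0 ?cabs_ge0.
- by rewrite eI_Z//; [rewrite lte_mul_pinfty|move=> e; exact: cabs_ge0].
Qed.

Lemma cint_sum2 (N : nat) (F : 'I_N -> 'I_N -> MX R -> C) : (forall i j, cintg mu2 setT (F i j)) ->
  cint mu2 setT (fun x => \sum_(i < N) \sum_(j < N) F i j x) = \sum_(i < N) \sum_(j < N) cint mu2 setT (F i j).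
Proof.
move=> iF; rewrite (cint_sum measurableT); last by move=> i; exact: (cintg_sum measurableT _ (iF i)).
by apply: eq_bigr => i _; exact: (cint_sum measurableT _ (iF i)).
Qed.

Lemma main_inequality (N : nat) (s d M : R) (K : 'I_N -> MX R -> MX R -> C) (h : 'I_N -> MX R -> C) :
  1 < s -> 0 < d -> 0 < M -> (forall i, holK s (K i)) -> (forall i, schurK M (K i)) -> (forall i, cl2 (h i)) ->
  \sum_(i < N) \sum_(j < N) cint mu2 setT (fun p => cint mu2 setT (fun q => h i p * (h j q)^* * dker2 s d (K i) (K j) p q))
    <= 0.
Proof.
move=> s1 d0 M0 hK sK lh; have d0' := ltW d0.
have t1 : 1 < s + d by rewrite (lt_le_trans s1)// lerDl.
have [B B0 hB] := weight_bound d0.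
(* W is a product bound, so each factor receives the square root. B absorbs the logarithms in [VW],
   and the factor s + d is the price of bounding the weight 1 + (t - 1) Log b in each term
   [G i j]. *)
pose b : R := Num.sqrt ((s + d) * B).
have tB0 : 0 <= (s + d) * B by rewrite mulr_ge0 ?(ltW B0)//; lra.
have b0 : 0 <= b by rewrite sqrtr_ge0.
pose Wi i p e : C := (b * (cabs (h i p) * cabs (K i e p)))%:C.
pose W p e : C := \sum_(i < N) Wi i p e.
pose Vi i p e : C := h i p * vker d (K i) p e.
pose V p e : C := \sum_(i < N) Vi i p e.
have mK i : cmeas2 (K i) by case: (sK i).
have mh i : cmeas setT (h i) by case: (lh i).
have mVi i : cmeas2 (Vi i).
  apply: (@cmeasM _ _ _ setT (fun v : MX R * MX R => h i v.1) (fun v => vker d (K i) v.1 v.2)).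
    exact: (@cmeas2_fst _ (h i)).
  exact: cmeas2_vker.
have kVi i : kgood (Vi i).
  apply: (proj1 (kgood_schur M0 (lh i) (schurK_T (sK i)) (mVi i) _)) => p e.
  by rewrite /Vi /vker !cabsM cabsJ ler_wpM2l ?cabs_ge0// ler_piMr ?cabs_ge0// cabs_Dk_le1.
have kWi i : kgood (Wi i).
  have mW : cmeas2 (fun p e => (cabs (h i p) * cabs (K i e p))%:C : C).
    apply: (@cmeas_real _ _ _ setT (fun v : MX R * MX R => cabs (h i v.1) * cabs (K i v.2 v.1))).
    apply: measurable_funM; apply: measurable_cabs; first exact: (@cmeas2_fst _ (h i)).
    exact: (@cmeas2_swap _ (K i)).
  have kW : kgood (fun p e => (cabs (h i p) * cabs (K i e p))%:C : C).
    apply: (proj1 (kgood_schur M0 (lh i) (schurK_T (sK i)) mW _)) => p e.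
    by rewrite cabs_real ger0_norm// mulr_ge0 ?cabs_ge0.
  have := kgoodZ b%:C kW; rewrite (_ : (fun x e => b%:C * _) = Wi i)//.
  by apply/funext => p; apply/funext => e; rewrite /Wi [RHS]rmorphM.
have kV : kgood V by exact: (@kgood_sum _ _ (index_enum _) Vi).
have kW : kgood W by exact: (@kgood_sum _ _ (index_enum _) Wi).
have WE p e : cabs (W p e) = b * \sum_(i < N) cabs (h i p) * cabs (K i e p).
  rewrite /W /Wi -rmorph_sum cabs_real -mulr_sumr ger0_norm// mulr_ge0// sumr_ge0// => i _.
  by rewrite mulr_ge0 ?cabs_ge0.
have Wige i p e : cabs (Wi i p e) <= cabs (W p e).
  rewrite WE /Wi cabs_real ger0_norm ?mulr_ge0 ?cabs_ge0// ler_wpM2l//.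
  rewrite (bigD1 i)//= lerDl sumr_ge0// => j _; by rewrite mulr_ge0 ?cabs_ge0.
have Vle p e : cabs (V p e) <= cabs (Dk d p e) * \sum_(i < N) cabs (h i p) * cabs (K i e p).
  rewrite /V (le_trans (cabs_sum _ _ _))// mulr_sumr ler_sum// => i _.
  rewrite le_eqVlt; apply/orP; left; apply/eqP; rewrite /Vi /vker !cabsM cabsJ; ring.
have b2 : b * b = (s + d) * B by rewrite -expr2 sqr_sqrtr.
have st1 : 1 <= s + d by exact: ltW.
have VW p q e : cabs (V p e) * cabs (V q e) * (1 + cabs (lbX p e q) + cabs (lbX p e q) ^+ 2)
    <= cabs (W p e) * cabs (W q e).
  have S0 x : 0 <= \sum_(i < N) cabs (h i x) * cabs (K i e x).
    by rewrite sumr_ge0// => i _; rewrite mulr_ge0 ?cabs_ge0.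
  rewrite !WE mulrACA b2.
  have P0 : 0 <= 1 + cabs (lbX p e q) + cabs (lbX p e q) ^+ 2 by rewrite !addr_ge0 ?cabs_ge0 ?sqr_ge0.
  have hv := ler_pM (cabs_ge0 _) (cabs_ge0 _) (Vle p e) (Vle q e).
  apply: (le_trans (ler_wpM2r P0 hv)).
  have := S0 q; have := S0 p; move: (\sum_(i < N) cabs (h i p) * _) (\sum_(i < N) cabs (h i q) * _) => S S' S1 S2.
  rewrite (_ : _ * S * (_ * S') * _ = cabs (Dk d p e) * cabs (Dk d q e) *
    (1 + cabs (lbX p e q) + cabs (lbX p e q) ^+ 2) * (S * S')); last by ring.
  apply: ler_wpM2r; first by rewrite mulr_ge0.
  by apply: (le_trans (hB p e q)); rewrite ler_peMl// ltW.
pose w p q e : C := 1 + (s + d - 1)%:C * lbX p e q.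
pose G i j p q e := Vi i p e * (Vi j q e)^* * w p q e.
have bG i j p q e : cabs (G i j p q e) <= cabs (W p e) * cabs (W q e).
  rewrite (le_trans _ (ler_pM (cabs_ge0 _) (cabs_ge0 _) (Wige i p e) (Wige j q e)))//.
  rewrite /Wi !cabs_real !ger0_norm ?mulr_ge0 ?cabs_ge0// mulrACA b2.
  have wb := weight_bound1 d p e q t1.
  have := le_trans wb (ler_wpM2l (le_trans ler01 st1) (hB p e q)) => {}wb.
  have -> : cabs (G i j p q e) = cabs (h i p) * (cabs (K i e p) * cabs (Dk d p e)) *
      (cabs (h j q) * (cabs (K j e q) * cabs (Dk d q e))) * cabs (w p q e).
    by rewrite /G cabsM; congr (_ * _); rewrite cabsM cabsJ /Vi /vker !cabsM !cabsJ.
  rewrite (_ : cabs (h i p) * _ * _ * _ = (cabs (Dk d p e) * cabs (Dk d q e) * cabs (w p q e)) *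
     (cabs (h i p) * cabs (K i e p) * (cabs (h j q) * cabs (K j e q)))); last by ring.
  by rewrite ler_wpM2r// !mulr_ge0 ?cabs_ge0.
have mG i j : cmeas3 (G i j).
  apply: (@cmeasM _ _ _ setT (fun v : (MX R * MX R) * MX R => Vi i v.1.1 v.2 * (Vi j v.1.2 v.2)^*)
    (fun v => w v.1.1 v.1.2 v.2)); last exact: cmeas_wgt.
  apply: (@cmeasM _ _ _ setT (fun v : (MX R * MX R) * MX R => Vi i v.1.1 v.2)); first exact: (cmeas3_13 (mVi i)).
  exact: (cmeasJ (cmeas3_23 (mVi j))).
have TF1 i j p q : cintg mu2 setT (G i j p q) by case: (triple_fubini kW (mG i j) (bG i j)) => + _ _; exact.
have TF2 i j p : cintg mu2 setT (fun q => cint mu2 setT (G i j p q)).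
  by case: (triple_fubini kW (mG i j) (bG i j)) => _ + _; exact.
have TF3 i j : cintg mu2 setT (fun p => cint mu2 setT (fun q => cint mu2 setT (G i j p q))).
  by case: (triple_fubini kW (mG i j) (bG i j)) => _ _; exact.
have rV p x : cint mu2 setT (fun e => V p e * Dk (s + d) e x) = (mass (s + d))%:C * V p x.
  have i0 i : cintg mu2 setT (fun e => Vi i p e * Dk (s + d) e x).
    by apply: cl2M; [case: (kVi i)|exact: cl2_Dk'].
  rewrite (_ : (fun e => _) = fun e => \sum_(i < N) Vi i p e * Dk (s + d) e x); last first.
    by apply/funext => e; rewrite mulr_suml.
  rewrite (cint_sum measurableT)// mulr_sumr; apply: eq_bigr => i _.
  have lp : cl2 (K i ^~ p) by case: (sK i).
  rewrite /Vi (mulrCA _ (h i p)) -(vker_repr x s1 d0' (hK i) lp) -(cintZ measurableT).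
    by apply: eq_cint => e _; rewrite mulrA.
  apply: cl2M; last exact: cl2_Dk'.
  by apply: (@cl2_mulDk (fun e => (K i e p)^*)) => //; exact: cl2J.
have := log_inequality t1 kV kW rV VW.
have e1 p q : cint mu2 setT (fun e => V p e * (V q e)^* * (1 + (s + d - 1)%:C * lbX p e q)) =
    \sum_(i < N) \sum_(j < N) cint mu2 setT (G i j p q).
  rewrite -(cint_sum2 (fun i j => TF1 i j p q)); apply: eq_cint => e _.
  rewrite -/(w p q e) cJ_sum mulr_suml mulr_suml; apply: eq_bigr => i _.
  by rewrite mulr_sumr mulr_suml; apply: eq_bigr => j _.
have e2 p : cint mu2 setT (fun q => cint mu2 setT (fun e => V p e * (V q e)^* * (1 + (s + d - 1)%:C * lbX p e q))) =
    \sum_(i < N) \sum_(j < N) cint mu2 setT (fun q => cint mu2 setT (G i j p q)).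
  by rewrite -(cint_sum2 (fun i j => TF2 i j p)); apply: eq_cint => q _; exact: e1.
have e3 : cint mu2 setT (fun p => cint mu2 setT (fun q => cint mu2 setT (fun e => V p e * (V q e)^* * (1 + (s + d - 1)%:C * lbX p e q)))) =
    \sum_(i < N) \sum_(j < N) cint mu2 setT (fun p => cint mu2 setT (fun q => cint mu2 setT (G i j p q))).
  by rewrite -(cint_sum2 TF3); apply: eq_cint => p _; exact: e2.
rewrite e3; apply: le_trans; rewrite le_eqVlt; apply/orP; left; apply/eqP.
apply: eq_bigr => i _; apply: eq_bigr => j _; apply: eq_cint => p _; apply: eq_cint => q _.
have ck (l : 'I_N) y : cl2 (K l ^~ y) by case: (sK l).
rewrite /dker2 -(cintZ measurableT); last exact: dker2_int.
apply: eq_cint => e _; rewrite /G /Vi /w (cJM (h j q)); ring.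
Qed.

End MainInequality.

(** * The derivative of the product of symbols *)

Section DerivativeKernel.
Context {R : realType}.
Local Notation C := R[i].
Local Notation X := (R * R)%type.
Local Notation mu2 := (@lebesgue_measure R \x @lebesgue_measure R)%E.
Implicit Types (h F : MX R -> C) (f : C -> C) (p q e x y : X) (r s t d M : R) (K U V : MX R -> MX R -> C) (k l : @symbol R).

Lemma cpow_bX r p e q : cpow (bX p e q) r = Dk r p e * Dk r e q * Dk (- r) p q.
Proof.
rewrite -cpow_bX_Dk -mulrA -DkD subrr (_ : Dk 0 p q = 1) ?mulr1//.
by rewrite DkE mul0r cexp0.
Qed.

Lemma ccvg_cpow_bX r p e q : ccvg (nbhs e) (fun e => cpow (bX p e q) r) (cpow (bX p e q) r).
Proof.
rewrite cpow_bX; under [X in ccvg _ X]eq_fun do rewrite cpow_bX.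
apply: ccvgM; last exact: ccvg_cst.
by apply: ccvgM; apply: ccvg_Dk; [exact: cvg_cst|exact: cvg_id|exact: cvg_id|exact: cvg_cst].
Qed.

Lemma star_kapE r l k p q : (forall e, ccvg (nbhs e) (kap l p) (kap l p e)) ->
  (forall e, ccvg (nbhs e) (kap k ^~ q) (kap k e q)) ->
  kap (star r l k) p q = (c_nu r)%:C * cint mu2 setT (fun e => kap l p e * kap k e q * cpow (bX p e q) r).
Proof.
move=> cl ck; rewrite {1}/kap /star; congr (_ * _); rewrite cint_nuE.
  apply: eq_cint => e _; rewrite mul0r expR0.
  by rewrite [RHS](_ : _ = kap l p e * kap k e q * cpow (bX p e q) r * 1%:C)// mulr1.
move=> e; apply: ccvgM; first exact: (ccvgM (cl e) (ck e)).
exact: ccvg_cpow_bX.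
Qed.

Lemma kap_ccvg s k : (forall x y, ccvg (nbhs (x, y)) (fun u : X * X => kap k u.1 u.2 * Dk s u.1 u.2) (kap k x y * Dk s x y)) ->
  (forall x y, ccvg (nbhs y) (kap k x) (kap k x y)) /\ (forall x y, ccvg (nbhs x) (kap k ^~ y) (kap k x y)).
Proof.
move=> c; have E x y : kap k x y = kap k x y * Dk s x y * Dk (- s) x y.
  by rewrite -mulrA -DkD subrr (_ : Dk 0 x y = 1) ?mulr1// DkE mul0r cexp0.
split=> x y.
  rewrite [X in ccvg _ _ X]E [X in ccvg _ X](_ : _ = fun y => kap k x y * Dk s x y * Dk (- s) x y); last by apply/funext => z; exact: E.
  apply: ccvgM; first exact: (@ccvg_sec2 _ (fun x y => kap k x y * Dk s x y) x y (c x y)).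
  by apply: ccvg_Dk; [exact: cvg_cst|exact: cvg_id].
rewrite [X in ccvg _ _ X]E [X in ccvg _ X](_ : _ = fun x => kap k x y * Dk s x y * Dk (- s) x y); last by apply/funext => z; exact: E.
apply: ccvgM; first exact: (@ccvg_sec1 _ (fun x y => kap k x y * Dk s x y) x y (c x y)).
by apply: ccvg_Dk; [exact: cvg_id|exact: cvg_cst].
Qed.

(** Since c_r = (r - 1) / (4 pi), the derivative of c_r b^r at t is b^t (1 + (t - 1) Log b) / (4
    pi). The remainder is quadratic in r - t, with a coefficient dominated by the integrable |a b^s|
    by [log_bound] between s and t. *)
Lemma star_limit s t p q (a : MX R -> C) : 1 < s -> s < t -> cmeas setT a ->
  cintg mu2 setT (fun e => a e * cpow (bX p e q) s) ->
  let S r := cint mu2 setT (fun e => a e * cpow (bX p e q) r) in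
  ccvg t^'+ (fun r => ((r - t)^-1)%:C * ((c_nu r)%:C * S r - (c_nu t)%:C * S t))
    (((4 * pi)^-1)%:C * cint mu2 setT (fun e => a e * cpow (bX p e q) t * (1 + (t - 1)%:C * lbX p e q))).
Proof.
move=> s1 st ma is_ S; have t1 : 1 < t by exact: lt_trans st.
have mb r : cmeas setT (fun e => cpow (bX p e q) r).
  by apply: ccvg_cmeas => e; exact: ccvg_cpow_bX.
have mL : cmeas setT (fun e => lbX p e q).
  exact: (@cmeas2_sec _ (fun q e => lbX p e q) q (cmeas3_sec1 p cmeas3_lbX)).
have [ms fs] := is_; have mcs := measurable_cabs ms.
have dom r : s < r -> exists2 M, 0 < M & forall e, cabs (a e * cpow (bX p e q) r) * (1 + cabs (lbX p e q) + cabs (lbX p e q) ^+ 2) <=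
    M * cabs (a e * cpow (bX p e q) s).
  move=> sr; have [M M0 hM] := log_bound sr; exists M => // e.
  by rewrite !(cabsM (a e)) -mulrA [leRHS]mulrCA ler_wpM2l ?cabs_ge0.
have fin M : 0 < M -> (\int[mu2]_e (M * cabs (a e * cpow (bX p e q) s))%:E < +oo)%E.
  move=> M0; rewrite eI_Z ?(ltW M0)//; first by rewrite lte_mul_pinfty// lee_fin ltW.
  by move=> e; exact: cabs_ge0.
have mM M : measurable_fun setT (fun e => M * cabs (a e * cpow (bX p e q) s)) by exact: measurable_funM.
have L0 e : 0 <= cabs (lbX p e q) by exact: cabs_ge0.
have L2 e : 0 <= cabs (lbX p e q) ^+ 2 by exact: sqr_ge0.
have ir r : s < r -> cintg mu2 setT (fun e => a e * cpow (bX p e q) r).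
  move=> sr; have [M M0 hM] := dom r sr.
  apply: (@cintg_le _ _ _ mu2 setT measurableT _ (fun e => M * cabs (a e * cpow (bX p e q) s))) => //.
  - exact: (cmeasM ma (mb r)).
  - exact: mM.
  - by move=> e _; apply: le_trans (hM e); rewrite ler_peMr ?cabs_ge0// -addrA lerDl addr_ge0.
  - exact: fin.
have [M M0 hM] := dom t st.
have iL : cintg mu2 setT (fun e => a e * cpow (bX p e q) t * lbX p e q).
  apply: (@cintg_le _ _ _ mu2 setT measurableT _ (fun e => M * cabs (a e * cpow (bX p e q) s))) => //.
  - exact: (cmeasM (cmeasM ma (mb t)) mL).
  - exact: mM.
  - move=> e _; apply: le_trans (hM e); rewrite [cabs (_ * lbX p e q)]cabsM ler_wpM2l ?cabs_ge0//.
    by have := L2 e; move: (cabs (lbX p e q)) (L0 e) => L; nra.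
  - exact: fin.
pose S' := cint mu2 setT (fun e => a e * cpow (bX p e q) t * lbX p e q).
pose N := \int[mu2]_e (M * cabs (a e * cpow (bX p e q) s)).
have N0 : 0 <= N by apply: Rintegral_ge0 => e _; rewrite mulr_ge0 ?cabs_ge0 ?(ltW M0).
have limE : cint mu2 setT (fun e => a e * cpow (bX p e q) t * (1 + (t - 1)%:C * lbX p e q)) = S t + (t - 1)%:C * S'.
  rewrite /S /S' -(cintZ measurableT _ iL) -(cintD measurableT (ir t st) (cintgZ measurableT _ iL)).
  by apply: eq_cint => e _; ring.
rewrite limE.
have taylor r : t < r -> r - t <= 1 / 2 -> cabs (S r - S t - (r - t)%:C * S') <= 3 * (r - t) ^+ 2 * N.
  move=> tr rt; have i1 := ir r (lt_trans st tr); have i2 := ir t st; have i3 := cintgZ measurableT (r - t)%:C iL.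
  have i12 := cintgB measurableT i1 i2; have i123 := cintgB measurableT i12 i3.
  rewrite /S /S' -(cintZ measurableT _ iL) -(cintB measurableT i1 i2) -(cintB measurableT i12 i3).
  have c0 : 0 <= 3 * (r - t) ^+ 2 by rewrite mulr_ge0 ?sqr_ge0.
  have -> : 3 * (r - t) ^+ 2 * N = \int[mu2]_e (3 * (r - t) ^+ 2 * (M * cabs (a e * cpow (bX p e q) s))).
    rewrite /N /Rintegral [in RHS]eI_Z; [|exact: c0|exact: mM|by move=> e; rewrite mulr_ge0 ?cabs_ge0 ?(ltW M0)].
    rewrite fineM// ge0_fin_numE ?fin//; apply: eI_ge0 => e; by rewrite mulr_ge0 ?cabs_ge0 ?(ltW M0).
  apply: (@cabs_cint_le _ _ _ mu2 setT measurableT _ (fun e => 3 * (r - t) ^+ 2 * (M * cabs (a e * cpow (bX p e q) s)))) => //.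
  - by apply: measurable_funM => //; exact: mM.
  - move=> e _; have := cpow_bX_taylor p e q (ltW tr) rt => h.
    have -> : a e * cpow (bX p e q) r - a e * cpow (bX p e q) t - (r - t)%:C * (a e * cpow (bX p e q) t * lbX p e q) =
      a e * (cpow (bX p e q) r - cpow (bX p e q) t - (r - t)%:C * (cpow (bX p e q) t * lbX p e q)) by ring.
    rewrite cabsM; apply: (le_trans (ler_wpM2l (cabs_ge0 _) h)).
    rewrite mulrCA ler_wpM2l//; apply: le_trans (hM e); rewrite mulrA -cabsM ler_wpM2l ?cabs_ge0//.
    by rewrite lerDr addr_ge0.
  - rewrite eI_Z; [|exact: c0|exact: mM|by move=> e; rewrite mulr_ge0 ?cabs_ge0 ?(ltW M0)].
    by rewrite lte_mul_pinfty// fin.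
pose ka : R := (4 * pi)^-1; have ka0 : 0 < ka by rewrite invr_gt0 mulr_gt0// pi_gt0.
have cn r : c_nu r = (r - 1) * ka by [].
pose B : R := ka * (t * 3 * N + cabs S').
have B0 : 0 <= B by rewrite mulr_ge0 ?(ltW ka0)// addr_ge0 ?cabs_ge0// !mulr_ge0//; lra.
have bound r : t < r -> r - t <= 1 / 2 ->
   cabs (ka%:C * (S t + (t - 1)%:C * S') - ((r - t)^-1)%:C * ((c_nu r)%:C * S r - (c_nu t)%:C * S t)) <= (r - t) * B.
  move=> tr rt; have h := taylor r tr rt; have d0 : 0 < r - t by rewrite subr_gt0.
  set Z := S r - S t - (r - t)%:C * S' in h.
  have -> : ka%:C * (S t + (t - 1)%:C * S') - ((r - t)^-1)%:C * ((c_nu r)%:C * S r - (c_nu t)%:C * S t) =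
     - (ka%:C * ((r - 1)%:C * (((r - t)^-1)%:C * Z) + (r - t)%:C * S')).
    have SE : S r = Z + S t + (r - t)%:C * S' by rewrite /Z; ring.
    have dd : ((r - t)^-1)%:C * (r - t)%:C = 1 :> C by rewrite -rmorphM mulVf// lt0r_neq0.
    have e1 : (r - 1)%:C = (t - 1)%:C + (r - t)%:C :> C by rewrite -rmorphD; congr (_%:C); ring.
    rewrite SE !cn !(rmorphM (real_complex R)) e1.
    set u := ((r - t)^-1)%:C in dd *; set v := (r - t)%:C in dd *; set tt := (t - 1)%:C; set kk := ka%:C.
    transitivity (kk * (S t + tt * S') - kk * ((u * v) * (S t + tt * S' + v * S') + u * (tt + v) * Z)); first by ring.
    rewrite dd; ring.
  rewrite cabsN cabsM cabs_real (ger0_norm (ltW ka0)) /B [leRHS]mulrCA ler_wpM2l ?(ltW ka0)//.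
  apply: (le_trans (cabsD _ _)); rewrite !cabsM !cabs_real !ger0_norm ?invr_ge0 ?(ltW d0)//; last by lra.
  rewrite mulrDr lerD//.
  have h2 : (r - t)^-1 * cabs Z <= (r - t) * (3 * N).
    by rewrite mulrC ler_pdivrMr// (le_trans h)// le_eqVlt; apply/orP; left; apply/eqP; ring.
  have r1 : 0 <= r - 1 by lra.
  apply: (le_trans (ler_wpM2l r1 h2)); rewrite [leRHS](_ : _ = t * ((r - t) * (3 * N))); last by ring.
  apply: ler_wpM2r; [by rewrite !mulr_ge0 ?(ltW d0)|lra].
move=> eps eps0.
have e2 : 0 < Num.min (1 / 2) (eps / (B + 1)) by rewrite lt_min !divr_gt0// ltr_wpDl.
near=> r.
have tr : t < r by near: r; exact: nbhs_right_gt.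
have : r < t + Num.min (1 / 2) (eps / (B + 1)) by near: r; apply: nbhs_right_lt; rewrite ltrDl.
rewrite -ltrBlDl lt_min => /andP[h1 h2].
apply: (le_lt_trans (bound r tr (ltW h1))).
have B1 : 0 < B + 1 by rewrite ltr_wpDl.
rewrite ltr_pdivlMr// in h2; apply: le_lt_trans h2; rewrite ler_wpM2l ?lerDl// subr_ge0 ltW//.
Unshelve. all: by end_near.
Qed.

(** Multiplication by D_t(p, q) splits b^t into D_t(p, e) D_t(e, q), and each of these factors
    completes a symbol to its kernel. *)
Theorem Cderiv_kernel s d k1 k2 : 1 < s -> 0 < d ->
  let K1 x y := kap k1 x y * Dk s x y in let K2 x y := kap k2 x y * Dk s x y in
  (forall x y, ccvg (nbhs (x, y)) (fun u : X * X => K1 u.1 u.2) (K1 x y)) ->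
  (forall x y, ccvg (nbhs (x, y)) (fun u : X * X => K2 u.1 u.2) (K2 x y)) ->
  (forall y, cl2 (K1 ^~ y)) -> (forall y, cl2 (K2 ^~ y)) -> forall p q,
  kap (Cderiv (s + d) (adj k1) k2) p q * Dk (s + d) p q = ((4 * pi)^-1)%:C * dker2 s d K1 K2 p q.
Proof.
move=> s1 d0 K1 K2 c1 c2 l1 l2 p q.
have [k11 k12] := kap_ccvg c1; have [k21 k22] := kap_ccvg c2.
pose t := s + d; have st : s < t by rewrite ltrDl.
pose a e := (kap k1 e p)^* * kap k2 e q.
have ma : cmeas setT a.
  by apply: ccvg_cmeas => e; apply: ccvgM; [apply: ccvgJ; exact: k12|exact: k22].
have starE r : kap (star r (adj k1) k2) p q = (c_nu r)%:C * cint mu2 setT (fun e => a e * cpow (bX p e q) r).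
  rewrite star_kapE//; first by congr (_ * _); apply: eq_cint => e _; rewrite kap_adj.
  move=> e; rewrite kap_adj (_ : kap (adj k1) p = fun e => (kap k1 e p)^*); first by apply: ccvgJ; exact: k12.
  by apply/funext => x; rewrite kap_adj.
have is_ : cintg mu2 setT (fun e => a e * cpow (bX p e q) s).
  have := cintgZr measurableT (Dk (- s) p q) (cl2M (cl2J (l1 p)) (l2 q)).
  rewrite (_ : (fun x => _) = fun e => a e * cpow (bX p e q) s)//; apply/funext => e.
  by rewrite cpow_bX /K1 /K2 cJM DkJ /a; ring.
have limS := star_limit s1 st ma is_.
have -> : kap (Cderiv t (adj k1) k2) p q = ((4 * pi)^-1)%:C *
    cint mu2 setT (fun e => a e * cpow (bX p e q) t * (1 + (t - 1)%:C * lbX p e q)).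
  have -> : kap (Cderiv t (adj k1) k2) p q = lim ((fun r => ((r - t)^-1)%:C *
     (kap (star r (adj k1) k2) p q - kap (star t (adj k1) k2) p q) : C^o) @ t^'+) by [].
  apply: (@cvg_lim C^o); first exact: norm_hausdorff.
  apply/ccvg_co; move: limS; apply: ccvg_near.
  by apply: nearW => r; rewrite -!starE.
rewrite -mulrA /dker2; congr (_ * _).
have key e : vker d K1 p e * (vker d K2 q e)^* * (1 + (t - 1)%:C * lbX p e q) =
   a e * cpow (bX p e q) t * (1 + (t - 1)%:C * lbX p e q) * Dk t p q.
  rewrite /vker !cJM conjcK !DkJ -[(kap k1 e p)^* * _ * _]mulrA -DkD -[kap k2 e q * _ * _]mulrA -DkD -/t.
  rewrite (_ : _ * Dk t p q = (a e * (1 + (t - 1)%:C * lbX p e q)) * (cpow (bX p e q) t * Dk t p q)); last by ring.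
  by rewrite cpow_bX_Dk /a; ring.
have iD : cintg mu2 setT (fun e => a e * cpow (bX p e q) t * (1 + (t - 1)%:C * lbX p e q)).
  have m1 : cmeas2 K1 by exact: (@ccvg_cmeas2 R K1).
  have m2 : cmeas2 K2 by exact: (@ccvg_cmeas2 R K2).
  have := cintgZr measurableT (Dk (- t) p q) (dker2_int s1 d0 m1 m2 l1 l2 p q).
  rewrite (_ : (fun x => _) = fun e => a e * cpow (bX p e q) t * (1 + (t - 1)%:C * lbX p e q))//; apply/funext => e.
  by rewrite key -mulrA -DkD subrr (_ : Dk 0 p q = 1) ?mulr1// DkE mul0r cexp0.
by rewrite -(cintZr measurableT _ iD); apply: eq_cint => e _; rewrite key.
Qed.

End DerivativeKernel.

(** * The operator of the derivative *)

Section KernelOperator.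
Context {R : realType}.
Local Notation C := R[i].
Local Notation X := (R * R)%type.
Local Notation mu2 := (@lebesgue_measure R \x @lebesgue_measure R)%E.
Implicit Types (h F : MX R -> C) (f : C -> C) (p q e x y : MX R) (K : MX R -> MX R -> C).

Lemma lbXJ p e q : (lbX p e q)^* = lbX q e p :> C.
Proof.
rewrite /lbX !cJB !cJD cJR -!clogJ; [|exact: Re_qz..].
by rewrite !qzJ; ring.
Qed.

Section Kernel.
Variables (s d M : R) (K K' : MX R -> MX R -> C).
Hypotheses (s1 : 1 < s) (d0 : 0 < d) (M0 : 0 < M).
Hypotheses (hK : holK s K) (hK' : holK s K') (sK : schurK M K) (sK' : schurK M K').
Let t := s + d.
Let t1 : 1 < t. Proof. by rewrite (lt_le_trans s1)// lerDl ltW. Qed.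
Let w p e q : C := 1 + (t - 1)%:C * lbX p e q.
Let D := dker2 s d K K'.

Let mK : cmeas2 K. Proof. by case: sK. Qed.
Let mK' : cmeas2 K'. Proof. by case: sK'. Qed.
Let lK y : cl2 (K ^~ y). Proof. by case: sK. Qed.
Let lK' y : cl2 (K' ^~ y). Proof. by case: sK'. Qed.
Let rK' e : cl2 (K' e). Proof. by case: sK'. Qed.

Let wbound : exists2 B, 0 < B & forall p e q, cabs (Dk d p e) * cabs (Dk d q e) * cabs (w p e q) <= B.
Proof.
have [B B0 hB] := weight_bound d0; exists (t * B); first by rewrite mulr_gt0// (lt_trans _ t1).
move=> p e q; apply: (le_trans (weight_bound1 d p e q t1)).
by rewrite ler_wpM2l// ltW// (lt_trans _ t1).
Qed.

Let mw : cmeas3 (fun p q e => w p e q). Proof. exact: cmeas_wgt. Qed.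

Let mwq p e : cmeas setT (fun q => w p e q).
Proof. exact: (@kgood_sec _ (fun q e => w p e q) e (cmeas3_sec1 p mw)). Qed.

Let mvq e : cmeas setT (fun q => (vker d K' q e)^*).
Proof. by apply: cmeasJ; exact: (kgood_sec e (cmeas2_vker d mK')). Qed.

Lemma cmeas2_dker2 : cmeas2 D.
Proof.
apply: cmeas3_cint.
apply: (@cmeasM _ _ _ setT (fun v : (MX R * MX R) * MX R => vker d K v.1.1 v.2 * (vker d K' v.1.2 v.2)^*)
    (fun v => w v.1.1 v.2 v.1.2)); last exact: mw.
apply: (@cmeasM _ _ _ setT (fun v : (MX R * MX R) * MX R => vker d K v.1.1 v.2)); first exact: (cmeas3_13 (cmeas2_vker d mK)).
exact: (cmeasJ (cmeas3_23 (cmeas2_vker d mK'))).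
Qed.

(** The logarithmic weight is itself holomorphic in q: the two logarithms in [lbX p e q] that
    contain q depend holomorphically on it. So the reproducing formula in weight t applies to the
    whole product. *)
Lemma weighted_repr p e x :
  cint mu2 setT (fun q => (vker d K' q e)^* * w p e q * Dk t q x) = (mass t)%:C * ((vker d K' x e)^* * w p e x).
Proof.
have [f hf fE] := hK'.1 e; have [B B0 hB] := wbound.
pose g z : C := (f z * evX d e z) * (1 + (t - 1)%:C *
  (clog (qker (hpt p)^* z) + (e.2)%:C - clog (qz p e) - clog (qker (hpt e)^* z))).
have gE q : shp t g q = (vker d K' q e)^* * w p e q.
  have -> : shp t g q = shp t (fun z => f z * evX d e z) q * w p e q.
    by rewrite /shp /g /w /lbX qz.unlock mulrAC.
  by rewrite shp_evX_mul fE /vker cJM conjcK DkJ.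
have mf : cmeas setT (fun q => (vker d K' q e)^* * w p e q).
  exact: (cmeasM (mvq e) (mwq p e)).
rewrite -gE -reproducing//; first by apply: eq_cint => q _; rewrite gE.
  move=> z uz; apply: cholM; first by apply: cholM; [exact: hf|exact: evX_chol].
  apply: cholD; first exact: chol_cst.
  apply: cholZ; apply: cholB; last exact: clog_qker_chol (hpt_uhp e) uz.
  apply: cholB; last exact: chol_cst.
  by apply: cholD; [exact: clog_qker_chol (hpt_uhp p) uz|exact: chol_cst].
rewrite (_ : shp t g = fun q => (vker d K' q e)^* * w p e q); last by apply/funext.
have [mc fc] := rK' e; have cD : 0 < cabs (Dk d p e) by rewrite cabs_gt0 Dk_neq0.
(* Here p and e are fixed, so the bound on the weight may be divided by the nonzero number |D_d(p,
   e)|. *)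
apply: (@cl2_le _ _ (fun q => (B / cabs (Dk d p e)) ^+ 2 * cabs (K' e q) ^+ 2)) => //.
- by apply: measurable_funM => //; apply: measurable_funX; exact: measurable_cabs.
- move=> q; rewrite -exprMn ler_sqr ?nnegrE ?mulr_ge0 ?invr_ge0 ?cabs_ge0 ?(ltW B0)//.
  rewrite mulrAC ler_pdivlMr// /vker cJM conjcK !cabsM cabsJ.
  rewrite (_ : _ * _ * _ * _ = cabs (Dk d p e) * cabs (Dk d q e) * cabs (w p e q) * cabs (K' e q)); last by ring.
  by rewrite ler_wpM2r ?cabs_ge0.
- have m2 : measurable_fun setT (fun q => cabs (K' e q) ^+ 2) by apply: measurable_funX; exact: measurable_cabs.
  have c0 : 0 <= (B / cabs (Dk d p e)) ^+ 2 by exact: sqr_ge0.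
  have := @eI_Z _ _ _ mu2 _ (fun q => cabs (K' e q) ^+ 2) c0 m2 (fun q => sqr_ge0 _).
  by move=> ->; rewrite lte_mul_pinfty// lee_fin.
Qed.

Let G h h' p q e := h p * h' q * (vker d K p e * (vker d K' q e)^* * w p e q).

Let cint_G h h' p q : cint mu2 setT (G h h' p q) = h p * h' q * D p q.
Proof. by rewrite -(cintZ measurableT _ (dker2_int s1 d0 mK mK' lK lK' p q)). Qed.

Let GF h h' : cl2 h -> cl2 h' ->
  [/\ forall p, cintg mu2 setT (fun q => h p * h' q * D p q),
      forall q, cintg mu2 setT (fun p => h p * h' q * D p q),
      cintg mu2 setT (fun p => cint mu2 setT (fun q => h p * h' q * D p q)),
      cint mu2 setT (fun p => cint mu2 setT (fun q => h p * h' q * D p q)) =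
        cint mu2 setT (fun q => cint mu2 setT (fun p => h p * h' q * D p q)) &
      forall p, cint mu2 setT (fun q => h p * h' q * D p q) =
        cint mu2 setT (fun e => cint mu2 setT (fun q => G h h' p q e))].
Proof.
move=> lh lh'; have [B B0 hB] := wbound.
pose b : R := Num.sqrt B; have b0 : 0 <= b by rewrite sqrtr_ge0.
have b2 : b * b = B by rewrite -expr2 sqr_sqrtr// ltW.
pose U1 p e : C := (cabs (h p) * cabs (K e p))%:C.
pose U2 p e : C := (cabs (h' p) * cabs (K' e p))%:C.
(* [triple_fubini] takes one dominating kernel for both places, hence the sum of the two. *)
pose U p e : C := b%:C * (U1 p e + U2 p e).
have [mh _] := lh; have [mh' _] := lh'.
have kU1 : kgood U1.
  apply: (proj1 (kgood_schur M0 lh (schurK_T sK) _ _)).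
    apply: (@cmeas_real _ _ _ setT (fun v : MX R * MX R => cabs (h v.1) * cabs (K v.2 v.1))).
    apply: measurable_funM; apply: measurable_cabs; first exact: (@cmeas2_fst _ h).
    exact: (@cmeas2_swap _ K).
  by move=> p e; rewrite cabs_real ger0_norm// mulr_ge0 ?cabs_ge0.
have kU2 : kgood U2.
  apply: (proj1 (kgood_schur M0 lh' (schurK_T sK') _ _)).
    apply: (@cmeas_real _ _ _ setT (fun v : MX R * MX R => cabs (h' v.1) * cabs (K' v.2 v.1))).
    apply: measurable_funM; apply: measurable_cabs; first exact: (@cmeas2_fst _ h').
    exact: (@cmeas2_swap _ K').
  by move=> p e; rewrite cabs_real ger0_norm// mulr_ge0 ?cabs_ge0.
have kU : kgood U by apply: kgoodZ; exact: kgoodD.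
have UE p e : cabs (U p e) = b * (cabs (h p) * cabs (K e p) + cabs (h' p) * cabs (K' e p)).
  by rewrite /U /U1 /U2 cabsM -rmorphD !cabs_real !ger0_norm// addr_ge0 ?mulr_ge0 ?cabs_ge0.
have core p q e : cabs (G h h' p q e) <= B * (cabs (h p) * cabs (K e p) * (cabs (h' q) * cabs (K' e q))).
  rewrite /G /vker !cabsM !cabsJ !cabsM !cabsJ.
  rewrite (_ : _ * _ * _ = cabs (Dk d p e) * cabs (Dk d q e) * cabs (w p e q) *
    (cabs (h p) * cabs (K e p) * (cabs (h' q) * cabs (K' e q)))); last by ring.
  by rewrite ler_wpM2r ?mulr_ge0 ?cabs_ge0.
have bG p q e : cabs (G h h' p q e) <= cabs (U p e) * cabs (U q e).
  apply: (le_trans (core p q e)); rewrite !UE [leRHS]mulrACA b2 ler_wpM2l ?(ltW B0)//.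
  by apply: ler_pM; rewrite ?mulr_ge0 ?cabs_ge0// ?lerDl ?lerDr ?mulr_ge0 ?cabs_ge0.
have bG' p q e : cabs (G h h' q p e) <= cabs (U p e) * cabs (U q e) by rewrite mulrC.
have mG : cmeas3 (G h h').
  apply: (@cmeasM _ _ _ setT (fun v : (MX R * MX R) * MX R => h v.1.1 * h' v.1.2)
    (fun v => vker d K v.1.1 v.2 * (vker d K' v.1.2 v.2)^* * w v.1.1 v.2 v.1.2)).
    apply: (@cmeasM _ _ _ setT (fun v : (MX R * MX R) * MX R => h v.1.1)).
      exact: (cmeas3_12 (@cmeas2_fst _ h mh)).
    exact: (cmeas3_12 (@cmeas2_snd _ h' mh')).
  apply: (@cmeasM _ _ _ setT (fun v : (MX R * MX R) * MX R => vker d K v.1.1 v.2 * (vker d K' v.1.2 v.2)^*)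
    (fun v => w v.1.1 v.2 v.1.2)); last exact: mw.
  apply: (@cmeasM _ _ _ setT (fun v : (MX R * MX R) * MX R => vker d K v.1.1 v.2)); first exact: (cmeas3_13 (cmeas2_vker d mK)).
  exact: (cmeasJ (cmeas3_23 (cmeas2_vker d mK'))).
have mG' : cmeas3 (fun p q e => G h h' q p e).
  apply: (cmeas_comp (h := fun v : (MX R * MX R) * MX R => ((v.1.2, v.1.1), v.2)) _ mG).
  apply: measurable_fun_pair; last exact: measurable_snd.
  by apply: measurable_fun_pair; apply: measurableT_comp.
have E1 p : (fun q => cint mu2 setT (G h h' p q)) = fun q => h p * h' q * D p q by apply/funext => q; exact: cint_G.
have E2 q : (fun p => cint mu2 setT (G h h' p q)) = fun p => h p * h' q * D p q by apply/funext => p; exact: cint_G.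
have E3 : (fun p => cint mu2 setT (fun q => h p * h' q * D p q)) =
    (fun p => cint mu2 setT (fun q => cint mu2 setT (G h h' p q))).
  by apply/funext => p; rewrite -(E1 p).
have E4 : (fun q => cint mu2 setT (fun p => h p * h' q * D p q)) =
    (fun q => cint mu2 setT (fun p => cint mu2 setT (G h h' p q))).
  by apply/funext => q; rewrite -(E2 q).
have [_ a2 a3 a4 a5] := triple_fubini kU mG bG.
have [_ b22 _ _ _] := triple_fubini kU mG' bG'.
split.
- by move=> p; rewrite -E1; exact: a2.
- by move=> q; rewrite -E2; exact: b22.
- by rewrite E3; exact: a3.
- exact: (etrans (congr1 (cint mu2 setT) E3) (etrans a4 (esym (congr1 (cint mu2 setT) E4)))).
- move=> p; exact: (etrans (congr1 (cint mu2 setT) (esym (E1 p))) (a5 p)).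
Qed.

(** [GF] treats products h p * h' q. The choice h' = [Dk t q], which is 1 at q, isolates one
    column. *)
Lemma dker2_intl h q : cl2 h -> cintg mu2 setT (fun p => h p * D p q).
Proof.
move=> lh; have [_ H _ _ _] := GF lh (cl2_Dk q t1).
by have := H q; under [X in cintg _ _ X -> _]eq_fun do rewrite Dkxx mulr1.
Qed.

Lemma dker2_intr h p : cl2 h -> cintg mu2 setT (fun q => h q * D p q).
Proof.
move=> lh; have [H _ _ _ _] := GF (cl2_Dk p t1) lh.
by have := H p; under [X in cintg _ _ X -> _]eq_fun do rewrite Dkxx mul1r.
Qed.

Lemma dker2_reprr p x : cint mu2 setT (fun q => Dk t q x * D p q) = (mass t)%:C * D p x.
Proof.
have [_ _ _ _ H] := GF (cl2_Dk p t1) (cl2_Dk' x t1).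
have E : (fun q => Dk t q x * D p q) = fun q => Dk t p p * Dk t q x * D p q.
  by apply/funext => q; rewrite Dkxx mul1r.
rewrite E H -(cintZ measurableT _ (dker2_int s1 d0 mK mK' lK lK' p x)); apply: eq_cint => e _.
have iq : cintg mu2 setT (fun q => (vker d K' q e)^* * w p e q * Dk t q x).
  have [f hf fE] := hK'.1 e; have [B B0 hB] := wbound.
  have [mc fc] := cl2M (rK' e) (cl2_Dk' x t1).
  have cD : 0 < cabs (Dk d p e) by rewrite cabs_gt0 Dk_neq0.
  apply: (@cintg_le _ _ _ mu2 setT measurableT _ (fun q => B / cabs (Dk d p e) * cabs (K' e q * Dk t q x))) => //.
  - exact: (cmeasM (cmeasM (mvq e) (mwq p e)) (cmeas_Dk1 t x)).
  - by apply: measurable_funM => //; exact: measurable_cabs.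
  - move=> q _; rewrite [leRHS]mulrAC ler_pdivlMr// /vker cJM conjcK !cabsM cabsJ.
    rewrite (_ : _ * _ * _ * _ * _ = cabs (Dk d p e) * cabs (Dk d q e) * cabs (w p e q) * (cabs (K' e q) * cabs (Dk t q x))); last by ring.
    by rewrite ler_wpM2r ?mulr_ge0 ?cabs_ge0.
  - rewrite eI_Z; [|by rewrite divr_ge0 ?cabs_ge0 ?(ltW B0)|exact: measurable_cabs|by move=> q; exact: cabs_ge0].
    by rewrite lte_mul_pinfty// lee_fin divr_ge0 ?cabs_ge0 ?(ltW B0).
rewrite -mulrA mulrCA -weighted_repr -(cintZ measurableT _ iq).
by apply: eq_cint => q _; rewrite /G Dkxx; ring.
Qed.

Definition Tker h q : C := cint mu2 setT (fun p => h p * D p q).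

Lemma Tker_pairing h h' : cl2 h -> cl2 h' ->
  cint mu2 setT (fun q => Tker h q * h' q) = cint mu2 setT (fun p => cint mu2 setT (fun q => h p * h' q * D p q)).
Proof.
move=> lh lh'; have [_ _ _ -> _] := GF lh lh'.
apply: eq_cint => q _; rewrite -(cintZr measurableT _ (dker2_intl q lh)).
by apply: eq_cint => p _; ring.
Qed.

(** Shows that [Tker h] is reproduced by [Dk t], and hence comes from a function of H_t by
    [hol_repr], for every square integrable h. *)
Lemma Tker_repr h x : cl2 h -> cint mu2 setT (fun q => Tker h q * Dk t q x) = (mass t)%:C * Tker h x.
Proof.
move=> lh; rewrite (Tker_pairing lh (cl2_Dk' x t1)) -(cintZ measurableT _ (dker2_intl x lh)).
apply: eq_cint => p _; rewrite mulrCA -dker2_reprr -(cintZ measurableT _ (dker2_intr p (cl2_Dk' x t1))).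
by apply: eq_cint => q _; rewrite mulrA.
Qed.

(** The kernel D(p, q) is at most B times the integral of |K(e, p) K'(e, q)| in e. This is a product
    of two kernels with Schur bounds, each of which contributes a factor M^2 to the squared norm. *)
Lemma Tker_cl2 : exists2 A, 0 <= A & forall h, cl2 h -> cl2 (Tker h) /\ n2 (Tker h) <= A * n2 h.
Proof.
have [B B0 hB] := wbound.
exists (B ^+ 2 * (M ^+ 2 * M ^+ 2)); first by apply: mulr_ge0; [exact: sqr_ge0|apply: mulr_ge0; exact: sqr_ge0].
move=> h lh; have [mh _] := lh.
pose V1 p e : C := (cabs (h p) * cabs (K e p))%:C.
have [kV1 bV1] : kgood V1 /\ (\int[mu2]_e (N1 V1 e ^+ 2)%:E <= (M ^+ 2 * n2 h)%:E)%E.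
  apply: (kgood_schur M0 lh (schurK_T sK)).
    apply: (@cmeas_real _ _ _ setT (fun v : MX R * MX R => cabs (h v.1) * cabs (K v.2 v.1))).
    apply: measurable_funM; apply: measurable_cabs; first exact: (@cmeas2_fst _ h).
    exact: (@cmeas2_swap _ K).
  by move=> p e; rewrite cabs_real ger0_norm// mulr_ge0 ?cabs_ge0.
have [mV1 _ iV1 _] := kV1.
pose N e : C := (N1 V1 e)%:C.
have mN : cmeas setT N by apply: cmeas_real; exact: measurable_N1.
have cN e : cabs (N e) = N1 V1 e by rewrite /N cabs_real ger0_norm ?N1_ge0.
have lN : cl2 N.
  split => //; under eq_integral do rewrite cN.
  exact: le_lt_trans bV1 (ltry _).
have nN : n2 N <= M ^+ 2 * n2 h.
  by rewrite -lee_fin -(n2E lN); under eq_integral do rewrite cN.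
pose V2 e q := N e * K' e q.
have [kV2 bV2] : kgood V2 /\ (\int[mu2]_q (N1 V2 q ^+ 2)%:E <= (M ^+ 2 * n2 N)%:E)%E.
  apply: (kgood_schur M0 lN sK').
    apply: (@cmeasM _ _ _ setT (fun v : MX R * MX R => N v.1)); last exact: mK'.
    exact: (@cmeas2_fst _ N).
  by move=> e q; rewrite /V2 cabsM.
have [mV2 _ iV2 _] := kV2.
have mT : cmeas setT (Tker h).
  apply: (@cmeas_cint22 _ (fun q p => h p * D p q)).
  apply: (@cmeasM _ _ _ setT (fun v : MX R * MX R => h v.2) (fun v => D v.2 v.1)).
    exact: (@cmeas2_snd _ h).
  exact: (@cmeas2_swap _ D cmeas2_dker2).
have le q : cabs (Tker h q) <= B * N1 V2 q.
  pose f p e := h p * (K e p * K' e q).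
  have mf : cmeas2 f.
    apply: (@cmeasM _ _ _ setT (fun v : MX R * MX R => h v.1) (fun v => K v.2 v.1 * K' v.2 q)).
      exact: (@cmeas2_fst _ h).
    apply: (@cmeasM _ _ _ setT (fun v : MX R * MX R => K v.2 v.1) (fun v => K' v.2 q)).
      exact: (@cmeas2_swap _ K).
    exact: (@cmeas2_snd _ (fun e => K' e q) (kgood_sec q mK')).
  have [mhD _] := dker2_intl q lh.
  rewrite -lee_fin EFinM -(N1E (iV2 q)).
  apply: (le_trans (@ecabs_cint _ _ _ mu2 setT measurableT _ mhD)).
  have -> : (\int[mu2]_x (cabs (V2 x q))%:E = \int[mu2]_p \int[mu2]_e (cabs (f p e))%:E)%E.
    rewrite (tonelli_cabs22 mf); apply: eq_integral => e _.
    rewrite /V2 cabsM cN mulrC EFinM -(N1E (iV1 e)) -eI_Z ?cabs_ge0//.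
    - apply: eq_integral => p _; rewrite /f /V1 !cabsM cabs_real ger0_norm ?mulr_ge0 ?cabs_ge0//.
      by congr (_%:E); ring.
    - by apply: measurable_cabs; case: (iV1 e).
    - by move=> p; exact: cabs_ge0.
  rewrite -ge0_integralZl//; last 3 first.
  - exact: (measurable_eint22 mf).
  - by move=> p _; apply: eI_ge0 => e; exact: cabs_ge0.
  - by rewrite lee_fin ltW.
  apply: ge0_le_integral => //.
  - by move=> p _; rewrite lee_fin cabs_ge0.
  - by apply/measurable_EFinP; exact: measurable_cabs.
  - by apply: emeasurable_funM => //; exact: (measurable_eint22 mf).
  move=> p _.
  have [mD _] := dker2_int s1 d0 mK mK' lK lK' p q.
  have iK := cl2M (lK p) (lK' q).
  rewrite cabsM EFinM; have hD : ((cabs (D p q))%:E <= B%:E * \int[mu2]_e (cabs (K e p * K' e q))%:E)%E.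
    apply: (le_trans (@ecabs_cint _ _ _ mu2 setT measurableT _ mD)).
    rewrite -eI_Z ?(ltW B0)//; [|by apply: measurable_cabs; case: iK|by move=> e; exact: cabs_ge0].
    apply: eI_le; [exact: measurable_cabs|by apply: measurable_funM => //; apply: measurable_cabs; case: iK|by move=> e; exact: cabs_ge0|].
    move=> e; rewrite /vker !cabsM !cabsJ ?cabsM ?cabsJ.
    rewrite (_ : _ * _ * _ * _ = cabs (Dk d p e) * cabs (Dk d q e) * cabs (w p e q) * (cabs (K e p) * cabs (K' e q))); last by rewrite /w /t; ring.
    by rewrite ler_wpM2r// mulr_ge0 ?cabs_ge0.
  apply: (@le_trans _ _ ((cabs (h p))%:E * (B%:E * \int[mu2]_e (cabs (K e p * K' e q))%:E))%E).
    by apply: lee_pmul => //; rewrite lee_fin cabs_ge0.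
  rewrite muleCA le_eqVlt; apply/orP; left; apply/eqP; congr (_ * _)%E.
  rewrite -eI_Z ?cabs_ge0//; [|by apply: measurable_cabs; case: iK|by move=> e; exact: cabs_ge0].
  by apply: eq_integral => e _; rewrite /f (cabsM (h p)).
have mN2 : measurable_fun setT (N1 V2) by exact: measurable_N1.
have finB : (\int[mu2]_q (B ^+ 2 * N1 V2 q ^+ 2)%:E <= (B ^+ 2 * (M ^+ 2 * n2 N))%:E)%E.
  rewrite eI_Z ?sqr_ge0//; [|exact: measurable_funX|by move=> q; exact: sqr_ge0].
  by rewrite (EFinM (B ^+ 2)); apply: lee_pmul => //; [rewrite lee_fin sqr_ge0|apply: eI_ge0 => q; exact: sqr_ge0].
have sq q : cabs (Tker h q) ^+ 2 <= B ^+ 2 * N1 V2 q ^+ 2.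
  by rewrite -exprMn ler_sqr ?nnegrE ?cabs_ge0 ?mulr_ge0 ?N1_ge0 ?(ltW B0).
have lT : cl2 (Tker h).
  apply: (@cl2_le _ _ (fun q => B ^+ 2 * N1 V2 q ^+ 2)) => //.
    by apply: measurable_funM => //; exact: measurable_funX.
  exact: le_lt_trans finB (ltry _).
split => //; rewrite -lee_fin -(n2E lT).
apply: (@le_trans _ _ (\int[mu2]_q (B ^+ 2 * N1 V2 q ^+ 2)%:E)%E).
  apply: eI_le => //.
  - by apply: measurable_funX; exact: measurable_cabs.
  - by apply: measurable_funM => //; exact: measurable_funX.
  - by move=> q; exact: sqr_ge0.
apply: (le_trans finB); rewrite lee_fin.
rewrite (_ : B ^+ 2 * (M ^+ 2 * M ^+ 2) * n2 h = B ^+ 2 * (M ^+ 2 * (M ^+ 2 * n2 h))); last by ring.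
by rewrite ler_wpM2l ?sqr_ge0// ler_wpM2l ?sqr_ge0.
Qed.

End Kernel.
End KernelOperator.

(** * The operator with the derived symbol *)

Section DerivativeOperator.
Context {R : realType}.
Local Notation C := R[i].
Local Notation X := (R * R)%type.
Local Notation mu2 := (@lebesgue_measure R \x @lebesgue_measure R)%E.
Implicit Types (h F : MX R -> C) (f : C -> C) (p q e x y : X) (K : MX R -> MX R -> C) (g : 'M[R]_2) (k : @symbol R).

(** By [cpow_bX_Dk] with exponent 1, the bracket is D_1(p, e) D_1(e, q) / D_1(p, q), in which the
    phases cancel. *)
Lemma bX_mob g p e q : \det g = 1 -> bX (mob g p) (mob g e) (mob g q) = bX p e q.
Proof.
move=> dg; have H := cpow_bX_Dk 1 (mob g p) (mob g e) (mob g q).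
have H0 := cpow_bX_Dk 1 p e q.
rewrite !cpowr1 ?bX_neq0// in H H0.
have e0 x : eps g 1 x != 0 by exact: eps_neq0.
have eJ0 x : (eps g 1 x)^* != 0 by rewrite conjc_eq0.
rewrite !Dk_mob// in H.
have eE := epsJ g 1 e.
apply: (mulIf (Dk_neq0 1 p q)); rewrite H0; apply: (mulfI (eJ0 p)); apply: (mulIf (e0 q)).
rewrite (_ : _ * _ * eps g 1 q = bX (mob g p) (mob g e) (mob g q) * ((eps g 1 p)^* * Dk 1 p q * eps g 1 q)); last by ring.
rewrite H (_ : (eps g 1 p)^* * Dk 1 p e * eps g 1 e * _ =
   ((eps g 1 e)^* * eps g 1 e) * ((eps g 1 p)^* * (Dk 1 p e * Dk 1 e q) * eps g 1 q)); last by ring.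
by rewrite eE mul1r.
Qed.

Lemma lbX_mob g p e q : \det g = 1 -> lbX (mob g p) (mob g e) (mob g q) = lbX p e q.
Proof. by move=> dg; rewrite -!clog_bX bX_mob. Qed.

Lemma vker_mob s d k g p e : \det g = 1 -> (forall x y, kap k (mob g x) (mob g y) = kap k x y) ->
  let K x y := kap k x y * Dk s x y in
  vker d K (mob g p) (mob g e) = (eps g (s + d) p)^* * vker d K p e * eps g (s + d) e.
Proof.
move=> dg inv K.
have E x y : vker d K x y = (kap k y x)^* * Dk (s + d) x y.
  by rewrite /vker /K cJM DkJ -mulrA -DkD.
by rewrite !E inv Dk_mob//; ring.
Qed.

Section Operator.
Variables (s d M : R) (K K' : MX R -> MX R -> C).
Hypotheses (s1 : 1 < s) (d0 : 0 < d) (M0 : 0 < M).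
Hypotheses (hK : holK s K) (hK' : holK s K') (sK : schurK M K) (sK' : schurK M K').
Let t := s + d.
Let t1 : 1 < t. Proof. by rewrite (lt_le_trans s1)// lerDl ltW. Qed.
Let D := dker2 s d K K'.
Let T := Tker s d K K'.

(** The 1 / (4 pi) is that of [Cderiv_kernel]. The mass undoes the reproducing formula: [Tker] takes
    [Dk t p] to mass(t) times the row of [dker2] at p. *)
Definition opc : R := (4 * pi)^-1 / mass (s + d).

Lemma opc_gt0 : 0 < opc.
Proof. by rewrite divr_gt0 ?invr_gt0 ?mulr_gt0 ?pi_gt0// mass_gt0. Qed.

(** [Tker] transported to H_t by the inverse of [shp], with the value 0 off the upper half-plane. *)
Definition Top (f : C -> C) : C -> C := fun z =>
  if 0 < complex.Im z then
    opc%:C * Tker s d K K' (shp (s + d) f) (hcoord z) * (expR (- ((s + d) / 2 * (hcoord z).2)))%:C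
  else 0.

Lemma shp_Top f x : shp t (Top f) x = opc%:C * T (shp t f) x.
Proof.
rewrite /shp /Top [complex.Im _]/= expR_gt0 hptK -mulrA -rmorphM -expRD addNr expR0.
by rewrite rmorph1 mulr1.
Qed.

Lemma Top_nuhp f z : ~ uhp z -> Top f z = 0.
Proof. by move=> nz; rewrite /Top; case: ifP => // /nz. Qed.

Lemma Top_Hspace f : Hspace t f -> Hspace t (Top f).
Proof.
move=> /HspaceP[_ hf lf].
have [A A0 hA] := Tker_cl2 s1 d0 M0 sK sK'.
have [lT _] := hA _ lf; have lF := cl2Z opc%:C lT.
have [|g hg gE] := hol_repr t1 lF.
  move=> x; have lD := cl2_Dk' x t1.
  have := Tker_repr s1 d0 M0 hK' sK sK' x lf; rewrite -/T -/t => RP.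
  rewrite mulrCA -RP -(cintZ measurableT _ (cl2M lT lD)).
  by apply: eq_cint => e _; rewrite mulrA.
apply/HspaceP; split.
- by move=> z; exact: Top_nuhp.
- move=> z uz; apply: (@chol_near _ g); last exact: hg.
  exists (complex.Im z) => // w hw.
  have uw : uhp w.
    have := le_lt_trans (ger_Im_cabs _) hw; rewrite cImD cImN ltr_norml => /andP[a _].
    by rewrite /uhp/=; lra.
  have := gE (hcoord w); rewrite -[opc%:C * _](shp_Top f (hcoord w)) /shp hcoordK// => /mulIf; apply.
  by rewrite eq_complex/= eqxx andbT lt0r_neq0// expR_gt0.
- by rewrite (_ : shp t (Top f) = fun x => opc%:C * T (shp t f) x)//; apply/funext => x; exact: shp_Top.
Qed.

Lemma Top_bounded : bounded_operator t Top.
Proof.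
have [A A0 hA] := Tker_cl2 s1 d0 M0 sK sK'.
split; first exact: Top_Hspace.
- move=> a f1 f2 H1 H2; have /HspaceP[_ _ l1] := H1; have /HspaceP[_ _ l2] := H2.
  apply: (@Hspace_ext _ t).
  + by move=> z; exact: Top_nuhp.
  + by move=> z nz; rewrite !Top_nuhp// mulr0 addr0.
  move=> x; rewrite shpL !shp_Top.
  have -> : T (shp t (fun z => a * f1 z + f2 z)) x = a * T (shp t f1) x + T (shp t f2) x.
    have i1 := dker2_intl s1 d0 M0 sK sK' x l1; have i2 := dker2_intl s1 d0 M0 sK sK' x l2.
    rewrite /T /Tker -(cintZ measurableT _ i1) -(cintD measurableT (cintgZ measurableT a i1) i2).
    by apply: eq_cint => p _; rewrite shpL; ring.
  ring.
exists (Num.sqrt (opc ^+ 2 * A)) => f Hf.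
have /HspaceP[_ hf lf] := Hf; have /HspaceP[_ hT _] := Top_Hspace Hf.
have oA : 0 <= opc ^+ 2 * A by apply: mulr_ge0 => //; exact: sqr_ge0.
rewrite !normHE// -(sqrtrM _ oA); apply: ler_wsqrtr.
have -> : n2 (shp t (Top f)) = opc ^+ 2 * n2 (T (shp t f)).
  have [lT _] := hA _ lf; have c0 : 0 <= opc ^+ 2 by exact: sqr_ge0.
  have m2 : measurable_fun setT (fun x => cabs (T (shp t f) x) ^+ 2).
    by apply: measurable_funX; apply: measurable_cabs; case: lT.
  have lTop : cl2 (shp t (Top f)) by have /HspaceP[] := Top_Hspace Hf.
  apply: EFin_inj; rewrite -(n2E lTop) EFinM -(n2E lT).
  rewrite -(@eI_Z _ _ _ mu2 _ (fun x => cabs (T (shp t f) x) ^+ 2) c0 m2 (fun x => sqr_ge0 _)).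
  apply: eq_integral => x _; rewrite shp_Top cabsM cabs_real exprMn.
  by rewrite (ger0_norm (ltW opc_gt0)).
by rewrite -(mulrA (opc ^+ 2) A) ler_wpM2l ?sqr_ge0//; case: (hA _ lf).
Qed.

Lemma dker2_mob g p q : \det g = 1 ->
  (forall x y, vker d K (mob g x) (mob g y) = (eps g t x)^* * vker d K x y * eps g t y) ->
  (forall x y, vker d K' (mob g x) (mob g y) = (eps g t x)^* * vker d K' x y * eps g t y) ->
  D (mob g p) (mob g q) = (eps g t p)^* * D p q * eps g t q.
Proof.
move=> dg v1 v2.
have mK : cmeas2 K by case: sK.
have mK' : cmeas2 K' by case: sK'.
have lK y : cl2 (K ^~ y) by case: sK.
have lK' y : cl2 (K' ^~ y) by case: sK'.
have [_ E] := mpreserving_cint (mpreserving_mob dg) (dker2_int s1 d0 mK mK' lK lK' (mob g p) (mob g q)).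
have i0 := dker2_int s1 d0 mK mK' lK lK' p q.
rewrite /D /dker2 -E -(cintZ measurableT _ i0) -(cintZr measurableT _ (cintgZ measurableT _ i0)).
apply: eq_cint => e _; rewrite /= v1 v2 lbX_mob// (cJM _ (eps g t e)) (cJM _ (vker d K' q e)) conjcK.
have eE := epsJ g t e.
rewrite (_ : _ * (eps g t q * _ * _) * _ = ((eps g t e)^* * eps g t e) * ((eps g t p)^* * (vker d K p e * (vker d K' q e)^* * (1 + (s + d - 1)%:C * lbX p e q)) * eps g t q)); last by ring.
by rewrite eE mul1r.
Qed.

(** Change of variables by g in the integral over p: the phases at p of the vector and of the kernel
    cancel, and the phase at q is the one that [slash] produces. *)
Lemma Top_slash g f : \det g = 1 -> Hspace t f ->
  (forall x y, vker d K (mob g x) (mob g y) = (eps g t x)^* * vker d K x y * eps g t y) ->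
  (forall x y, vker d K' (mob g x) (mob g y) = (eps g t x)^* * vker d K' x y * eps g t y) ->
  Top (slash t g f) = slash t g (Top f).
Proof.
move=> dg /HspaceP[_ _ lf] v1 v2; apply: (@Hspace_ext _ t).
- by move=> z; exact: Top_nuhp.
- by apply: slash_nuhp => // z; exact: Top_nuhp.
move=> q; rewrite shp_slash// !shp_Top mulrCA; congr (_ * _).
have i0 := dker2_intl s1 d0 M0 sK sK' (mob g q) lf.
have [i1 E] := mpreserving_cint (mpreserving_mob dg) i0.
have Dm p := dker2_mob p q dg v1 v2.
have pt p : shp t (slash t g f) p * D p q = (eps g t q)^* * (shp t f (mob g p) * D (mob g p) (mob g q)).
  rewrite (shp_slash t f p dg); have := Dm p; have := epsJ g t q.
  move: (shp t f (mob g p)) (D (mob g p) (mob g q)) (D p q) (eps g t p) (eps g t q) => a b c e1 e2 eE ->.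
  transitivity ((e2^* * e2) * (e1^* * a * c)); last by ring.
  by rewrite eE mul1r.
rewrite /T /Tker -E -(cintZ measurableT _ i1); apply: eq_cint => p _.
exact: (pt p).
Qed.

End Operator.

Lemma dker2J s d M K K' p q : 1 < s -> 0 < d -> schurK M K -> schurK M K' ->
  (dker2 s d K K' p q)^* = dker2 s d K' K q p.
Proof.
move=> s1 d0 [mK _ lK _ _] [mK' _ lK' _ _].
rewrite /dker2 -(cintJ measurableT (dker2_int s1 d0 mK mK' lK lK' p q)); apply: eq_cint => e _.
have wJ : (1 + (s + d - 1)%:C * lbX p e q)^* = 1 + (s + d - 1)%:C * lbX q e p.
  have h1 : (1 : C)^* = 1 by exact: rmorph1.
  transitivity ((1 : C)^* + ((s + d - 1)%:C)^* * (lbX p e q)^*); first by rewrite cJD cJM.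
  by rewrite h1 lbXJ (cJR (s + d - 1)).
move: (vker d K p e) (vker d K' q e) (1 + _ * lbX q e p) wJ => a b c.
by move: (1 + _) => w0 wJ; rewrite !cJM conjcK wJ; ring.
Qed.

Lemma dker2_reprl s d M K K' p q : 1 < s -> 0 < d -> 0 < M -> holK s K -> schurK M K -> schurK M K' ->
  cint mu2 setT (fun x => Dk (s + d) p x * dker2 s d K K' x q) = (mass (s + d))%:C * dker2 s d K K' p q.
Proof.
move=> s1 d0 M0 hK sK sK'; have t1 : 1 < s + d by rewrite (lt_le_trans s1)// lerDl ltW.
have := dker2_reprr s1 d0 M0 hK sK' sK q p => /(congr1 (@conjc R)).
have i0 := dker2_intr s1 d0 M0 sK' sK q (cl2_Dk' p t1).
rewrite -(cintJ measurableT i0) cJM cJR (dker2J _ _ s1 d0 sK' sK) => <-.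
by apply: eq_cint => x _; rewrite cJM DkJ (dker2J _ _ s1 d0 sK' sK).
Qed.

(** Compares k with the canonical symbol [k0] of A: both have the kernel [Kop t A], and [Dk]
    vanishes nowhere. *)
Lemma is_symbol_kernel t (A : @operator R) k : 1 < t -> bounded_operator t A ->
  (forall x y, kap k x y * Dk t x y = Kop t A x y) -> is_symbol t A k.
Proof.
move=> t1 bA kE z w uz uw.
pose k0 : @symbol R := fun a b => inner t (A (evec t a^*)) (evec t b) / inner t (evec t a^*) (evec t b).
have conj2 (a : C) : (a^*)^* = a by exact: conjcK.
have s0 : is_symbol t A k0.
  by move=> a b _ _; exact: (congr1 (fun c => inner t (A (evec t c)) (evec t b) / inner t (evec t c) (evec t b)) (conj2 a)).
have E := symbol_kernel t1 bA s0 (hcoord z) (hcoord w).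
have := kE (hcoord z) (hcoord w); rewrite -E /kap !hcoordK// => /(mulIf (Dk_neq0 _ _ _)) H.
by apply: (etrans H); exact: (s0 z w uz uw).
Qed.

Lemma schurK_le M M' K : M <= M' -> schurK M K -> schurK M' K.
Proof.
move=> le [a b c d' e']; split => // x; [exact: le_trans (d' x) _|exact: le_trans (e' x) _]; by rewrite lee_fin.
Qed.

Lemma hat_family G s (N : nat) (k : 'I_N -> @symbol R) : 1 < s -> (forall i, hat_alg G s (k i)) ->
  exists2 M, 0 < M & forall i, let K x y := kap (k i) x y * Dk s x y in
    [/\ holK s K, schurK M K & forall x y, ccvg (nbhs (x, y)) (fun u : X * X => K u.1 u.2) (K x y)].
Proof.
move=> s1 hk.
have /choice[m hm] : forall i, exists M, 0 < M /\ let K x y := kap (k i) x y * Dk s x y in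
    [/\ holK s K, schurK M K & forall x y, ccvg (nbhs (x, y)) (fun u : X * X => K u.1 u.2) (K x y)].
  by move=> i; have [M M0 H] := hat_kernel s1 (hk i); exists M.
(* One constant for the whole family; the 1 keeps it positive when N = 0. *)
exists (1 + \sum_(i < N) m i).
  by rewrite ltr_wpDr// sumr_ge0// => i _; case: (hm i) => /ltW.
move=> i K; have [m0 [a b c]] := hm i; split => //; apply: schurK_le b.
rewrite (bigD1 i)//= addrCA lerDl addr_ge0// sumr_ge0// => j _; by case: (hm j) => /ltW.
Qed.

Section Matrix.
Variables (G : set 'M[R]_2) (s d M : R) (N : nat) (k : 'I_N -> @symbol R).
Hypotheses (s1 : 1 < s) (d0 : 0 < d) (M0 : 0 < M) (hG : discrete_subgroup_PSL2 G).
Hypothesis hk : forall i, hat_alg G s (k i).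
Let K i x y := kap (k i) x y * Dk s x y.
Hypothesis hM : forall i, [/\ holK s (K i), schurK M (K i) & forall x y, ccvg (nbhs (x, y)) (fun u : X * X => K i u.1 u.2) (K i x y)].
Let t := s + d.
Let t1 : 1 < t. Proof. by rewrite (lt_le_trans s1)// lerDl ltW. Qed.

Lemma vN_Top i j : vN_alg G t (Top s d (K i) (K j)) /\
  is_symbol t (Top s d (K i) (K j)) (Cderiv t (adj (k i)) (k j)).
Proof.
have [hi si ci] := hM i; have [hj sj cj] := hM j.
have bT := Top_bounded s1 d0 M0 hj si sj.
have [det1 _ _ _ _] := hG.
have inv g l x y : G g -> kap (k l) (mob g x) (mob g y) = kap (k l) x y.
  by move=> Gg; case: (hk l) => sl _ _; exact: (kap_mob x y s1 sl Gg (det1 g Gg)).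
split; first split => //.
  move=> g f Gg Hf; have dg := det1 g Gg.
  by apply: (Top_slash s1 d0 M0 si sj dg Hf) => x y; apply: vker_mob => // a b; exact: inv.
apply: is_symbol_kernel => // p q.
have li y : cl2 (K i ^~ y) by case: si.
have lj y : cl2 (K j ^~ y) by case: sj.
rewrite (Cderiv_kernel s1 d0 ci cj li lj p q) /Kop shp_Top -/t.
have -> : Tker s d (K i) (K j) (shp t (evH t p)) q = (mass t)%:C * dker2 s d (K i) (K j) p q.
  rewrite -(dker2_reprl p q s1 d0 M0 hi si sj); apply: eq_cint => x _.
  by rewrite shp_evH.
rewrite mulrA -rmorphM /opc -/t divfK// lt0r_neq0// mass_gt0//.
Qed.

Lemma Top_nonpos (f : 'I_N -> C -> C) : (forall i, Hspace t (f i)) ->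
  \sum_(i < N) \sum_(j < N) inner t (Top s d (K i) (K j) (f i)) (f j) <= 0.
Proof.
move=> Hf; have hi i : holK s (K i) by case: (hM i).
have si i : schurK M (K i) by case: (hM i).
have lf i : cl2 (shp t (f i)) by have /HspaceP[] := Hf i.
have := main_inequality s1 d0 M0 hi si lf => H.
have -> : \sum_(i < N) \sum_(j < N) inner t (Top s d (K i) (K j) (f i)) (f j) =
   (opc s d)%:C * \sum_(i < N) \sum_(j < N) cint mu2 setT (fun p => cint mu2 setT (fun q =>
     shp t (f i) p * (shp t (f j) q)^* * dker2 s d (K i) (K j) p q)).
  rewrite mulr_sumr; apply: eq_bigr => i _; rewrite mulr_sumr; apply: eq_bigr => j _.
  have HT := Top_Hspace s1 d0 M0 (hi j) (si i) (si j) (Hf i).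
  have /HspaceP[_ h1 _] := HT; have /HspaceP[_ h2 _] := Hf j.
  rewrite innerE//.
  rewrite -(Tker_pairing s1 d0 M0 (si i) (si j) (lf i) (cl2J (lf j))).
  have [A _ hA] := Tker_cl2 s1 d0 M0 (si i) (si j).
  have [lT _] := hA _ (lf i).
  rewrite -(cintZ measurableT _ (cl2M lT (cl2J (lf j)))); apply: eq_cint => q _.
  by rewrite shp_Top mulrA.
by rewrite mulr_ge0_le0// lecR ltW// opc_gt0.
Qed.

Lemma Cderiv_nonpos : nonpos_matrix G t (fun i j => Cderiv t (adj (k i)) (k j)).
Proof.
exists (fun i j => Top s d (K i) (K j)); split; first exact: vN_Top.
exact: Top_nonpos.
Qed.

End Matrix.
End DerivativeOperator.

(** * The trace *)

Section Trace.
Context {R : realType}.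
Local Notation C := R[i].
Local Notation X := (R * R)%type.
Local Notation mu2 := (@lebesgue_measure R \x @lebesgue_measure R)%E.
Implicit Types (h F : MX R -> C) (f : C -> C) (p q e x y : X) (K : MX R -> MX R -> C) (k : @symbol R).

Lemma Dk_cancel t p q : Dk t p q * Dk (- t) p q = 1.
Proof. by rewrite -DkD subrr DkE mul0r cexp0. Qed.

(** The integral runs over a general set, so there is no change of variables: only the integrand is
    rewritten through [hcoord]. *)
Lemma cint_nu_hcoord (D : set C) (phi : C -> C) (psi : MX R -> C) :
  (forall p, phi (hpt p) = psi p) ->
  cint_nu 0 D phi = cint mu2 ((@toC R) @^-1` (D `&` uhp))
    (fun x => psi (hcoord (toC x)) * (x.2 `^ (0 - 2))%:C).
Proof.
move=> E; rewrite /cint_nu /cint; congr (_ +i* _); apply: eq_Rintegral => x.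
  by rewrite inE => -[_ ux]; rewrite cReMr -E hpt_toC.
by rewrite inE => -[_ ux]; rewrite cImMr -E hpt_toC.
Qed.

Section Domain.
Variables (G : set 'M[R]_2) (F : set C).
Hypotheses (hF : fundamental_domain G F) (hcov : (covolume F < +oo)%E).
Let DF : set (MX R) := (@toC R) @^-1` (F `&` uhp).

Let mDF : measurable DF.
Proof.
have [_ mF _ _] := hF; rewrite /DF preimage_setI; apply: measurableI => //.
exact: measurable_uhp.
Qed.

Let mpow : measurable_fun DF (fun x : MX R => x.2 `^ (0 - 2)).
Proof.
pose phi (q : X) : R := expR ((0 - 2) * q.2).
apply: (eq_measurable_fun (fun p : MX R => phi (hcoord (toC p)))).
  by move=> p; rewrite inE => -[_ up]; rewrite /phi powR_toC.
apply: measurable_funTS; apply: measurableT_comp; last exact: measurable_hcoord.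
by apply: continuous_measurable_plane; exact: continuous_expR2.
Qed.

(** Bounded diagonals are integrable over a domain of finite covolume; the sums then move under the
    integral, where the integrand is nonpositive at every point. *)
Lemma tau_sum_le0 (N : nat) (Z : 'I_N -> 'I_N -> @symbol R) :
  (forall i j, cmeas setT (fun p => kap (Z i j) p p)) ->
  (forall i j, exists B : R, forall p, cabs (kap (Z i j) p p) <= B) ->
  (forall p, \sum_(i < N) \sum_(j < N) kap (Z i j) p p <= 0) ->
  \sum_(i < N) \sum_(j < N) tau F (Z i j) <= 0.
Proof.
move=> mZ bZ Zle.
pose f i j (x : MX R) : C := kap (Z i j) (hcoord (toC x)) (hcoord (toC x)) * (x.2 `^ (0 - 2))%:C.
have tauE i j : tau F (Z i j) = ((fine (covolume F))^-1)%:C * cint mu2 DF (f i j).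
  by rewrite /tau (@cint_nu_hcoord F _ (fun p => kap (Z i j) p p)).
have i_f i j : cintg mu2 DF (f i j).
  have [B hB] := bZ i j; have B0 : 0 <= B := le_trans (cabs_ge0 _) (hB (0, 0)).
  apply: (@cintg_le _ _ _ mu2 DF mDF _ (fun x : MX R => B * x.2 `^ (0 - 2))).
  - have m1 : cmeas DF (fun x => kap (Z i j) (hcoord (toC x)) (hcoord (toC x))).
      by have [r1 r2] := cmeas_comp (@measurable_hcoord R) (mZ i j); split; exact: measurable_funTS.
    exact: (cmeasM m1 (cmeas_real mpow)).
  - exact: measurable_funM.
  - by move=> x _; rewrite cabsM cabs_real ger0_norm ?powR_ge0// ler_wpM2r ?powR_ge0.
  - under eq_integral do rewrite EFinM.
    rewrite ge0_integralZl//; last 2 first.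
    + exact/measurable_EFinP.
    + by move=> x _; rewrite lee_fin powR_ge0.
    rewrite lte_mul_pinfty// ?lee_fin//; move: hcov; rewrite /covolume /eint_nu.
    move=> H; apply: le_lt_trans H; rewrite le_eqVlt; apply/orP; left; apply/eqP.
    by apply: eq_integral => x _; rewrite mul1r.
have -> : \sum_(i < N) \sum_(j < N) tau F (Z i j) =
    ((fine (covolume F))^-1)%:C * cint mu2 DF (fun x => \sum_(i < N) \sum_(j < N) f i j x).
  rewrite (cint_sum mDF); last by move=> i; exact: (cintg_sum mDF _ (i_f i)).
  rewrite mulr_sumr; apply: eq_bigr => i _.
  rewrite (cint_sum mDF _ (i_f i)) mulr_sumr; apply: eq_bigr => j _; exact: tauE.
rewrite mulr_ge0_le0//.
  rewrite lecR invr_ge0 fine_ge0//; apply: integral_ge0 => x _.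
  by rewrite lee_fin mul1r powR_ge0.
rewrite -oppr_ge0.
have iS : cintg mu2 DF (fun x => \sum_(i < N) \sum_(j < N) f i j x).
  by apply: (cintg_sum mDF) => i; exact: (cintg_sum mDF _ (i_f i)).
rewrite -(cintN mDF iS); apply: cint_ge0 => // x _.
rewrite oppr_ge0 /f.
under eq_bigr do rewrite -mulr_suml.
by rewrite -mulr_suml mulr_le0_ge0// lecR powR_ge0.
Qed.

End Domain.

Section TraceInequality.
Variables (G : set 'M[R]_2) (s d M : R) (N : nat) (k l : 'I_N -> @symbol R).
Hypotheses (s1 : 1 < s) (d0 : 0 < d) (M0 : 0 < M) (hG : discrete_subgroup_PSL2 G).
Hypothesis hk : forall i, hat_alg G s (k i).
Let K i x y := kap (k i) x y * Dk s x y.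
Hypothesis hM : forall i, [/\ holK s (K i), schurK M (K i) & forall x y, ccvg (nbhs (x, y)) (fun u : X * X => K i u.1 u.2) (K i x y)].
Let t := s + d.
Let t1 : 1 < t. Proof. by rewrite (lt_le_trans s1)// lerDl ltW. Qed.
Hypothesis hl : forall i, sym_alg G t (l i).
Let L i x y := kap (l i) x y * Dk t x y.
Let Cij i j := Cderiv t (adj (k i)) (k j).
Let Z i j := star t (star t (adj (l i)) (Cij i j)) (l j).
Let Fx i p e : C := (L i e p)^*.
Let D i j := dker2 s d (K i) (K j).
Let ka : R := (4 * pi)^-1.

Let Lfacts i : exists2 A, 0 <= A & [/\ forall x y, ccvg (nbhs (x, y)) (fun u : X * X => L i u.1 u.2) (L i x y),
  holK t (L i) & forall y, cl2 (L i ^~ y) /\ n2 (L i ^~ y) <= A].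
Proof.
have [A A0 [c _ h _ b]] := sym_kernel t1 (hl i).
exists (A ^+ 2 * mass t) => //; by rewrite mulr_ge0 ?sqr_ge0// ltW// mass_gt0.
Qed.

Let hi i : holK s (K i). Proof. by case: (hM i). Qed.
Let si i : schurK M (K i). Proof. by case: (hM i). Qed.
Let lF i p : cl2 (Fx i p).
Proof. by have [A _ [_ _ b]] := Lfacts i; apply: cl2J; case: (b p). Qed.

Let CijE i j p q : kap (Cij i j) p q * Dk t p q = ka%:C * D i j p q.
Proof.
have li (n : 'I_N) y : cl2 (K n ^~ y) by case: (si n).
have [_ _ ci] := hM i; have [_ _ cj] := hM j.
exact: (Cderiv_kernel s1 d0 ci cj (li i) (li j)).
Qed.

Let Ccont i j : (forall x y, ccvg (nbhs y) (kap (Cij i j) x) (kap (Cij i j) x y)) /\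
  (forall x y, ccvg (nbhs x) (kap (Cij i j) ^~ y) (kap (Cij i j) x y)).
Proof.
have [vT sT] := vN_Top s1 d0 M0 hG hk hM i j.
have sC : sym_alg G t (Cij i j) by exists (Top s d (K i) (K j)).
have [A _ [c _ _ _ _]] := sym_kernel t1 sC.
exact: (kap_ccvg c).
Qed.

Let Lcont i : (forall x y, ccvg (nbhs y) (kap (l i) x) (kap (l i) x y)) /\
  (forall x y, ccvg (nbhs x) (kap (l i) ^~ y) (kap (l i) x y)).
Proof. by have [A _ [c _ _]] := Lfacts i; exact: (kap_ccvg c). Qed.

Let innerE1 i j p q : kap (star t (adj (l i)) (Cij i j)) p q =
  (c_nu t * ka)%:C * (Tker s d (K i) (K j) (Fx i p) q * Dk (- t) p q).
Proof.
have [lc1 lc2] := Lcont i; have [cc1 cc2] := Ccont i j.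
rewrite star_kapE; last by move=> e; exact: cc2.
  have -> : (c_nu t * ka)%:C = (c_nu t)%:C * ka%:C :> C by exact: rmorphM.
  rewrite -(mulrA (c_nu t)%:C); congr (_ * _).
  have i0 := dker2_intl s1 d0 M0 (si i) (si j) q (lF i p).
  rewrite /Tker -(cintZr measurableT _ i0) -(cintZ measurableT _ (cintgZr measurableT _ i0)).
  apply: eq_cint => e _; rewrite kap_adj cpow_bX /Fx /L cJM DkJ.
  have := CijE i j e q; rewrite /D -/t.
  move: (kap (l i) e p)^* (kap (Cij i j) e q) (Dk t p e) (Dk t e q) (Dk (- t) p q) (dker2 s d _ _ e q) => a b c0 c1 c2 c3 E.
  transitivity (a * c0 * c2 * (b * c1)); first by ring.
  by rewrite E; ring.
move=> e; rewrite kap_adj (_ : kap (adj (l i)) p = fun e => (kap (l i) e p)^*); first by apply: ccvgJ; exact: lc2.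
by apply/funext => x; rewrite kap_adj.
Qed.

Let Tcont i j p q : ccvg (nbhs q) (Tker s d (K i) (K j) (Fx i p)) (Tker s d (K i) (K j) (Fx i p) q).
Proof.
have t0 := mass_gt0 t1.
have [A _ hA] := Tker_cl2 s1 d0 M0 (si i) (si j); have [lT _] := hA _ (lF i p).
have [g hg gE] := hol_repr t1 lT (fun x => Tker_repr s1 d0 M0 (hi j) (si i) (si j) x (lF i p)).
have -> : Tker s d (K i) (K j) (Fx i p) = shp t g by apply/funext => x; rewrite gE.
by apply: ccvg_shp => z uz; apply: chol_ccont; exact: hg.
Qed.

(** On the diagonal D_t(p, p) = 1, and the factor D_(-t)(p, e) left by the inner product cancels one
    half of the bracket of the outer one. What remains is the pairing of [Tker] applied to the i-th
    vector with the j-th vector. *)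
Lemma kap_trace i j p : kap (Z i j) p p = (c_nu t * (c_nu t * ka))%:C *
  cint mu2 setT (fun q => Tker s d (K i) (K j) (Fx i p) q * (Fx j p q)^*).
Proof.
have [lc1 lc2] := Lcont j.
have [A _ hA] := Tker_cl2 s1 d0 M0 (si i) (si j); have [lT _] := hA _ (lF i p).
rewrite star_kapE; last by move=> e; exact: lc2.
  have -> : (c_nu t * (c_nu t * ka))%:C = (c_nu t)%:C * (c_nu t * ka)%:C :> C by exact: rmorphM.
  rewrite -(mulrA (c_nu t)%:C); congr (_ * _).
  rewrite -(cintZ measurableT _ (cl2M lT (cl2J (lF j p)))); apply: eq_cint => e _.
  rewrite innerE1 cpow_bX Dkxx mulr1 /Fx conjcK /L.
  have := Dk_cancel t p e.
  move: (c_nu t * ka)%:C (Tker _ _ _ _ _ e) (Dk (- t) p e) (kap (l j) e p) (Dk t p e) (Dk t e p) => a b c0 c1 c2 c3 E.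
  transitivity (a * (b * (c1 * c3)) * (c2 * c0)); first by ring.
  by rewrite E mulr1.
move=> e; rewrite innerE1 (_ : kap (star t (adj (l i)) (Cij i j)) p = fun q =>
   (c_nu t * ka)%:C * (Tker s d (K i) (K j) (Fx i p) q * Dk (- t) p q)); last by apply/funext => q; exact: innerE1.
apply: ccvgM; first exact: ccvg_cst.
apply: ccvgM; first exact: Tcont.
by apply: ccvg_Dk; [exact: cvg_cst|exact: cvg_id].
Qed.

Let c_gt0 : 0 < c_nu t * (c_nu t * ka).
Proof.
have c0 := cnu_gt0 t1; have k0 : 0 < ka by rewrite /ka invr_gt0 mulr_gt0// pi_gt0.
by apply: mulr_gt0 => //; exact: mulr_gt0.
Qed.

Lemma kap_trace_le0 p : \sum_(i < N) \sum_(j < N) kap (Z i j) p p <= 0.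
Proof.
have := main_inequality s1 d0 M0 hi si (fun i => lF i p).
have -> : \sum_(i < N) \sum_(j < N) kap (Z i j) p p = (c_nu t * (c_nu t * ka))%:C *
   \sum_(i < N) \sum_(j < N) cint mu2 setT (fun x => cint mu2 setT (fun q => Fx i p x * (Fx j p q)^* * dker2 s d (K i) (K j) x q)).
  rewrite mulr_sumr; apply: eq_bigr => i _; rewrite mulr_sumr; apply: eq_bigr => j _.
  by rewrite kap_trace (Tker_pairing s1 d0 M0 (si i) (si j) (lF i p) (cl2J (lF j p))).
by move=> H; rewrite mulr_ge0_le0// lecR ltW.
Qed.

(** Uniform in p, because the columns of the kernels of the l_i have uniformly bounded norms by
    [sym_kernel]. *)
Lemma kap_trace_bound i j : exists B : R, forall p, cabs (kap (Z i j) p p) <= B.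
Proof.
have [A A0 hA] := Tker_cl2 s1 d0 M0 (si i) (si j).
have [B B0 [_ _ bi]] := Lfacts i; have [B' B0' [_ _ bj]] := Lfacts j.
exists (c_nu t * (c_nu t * ka) * Num.sqrt (A * B * B')) => p.
rewrite kap_trace cabsM cabs_real (ger0_norm (ltW c_gt0)) ler_wpM2l ?(ltW c_gt0)//.
have [lT nT] := hA _ (lF i p).
have nF (n : 'I_N) b : (forall y, cl2 (L n ^~ y) /\ n2 (L n ^~ y) <= b) -> n2 (Fx n p) <= b.
  by move=> H; rewrite /Fx (n2J (fun e => L n e p)); case: (H p).
have := cint_cl2_bound lT (cl2J (lF j p)); rewrite n2J => H.
rewrite -[leLHS]ger0_norm ?cabs_ge0// -sqrtr_sqr; apply: ler_wsqrtr; apply: (le_trans H).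
apply: ler_pM; rewrite ?n2_ge0//; last exact: nF.
by rewrite (le_trans nT)// ler_wpM2l// nF.
Qed.

Lemma cmeas_kap_trace i j : cmeas setT (fun p => kap (Z i j) p p).
Proof.
have [A A0 hA] := Tker_cl2 s1 d0 M0 (si i) (si j).
have mL (n : 'I_N) : cmeas2 (L n) by have [B _ [c _ _]] := Lfacts n; exact: (@ccvg_cmeas2 R (L n)).
have mF (n : 'I_N) : cmeas2 (Fx n).
  exact: (cmeasJ (@cmeas2_swap _ (L n) (mL n))).
have mD := cmeas2_dker2 s d (si i) (si j).
have mT : cmeas2 (fun p q => Tker s d (K i) (K j) (Fx i p) q).
  apply: (@cmeas3_cint _ (fun p q e => Fx i p e * dker2 s d (K i) (K j) e q)).
  apply: (@cmeasM _ _ _ setT (fun v : (MX R * MX R) * MX R => Fx i v.1.1 v.2)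
    (fun v => dker2 s d (K i) (K j) v.2 v.1.2)); first exact: (cmeas3_13 (mF i)).
  exact: (cmeas3_23 (@cmeas2_swap _ (dker2 s d (K i) (K j)) mD)).
have mI : cmeas setT (fun p => cint mu2 setT (fun q => Tker s d (K i) (K j) (Fx i p) q * (Fx j p q)^*)).
  apply: (@cmeas_cint22 _ (fun p q => Tker s d (K i) (K j) (Fx i p) q * (Fx j p q)^*)).
  apply: (@cmeasM _ _ _ setT (fun v : MX R * MX R => Tker s d (K i) (K j) (Fx i v.1) v.2)
    (fun v => (Fx j v.1 v.2)^*)) => //.
  exact: (cmeasJ (mF j)).
rewrite (_ : (fun p => kap (Z i j) p p) = fun p => (c_nu t * (c_nu t * ka))%:C *
  cint mu2 setT (fun q => Tker s d (K i) (K j) (Fx i p) q * (Fx j p q)^*)); last by apply/funext => p; exact: kap_trace.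
apply: (@cmeasM _ _ _ setT (fun=> (c_nu t * (c_nu t * ka))%:C)) => //; exact: cmeas_cst.
Qed.

Lemma trace_le0 (F : set C) : fundamental_domain G F -> (covolume F < +oo)%E ->
  \sum_(i < N) \sum_(j < N) tau F (Z i j) <= 0.
Proof.
move=> hF hcov; apply: (tau_sum_le0 hF hcov).
- exact: cmeas_kap_trace.
- exact: kap_trace_bound.
- exact: kap_trace_le0.
Qed.

End TraceInequality.
End Trace.

Theorem proposition1p6 (R : realType) (G : set 'M[R]_2) (F : set R[i])
    (t0 t : R) (hG : discrete_subgroup_PSL2 G) (hF : fundamental_domain G F)
    (hcov : (covolume F < +oo)%E) (ht0 : 1 < t0) (ht : t0 < t)
    (N : nat) (k : 'I_N -> @symbol R) (hk : forall i, hat_alg G t0 (k i)) :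
  (forall l : 'I_N -> @symbol R, (forall i, sym_alg G t (l i)) ->
     \sum_(i < N) \sum_(j < N)
       tau F (star t (star t (adj (l i)) (Cderiv t (adj (k i)) (k j))) (l j))
     <= 0) /\
  nonpos_matrix G t (fun i j => Cderiv t (adj (k i)) (k j)).
Proof.
(* The exponent t0 plays the part of s, with the Schur bounds, and the gap d = t - t0 is what
   absorbs the logarithm. *)
have [d d0 tE] : exists2 d, 0 < d & t = t0 + d by exists (t - t0); [rewrite subr_gt0|rewrite addrC subrK].
subst t; have [M M0 hM] := hat_family ht0 hk.
split; [move=> l hl; exact: (trace_le0 ht0 d0 M0 hG hk hM hl hF hcov) | exact: (Cderiv_nonpos ht0 d0 M0 hG hk hM)].
Qed.
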